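(* Let $(X,\Lambda_0)$ be a nonsingular projective Poisson variety over $\mathbb{C}$ of dimension $n$ and let $(L,\nabla)$ be a Poisson invertible sheaf on $(X,\Lambda_0)$. Then the Poisson Chern class $c(L,\nabla)\in\mathbb{H}^1(X,\Omega_X^1\xrightarrow{i_{\Lambda_0}}T_X)$ gives an element of $Ext^1(T_X^\bullet,\mathcal O_X^\bullet)$ (the Poisson Atiyah extension associated with $c(L,\nabla)$), which extends the Atiyah extension associated with the Chern class $c(L)$. It is described by a short exact sequence of complexes of sheaves $$0\to\mathcal O_X^\bullet\to\mathcal E_L^\bullet\to T_X^\bullet\to0,$$ where $\mathcal E_L^\bullet:\mathcal E_L^0\xrightarrow{d}\mathcal E_L^1\xrightarrow{d}\mathcal E_L^2\to\cdots$ is the complex constructed from $(L,\nabla)$ as described in the context; in degree $i$ the sequence is $0\to\wedge^iT_X\to\mathcal E_L^i\to\wedge^{i+1}T_X\to0$. Each sheaf $\mathcal E_L^i$ is locally free of rank $\binom{n}{i}+\binom{n}{i+1}=\binom{n+1}{i+1}$, and the degree $0$ part $0\to\mathcal O_X\to\mathcal E_L^0\to T_X\to0$ is the Atiyah extension associated with the Chern class $c(L)$.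
   Context: A Poisson variety $(X,\Lambda_0)$ is a variety with $\Lambda_0\in\Gamma(X,\wedge^2T_X)$, $[\Lambda_0,\Lambda_0]=0$, where $[-,-]$ is the Schouten bracket on $\bigoplus_p\wedge^pT_X$ (with $[\Lambda_0,f](dg)=\Lambda_0(df\wedge dg)=\{f,g\}$ and, for $b\in\wedge^{p+1}T_X$ and a function $f$, $[b,f]=b(df\wedge-)$). $[b,\log f]:=f^{-1}[b,f]$ for invertible $f$. $i_{\Lambda_0}:\Omega^1_X\to T_X$ is contraction, $i_{\Lambda_0}(df)=[\Lambda_0,f]$. $\mathcal O_X^\bullet:\mathcal O_X\to T_X\to\wedge^2T_X\to\cdots$ and $T_X^\bullet:T_X\to\wedge^2T_X\to\cdots$, with all differentials $[\Lambda_0,-]$ and with $\mathcal O_X$, respectively $T_X$, in degree $0$. (The differentials are $\mathbb C$-linear, so $Ext^1$ refers to extensions of complexes of sheaves of $\mathbb C$-vector spaces.) A Poisson invertible sheaf $(L,\nabla)$ is an invertible sheaf with a flat Poisson connection, i.e. a $\mathbb C$-linear $\{-,-\}_L:\mathcal O_X\otimes_{\mathbb C}L\to L$ with $\{fg,s\}_L=f\{g,s\}_L+g\{f,s\}_L$, $\{f,gs\}_L=\{f,g\}s+g\{f,s\}_L$, $\{f,\{g,s\}_L\}_L=\{\{f,g\},s\}_L+\{g,\{f,s\}_L\}_L$; $\nabla(s)(f)=\{f,s\}_L$. On an affine open cover $\{U_i\}$ trivializing $L$ it is given by transition functions $h_{ij}\in\Gamma(U_{ij},\mathcal O_X^* )$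 ($s_i=h_{ij}s_j$) and $T_i^0\in\Gamma(U_i,T_X)$ (where $\nabla(s)=-[\Lambda_0,s_i]+s_iT_i^0$ on $U_i$), with $h_{ij}h_{jk}=h_{ik}$, $[\Lambda_0,T_i^0]=0$, $T_j^0-T_i^0+[\Lambda_0,\log h_{ij}]=0$. Isomorphism classes of Poisson invertible sheaves are thereby identified with $\mathbb{H}^1$ of $\mathcal O_X^{*\bullet}:\mathcal O_X^*\xrightarrow{[\Lambda_0,\log-]}T_X\xrightarrow{[\Lambda_0,-]}\wedge^2T_X\to\cdots$. Poisson Chern class: the morphism of complexes $\mathcal O_X^{*\bullet}\to(\Omega^1_X\xrightarrow{i_{\Lambda_0}}T_X)$ given by $d\log$ in degree $0$, the identity in degree $1$, zero elsewhere, induces a map on $\mathbb H^1$; $c(L,\nabla)$ is the image of the class of $(L,\nabla)$, represented by $(\{d\log h_{ij}\},\{T_i^0\})$. The Chern class $c(L)\in H^1(X,\Omega^1_X)$ is the class of $\{d\log h_{ij}\}$, and the Atiyah extension associated with it is the extension of $T_X$ by $\mathcal O_X$ corresponding to $c(L)\in H^1(X,\Omega_X^1)=Ext^1(T_X,\mathcal O_X)$. Construction of $\mathcal E_L^\bullet$: $\mathcal E_L^p|_{U_i}=\wedge^pT_X|_{U_i}\oplus\wedge^{p+1}T_X|_{U_i}$, with $(a_i,b_i)$ over $U_i$ and $(a_j,b_j)$ over $U_j$ identified on $U_{ij}$ if and only if $b_i=b_j$ and $a_j-a_i=[b_i,\log h_{ij}]$; the differential $d:\mathcal E_L^p\to\mathcal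 E_L^{p+1}$ is $(a_i,b_i)\mapsto([\Lambda_0,a_i]+(-1)^{p+1}[T_i^0,b_i],[\Lambda_0,b_i])$ on $U_i$. The maps in the exact sequence are $a\mapsto(a,0)$ and $(a,b)\mapsto b$. That $c(L,\nabla)$ gives the extension includes that the extension, up to isomorphism, depends only on $c(L,\nabla)$. *)

(* Defs.v *)
From HB Require Import structures.
From mathcomp Require Import all_boot all_order all_algebra.
From mathcomp Require Import boolp classical_sets reals.
From mathcomp Require Import topology_structure initial_topology subtype_topology.
From mathcomp Require Import complex mpoly.

Set Implicit Arguments.
Unset Strict Implicit.
Unset Printing Implicit Defensive.

Import GRing.Theory.
Local Open Scope classical_set_scope.
Local Open Scope ring_scope.

Definition irreducible_set (T : topologicalType) (Z : set T) : Prop :=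
  Z !=set0 /\
  forall A B : set T, closed A -> closed B ->
    Z `<=` A `|` B -> Z `<=` A \/ Z `<=` B.

Definition irreducible_chain (T : topologicalType) (m : nat)
    (Z : nat -> set T) : Prop :=
  (forall i, (i <= m)%N -> closed (Z i) /\ irreducible_set (Z i)) /\
  (forall i, (i < m)%N -> Z i `<=` Z i.+1 /\ Z i <> Z i.+1).

Definition krull_dim (T : topologicalType) (n : nat) : Prop :=
  (exists Z : nat -> set T, irreducible_chain n Z) /\
  (forall m (Z : nat -> set T), irreducible_chain m Z -> (m <= n)%N).

Record opens (T : topologicalType) : Type := Opens {
  oset :> set T;
  oset_open : open oset
}.

Definition opens_setT (T : topologicalType) : opens T := Opens (@openT T).
Definition opens_setI (T : topologicalType) (U V : opens T) : opens T :=
  Opens (openI (oset_open U) (oset_open V)).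

Definition covers (T : topologicalType) (I : Type) (U : I -> opens T) : Prop :=
  forall x, exists i, oset (U i) x.

Lemma subIl (T : topologicalType) (U V : opens T) : opens_setI U V `<=` U.
Proof. by move=> x []. Qed.
Lemma subIr (T : topologicalType) (U V : opens T) : opens_setI U V `<=` V.
Proof. by move=> x []. Qed.
Lemma subII (T : topologicalType) (U V W : opens T) :
  W `<=` U -> W `<=` V -> W `<=` opens_setI U V.
Proof. by move=> WU WV x Wx; split; [exact: WU|exact: WV]. Qed.

Section ProjectiveSpace.
Variables (R : realType) (N : nat).

(* The points of P^N(C) are the lines of C^{N+1}. *)
Definition proj_space : Type :=
  {l : {vspace 'rV[R[i]]_N.+1} | \dim l == 1%N}.
HB.instance Definition _ := Choice.on proj_space.

(* [vpick l] is a nonzero vector of the line [l]; only the vanishing of a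
   homogeneous polynomial at [x], and quotients of two homogeneous polynomials
   of the same degree, are used below, and these do not depend on it. *)
Definition heval (F : {mpoly R[i][N.+1]}) (x : proj_space) : R[i] :=
  F.@[fun j => vpick (val x) 0 j].

Definition zariski_open (U : set proj_space) : Prop :=
  forall x, U x -> exists d, exists F : {mpoly R[i][N.+1]},
    [/\ F \is d.-homog, heval F x != 0 & [set y | heval F y != 0] `<=` U].

Lemma zariski_openT : zariski_open setT.
Proof.
move=> x _; exists 0%N, 1; split=> //; first exact: dhomog1.
by rewrite /heval rmorph1 oner_neq0.
Qed.

Lemma zariski_openI : setI_closed zariski_open.
Proof.
move=> U V oU oV x [/oU[d [F [hF Fx FU]]] /oV[e [G [hG Gx GV]]]].
exists (d + e)%N, (F * G); split; first exact: dhomogM.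
  by rewrite /heval rmorphM mulf_neq0.
move=> y /=; rewrite /heval rmorphM mulf_eq0 negb_or => /andP[Fy Gy].
by split; [exact: FU|exact: GV].
Qed.

Lemma zariski_open_bigU (I : Type) (f : I -> set proj_space) :
  (forall i, zariski_open (f i)) -> zariski_open (\bigcup_i f i).
Proof.
move=> of_ x [i _ /of_[d [F [hF Fx FU]]]].
by exists d, F; split=> // y /FU fy; exists i.
Qed.

HB.instance Definition _ := @isOpenTopological.Build proj_space
  zariski_open zariski_openT zariski_openI zariski_open_bigU.

Record projective_variety : Type := ProjectiveVariety {
  pv_set :> set proj_space;
  pv_closed : closed pv_set;
  pv_irreducible : irreducible_set pv_set
}.

End ProjectiveSpace.

Section Sheaves.
Variables (R : realType) (N : nat) (X : projective_variety R N).

Notation C := R[i].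
(* The points of X, with the Zariski topology induced by P^N. *)
Notation pts := (set_type (pv_set X)).
Notation op := (opens pts).
Implicit Types U V W : op.

Definition regular_on (U : set pts) (f : pts -> C) : Prop :=
  forall x, U x -> exists W : op, [/\ oset W x, W `<=` U &
    exists d, exists G H : {mpoly C[N.+1]},
      [/\ G \is d.-homog, H \is d.-homog &
        forall y, oset W y ->
          heval H (val y) != 0 /\ f y = heval G (val y) / heval H (val y)]].

(* A function on U is encoded by its extension by zero to X. *)
Record regfun (U : op) : Type := RegFun {
  rf_fun :> pts -> C;
  rf_regular : regular_on U rf_fun;
  rf_off : forall x, ~ oset U x -> rf_fun x = 0
}.

Lemma regfun_ext U (f g : regfun U) : (forall x, f x = g x) -> f = g.
Proof.
case: f g => f f1 f2 [g g1 g2] /= /funext fg.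
by move: f1 f2; rewrite fg => f1 f2; congr RegFun; exact: Prop_irrelevance.
Qed.

HB.instance Definition _ U := gen_eqMixin (regfun U).
HB.instance Definition _ U := gen_choiceMixin (regfun U).

Definition cutoff (U : set pts) (f : pts -> C) (x : pts) : C :=
  if `[< U x >] then f x else 0.

Lemma cutoff_in (U : set pts) f x : U x -> cutoff U f x = f x.
Proof. by rewrite /cutoff; case: asboolP. Qed.
Lemma cutoff_out (U : set pts) f x : ~ U x -> cutoff U f x = 0.
Proof. by rewrite /cutoff; case: asboolP. Qed.

Lemma regular_cst (U : op) (c : C) : regular_on U (cutoff U (fun=> c)).
Proof.
move=> x Ux; exists U; split=> //; exists 0%N, (c *: 1), 1; split.
- by apply: dhomogZ; exact: dhomog1.
- exact: dhomog1.
move=> y Uy; rewrite cutoff_in // /heval rmorph1 mevalZ rmorph1 mulr1 divr1.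
by rewrite oner_neq0.
Qed.

Lemma regular_add (U : op) f g :
  regular_on U f -> regular_on U g -> regular_on U (fun x => f x + g x).
Proof.
move=> rf rg x Ux.
have [W [Wx WU [d [F [H [hF hH FH]]]]]] := rf x Ux.
have [W' [W'x W'U [d' [F' [H' [hF' hH' FH']]]]]] := rg x Ux.
exists (opens_setI W W'); split=> //; first by move=> y [/WU].
exists (d + d')%N, (F * H' + F' * H), (H * H'); split.
- by apply: dhomogD; [exact: dhomogM|rewrite addnC; exact: dhomogM].
- exact: dhomogM.
move=> y [/FH[Hy ->] /FH'[H'y ->]].
by rewrite /heval rmorphD !rmorphM mulf_neq0 //= addf_div.
Qed.

Lemma regular_mul (U : op) f g :
  regular_on U f -> regular_on U g -> regular_on U (fun x => f x * g x).
Proof.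
move=> rf rg x Ux.
have [W [Wx WU [d [F [H [hF hH FH]]]]]] := rf x Ux.
have [W' [W'x W'U [d' [F' [H' [hF' hH' FH']]]]]] := rg x Ux.
exists (opens_setI W W'); split=> //; first by move=> y [/WU].
exists (d + d')%N, (F * F'), (H * H'); split; try exact: dhomogM.
move=> y [/FH[Hy ->] /FH'[H'y ->]].
by rewrite /heval !rmorphM mulf_neq0 //= mulf_div.
Qed.

Lemma regular_res (U V : op) f : V `<=` U -> regular_on U f ->
  regular_on V (cutoff V f).
Proof.
move=> VU rf x Vx; have [W [Wx WU [d [F [H [hF hH FH]]]]]] := rf x (VU x Vx).
exists (opens_setI W V); split=> //; first by move=> y [].
by exists d, F, H; split=> // y [/FH[Hy fy] Vy]; rewrite cutoff_in.
Qed.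

Definition rf_cst U (c : C) : regfun U :=
  RegFun (@regular_cst U c) (@cutoff_out U (fun=> c)).

Lemma rf_add_off U (f g : regfun U) x : ~ oset U x -> f x + g x = 0.
Proof. by move=> Ux; rewrite !rf_off ?addr0. Qed.
Definition rf_add U (f g : regfun U) : regfun U :=
  RegFun (regular_add (rf_regular f) (rf_regular g)) (@rf_add_off U f g).

Lemma rf_mul_off U (f g : regfun U) x : ~ oset U x -> f x * g x = 0.
Proof. by move=> Ux; rewrite !rf_off ?mul0r. Qed.
Definition rf_mul U (f g : regfun U) : regfun U :=
  RegFun (regular_mul (rf_regular f) (rf_regular g)) (@rf_mul_off U f g).

Definition rf_opp U (f : regfun U) : regfun U := rf_mul (rf_cst U (-1)) f.

Lemma rf_cstE U c x : oset U x -> rf_cst U c x = c.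
Proof. by move=> Ux; rewrite /= cutoff_in. Qed.

Fact rf_addA U : associative (@rf_add U).
Proof. by move=> f g h; apply: regfun_ext => x; rewrite /= addrA. Qed.
Fact rf_addC U : commutative (@rf_add U).
Proof. by move=> f g; apply: regfun_ext => x; rewrite /= addrC. Qed.
Fact rf_add0 U : left_id (rf_cst U 0) (@rf_add U).
Proof.
by move=> f; apply: regfun_ext => x; rewrite /= /cutoff; case: asboolP;
  rewrite add0r.
Qed.
Fact rf_addN U : left_inverse (rf_cst U 0) (@rf_opp U) (@rf_add U).
Proof.
move=> f; apply: regfun_ext => x; rewrite /= /cutoff.
by case: asboolP => Ux; rewrite ?mulN1r ?addNr // mul0r add0r rf_off.
Qed.
HB.instance Definition _ U := GRing.isZmodule.Build (regfun U)
  (@rf_addA U) (@rf_addC U) (@rf_add0 U) (@rf_addN U).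

Fact rf_mulA U : associative (@rf_mul U).
Proof. by move=> f g h; apply: regfun_ext => x; rewrite /= mulrA. Qed.
Fact rf_mulC U : commutative (@rf_mul U).
Proof. by move=> f g; apply: regfun_ext => x; rewrite /= mulrC. Qed.
Fact rf_mul1 U : left_id (rf_cst U 1) (@rf_mul U).
Proof.
move=> f; apply: regfun_ext => x; rewrite /= /cutoff.
by case: asboolP => Ux; rewrite ?mul1r // mul0r rf_off.
Qed.
Fact rf_mulD U : left_distributive (@rf_mul U) (@rf_add U).
Proof. by move=> f g h; apply: regfun_ext => x; rewrite /= mulrDl. Qed.
(* Only a possibly trivial ring: the empty open set is allowed. *)
HB.instance Definition _ U := GRing.Zmodule_isComPzRing.Build (regfun U)
  (@rf_mulA U) (@rf_mulC U) (@rf_mul1 U) (@rf_mulD U).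

Definition rf_res (U V : op) (VU : V `<=` U) (f : regfun U) : regfun V :=
  RegFun (regular_res VU (rf_regular f)) (@cutoff_out V f).

Lemma rf_resE U V (VU : V `<=` U) (f : regfun U) x :
  oset V x -> rf_res VU f x = f x.
Proof. by move=> Vx; rewrite /= cutoff_in. Qed.

Lemma regfun_eqP U (f g : regfun U) :
  (forall x, oset U x -> f x = g x) -> f = g.
Proof.
move=> fg; apply: regfun_ext => x; have [/fg//|nUx] := pselect (oset U x).
by rewrite !rf_off.
Qed.

Lemma rf_res_comp U V W (VU : V `<=` U) (WV : W `<=` V) (WU : W `<=` U)
  (f : regfun U) : rf_res WV (rf_res VU f) = rf_res WU f.
Proof. by apply: regfun_eqP => x Wx; rewrite !rf_resE //; exact: WV. Qed.

Lemma rf_resD U V (VU : V `<=` U) (f g : regfun U) :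
  rf_res VU (f + g) = rf_res VU f + rf_res VU g.
Proof.
apply: regfun_eqP => x Vx.
by rewrite rf_resE //= -[RHS]/(rf_res VU f x + rf_res VU g x) !rf_resE.
Qed.

Lemma rf_resM U V (VU : V `<=` U) (f g : regfun U) :
  rf_res VU (f * g) = rf_res VU f * rf_res VU g.
Proof.
apply: regfun_eqP => x Vx.
by rewrite rf_resE //= -[RHS]/(rf_res VU f x * rf_res VU g x) !rf_resE.
Qed.

Lemma rf_res_cst U V (VU : V `<=` U) c : rf_res VU (rf_cst U c) = rf_cst V c.
Proof.
by apply: regfun_eqP => x Vx; rewrite rf_resE // !rf_cstE //; exact: VU.
Qed.

Lemma rf_cstD U c c' : rf_cst U (c + c') = rf_cst U c + rf_cst U c'.
Proof.
apply: regfun_eqP => x Ux.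
by rewrite -[RHS]/(rf_cst U c x + rf_cst U c' x) !rf_cstE.
Qed.

Lemma rf_cstM U c c' : rf_cst U (c * c') = rf_cst U c * rf_cst U c'.
Proof.
apply: regfun_eqP => x Ux.
by rewrite -[RHS]/(rf_cst U c x * rf_cst U c' x) !rf_cstE.
Qed.

Lemma rf_res0 U V (VU : V `<=` U) : rf_res VU 0 = 0.
Proof. exact: rf_res_cst. Qed.

Lemma rf_resN1 U V (VU : V `<=` U) : rf_res VU (-1) = -1 .
Proof.
apply: (addrI 1); rewrite subrr.
by rewrite -{1}[1](rf_res_cst VU 1) -rf_resD subrr rf_res0.
Qed.

Lemma rf_res_sum U V (VU : V `<=` U) (I : Type) (s : seq I) (F : I -> regfun U) :
  rf_res VU (\sum_(i <- s) F i) = \sum_(i <- s) rf_res VU (F i).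
Proof.
elim: s => [|i s IH]; first by rewrite !big_nil rf_res0.
by rewrite !big_cons rf_resD IH.
Qed.

(* The germ at x of f lies in the square of the maximal ideal of O_{X,x}. *)
Definition in_max_ideal_sq (x : pts) (U : op) (f : regfun U) : Prop :=
  exists (W : op) (WU : W `<=` U) (gs : seq (regfun W * regfun W)),
    [/\ oset W x,
        (forall g, g \in gs -> g.1 x = 0 /\ g.2 x = 0) &
        rf_res WU f = \sum_(g <- gs) g.1 * g.2].

(* O_{X,x} is a regular local ring of dimension n: the germs t_0, ..., t_{n-1}
   form a basis of m_x / m_x^2.  (On an irreducible variety all the O_{X,x}
   have the dimension of X.) *)
Definition nonsingular_at (n : nat) (x : pts) : Prop :=
  exists (W : op) (t : 'I_n -> regfun W),
    [/\ oset W x, (forall k, t k x = 0) &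
      forall (V : op) (VW : V `<=` W) (f : regfun V), oset V x -> f x = 0 ->
        exists! c : 'I_n -> C,
          in_max_ideal_sq x (f - \sum_k rf_cst V (c k) * rf_res VW (t k))].

Definition nonsingular (n : nat) : Prop := forall x, nonsingular_at n x.

Definition is_sheaf (F : op -> Type)
    (res : forall U V : op, V `<=` U -> F U -> F V) : Prop :=
  forall (U : op) (I : Type) (V : I -> op) (VU : forall i, V i `<=` U),
    (forall x, oset U x -> exists i, oset (V i) x) ->
    forall s : (forall i, F (V i)),
      (forall i j (W : op) (Wi : W `<=` V i) (Wj : W `<=` V j),
         res _ _ Wi (s i) = res _ _ Wj (s j)) ->
      exists! t : F U, forall i, res _ _ (VU i) t = s i.

Record cpresheaf : Type := CPresheaf {
  cs_sec :> op -> lmodType C;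
  cs_res : forall U V : op, V `<=` U -> cs_sec U -> cs_sec V;
  cs_resD : forall U V (VU : V `<=` U) (s t : cs_sec U),
    cs_res VU (s + t) = cs_res VU s + cs_res VU t;
  cs_resZ : forall U V (VU : V `<=` U) (c : C) (s : cs_sec U),
    cs_res VU (c *: s) = c *: cs_res VU s;
  cs_res_id : forall U (UU : U `<=` U) (s : cs_sec U), cs_res UU s = s;
  cs_res_comp : forall U V W (VU : V `<=` U) (WV : W `<=` V) (WU : W `<=` U)
    (s : cs_sec U), cs_res WV (cs_res VU s) = cs_res WU s
}.

Record chom (F G : cpresheaf) : Type := CHom {
  ch_fun :> forall U : op, F U -> G U;
  ch_D : forall U (s t : F U), ch_fun (s + t) = ch_fun s + ch_fun t;
  ch_Z : forall U (c : C) (s : F U), ch_fun (c *: s) = c *: ch_fun s;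
  ch_nat : forall U V (VU : V `<=` U) (s : F U),
    cs_res VU (ch_fun s) = ch_fun (cs_res VU s)
}.

Record omod : Type := OMod {
  om_sec :> forall U : op, lmodType (regfun U);
  om_res : forall U V : op, V `<=` U -> om_sec U -> om_sec V;
  om_resD : forall U V (VU : V `<=` U) (s t : om_sec U),
    om_res VU (s + t) = om_res VU s + om_res VU t;
  om_resZ : forall U V (VU : V `<=` U) (f : regfun U) (s : om_sec U),
    om_res VU (f *: s) = rf_res VU f *: om_res VU s;
  om_res_id : forall U (UU : U `<=` U) (s : om_sec U), om_res UU s = s;
  om_res_comp : forall U V W (VU : V `<=` U) (WV : W `<=` V) (WU : W `<=` U)
    (s : om_sec U), om_res WV (om_res VU s) = om_res WU s
}.

Record ohom (F G : omod) : Type := OHom {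
  oh_fun :> forall U : op, F U -> G U;
  oh_D : forall U (s t : F U), oh_fun (s + t) = oh_fun s + oh_fun t;
  oh_Z : forall U (f : regfun U) (s : F U), oh_fun (f *: s) = f *: oh_fun s;
  oh_nat : forall U V (VU : V `<=` U) (s : F U),
    om_res VU (oh_fun s) = oh_fun (om_res VU s)
}.

Definition locally_free (F : omod) (r : nat) : Prop :=
  forall x, exists (W : op) (e : 'I_r -> F W), oset W x /\
    forall (V : op) (VW : V `<=` W) (s : F V),
      exists! c : 'I_r -> regfun V, s = \sum_k c k *: om_res VW (e k).

Definition restrict_scalars (U : op) (M : lmodType (regfun U)) : Type := M.

Section RestrictScalars.
Variables (U : op) (M : lmodType (regfun U)).
HB.instance Definition _ := GRing.Zmodule.on (restrict_scalars M).

Definition cscale (c : C) (s : restrict_scalars M) : restrict_scalars M :=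
  (rf_cst U c *: (s : M)).

Fact cscaleA a b s : cscale a (cscale b s) = cscale (a * b) s.
Proof. by rewrite /cscale scalerA rf_cstM. Qed.
Fact cscale1 : left_id 1 cscale.
Proof. by move=> s; rewrite /cscale; exact: scale1r. Qed.
Fact cscaleDr : right_distributive cscale +%R.
Proof. by move=> c s t; rewrite /cscale; exact: scalerDr. Qed.
Fact cscaleDl s : {morph cscale^~ s : a b / a + b}.
Proof. by move=> a b; rewrite /cscale rf_cstD; exact: scalerDl. Qed.
HB.instance Definition _ := GRing.Zmodule_isLmodule.Build C
  (restrict_scalars M) cscaleA cscale1 cscaleDr cscaleDl.
End RestrictScalars.

Section Forget.
Variable F : omod.
Fact forget_resZ U V (VU : V `<=` U) (c : C) (s : restrict_scalars (F U)) :
  om_res VU (c *: s) = c *: (om_res VU s : restrict_scalars (F V)).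
Proof. by rewrite -[c *: s]/(rf_cst U c *: (s : F U)) om_resZ rf_res_cst. Qed.
Definition forget : cpresheaf :=
  @CPresheaf (fun U => restrict_scalars (F U)) (@om_res F)
    (@om_resD F) forget_resZ (@om_res_id F) (@om_res_comp F).
End Forget.

Definition forget_hom (F G : omod) (phi : ohom F G) :
  chom (forget F) (forget G) :=
  @CHom (forget F) (forget G) (@oh_fun _ _ phi) (@oh_D _ _ phi)
    (fun U c s => @oh_Z _ _ phi U (rf_cst U c) s) (@oh_nat _ _ phi).

(* Sections over U of the sheaf Der_C(O_X, O_X) = T_X. *)
Record derivation (U : op) : Type := Derivation {
  der :> forall V : op, V `<=` U -> regfun V -> regfun V;
  der_D : forall V (VU : V `<=` U) f g,
    der VU (f + g) = der VU f + der VU g;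
  der_Z : forall V (VU : V `<=` U) (c : C) f,
    der VU (rf_cst V c * f) = rf_cst V c * der VU f;
  der_M : forall V (VU : V `<=` U) f g,
    der VU (f * g) = f * der VU g + g * der VU f;
  der_res : forall V W (VU : V `<=` U) (WU : W `<=` U) (WV : W `<=` V) f,
    rf_res WV (der VU f) = der WU (rf_res WV f)
}.

Definition der_restrict (U V : op) (VU : V `<=` U) (D : derivation U) :
  derivation V :=
  @Derivation V (fun W WV f => D W (subset_trans WV VU) f)
    (fun W WV => der_D D (subset_trans WV VU))
    (fun W WV => der_Z D (subset_trans WV VU))
    (fun W WV => der_M D (subset_trans WV VU))
    (fun W W' WV W'V => der_res D (subset_trans WV VU) (subset_trans W'V VU)).

(* A p-vector field P is encoded by the values P(df_1 /\ ... /\ df_p), as a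
   function of the list [:: f_1; ...; f_p]; its value is 0 on lists of a
   different length. *)
Definition evaluation (U : op) : Type :=
  forall V : op, V `<=` U -> seq (regfun V) -> regfun V.
Identity Coercion evaluation_fun : evaluation >-> Funclass.

Definition wedge (p : nat) (U : op) (D : 'I_p -> derivation U) : evaluation U :=
  fun V VU fs =>
    if size fs == p then \det (\matrix_(i < p, j < p) D i V VU (nth 0 fs j))
    else 0.

(* P is the sum of the h.D_1 /\ ... /\ D_p for (h, (D_i)) in ts. *)
Definition wedge_sum (p : nat) (U W : op) (WU : W `<=` U) (P : evaluation U)
    (ts : seq (regfun W * ('I_p -> derivation W))) : Prop :=
  forall (V : op) (VW : V `<=` W) (fs : seq (regfun V)),
    P V (subset_trans VW WU) fs
      = \sum_(t <- ts) rf_res VW t.1 * wedge t.2 VW fs.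

Definition is_polyvec (p : nat) (U : op) (P : evaluation U) : Prop :=
  (forall V W (VU : V `<=` U) (WU : W `<=` U) (WV : W `<=` V) fs,
     rf_res WV (P V VU fs) = P W WU [seq rf_res WV f | f <- fs]) /\
  (forall x, oset U x -> exists (W : op) (WU : W `<=` U) ts,
     oset W x /\ @wedge_sum p U W WU P ts).

(* Sections over U of /\^p T_X: locally, finite sums of products
   D_1 /\ ... /\ D_p of vector fields.  A polyvector field is identified with
   its evaluation on exact forms, which is harmless since T_X is locally free
   (X is nonsingular) and C has characteristic 0.  In degree 0 this is O_X. *)
Record polyvec (p : nat) (U : op) : Type := Polyvec {
  pv_fun :> evaluation U;
  pv_polyvec : is_polyvec p pv_fun
}.

Lemma polyvec_ext p U (P Q : polyvec p U) :
  (forall V VU fs, P V VU fs = Q V VU fs) -> P = Q.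
Proof.
case: P Q => P HP [Q HQ] /= PQ; have E : P = Q.
  apply: functional_extensionality_dep => V.
  by apply: functional_extensionality_dep => VU; apply: funext => fs.
by move: HP HQ; rewrite E => HP HQ; congr Polyvec; exact: Prop_irrelevance.
Qed.

Definition shrink p (W W' : op) (W'W : W' `<=` W)
    (ts : seq (regfun W * ('I_p -> derivation W))) :=
  [seq (rf_res W'W t.1, fun i => der_restrict W'W (t.2 i)) | t <- ts].

Lemma wedge_sum_shrink p U W W' (WU : W `<=` U) (W'U : W' `<=` U)
    (W'W : W' `<=` W) P ts :
  @wedge_sum p U W WU P ts -> wedge_sum W'U P (shrink W'W ts).
Proof.
move=> H V VW' fs; have VW := subset_trans VW' W'W.
rewrite (Prop_irrelevance (subset_trans VW' W'U) (subset_trans VW WU)) H.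
rewrite big_map; apply: eq_bigr => t _ /=.
rewrite (rf_res_comp W'W VW' VW); congr (_ * _); rewrite /wedge.
case: ifP => // _; congr (\det _); apply/matrixP => i j; rewrite !mxE /=.
by rewrite (Prop_irrelevance (subset_trans VW' W'W) VW).
Qed.

Fact pv_zero_proof p U : @is_polyvec p U (fun _ _ _ => 0).
Proof.
split=> [V W VU WU WV fs|x Ux]; first exact: rf_res0.
by exists U, (@subset_refl _ U), [::]; split=> // V VW fs; rewrite big_nil.
Qed.
Definition pv_zero p U : polyvec p U := Polyvec (@pv_zero_proof p U).

Fact pv_add_proof p U (P Q : polyvec p U) :
  @is_polyvec p U (fun V VU fs => P V VU fs + Q V VU fs).
Proof.
split=> [V W VU WU WV fs|x Ux].
  by rewrite rf_resD (pv_polyvec P).1 (pv_polyvec Q).1.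
have [W [WU [ts [Wx Hts]]]] := (pv_polyvec P).2 x Ux.
have [W' [W'U [ts' [W'x Hts']]]] := (pv_polyvec Q).2 x Ux.
have IU : opens_setI W W' `<=` U := subset_trans (@subIl _ W W') WU.
exists (opens_setI W W'), IU, (shrink (@subIl _ W W') ts ++ shrink (@subIr _ W W') ts').
split=> // V VI fs; rewrite big_cat /=.
by rewrite (wedge_sum_shrink IU (@subIl _ W W') Hts)
           (wedge_sum_shrink IU (@subIr _ W W') Hts').
Qed.
Definition pv_add p U (P Q : polyvec p U) : polyvec p U :=
  Polyvec (pv_add_proof P Q).

Fact pv_scale_proof p U (f : regfun U) (P : polyvec p U) :
  @is_polyvec p U (fun V VU fs => rf_res VU f * P V VU fs).
Proof.
split=> [V W VU WU WV fs|x Ux].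
  by rewrite rf_resM (pv_polyvec P).1 (rf_res_comp VU WV WU).
have [W [WU [ts [Wx Hts]]]] := (pv_polyvec P).2 x Ux.
exists W, WU, [seq (rf_res WU f * t.1, t.2) | t <- ts]; split=> // V VW fs.
rewrite Hts mulr_sumr big_map; apply: eq_bigr => t _ /=.
by rewrite rf_resM mulrA (rf_res_comp WU VW (subset_trans VW WU)).
Qed.
Definition pv_scale p U (f : regfun U) (P : polyvec p U) : polyvec p U :=
  Polyvec (pv_scale_proof f P).

Fact pv_res_proof p (U V : op) (VU : V `<=` U) (P : polyvec p U) :
  @is_polyvec p V (fun W WV fs => P W (subset_trans WV VU) fs).
Proof.
split=> [W W' WV W'V W'W fs|x Vx]; first exact: (pv_polyvec P).1.
have [W [WU [ts [Wx Hts]]]] := (pv_polyvec P).2 x (VU x Vx).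
have IU : opens_setI W V `<=` U := subset_trans (@subIl _ W V) WU.
exists (opens_setI W V), (@subIr _ W V), (shrink (@subIl _ W V) ts); split=> //.
move=> W' W'I fs; rewrite -(wedge_sum_shrink IU (@subIl _ W V) Hts).
by congr (pv_fun P _ _); exact: Prop_irrelevance.
Qed.
Definition pv_res p (U V : op) (VU : V `<=` U) (P : polyvec p U) : polyvec p V :=
  Polyvec (pv_res_proof VU P).

HB.instance Definition _ p U := gen_eqMixin (polyvec p U).
HB.instance Definition _ p U := gen_choiceMixin (polyvec p U).

Section PolyvecModule.
Variables (p : nat) (U : op).
Fact pv_addA : associative (@pv_add p U).
Proof. by move=> P Q S; apply: polyvec_ext => V VU fs; exact: addrA. Qed.
Fact pv_addC : commutative (@pv_add p U).
Proof. by move=> P Q; apply: polyvec_ext => V VU fs; exact: addrC. Qed.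
Fact pv_add0 : left_id (pv_zero p U) (@pv_add p U).
Proof. by move=> P; apply: polyvec_ext => V VU fs; exact: add0r. Qed.
Fact pv_addN : left_inverse (pv_zero p U) (pv_scale (-1)) (@pv_add p U).
Proof.
by move=> P; apply: polyvec_ext => V VU fs /=; rewrite rf_resN1 mulN1r addNr.
Qed.
HB.instance Definition _ := GRing.isZmodule.Build (polyvec p U)
  pv_addA pv_addC pv_add0 pv_addN.

Fact pv_scaleA f g P : pv_scale f (pv_scale g P) = pv_scale (f * g) P :> polyvec p U.
Proof. by apply: polyvec_ext => V VU fs; rewrite /= rf_resM mulrA. Qed.
Fact pv_scale1 : left_id 1 (@pv_scale p U).
Proof.
move=> P; apply: polyvec_ext => V VU fs /=.
by rewrite -[rf_res VU 1]/(rf_res VU (rf_cst U 1)) rf_res_cst; exact: mul1r.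
Qed.
Fact pv_scaleDr : right_distributive (@pv_scale p U) +%R.
Proof. by move=> f P Q; apply: polyvec_ext => V VU fs; exact: mulrDr. Qed.
Fact pv_scaleDl P : {morph (@pv_scale p U)^~ P : f g / f + g}.
Proof.
by move=> f g; apply: polyvec_ext => V VU fs; rewrite /= rf_resD; exact: mulrDl.
Qed.
HB.instance Definition _ := GRing.Zmodule_isLmodule.Build (regfun U)
  (polyvec p U) pv_scaleA pv_scale1 pv_scaleDr pv_scaleDl.
End PolyvecModule.

Section PolyvecSheaf.
Variable p : nat.
Fact pv_resD U V (VU : V `<=` U) (P Q : polyvec p U) :
  pv_res VU (P + Q) = pv_res VU P + pv_res VU Q.
Proof. exact: polyvec_ext. Qed.
Fact pv_resZ U V (VU : V `<=` U) f (P : polyvec p U) :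
  pv_res VU (f *: P) = rf_res VU f *: pv_res VU P.
Proof.
apply: polyvec_ext => W WV fs /=.
by rewrite (rf_res_comp VU WV (subset_trans WV VU)).
Qed.
Fact pv_res_id U (UU : U `<=` U) (P : polyvec p U) : pv_res UU P = P.
Proof.
apply: polyvec_ext => V VU fs /=.
by rewrite (Prop_irrelevance (subset_trans VU UU) VU).
Qed.
Fact pv_res_comp U V W (VU : V `<=` U) (WV : W `<=` V) (WU : W `<=` U)
  (P : polyvec p U) : pv_res WV (pv_res VU P) = pv_res WU P.
Proof.
by apply: polyvec_ext => W' W'W fs /=; congr (pv_fun P _ _);
  exact: Prop_irrelevance.
Qed.

Definition wedgeT : omod :=
  @OMod (fun U => polyvec p U) (@pv_res p) pv_resD pv_resZ pv_res_id pv_res_comp.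
End PolyvecSheaf.

Fact pv_of_fun_proof (U : op) (f : regfun U) :
  @is_polyvec 0 U (fun V VU fs => if size fs == 0%N then rf_res VU f else 0).
Proof.
split=> [V W VU WU WV fs|x Ux].
  by rewrite size_map; case: ifP => _; rewrite ?rf_res0 // (rf_res_comp VU WV WU).
pose D0 (i : 'I_0) : derivation U := match notF (ltn_ord i) with end.
exists U, (@subset_refl _ U), [:: (f, D0)]; split=> // V VU fs.
rewrite big_seq1 /wedge det_mx00 /=; case: ifP => _; rewrite ?mulr0 // mulr1.
by rewrite (Prop_irrelevance (subset_trans VU (@subset_refl _ U)) VU).
Qed.
Definition pv_of_fun (U : op) (f : regfun U) : polyvec 0 U :=
  Polyvec (pv_of_fun_proof f).

Definition inversions (k : nat) (m : k.-tuple bool) : nat :=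
  #|[pred ij : 'I_k * 'I_k |
     [&& (ij.1 < ij.2)%N, ~~ tnth m ij.1 & tnth m ij.2]]|.

(* The sum of sgn(s) P(Q(f_s(1), ..., f_s(q)), f_s(q+1), ...) over the shuffles
   s; a shuffle is given by the mask m of {s(1), ..., s(q)}. *)
Definition insertion (q : nat) (U : op) (P Q : evaluation U) : evaluation U :=
  fun V VU fs =>
    \sum_(m : (size fs).-tuple bool | count id m == q)
      (-1) ^+ inversions m *
      P V VU (Q V VU (mask m fs) :: mask (map negb m) fs).

(* [P, Q] for P in /\^p T_X and Q in /\^q T_X.  The exponent has the parity of
   (p - 1)(q - 1).  With this normalization [P, f] = P(df /\ -), and [P, Q] is
   the Lie bracket for p = q = 1. *)
Definition schouten (p q : nat) (U : op) (P Q : evaluation U) : evaluation U :=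
  fun V VU fs =>
    insertion q P Q VU fs - (-1) ^+ (p.+1 * q.+1) * insertion p Q P VU fs.

(* Sections over U of Omega^1_X: locally, finite sums of f dg.  A 1-form is
   identified with its pairing with vector fields, which is harmless since
   Omega^1_X is locally free. *)
Record form1 (U : op) : Type := Form1 {
  fm :> forall V : op, V `<=` U -> polyvec 1 V -> regfun V;
  fm_res : forall V W (VU : V `<=` U) (WU : W `<=` U) (WV : W `<=` V) P,
    rf_res WV (fm VU P) = fm WU (pv_res WV P);
  fm_local : forall x, oset U x ->
    exists (W : op) (WU : W `<=` U) (fg : seq (regfun W * regfun W)),
      oset W x /\
      forall (V : op) (VW : V `<=` W) (P : polyvec 1 V),
        fm (subset_trans VW WU) P
          = \sum_(t <- fg)
              rf_res VW t.1 * P V (@subset_refl _ V) [:: rf_res VW t.2]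
}.

(* The form v du; it is used for v = u^-1, where it is dlog u. *)
Section FormOf.
Variables (U : op) (v u : regfun U).
Definition vdu_fun V (VU : V `<=` U) (P : polyvec 1 V) : regfun V :=
  rf_res VU v * P V (@subset_refl _ V) [:: rf_res VU u].
Fact vdu_res V W (VU : V `<=` U) (WU : W `<=` U) (WV : W `<=` V) P :
  rf_res WV (vdu_fun VU P) = vdu_fun WU (pv_res WV P).
Proof.
rewrite /vdu_fun rf_resM (rf_res_comp VU WV WU); congr (_ * _).
rewrite ((pv_polyvec P).1 V W (@subset_refl _ V) WV WV) /= (rf_res_comp VU WV WU).
by congr (pv_fun P _ _); exact: Prop_irrelevance.
Qed.
Fact vdu_local x : oset U x ->
    exists (W : op) (WU : W `<=` U) (fg : seq (regfun W * regfun W)),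
      oset W x /\
      forall (V : op) (VW : V `<=` W) (P : polyvec 1 V),
        vdu_fun (subset_trans VW WU) P
          = \sum_(t <- fg)
              rf_res VW t.1 * P V (@subset_refl _ V) [:: rf_res VW t.2].
Proof.
move=> Ux; exists U, (@subset_refl _ U), [:: (v, u)]; split=> // V VU P.
rewrite big_seq1 /vdu_fun /=.
by rewrite (Prop_irrelevance (subset_trans VU (@subset_refl _ U)) VU).
Qed.
Definition vdu : form1 U := Form1 vdu_res vdu_local.
End FormOf.

Record ccomplex : Type := CComplex {
  cx_obj :> nat -> cpresheaf;
  cx_d : forall p : nat, chom (cx_obj p) (cx_obj p.+1)
}.

Definition is_ccomplex (K : ccomplex) : Prop :=
  (forall p, is_sheaf (@cs_res (K p))) /\
  (forall p (U : op) (s : K p U), cx_d K p.+1 U (cx_d K p U s) = 0).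

Definition short_exact (A E B : cpresheaf) (i : chom A E) (q : chom E B) : Prop :=
  [/\ (forall (U : op) (a : A U), i U a = 0 -> a = 0),
      (forall (U : op) (s : E U), q U s = 0 <->
         forall x, oset U x -> exists (W : op) (WU : W `<=` U),
           oset W x /\ exists a : A W, i W a = cs_res WU s) &
      (forall (U : op) (b : B U) x, oset U x ->
         exists (W : op) (WU : W `<=` U),
           oset W x /\ exists s : E W, q W s = cs_res WU b)].

Record extension (A B : ccomplex) : Type := Extension {
  ext_mid : ccomplex;
  ext_in : forall p, chom (A p) (ext_mid p);
  ext_out : forall p, chom (ext_mid p) (B p)
}.

Definition is_extension (A B : ccomplex) (e : extension A B) : Prop :=
  [/\ is_ccomplex (ext_mid e),
      (forall p U (a : A p U),
         ext_in e p.+1 U (cx_d A p U a) = cx_d (ext_mid e) p U (ext_in e p U a)),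
      (forall p U (s : ext_mid e p U),
         ext_out e p.+1 U (cx_d (ext_mid e) p U s)
           = cx_d B p U (ext_out e p U s)) &
      (forall p, short_exact (ext_in e p) (ext_out e p))].

(* Equality of the elements of Ext^1(B, A) given by two extensions. *)
Definition ext_iso (A B : ccomplex) (e e' : extension A B) : Prop :=
  exists phi : forall p, chom (ext_mid e p) (ext_mid e' p),
    [/\ (forall p U, bijective (phi p U)),
        (forall p U s, phi p.+1 U (cx_d (ext_mid e) p U s)
                         = cx_d (ext_mid e') p U (phi p U s)),
        (forall p U a, phi p U (ext_in e p U a) = ext_in e' p U a) &
        (forall p U s, ext_out e' p U (phi p U s) = ext_out e p U s)].

Section Poisson.
Variable Lambda : polyvec 2 (opens_setT pts).

Definition is_poisson : Prop :=
  forall V (VT : V `<=` opens_setT pts) fs, schouten 2 2 Lambda Lambda VT fs = 0.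

Definition inT (V : op) : V `<=` opens_setT pts := @subsetT _ V.

Definition pbracket (V : op) (f g : regfun V) : regfun V :=
  Lambda V (@inT V) [:: f; g].

(* Y = i_Lambda(theta), where i_Lambda(sum f dg) = sum f [Lambda, g]. *)
Definition is_contraction (U : op) (theta : form1 U)
    (Y : forall V : op, V `<=` U -> regfun V -> regfun V) : Prop :=
  forall x, oset U x ->
    exists (W : op) (WU : W `<=` U) (fg : seq (regfun W * regfun W)),
      [/\ oset W x,
          (forall V (VW : V `<=` W) (P : polyvec 1 V),
             theta V (subset_trans VW WU) P
               = \sum_(t <- fg)
                   rf_res VW t.1 * P V (@subset_refl _ V) [:: rf_res VW t.2]) &
          (forall V (VW : V `<=` W) (k : regfun V),
             Y V (subset_trans VW WU) k
               = \sum_(t <- fg) rf_res VW t.1 * pbracket (rf_res VW t.2) k)].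

Record cech_cochain : Type := CechCochain {
  cc_index : Type;
  cc_open : cc_index -> op;
  cc_cover : covers cc_open;
  cc_form : forall i j, form1 (opens_setI (cc_open i) (cc_open j))
}.
Arguments cc_open : clear implicits.
Arguments cc_form : clear implicits.

Definition is_cocycle (z : cech_cochain) : Prop :=
  forall i j k (V : op) (Vi : V `<=` cc_open z i) (Vj : V `<=` cc_open z j)
    (Vk : V `<=` cc_open z k) (P : polyvec 1 V),
    cc_form z i j V (subII Vi Vj) P + cc_form z j k V (subII Vj Vk) P
      = cc_form z i k V (subII Vi Vk) P.

(* On the common refinement W, the 1-cochains z and z' differ by the
   coboundary of the 0-cochain theta. *)
Definition cobounds (z z' : cech_cochain) (K : Type) (W : K -> op)
    (r : K -> cc_index z) (r' : K -> cc_index z')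
    (Wr : forall k, W k `<=` cc_open z (r k))
    (Wr' : forall k, W k `<=` cc_open z' (r' k))
    (theta : forall k, form1 (W k)) : Prop :=
  forall k l (V : op) (Vk : V `<=` W k) (Vl : V `<=` W l) (P : polyvec 1 V),
    cc_form z (r k) (r l) V
        (subII (subset_trans Vk (Wr k)) (subset_trans Vl (Wr l))) P
    - cc_form z' (r' k) (r' l) V
        (subII (subset_trans Vk (Wr' k)) (subset_trans Vl (Wr' l))) P
    = theta l V Vl P - theta k V Vk P.

(* Equality in H^1(X, Omega^1_X). *)
Definition cohomologous (z z' : cech_cochain) : Prop :=
  exists (K : Type) (W : K -> op) (r : K -> cc_index z) (r' : K -> cc_index z')
    (Wr : forall k, W k `<=` cc_open z (r k))
    (Wr' : forall k, W k `<=` cc_open z' (r' k))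
    (theta : forall k, form1 (W k)),
    covers W /\ cobounds Wr Wr' theta.

(* 1-cochains of the complex i_Lambda : Omega^1_X -> T_X. *)
Record hyper_cochain : Type := HyperCochain {
  hc_cech :> cech_cochain;
  hc_vec : forall i, polyvec 1 (cc_open hc_cech i)
}.
Arguments hc_vec : clear implicits.

Definition is_hyper_cocycle (z : hyper_cochain) : Prop :=
  is_cocycle z /\
  forall i j, is_contraction (cc_form z i j) (fun V VU f =>
    hc_vec z i V (subset_trans VU (@subIl _ _ _)) [:: f]
    - hc_vec z j V (subset_trans VU (@subIr _ _ _)) [:: f]).

(* Equality in H^1(X, Omega^1_X -> T_X): with the differential
   ({w_ij}, {T_i}) |-> T_j - T_i + i_Lambda(w_ij), the coboundary of {theta_k}
   is ({theta_l - theta_k}, {- i_Lambda(theta_k)}). *)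
Definition hyper_cohomologous (z z' : hyper_cochain) : Prop :=
  exists (K : Type) (W : K -> op) (r : K -> cc_index z) (r' : K -> cc_index z')
    (Wr : forall k, W k `<=` cc_open z (r k))
    (Wr' : forall k, W k `<=` cc_open z' (r' k))
    (theta : forall k, form1 (W k)),
    [/\ covers W, cobounds Wr Wr' theta &
        forall k, is_contraction (theta k) (fun V VU f =>
          hc_vec z' (r' k) V (subset_trans VU (Wr' k)) [:: f]
          - hc_vec z (r k) V (subset_trans VU (Wr k)) [:: f])].

Record poisson_invertible_sheaf : Type := PoissonInvertibleSheaf {
  pl_mod :> omod;
  pl_sheaf : is_sheaf (@om_res pl_mod);
  pl_invertible : locally_free pl_mod 1;
  pl_br : forall U : op, regfun U -> pl_mod U -> pl_mod U;
  pl_br_res : forall U V (VU : V `<=` U) f (s : pl_mod U),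
    om_res VU (pl_br f s) = pl_br (rf_res VU f) (om_res VU s);
  pl_br_Dl : forall U (f g : regfun U) (s : pl_mod U),
    pl_br (f + g) s = pl_br f s + pl_br g s;
  pl_br_Dr : forall U (f : regfun U) (s t : pl_mod U),
    pl_br f (s + t) = pl_br f s + pl_br f t;
  pl_br_Zl : forall U (c : C) (f : regfun U) (s : pl_mod U),
    pl_br (rf_cst U c * f) s = rf_cst U c *: pl_br f s;
  pl_br_Zr : forall U (c : C) (f : regfun U) (s : pl_mod U),
    pl_br f (rf_cst U c *: s) = rf_cst U c *: pl_br f s;
  pl_br_Ml : forall U (f g : regfun U) (s : pl_mod U),
    pl_br (f * g) s = f *: pl_br g s + g *: pl_br f s;
  pl_br_Mr : forall U (f g : regfun U) (s : pl_mod U),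
    pl_br f (g *: s) = pbracket f g *: s + g *: pl_br f s;
  pl_flat : forall U (f g : regfun U) (s : pl_mod U),
    pl_br f (pl_br g s) = pl_br (pbracket f g) s + pl_br g (pl_br f s)
}.

(* Frames e_i of L on an open cover.  A section with coordinates s_i, i.e. equal
   to s_i e_i on U_i, has s_i = h_ij s_j if and only if e_j = h_ij e_i; and
   nabla(s) = - [Lambda, s_i] + s_i T_i amounts to {f, e_i} = T_i(f) e_i. *)
Record trivialization (L : poisson_invertible_sheaf) : Type := Trivialization {
  tr_index : Type;
  tr_open : tr_index -> op;
  tr_cover : covers tr_open;
  tr_frame : forall i, L (tr_open i);
  tr_frameP : forall i (V : op) (Vi : V `<=` tr_open i) (s : L V),
    exists! f : regfun V, s = f *: om_res Vi (tr_frame i);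
  tr_h : forall i j, regfun (opens_setI (tr_open i) (tr_open j));
  tr_hP : forall i j,
    om_res (@subIr _ (tr_open i) (tr_open j)) (tr_frame j)
      = tr_h i j *: om_res (@subIl _ (tr_open i) (tr_open j)) (tr_frame i);
  tr_T : forall i, polyvec 1 (tr_open i);
  tr_TP : forall i (V : op) (Vi : V `<=` tr_open i) (f : regfun V),
    pl_br f (om_res Vi (tr_frame i))
      = tr_T i V Vi [:: f] *: om_res Vi (tr_frame i)
}.
Arguments tr_open {L}.
Arguments tr_frame {L}.
Arguments tr_h {L}.
Arguments tr_T {L}.

Section Atiyah.
Variables (L : poisson_invertible_sheaf) (tau : trivialization L).

Notation I := (tr_index tau).
Notation U_ := (tr_open tau).

Definition tr_hres (i j : I) (V : op) (Vi : V `<=` U_ i) (Vj : V `<=` U_ j) :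
  regfun V := rf_res (subII Vi Vj) (tr_h tau i j).

Lemma tr_hres_irr (i j : I) (V : op) (Vi Vi' : V `<=` U_ i)
  (Vj Vj' : V `<=` U_ j) : tr_hres Vi Vj = tr_hres Vi' Vj'.
Proof. by congr rf_res; exact: Prop_irrelevance. Qed.

(* h_ji is the inverse of h_ij. *)
Definition dlog_h (i j : I) : form1 (opens_setI (U_ i) (U_ j)) :=
  vdu (tr_hres (@subIr _ (U_ i) (U_ j)) (@subIl _ (U_ i) (U_ j))) (tr_h tau i j).

Definition chern_cochain : cech_cochain :=
  CechCochain (@tr_cover _ tau) dlog_h.
Definition poisson_chern_cochain : hyper_cochain :=
  @HyperCochain chern_cochain (tr_T tau).

(* Sections over U of E_L^p: the a_i, b_i live on U n U_i, and
   [b_i, log h_ij] = h_ij^-1 b_i(dh_ij /\ -). *)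
Record esec (p : nat) (U : op) : Type := ESec {
  es_a : forall i, polyvec p (opens_setI U (U_ i));
  es_b : forall i, polyvec p.+1 (opens_setI U (U_ i));
  es_glue_b : forall i j (V : op) (Vi : V `<=` opens_setI U (U_ i))
    (Vj : V `<=` opens_setI U (U_ j)) fs, es_b i V Vi fs = es_b j V Vj fs;
  es_glue_a : forall i j (V : op) (Vi : V `<=` opens_setI U (U_ i))
    (Vj : V `<=` opens_setI U (U_ j)) fs,
    es_a j V Vj fs - es_a i V Vi fs
      = tr_hres (subset_trans Vj (@subIr _ _ _)) (subset_trans Vi (@subIr _ _ _))
        * es_b i V Vi
            (tr_hres (subset_trans Vi (@subIr _ _ _))
                     (subset_trans Vj (@subIr _ _ _)) :: fs)
}.

Lemma esec_ext p U (s t : esec p U) :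
  (forall i, es_a s i = es_a t i) -> (forall i, es_b s i = es_b t i) -> s = t.
Proof.
case: s t => a b Gb Ga [a' b' Gb' Ga'] /=.
move=> Ea Eb; have Ea' : a = a' by exact: functional_extensionality_dep.
have Eb' : b = b' by exact: functional_extensionality_dep.
subst a' b'.
by congr ESec; exact: Prop_irrelevance.
Qed.

HB.instance Definition _ p U := gen_eqMixin (esec p U).
HB.instance Definition _ p U := gen_choiceMixin (esec p U).

Section ESecModule.
Variables (p : nat) (U : op).

Definition es_zero : esec p U.
Proof.
refine (@ESec p U (fun=> 0) (fun=> 0) _ _) => // i j V Vi Vj fs.
by rewrite -[RHS]/(_ * 0) mulr0; exact: subrr.
Defined.

Definition es_add (s t : esec p U) : esec p U.
Proof.
refine (@ESec p U (fun i => es_a s i + es_a t i)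
                  (fun i => es_b s i + es_b t i) _ _) => i j V Vi Vj fs.
  by congr (_ + _); exact: es_glue_b.
rewrite /= -[LHS]/(_ + _ - (_ + _)) opprD addrACA !(es_glue_a _ Vi Vj).
by rewrite -mulrDr.
Defined.

Definition es_scale (f : regfun U) (s : esec p U) : esec p U.
Proof.
pose fr i := rf_res (@subIl _ U (U_ i)) f.
refine (@ESec p U (fun i => fr i *: es_a s i)
                  (fun i => fr i *: es_b s i) _ _) => i j V Vi Vj fs.
  rewrite /= /fr !(rf_res_comp _ _ (subset_trans Vi (@subIl _ _ _))).
  by congr (_ * _); exact: es_glue_b.
rewrite /= /fr !(rf_res_comp _ _ (subset_trans Vi (@subIl _ _ _))).
by rewrite -mulrBr (es_glue_a _ Vi Vj) mulrCA.
Defined.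

Fact es_addA : associative es_add.
Proof. by move=> s t u; apply: esec_ext => i; exact: addrA. Qed.
Fact es_addC : commutative es_add.
Proof. by move=> s t; apply: esec_ext => i; exact: addrC. Qed.
Fact es_add0 : left_id es_zero es_add.
Proof. by move=> s; apply: esec_ext => i; exact: add0r. Qed.
Fact es_addN : left_inverse es_zero (es_scale (-1)) es_add.
Proof.
by move=> s; apply: esec_ext => i; rewrite /= rf_resN1 scaleN1r addNr.
Qed.
HB.instance Definition _ := GRing.isZmodule.Build (esec p U)
  es_addA es_addC es_add0 es_addN.

Fact es_scaleA f g s : es_scale f (es_scale g s) = es_scale (f * g) s.
Proof. by apply: esec_ext => i; rewrite /= scalerA rf_resM. Qed.
Fact es_scale1 : left_id 1 es_scale.
Proof.
move=> s; apply: esec_ext => i /=;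
by rewrite -[rf_res _ 1]/(rf_res _ (rf_cst U 1)) rf_res_cst; exact: scale1r.
Qed.
Fact es_scaleDr : right_distributive es_scale +%R.
Proof. by move=> f s t; apply: esec_ext => i; exact: scalerDr. Qed.
Fact es_scaleDl s : {morph es_scale^~ s : f g / f + g}.
Proof.
by move=> f g; apply: esec_ext => i; rewrite /= rf_resD; exact: scalerDl.
Qed.
HB.instance Definition _ := GRing.Zmodule_isLmodule.Build (regfun U)
  (esec p U) es_scaleA es_scale1 es_scaleDr es_scaleDl.
End ESecModule.

Section ESheaf.
Variable p : nat.

Lemma openIS (U V W : op) : V `<=` U -> opens_setI V W `<=` opens_setI U W.
Proof. by move=> VU x [Vx Wx]; split=> //; exact: VU. Qed.

Definition es_res (U V : op) (VU : V `<=` U) (s : esec p U) : esec p V.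
Proof.
refine (@ESec p V (fun i => pv_res (@openIS U V (U_ i) VU) (es_a s i))
                  (fun i => pv_res (@openIS U V (U_ i) VU) (es_b s i)) _ _)
  => i j W Wi Wj fs.
  exact: es_glue_b.
rewrite /= es_glue_a; congr (_ * _); first exact: tr_hres_irr.
by congr (pv_fun (es_b s i) _ (_ :: _)); exact: tr_hres_irr.
Defined.

Fact es_resD U V (VU : V `<=` U) (s t : esec p U) :
  es_res VU (s + t) = es_res VU s + es_res VU t.
Proof. by apply: esec_ext => i; exact: polyvec_ext. Qed.
Fact es_resZ U V (VU : V `<=` U) f (s : esec p U) :
  es_res VU (f *: s) = rf_res VU f *: es_res VU s.
Proof.
by apply: esec_ext => i; rewrite /= pv_resZ;
  congr (_ *: _); rewrite !(rf_res_comp _ _ (subset_trans (@subIl _ V (U_ i)) VU)).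
Qed.
Fact es_res_id U (UU : U `<=` U) (s : esec p U) : es_res UU s = s.
Proof. by apply: esec_ext => i; exact: pv_res_id. Qed.
Fact es_res_comp U V W (VU : V `<=` U) (WV : W `<=` V) (WU : W `<=` U)
  (s : esec p U) : es_res WV (es_res VU s) = es_res WU s.
Proof. by apply: esec_ext => i; exact: pv_res_comp. Qed.

Definition atiyah_sheaf : omod :=
  @OMod (fun U => esec p U) es_res es_resD es_resZ es_res_id es_res_comp.
End ESheaf.

(* d, iota and pi are the maps
     (a_i, b_i) |-> ([Lambda, a_i] + (-1)^{p+1} [T_i, b_i], [Lambda, b_i]),
     a |-> (a, 0),   (a, b) |-> b. *)
Definition is_atiyah_data
    (dE : forall p, chom (forget (atiyah_sheaf p)) (forget (atiyah_sheaf p.+1)))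
    (iota : forall p, ohom (wedgeT p) (atiyah_sheaf p))
    (pi : forall p, ohom (atiyah_sheaf p) (wedgeT p.+1)) : Prop :=
  [/\ (forall p (U : op) (s : esec p U) k (V : op)
         (Vk : V `<=` opens_setI U (U_ k)) fs,
         let ds : esec p.+1 U := dE p U s in
         let LambdaU := pv_res (@inT (opens_setI U (U_ k))) Lambda in
         let TU := pv_res (@subIr _ U (U_ k)) (tr_T tau k) in
         es_a ds k V Vk fs
           = schouten 2 p LambdaU (es_a s k) Vk fs
             + (-1) ^+ p.+1 * schouten 1 p.+1 TU (es_b s k) Vk fs /\
         es_b ds k V Vk fs = schouten 2 p.+1 LambdaU (es_b s k) Vk fs),
      (forall p (U : op) (a : polyvec p U) k,
         es_a (iota p U a) k = pv_res (@subIl _ U (U_ k)) a /\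
         es_b (iota p U a) k = 0) &
      (forall p (U : op) (s : esec p U) k,
         pv_res (@subIl _ U (U_ k)) (pi p U s) = es_b s k)].

End Atiyah.

(* A class in H^1(X, Omega^1_X), or in H^1(X, Omega^1_X -> T_X), is encoded by
   the set of its representing cocycles. *)
Definition chern_class (L : poisson_invertible_sheaf) : set cech_cochain :=
  [set z | is_cocycle z /\
     exists tau : trivialization L, cohomologous z (chern_cochain tau)].

Definition poisson_chern_class (L : poisson_invertible_sheaf) :
    set hyper_cochain :=
  [set z | is_hyper_cocycle z /\
     exists tau : trivialization L,
       hyper_cohomologous z (poisson_chern_cochain tau)].

(* The extension 0 -> O_X -> E -> T_X -> 0 of O_X-modules corresponds to the
   class c under Ext^1(T_X, O_X) = H^1(X, Hom(T_X, O_X)) = H^1(X, Omega^1_X):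
   it has local splittings sigma_k whose differences sigma_k - sigma_l are given
   by the 1-forms w_kl of a cocycle in c. *)
Definition is_extension_of_class (c : set cech_cochain) (E : omod)
    (iota : ohom (wedgeT 0) E) (pi : ohom E (wedgeT 1)) : Prop :=
  short_exact (forget_hom iota) (forget_hom pi) /\
  exists z : cech_cochain, c z /\
  exists sigma : forall k (V : op), V `<=` cc_open z k -> wedgeT 1 V -> E V,
    [/\ (forall k V (Vk : V `<=` cc_open z k) (f : regfun V) P Q,
           sigma k V Vk (f *: P + Q) = f *: sigma k V Vk P + sigma k V Vk Q),
        (forall k V W (Vk : V `<=` cc_open z k) (Wk : W `<=` cc_open z k)
           (WV : W `<=` V) P,
           om_res WV (sigma k V Vk P) = sigma k W Wk (om_res WV P)),
        (forall k V (Vk : V `<=` cc_open z k) P, pi V (sigma k V Vk P) = P) &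
        (forall k l V (Vk : V `<=` cc_open z k) (Vl : V `<=` cc_open z l) P,
           sigma k V Vk P - sigma l V Vl P
             = iota V (pv_of_fun (cc_form z k l V (subII Vk Vl) P)))].

Section PoissonComplexes.
Variable d : forall p, chom (forget (wedgeT p)) (forget (wedgeT p.+1)).

Definition is_poisson_differential : Prop :=
  forall p (U : op) (P : polyvec p U) (V : op) (VU : V `<=` U) fs,
    (d p U P : polyvec p.+1 U) V VU fs
      = schouten 2 p (pv_res (@inT U) Lambda) P VU fs.

Definition O_complex : ccomplex := CComplex d.
Definition T_complex : ccomplex := @CComplex _ (fun p => d p.+1).

Definition poisson_atiyah (L : poisson_invertible_sheaf)
    (tau : trivialization L)
    (dE : forall p,
       chom (forget (atiyah_sheaf tau p)) (forget (atiyah_sheaf tau p.+1)))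
    (iota : forall p, ohom (wedgeT p) (atiyah_sheaf tau p))
    (pi : forall p, ohom (atiyah_sheaf tau p) (wedgeT p.+1)) :
    extension O_complex T_complex :=
  @Extension O_complex T_complex (CComplex dE)
    (fun p => forget_hom (iota p)) (fun p => forget_hom (pi p)).
End PoissonComplexes.

End Poisson.

End Sheaves.

(* Main.v *)
Require Import Defs.
From mathcomp Require Import all_boot all_order all_algebra.
From mathcomp Require Import boolp classical_sets reals.
From mathcomp Require Import topology_structure initial_topology subtype_topology.
From mathcomp Require Import complex mpoly ring lra.
From mathcomp Require sequences exp.

Set Implicit Arguments.
Unset Strict Implicit.
Unset Printing Implicit Defensive.

Import GRing.Theory.
Local Open Scope classical_set_scope.
Local Open Scope ring_scope.

Local Notation irr := Prop_irrelevance.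
Local Notation subxx := (@subset_refl _ _).
Local Notation "p >> q" := (subset_trans p q) (at level 60, right associativity).
Local Notation "U ∩ V" := (opens_setI U V) (at level 35).
Local Notation subl := (@subIl _ _ _).
Local Notation subr := (@Defs.subIr _ _ _).

Section ShuffleSums.
Variable A : comPzRingType.
Implicit Types (P Q : seq A -> A) (F G : seq A -> seq A -> A) (fs : seq A).

Fixpoint shuffle_sum (q : nat) F fs : A :=
  if fs is f :: fs' then
    (if q is q'.+1 then shuffle_sum q' (fun s r => F (f :: s) r) fs' else 0)
    + (-1) ^+ q * shuffle_sum q (fun s r => F s (f :: r)) fs'
  else if q == 0%N then F [::] [::] else 0.

Lemma eq_shuffle_sum q F G fs :
  (forall s r, size s = q -> (size s + size r)%N = size fs -> F s r = G s r) ->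
  shuffle_sum q F fs = shuffle_sum q G fs.
Proof.
elim: fs q F G => [|f fs IH] q F G FG /=.
  by case: eqP => // q0; apply: FG.
congr (_ + _ * _).
  case: q FG => // q FG; apply: IH => s r sq srf.
  by apply: FG => /=; [rewrite sq|rewrite addSn srf].
by apply: IH => s r sq srf; apply: FG; rewrite //= addnS srf.
Qed.

Lemma shuffle_sum0 q F fs :
  (forall s r, size s = q -> (size s + size r)%N = size fs -> F s r = 0) ->
  shuffle_sum q F fs = 0.
Proof.
move=> F0; rewrite (@eq_shuffle_sum q F (fun _ _ => 0)) //.
elim: fs q {F F0} => [|f fs IH] q /=; first by case: ifP.
by rewrite IH mulr0 addr0; case: q => // q; rewrite IH.
Qed.

Lemma shuffle_sumD q F G fs :
  shuffle_sum q (fun s r => F s r + G s r) fs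
    = shuffle_sum q F fs + shuffle_sum q G fs.
Proof.
elim: fs q F G => [|f fs IH] q F G /=; first by case: ifP; rewrite ?addr0.
by case: q => [|q]; rewrite !IH; ring.
Qed.

Lemma shuffle_sumZ q u F fs :
  shuffle_sum q (fun s r => u * F s r) fs = u * shuffle_sum q F fs.
Proof.
elim: fs q F => [|f fs IH] q F /=; first by case: ifP; rewrite ?mulr0.
by case: q => [|q]; rewrite !IH; ring.
Qed.

End ShuffleSums.

Section MaskSums.
Variable A : comPzRingType.

Lemma inversionsE k (m : k.-tuple bool) :
  inversions m = (\sum_(i < k) \sum_(j < k)
    [&& (i < j)%N, ~~ tnth m i & tnth m j])%N.
Proof.
rewrite /inversions -sum1_card pair_big /= big_mkcond /=.
by apply: eq_bigr => -[i j] _; rewrite inE /=; case: ([&& _, _ & _]).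
Qed.

Lemma inversions_cons k (b : bool) (m : k.-tuple bool) :
  inversions (cons_tuple b m) = ((if b then 0 else count id m) + inversions m)%N.
Proof.
rewrite !inversionsE big_ord_recl /=; congr (_ + _)%N.
  rewrite big_ord_recl /= add0n.
  have -> : count id m = (\sum_(i < k) tnth m i)%N.
    rewrite -sum1_count big_tuple big_mkcond /=.
    by apply: eq_bigr => i _; case: (tnth m i).
  case: b => /=; first by rewrite big1 // => i _; rewrite (tnth_nth false).
  by apply: eq_bigr => i _; rewrite tnthS.
apply: eq_bigr => i _; rewrite big_ord_recl /= add0n.
by apply: eq_bigr => j _; rewrite !tnthS /= /bump /= !add1n ltnS.
Qed.

Lemma shuffle_sumE q (F : seq A -> seq A -> A) fs :
  \sum_(m : (size fs).-tuple bool | count id m == q)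
     (-1) ^+ inversions m * F (mask m fs) (mask (map negb m) fs)
    = shuffle_sum q F fs.
Proof.
elim: fs q F => [|f fs IH] q F /=.
  rewrite big_mkcond (big_pred1 [tuple]) => [|m]; last first.
    by apply/esym/eqP; exact: tuple0.
  rewrite eq_sym; case: ifP => // _.
  by rewrite inversionsE big_ord0 expr0 mul1r.
pose h (bm : bool * (size fs).-tuple bool) := cons_tuple bm.1 bm.2.
pose h' (m : (size fs).+1.-tuple bool) := (thead m, behead_tuple m).
have hK : cancel h h'.
  by case=> b m; rewrite /h /h' theadE; congr (_, _); apply: val_inj.
have h'K : cancel h' h by move=> m; rewrite /h /h' [RHS]tuple_eta.
rewrite (reindex h); last by exists h' => x _; [exact: hK|exact: h'K].
rewrite /h /= -(pair_big_dep predT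
  (fun (b : bool) (m : (size fs).-tuple bool) => b + count id m == q)%N
  (fun (b : bool) (m : (size fs).-tuple bool) =>
    (-1) ^+ inversions (cons_tuple b m) *
    F (mask (b :: m) (f :: fs)) (mask (~~ b :: map negb m) (f :: fs)))) /=.
rewrite (bigD1 true) //= (big_pred1 false); last by case.
congr (_ + _).
  case: q => [|q]; first by rewrite big1 // => m; rewrite add1n.
  by rewrite -IH; apply: eq_big => m; rewrite ?add1n ?eqSS // inversions_cons.
rewrite -IH mulr_sumr; apply: eq_bigr => m /eqP mq.
by rewrite inversions_cons -mq exprD mulrA.
Qed.

End MaskSums.

Lemma signE (A : comPzRingType) n : (-1) ^+ n = (if odd n then -1 else 1 : A).
Proof. by rewrite -signr_odd; case: (odd n). Qed.

Ltac sign_ring :=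
  rewrite ?signE ?(oddM, oddD, oddS) ?negbK /=;
  repeat match goal with |- context [odd ?n] => case: (odd n) end;
  rewrite /=; ring.

Section IsMds.
Variables (A : comPzRingType) (K : A -> Prop).
Implicit Types (P Q : seq A -> A) (fs : seq A).

Record is_md (p : nat) P : Prop := IsMd {
  md_size : forall fs, size fs <> p -> P fs = 0;
  md_D : forall l r f g, P (l ++ (f + g) :: r) = P (l ++ f :: r) + P (l ++ g :: r);
  md_M : forall l r f g,
    P (l ++ (f * g) :: r) = f * P (l ++ g :: r) + g * P (l ++ f :: r);
  md_K : forall l r c, K c -> P (l ++ c :: r) = 0;
  md_alt : forall l r f, P (l ++ f :: f :: r) = 0
}.

Definition slot f P : seq A -> A := fun fs => P (f :: fs).

Lemma md_slot p P f : is_md p P -> is_md p.-1 (slot f P).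
Proof.
move=> mP; split=> [fs|l r g h|l r g h|l r c Kc|l r g]; rewrite /slot.
- case: p mP => [|p] mP ne; apply: (md_size mP) => //=.
  by move=> [].
- exact: (md_D mP (f :: l)).
- exact: (md_M mP (f :: l)).
- exact: (md_K mP (f :: l)).
- exact: (md_alt mP (f :: l)).
Qed.

Lemma md_slot0 P f : is_md 0 P -> slot f P = fun=> 0.
Proof. by move=> mP; apply: funext => fs; exact: (md_size mP). Qed.

Lemma md_swap p P l r f g : is_md p P ->
  P (l ++ f :: g :: r) = - P (l ++ g :: f :: r).
Proof.
move=> mP; have := md_alt mP l r (f + g); rewrite (md_D mP).
have E h k k' : P (l ++ h :: (k + k') :: r)
    = P (l ++ h :: k :: r) + P (l ++ h :: k' :: r).
  by have := md_D mP (rcons l h) r k k'; rewrite !cat_rcons.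
rewrite !E !(md_alt mP) add0r addr0 => /eqP; rewrite addr_eq0 => /eqP.
done.
Qed.

Lemma md_0 p P l r : is_md p P -> P (l ++ 0 :: r) = 0.
Proof.
move=> mP; have := md_D mP l r 0 0; rewrite addr0 => /eqP.
by rewrite -subr_eq subrr eq_sym => /eqP.
Qed.

Lemma md_zero p : is_md p (fun=> 0).
Proof. by split=> // *; rewrite ?mulr0 addr0. Qed.

Lemma md_add p P Q : is_md p P -> is_md p Q ->
  is_md p (fun fs => P fs + Q fs).
Proof.
move=> mP mQ; split=> [fs ne|l r g h|l r g h|l r c Kc|l r g].
- by rewrite (md_size mP) ?(md_size mQ) ?addr0.
- by rewrite (md_D mP) (md_D mQ) addrACA.
- by rewrite (md_M mP) (md_M mQ); ring.
- by rewrite (md_K mP) ?(md_K mQ) ?addr0.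
- by rewrite (md_alt mP) (md_alt mQ) addr0.
Qed.

Lemma md_scale p P u : is_md p P ->
  is_md p (fun fs => u * P fs).
Proof.
move=> mP; split=> [fs ne|l r g h|l r g h|l r c Kc|l r g].
- by rewrite (md_size mP) ?mulr0.
- by rewrite (md_D mP) mulrDr.
- by rewrite (md_M mP); ring.
- by rewrite (md_K mP) ?mulr0.
- by rewrite (md_alt mP) mulr0.
Qed.

Lemma md_sum p (I : Type) (s : seq I) (F : I -> seq A -> A) :
  (forall i, is_md p (F i)) ->
  is_md p (fun fs => \sum_(i <- s) F i fs).
Proof.
move=> mF; elim: s => [|i s IH].
  by under eq_fun do rewrite big_nil; exact: md_zero.
by under eq_fun do rewrite big_cons; exact: md_add.
Qed.

(* The empty prefix is isolated to allow inductive proofs. *)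
Lemma md_intro p P :
  (forall fs, size fs <> p -> P fs = 0) ->
  (forall r f g, P (f + g :: r) = P (f :: r) + P (g :: r)) ->
  (forall r f g, P (f * g :: r) = f * P (g :: r) + g * P (f :: r)) ->
  (forall r c, K c -> P (c :: r) = 0) ->
  (forall r f, P (f :: f :: r) = 0) ->
  (forall f, is_md p.-1 (slot f P)) ->
  is_md p P.
Proof.
move=> Ps PD PM PK Pa mP; split=> // [[|x l] r f g|[|x l] r f g|[|x l] r c Kc|[|x l] r f];
  rewrite ?cat0s ?cat_cons //.
- exact: (md_D (mP x)).
- exact: (md_M (mP x)).
- exact: PK.
- exact: (md_K (mP x)).
- exact: (md_alt (mP x)).
Qed.

Definition insert (q : nat) P Q : seq A -> A :=
  shuffle_sum q (fun s r => P (Q s :: r)).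

Definition sbracket (p q : nat) P Q : seq A -> A :=
  fun fs => insert q P Q fs - (-1) ^+ (p.+1 * q.+1) * insert p Q P fs.

Definition wprod (a : nat) P Q : seq A -> A :=
  shuffle_sum a (fun s r => P s * Q r).

Lemma insert_cons p q P Q f fs : is_md p P -> is_md q Q ->
  insert q P Q (f :: fs)
    = insert q.-1 P (slot f Q) fs - (-1) ^+ q * insert q (slot f P) Q fs.
Proof.
move=> mP mQ; rewrite /insert /=.
have -> : shuffle_sum q (fun s r => P [:: Q s, f & r]) fs
   = - shuffle_sum q (fun s r => slot f P (Q s :: r)) fs.
  rewrite -mulN1r -shuffle_sumZ; apply: eq_shuffle_sum => s r _ _.
  by rewrite mulN1r; exact: (md_swap [::] _ _ _ mP).
rewrite mulrN; case: q mQ => [|q] mQ //=; congr (_ - _).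
apply/esym/shuffle_sum0 => s r _ _.
by rewrite (md_slot0 _ mQ); exact: (md_0 [::] _ mP).
Qed.

Lemma insert_size p q P Q fs : is_md p P -> is_md q Q ->
  size fs <> (p + q).-1 -> insert q P Q fs = 0.
Proof.
move=> mP mQ ne; apply: shuffle_sum0 => s r sq srf.
apply: (md_size mP) => /= ep; apply: ne.
by rewrite -srf -ep sq addSn /= addnC.
Qed.

Lemma sbracket_size p q P Q fs : is_md p P -> is_md q Q ->
  size fs <> (p + q).-1 -> sbracket p q P Q fs = 0.
Proof.
move=> mP mQ ne; rewrite /sbracket (insert_size mP mQ ne).
by rewrite (insert_size mQ mP) 1?addnC // mulr0 subr0.
Qed.

Lemma sbracket_cons p q P Q f fs : is_md p P -> is_md q Q ->
  sbracket p q P Q (f :: fs)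
    = sbracket p q.-1 P (slot f Q) fs
      + (-1) ^+ q.+1 * sbracket p.-1 q (slot f P) Q fs.
Proof.
move=> mP mQ; rewrite /sbracket (insert_cons f fs mP mQ) (insert_cons f fs mQ mP).
have E0 m R S : is_md m R -> is_md 0 S ->
    (insert 0 R (slot f S) fs = 0) * (forall m', insert m' (slot f S) R fs = 0).
  move=> mR mS; rewrite (md_slot0 f mS); split=> [|m'];
    apply: shuffle_sum0 => // s r _ _; exact: (md_0 [::] _ mR).
case: p mP => [|p] mP; case: q mQ => [|q] mQ /=.
- by rewrite !(E0 _ _ _ mP mQ) !(E0 _ _ _ mQ mP); ring.
- by rewrite !(E0 _ _ _ mQ mP); sign_ring.
- by rewrite !(E0 _ _ _ mP mQ); sign_ring.
by sign_ring.
Qed.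

Lemma wprod_cons a b P Q f fs :
  is_md a P -> is_md b Q ->
  wprod a P Q (f :: fs)
    = wprod a.-1 (slot f P) Q fs + (-1) ^+ a * wprod a P (slot f Q) fs.
Proof.
move=> mP mQ; rewrite /wprod /=; case: a mP => [|a] mP //=; congr (_ + _).
by apply/esym/shuffle_sum0 => s r _ _; rewrite (md_slot0 _ mP) mul0r.
Qed.

Lemma wprodC a b P Q fs : is_md a P -> is_md b Q ->
  wprod a P Q fs = (-1) ^+ (a * b) * wprod b Q P fs.
Proof.
elim: fs a b P Q => [|f fs IH] a b P Q mP mQ.
  rewrite /wprod /=; case: a mP => [|a] mP; case: b mQ => [|b] mQ /=.
  - by rewrite mul1r mulrC.
  - by rewrite mulr0 (md_size mQ) ?mulr0.
  - by rewrite (md_size mP) ?mulr0 // mulr0.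
  - by rewrite mulr0.
rewrite (wprod_cons f fs mP mQ) (wprod_cons f fs mQ mP).
rewrite (IH _ _ _ _ (md_slot f mP) mQ) (IH _ _ _ _ mP (md_slot f mQ)).
have E0 R S k : is_md 0 R -> wprod k (slot f R) S fs = 0.
  by move=> mR; apply: shuffle_sum0 => s r _ _; rewrite (md_slot0 f mR) mul0r.
have E0' R S k : is_md 0 R -> wprod k S (slot f R) fs = 0.
  by move=> mR; apply: shuffle_sum0 => s r _ _; rewrite (md_slot0 f mR) mulr0.
case: a mP => [|a] mP; case: b mQ => [|b] mQ /=;
  rewrite ?(E0 _ _ _ mP) ?(E0 _ _ _ mQ) ?(E0' _ _ _ mP) ?(E0' _ _ _ mQ) //;
  by sign_ring.
Qed.

Lemma insert_scale p q u P Q fs : is_md p P ->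
  insert q P (fun s => u * Q s) fs
    = u * insert q P Q fs + wprod q Q (slot u P) fs.
Proof.
move=> mP; rewrite /insert /wprod -shuffle_sumZ -shuffle_sumD.
by apply: eq_shuffle_sum => s r _ _; exact: (md_M mP [::]).
Qed.

Lemma insert_scalel q u P Q fs :
  insert q (fun s => u * P s) Q fs = u * insert q P Q fs.
Proof. exact: shuffle_sumZ. Qed.

Lemma insertD p q P Q Q' fs : is_md p P ->
  insert q P (fun s => Q s + Q' s) fs = insert q P Q fs + insert q P Q' fs.
Proof.
move=> mP; rewrite /insert -shuffle_sumD.
by apply: eq_shuffle_sum => s r _ _; exact: (md_D mP [::]).
Qed.

Lemma insertDl q P P' Q fs :
  insert q (fun s => P s + P' s) Q fs = insert q P Q fs + insert q P' Q fs.
Proof. exact: shuffle_sumD. Qed.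

Lemma sbracketDr p q P Q Q' fs : is_md p P ->
  sbracket p q P (fun s => Q s + Q' s) fs
    = sbracket p q P Q fs + sbracket p q P Q' fs.
Proof.
by move=> mP; rewrite /sbracket (insertD _ _ _ _ mP) insertDl; ring.
Qed.

Lemma sbracketDl p q P P' Q fs : is_md q Q ->
  sbracket p q (fun s => P s + P' s) Q fs
    = sbracket p q P Q fs + sbracket p q P' Q fs.
Proof.
by move=> mQ; rewrite /sbracket (insertD _ _ _ _ mQ) insertDl; ring.
Qed.

Lemma sbracketZr p q u P Q fs : is_md p P ->
  sbracket p q P (fun s => u * Q s) fs
    = u * sbracket p q P Q fs + wprod q Q (slot u P) fs.
Proof.
by move=> mP; rewrite /sbracket (insert_scale _ _ _ _ mP) insert_scalel; ring.
Qed.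

Lemma sbracketC p q P Q fs :
  sbracket q p Q P fs = - (-1) ^+ (p.+1 * q.+1) * sbracket p q P Q fs.
Proof. by rewrite /sbracket; sign_ring. Qed.

Lemma sbracketZl p q u P Q fs : is_md q Q ->
  sbracket p q (fun s => u * P s) Q fs
    = u * sbracket p q P Q fs
      - (-1) ^+ (p.+1 * q.+1) * wprod p P (slot u Q) fs.
Proof.
by move=> mQ; rewrite sbracketC (sbracketZr _ _ _ _ mQ) (sbracketC p q); sign_ring.
Qed.

Lemma wprod0 a P fs : wprod a P (fun=> 0) fs = 0.
Proof. by apply: shuffle_sum0 => s r _ _; rewrite mulr0. Qed.

Lemma sbracket_zeror p q P fs : is_md p P ->
  sbracket p q P (fun=> 0) fs = 0.
Proof.
move=> mP; rewrite /sbracket /insert !shuffle_sum0 ?mulr0 ?subr0 // => s r _ _.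
exact: (md_0 [::] _ mP).
Qed.

Lemma sbracket_zerol p q Q fs : is_md q Q ->
  sbracket p q (fun=> 0) Q fs = 0.
Proof. by move=> mQ; rewrite sbracketC sbracket_zeror ?mulr0. Qed.

Lemma slot_sbracket p q P Q f : is_md p P -> is_md q Q ->
  slot f (sbracket p q P Q) = fun fs => sbracket p q.-1 P (slot f Q) fs
      + (-1) ^+ q.+1 * sbracket p.-1 q (slot f P) Q fs.
Proof. by move=> mP mQ; apply: funext => fs; exact: sbracket_cons. Qed.

Lemma slotD p P f g : is_md p P ->
  slot (f + g) P = fun fs => slot f P fs + slot g P fs.
Proof. by move=> mP; apply: funext => fs; exact: (md_D mP [::]). Qed.

Lemma slotM p P f g : is_md p P ->
  slot (f * g) P = fun fs => f * slot g P fs + g * slot f P fs.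
Proof. by move=> mP; apply: funext => fs; exact: (md_M mP [::]). Qed.

Lemma slotK p P c : is_md p P -> K c -> slot c P = fun=> 0.
Proof. by move=> mP Kc; apply: funext => fs; exact: (md_K mP [::]). Qed.

Lemma slot_slot p P f : is_md p P -> slot f (slot f P) = fun=> 0.
Proof. by move=> mP; apply: funext => fs; exact: (md_alt mP [::]). Qed.

Lemma md_null p P : (forall fs, P fs = 0) -> is_md p P.
Proof. by move=> P0; rewrite (_ : P = fun=> 0); [exact: md_zero|exact: funext]. Qed.

Lemma md_sbracket p q P Q : is_md p P -> is_md q Q ->
  is_md (p + q).-1 (sbracket p q P Q).
Proof.
move: {2}(p + q)%N (leqnn (p + q)) => m.
elim: m p q P Q => [|m IH] p q P Q pqm mP mQ.
  move: pqm; rewrite leqn0 addn_eq0 => /andP[/eqP p0 /eqP q0]; subst p q.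
  have Z fs : sbracket 0 0 P Q fs = 0.
    rewrite /sbracket /insert !shuffle_sum0 ?mulr0 ?subr0 // => s r _ _;
    by [exact: (md_size mQ)|exact: (md_size mP)].
  have -> : sbracket 0 0 P Q = fun=> 0 by exact: funext.
  exact: md_zero.
apply: md_intro => [fs ne|r f g|r f g|r c Kc|r f|f].
- exact: (sbracket_size mP mQ).
- rewrite !(sbracket_cons _ _ mP mQ) (slotD _ _ mP) (slotD _ _ mQ).
  by rewrite (sbracketDr _ _ _ _ mP) (sbracketDl _ _ _ _ mQ); ring.
- rewrite !(sbracket_cons _ _ mP mQ) (slotM _ _ mP) (slotM _ _ mQ).
  rewrite (sbracketDr _ _ _ _ mP) (sbracketDl _ _ _ _ mQ).
  rewrite !(sbracketZr _ _ _ _ mP) !(sbracketZl _ _ _ _ mQ).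
  rewrite (wprodC _ (md_slot g mQ) (md_slot f mP)).
  rewrite (wprodC _ (md_slot f mQ) (md_slot g mP)).
  have Z a R : wprod a (fun=> 0) R r = 0.
    by apply: shuffle_sum0 => *; rewrite mul0r.
  case: p mP {pqm IH} => [|p] mP; last case: q mQ => [|q] mQ.
  + by rewrite !(md_slot0 _ mP) !Z; ring.
  + by rewrite !(md_slot0 _ mQ) !wprod0; ring.
  + by sign_ring.
- rewrite (sbracket_cons _ _ mP mQ) (slotK mP Kc) (slotK mQ Kc).
  by rewrite (sbracket_zeror _ _ mP) (sbracket_zerol _ _ mQ); ring.
- rewrite (sbracket_cons _ _ mP mQ) (sbracket_cons _ _ mP (md_slot f mQ)).
  rewrite (sbracket_cons _ _ (md_slot f mP) mQ) (slot_slot f mP) (slot_slot f mQ).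
  rewrite (sbracket_zeror _ _ mP) (sbracket_zerol _ _ mQ).
  case: q mQ {pqm IH} => [|q] mQ /=; last by sign_ring.
  by rewrite (md_slot0 f mQ) (sbracket_zeror _ _ (md_slot f mP)); ring.
rewrite (slot_sbracket _ mP mQ); apply: md_add; last apply: md_scale.
- case: q mQ pqm => [|q] mQ pqm.
    apply: md_null => fs.
    by rewrite (md_slot0 f mQ) (sbracket_zeror _ _ mP).
  rewrite addnS in pqm *; exact: (IH _ _ _ _ pqm mP (md_slot f mQ)).
case: p mP pqm => [|p] mP pqm.
  apply: md_null => fs.
  by rewrite (md_slot0 f mP) (sbracket_zerol _ _ mQ).
rewrite addSn in pqm *; exact: (IH _ _ _ _ pqm (md_slot f mP) mQ).
Qed.

Lemma md_sign p P l r n : is_md p P -> P (l ++ (-1) ^+ n :: r) = 0.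
Proof.
move=> mP; have P1 : P (l ++ 1 :: r) = 0.
  have := md_M mP l r 1 1; rewrite !mul1r => /eqP.
  by rewrite -subr_eq0 opprD addrA subrr add0r oppr_eq0 => /eqP.
rewrite signE; case: ifP => // _.
by have := md_D mP l r (-1) 1; rewrite addNr (md_0 _ _ mP) P1 addr0.
Qed.

Lemma sbracket_signr p q n P Q fs : is_md p P ->
  sbracket p q P (fun s => (-1) ^+ n * Q s) fs = (-1) ^+ n * sbracket p q P Q fs.
Proof.
move=> mP; rewrite (sbracketZr _ _ _ _ mP) /wprod shuffle_sum0 ?addr0 // => s r _ _.
by rewrite /slot (md_sign [::] r n mP) mulr0.
Qed.

Lemma sbracketNr p q P Q fs : is_md p P ->
  sbracket p q P (fun s => - Q s) fs = - sbracket p q P Q fs.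
Proof.
move=> mP; rewrite -mulN1r -[-1]expr1 -(sbracket_signr q 1 Q fs mP).
by congr sbracket; apply: funext => s; rewrite expr1 mulN1r.
Qed.

Lemma sbracketNl p q P Q fs : is_md q Q ->
  sbracket p q (fun s => - P s) Q fs = - sbracket p q P Q fs.
Proof. by move=> mQ; rewrite sbracketC (sbracketNr _ _ _ mQ) (sbracketC p q); sign_ring. Qed.

Lemma shuffle_sum_0 (F : seq A -> seq A -> A) fs : shuffle_sum 0 F fs = F [::] fs.
Proof. by elim: fs F => //= f fs IH F; rewrite IH add0r mul1r. Qed.

Lemma sbracket_fun p P u fs : is_md 0 u -> 
  sbracket 0 p u P fs = (-1) ^+ p * P (u [::] :: fs).
Proof.
move=> mu; rewrite /sbracket /insert shuffle_sum0; last first.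
  by move=> s r _ _; exact: (md_size mu).
by rewrite shuffle_sum_0; sign_ring.
Qed.

Lemma lie_cons p X P f fs : is_md 1 X -> is_md p P ->
  sbracket 1 p X P (f :: fs)
    = sbracket 1 p.-1 X (slot f P) fs - P (X [:: f] :: fs).
Proof.
move=> mX mP; rewrite (sbracket_cons _ _ mX mP) (sbracket_fun _ _ _ (md_slot f mX)).
by rewrite /slot; sign_ring.
Qed.

Lemma lie_nil p X P :
  sbracket 1 p X P [::] = if p == 0%N then X [:: P [::]] else 0.
Proof. by rewrite /sbracket /insert /= mulr0 subr0. Qed.

Lemma lie1 X Y f : is_md 1 X -> is_md 1 Y ->
  sbracket 1 1 X Y [:: f] = X [:: Y [:: f]] - Y [:: X [:: f]].
Proof. by move=> mX mY; rewrite (lie_cons _ _ mX mY) lie_nil. Qed.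

#[local] Opaque sbracket.

Lemma slot_lie p X P f : is_md 1 X -> is_md p P ->
  slot f (sbracket 1 p X P)
    = fun fs => sbracket 1 p.-1 X (slot f P) fs + - slot (X [:: f]) P fs.
Proof. by move=> mX mP; apply: funext => fs; exact: lie_cons. Qed.

Lemma md_lie p X P : is_md 1 X -> is_md p P ->
  is_md p (sbracket 1 p X P).
Proof. by move=> mX mP; have := md_sbracket mX mP; rewrite add1n. Qed.

Lemma jacobi11 p X Y P fs : is_md 1 X -> is_md 1 Y ->
  is_md p P ->
  sbracket 1 p X (sbracket 1 p Y P) fs
    = sbracket 1 p (sbracket 1 1 X Y) P fs
      + sbracket 1 p Y (sbracket 1 p X P) fs.
Proof.
move=> mX mY; elim: fs p P => [|f fs IH] p P mP.
  rewrite !lie_nil; case: p {mP} => [|p] /=; last by rewrite addr0.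
  by rewrite lie1 //; ring.
have mXY := md_lie mX mY.
rewrite (lie_cons _ _ mX (md_lie mY mP)) (lie_cons _ _ mY (md_lie mX mP)).
rewrite (lie_cons _ _ mXY mP) (slot_lie _ mX mP) (slot_lie _ mY mP).
rewrite (sbracketDr _ _ _ _ mX) (sbracketDr _ _ _ _ mY) (sbracketNr _ _ _ mX).
rewrite (sbracketNr _ _ _ mY) (IH _ _ (md_slot f mP)).
rewrite (lie_cons _ _ mX mP) (lie_cons _ _ mY mP) lie1 //.
have -> : P (X [:: Y [:: f]] - Y [:: X [:: f]] :: fs)
    = P (X [:: Y [:: f]] :: fs) - P (Y [:: X [:: f]] :: fs).
  apply/eqP; rewrite eq_sym subr_eq; apply/eqP.
  by rewrite -(md_D mP [::]) /= subrK.
by ring.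
Qed.

Lemma jacobi12 p X B P fs : is_md 1 X -> is_md 2 B ->
  is_md p P ->
  sbracket 1 p.+1 X (sbracket 2 p B P) fs
    = sbracket 2 p (sbracket 1 2 X B) P fs
      + sbracket 2 p B (sbracket 1 p X P) fs.
Proof.
move=> mX mB; elim: fs p P => [|f fs IH] p P mP.
  have mBP := md_sbracket mB mP.
  rewrite (sbracket_size mX mBP) // (sbracket_size (md_lie mX mB) mP) //.
  by rewrite (sbracket_size mB (md_lie mX mP)) // addr0.
have mXB := md_lie mX mB; have mH := md_slot f mB.
rewrite (lie_cons _ _ mX (md_sbracket mB mP)) (sbracket_cons _ _ mXB mP).
rewrite (sbracket_cons _ _ mB (md_lie mX mP)) (slot_sbracket _ mB mP).
rewrite (slot_lie _ mX mB) (slot_lie _ mX mP) (sbracketDr _ _ _ _ mX).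
rewrite (sbracket_signr _ _ _ _ mX) (sbracketDl _ _ _ _ mP).
rewrite (sbracketNl _ _ _ mP) (sbracketDr _ _ _ _ mB) (sbracketNr _ _ _ mB).
rewrite (jacobi11 _ mX mH mP) (sbracket_cons _ _ mB mP).
have -> : sbracket 1 p X (sbracket 2 p.-1 B (slot f P)) fs
    = sbracket 1 p.-1.+1 X (sbracket 2 p.-1 B (slot f P)) fs.
  case: p mP => // mP; rewrite (md_slot0 f mP).
  have -> : sbracket 2 0.-1 B (fun=> 0) = (fun=> 0).
    by apply: funext => s; exact: (sbracket_zeror _ _ mB).
  by rewrite !(sbracket_zeror _ _ mX).
by rewrite (IH _ _ (md_slot f mP)) /=; ring.
Qed.

Lemma jacobi22 p B P fs : (forall a : A, a + a = 0 -> a = 0) ->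
  is_md 2 B -> (forall fs, sbracket 2 2 B B fs = 0) ->
  is_md p P ->
  sbracket 2 p.+1 B (sbracket 2 p B P) fs = 0.
Proof.
move=> two mB BB; elim: fs p P => [|f fs IH] p P mP; have mBP := md_sbracket mB mP.
  exact: (sbracket_size mB mBP).
have mH := md_slot f mB.
have HB : sbracket 1 2 (slot f B) B = fun=> 0.
  apply: funext => s; apply: two; apply/eqP; rewrite -oppr_eq0; apply/eqP.
  rewrite -[RHS](BB (f :: s)) (sbracket_cons _ _ mB mB) (sbracketC 1 2).
  by sign_ring.
rewrite (sbracket_cons _ _ mB mBP) (slot_sbracket _ mB mP).
rewrite (sbracketDr _ _ _ _ mB) (sbracket_signr _ _ _ _ mB) (jacobi12 _ mH mB mP).
rewrite HB (sbracket_zerol _ _ mP).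
have -> : sbracket 2 p B (sbracket 2 p.-1 B (slot f P)) fs
    = sbracket 2 p.-1.+1 B (sbracket 2 p.-1 B (slot f P)) fs.
  case: p mP {mBP} => // mP; rewrite (md_slot0 f mP).
  have -> : sbracket 2 0.-1 B (fun=> 0) = (fun=> 0).
    by apply: funext => s; exact: (sbracket_zeror _ _ mB).
  by rewrite !(sbracket_zeror _ _ mB).
rewrite (IH _ _ (md_slot f mP)) exprS /=.
by sign_ring.
Qed.

End IsMds.

Section Alternation.
Variables (A : comPzRingType) (K : A -> Prop) (I : finType) (t : I -> A).

Lemma md_move p (P : seq A -> A) l m r f : is_md K p P ->
  P (l ++ f :: m ++ r) = 0 <-> P (l ++ m ++ f :: r) = 0.
Proof.
move=> mP; elim: m l => [|g m IH] l //=.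
have := IH (rcons l g); rewrite !cat_rcons => IHg.
rewrite (md_swap l (m ++ r) f g mP) -IHg.
split=> [/eqP|->]; last exact: oppr0.
by rewrite oppr_eq0 => /eqP.
Qed.

Lemma md_perm p (P : seq A -> A) (s s' : seq I) : is_md K p P ->
  perm_eq s s' -> P (map t s') = 0 -> P (map t s) = 0.
Proof.
move=> mP; suff H : forall l, perm_eq s s' -> P (l ++ map t s') = 0 -> P (l ++ map t s) = 0.
  exact: (H [::]).
elim: s s' => [|i s IH] s' l.
  by rewrite perm_sym => /perm_nilP ->.
move=> ss'; have is' : i \in s' by rewrite -(perm_mem ss') mem_head.
case/splitPr: is' ss' => s1 s2 ss'; rewrite map_cat /= => P0.
rewrite -cat_rcons; apply: (IH (s1 ++ s2)).
  by rewrite -(perm_cons i); apply: perm_trans ss' _; rewrite perm_catC /= perm_cons perm_catC.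
by rewrite cat_rcons map_cat; apply/(md_move _ _ _ _ mP).
Qed.

Lemma md_repeat p (P : seq A -> A) (s : seq I) : is_md K p P ->
  ~~ uniq s -> P (map t s) = 0.
Proof.
move=> mP; rewrite -[map t s]cat0s; elim: s {1}[::] => // i s IH l /=.
rewrite negb_and negbK => /orP[|nu]; last by rewrite -cat_rcons; exact: IH.
case/splitPr => s1 s2; rewrite map_cat /= -cat_rcons.
apply/(md_move _ _ _ _ mP); rewrite cat_rcons; exact: (md_alt mP).
Qed.

Lemma md_sets p (P : seq A -> A) : is_md K p P ->
  (forall S : {set I}, #|S| = p -> P (map t (enum S)) = 0) ->
  forall s, P (map t s) = 0.
Proof.
move=> mP P0 s; have [us|] := boolP (uniq s); last exact: md_repeat mP.
have [sp|sp] := eqVneq (size s) p; last first.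
  by apply: (md_size mP); rewrite size_map; exact/eqP.
apply: (md_perm mP (s' := enum [set i in s])).
  apply: uniq_perm => // [|i]; first exact: enum_uniq.
  by rewrite mem_enum inE.
by apply: P0; rewrite cardsE -sp; exact/card_uniqP.
Qed.
End Alternation.

Lemma combine_remainders (A : comPzRingType) (r q u f h : A) :
  r - - q * u * f = (q * h + r) - q * (h - u * f).
Proof. by ring. Qed.

Section Tower.
Variable K : idomainType.

Fixpoint tower (n : nat) : idomainType :=
  if n is m.+1 then {poly tower m} : idomainType else K.

Fixpoint tev (n : nat) (v : nat -> K) : {rmorphism tower n -> K} :=
  match n with
  | 0 => idfun : {rmorphism K -> K}
  | m.+1 => (horner_eval (v m) \o map_poly (tev m v)) : {rmorphism {poly tower m} -> K}
  end.

Lemma tevS n v (f : tower n.+1) :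
  tev n.+1 v f = \sum_(i < size (f : {poly tower n})) tev n v (f : {poly tower n})`_i * v n ^+ i.
Proof.
rewrite /= /horner_eval (horner_coef_wide _ (size_poly _ _)).
by apply: eq_bigr => i _; rewrite coef_map.
Qed.

Lemma tev_lead n v (f : tower n.+1) (d : nat) : (size (f : {poly tower n}) <= d)%N ->
  tev n.+1 v f = \sum_(i < d) tev n v (f : {poly tower n})`_i * v n ^+ i.
Proof.
move=> sd; rewrite /= /horner_eval (horner_coef_wide _ (leq_trans (size_poly _ _) sd)).
by apply: eq_bigr => i _; rewrite coef_map.
Qed.

Lemma tevC n v (c : tower n) : tev n.+1 v (c%:P : {poly tower n}) = tev n v c.
Proof. by rewrite /= /horner_eval map_polyC hornerC. Qed.

Lemma tev_lift n m : (n <= m)%N -> forall f : tower n, exists g : tower m, forall v, tev m v g = tev n v f.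
Proof.
elim: m => [|m IH]; first by rewrite leqn0 => /eqP -> f; exists f.
rewrite leq_eqVlt => /orP[/eqP -> f|nm f]; first by exists f.
have [g gE] := IH nm f; exists (g%:P : {poly tower m}) => v.
by rewrite -gE /= /horner_eval map_polyC hornerC.
Qed.

Lemma tev_ext n v v' (f : tower n) : (forall k, (k < n)%N -> v k = v' k) -> tev n v f = tev n v' f.
Proof.
elim: n f => [//|n IH] f vv; rewrite !tevS; apply: eq_bigr => i _.
by rewrite (IH _ (fun k kn => vv k (ltnW kn))) vv.
Qed.

Section Generic.
Variables (S : set (nat -> K)) (m N : nat).

Definition vanishes n (f : tower n) : Prop := forall v, S v -> tev n v f = 0.

Hypothesis S_prime : forall n (f g : tower n), vanishes (f * g) -> vanishes f \/ vanishes g.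
Hypothesis S_ex : exists v, S v.
Hypothesis S_free : forall f : tower m, vanishes f -> f = 0.
Hypothesis S_alg : forall i, (m <= i < N)%N ->
  exists f : {poly tower i}, @vanishes i.+1 f /\ exists k, ~ vanishes f`_k.

Lemma vanishesX n (f : tower n) k : vanishes (f ^+ k) -> vanishes f.
Proof.
elim: k => [|k IH]; last by rewrite exprS => /S_prime[//|/IH].
have [v Sv] := S_ex => /(_ v Sv) /eqP; by rewrite expr0 rmorph1 oner_eq0.
Qed.

Lemma vanishesMl n (f g : tower n) : vanishes f -> vanishes (g * f).
Proof. by move=> vf v Sv; rewrite rmorphM vf // mulr0. Qed.

Lemma vanishesD n (f g : tower n) : vanishes f -> vanishes g -> vanishes (f + g).
Proof. by move=> vf vg v Sv; rewrite rmorphD vf // vg // addr0. Qed.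

Lemma vanishesN n (f : tower n) : vanishes f -> vanishes (- f).
Proof. by move=> vf v Sv; rewrite rmorphN vf // oppr0. Qed.

Lemma vanishes_coef n (f : {poly tower n}) : (forall k, vanishes f`_k) -> @vanishes n.+1 f.
Proof. by move=> vf v Sv; rewrite tevS big1 // => i _; rewrite vf // mul0r. Qed.

Lemma vanishes_coefM n (f g : {poly tower n}) :
  (forall k, vanishes f`_k) -> forall k, vanishes (f * g)`_k.
Proof.
move=> vf k v Sv; rewrite coefM rmorph_sum big1 // => i _.
by rewrite rmorphM vf // mul0r.
Qed.

(** Dropping a vanishing leading coefficient. *)
Lemma drop_lead n (f : {poly tower n}) : vanishes (lead_coef f) -> f != 0 ->
  exists g : {poly tower n}, [/\ (size g < size f)%N,
     forall k, vanishes (f`_k - g`_k) & @vanishes n.+1 (f - g)].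
Proof.
move=> vl f0; pose g := f - (lead_coef f)%:P * 'X^((size f).-1).
have fg k : vanishes (f`_k - g`_k).
  move=> v Sv; rewrite coefB opprB addrC subrK coefCM rmorphM vl // mul0r //.
exists g; split=> //; last by apply: vanishes_coef => k; rewrite coefB.
have sf : (0 < size f)%N by rewrite size_poly_gt0.
rewrite -(prednK sf) ltnS; apply/leq_sizeP => j jf; rewrite coefB coefCM coefXn.
have [->|jne] := eqVneq j (size f).-1; first by rewrite mulr1 subrr.
rewrite mulr0 subr0 nth_default //; move: jf; rewrite leq_eqVlt eq_sym (negbTE jne) /=.
by rewrite prednK.
Qed.

(** An element of least size in a nonempty family of polynomials. *)
Lemma least_size n (P : {poly tower n} -> Prop) : (exists f, P f) ->
  exists f, P f /\ forall g, P g -> (size f <= size g)%N.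
Proof.
move=> [f0 Pf0]; have [k] := ubnP (size f0).
elim: k f0 Pf0 => // k IH f0 Pf0 fk.
have [[g Pg gf]|no] := pselect (exists2 g, P g & (size g < size f0)%N).
  by apply: (IH g Pg); exact: leq_trans gf _.
exists f0; split=> // g Pg; rewrite leqNgt; apply/negP => gf.
by apply: no; exists g.
Qed.

Definition minimal_equation i (Q : {poly tower i}) : Prop :=
  [/\ @vanishes i.+1 Q, ~ vanishes (lead_coef Q) &
     forall f : {poly tower i}, @vanishes i.+1 f -> (size f < size Q)%N ->
       forall k, vanishes f`_k].

Lemma minimal_equation_exists i : (m <= i < N)%N -> exists Q, @minimal_equation i Q.
Proof.
move=> /S_alg /least_size[Q [[vQ [k nk]] mQ]].
have small (f : {poly tower i}) : @vanishes i.+1 f -> (size f < size Q)%N -> forall k, vanishes f`_k.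
  move=> vf sf l; apply: contrapT => nl; have := mQ f (conj vf (ex_intro _ l nl)).
  by rewrite leqNgt sf.
exists Q; split=> // vl.
have Q0 : Q != 0.
  by apply/eqP => Q0; apply: nk; rewrite Q0 coef0 => v _; exact: rmorph0.
have [g [sg cg vg]] := drop_lead vl Q0; apply: nk => v Sv.
have vgg : @vanishes i.+1 g.
  by move=> w Sw; have := vg w Sw; rewrite rmorphB vQ // sub0r => /eqP; rewrite oppr_eq0 => /eqP.
have := cg k v Sv; rewrite rmorphB (small g vgg sg k v Sv) subr0 //.
Qed.

Lemma vanishes_pseudo i (Q f : {poly tower i}) : @minimal_equation i Q ->
  @vanishes i.+1 f -> forall k, vanishes (f %% Q)`_k.
Proof.
move=> [vQ nl mQ] vf; have Q0 : Q != 0.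
  by apply/eqP => Q0; apply: nl; rewrite Q0 lead_coef0 => v _; exact: rmorph0.
apply: mQ; last exact: ltn_modpN0.
have := Pdiv.Idomain.divp_eq f Q => E v Sv.
have := congr1 (tev i.+1 v) E; rewrite -mul_polyC rmorphM vf // mulr0 rmorphD rmorphM vQ //.
by rewrite mulr0 add0r => <-.
Qed.

Lemma not_vanishes_small i (Q f : {poly tower i}) : @minimal_equation i Q ->
  (size f < size Q)%N -> ~ vanishes (lead_coef f) -> ~ @vanishes i.+1 f.
Proof. by move=> [_ _ mQ] sf nl vf; apply: nl; exact: mQ. Qed.

Lemma minimal_size i (Q : {poly tower i}) : @minimal_equation i Q -> (1 < size Q)%N.
Proof.
move=> [vQ nl _]; rewrite ltnNge; apply/negP => /size1_polyC QE; apply: nl.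
move=> v Sv; have := vQ v Sv; rewrite QE /= /horner_eval map_polyC hornerC lead_coefC.
by [].
Qed.

Lemma norm_exists n : (m <= n <= N)%N -> forall f : tower n, ~ vanishes f ->
  exists (E : tower n) (D : tower m), ~ vanishes D /\
    forall v, S v -> tev n v E * tev n v f = tev m v D.
Proof.
elim: n => [|n IH].
  rewrite leqn0 => /andP[/eqP m0 _] f nf; move: f nf; rewrite -m0 => f nf.
  by exists 1, f; split=> // v Sv; rewrite rmorph1 mul1r.
move=> /andP[]; rewrite leq_eqVlt => /orP[/eqP mE _|mn nN] f nf.
  move: f nf; rewrite -mE => f nf.
  by exists 1, f; split=> // v Sv; rewrite rmorph1 mul1r.
have mnN : (m <= n < N)%N by rewrite -ltnS mn.
have [Q mQ] := minimal_equation_exists mnN; have [vQ nlQ smQ] := mQ.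
have sQ := minimal_size mQ.
have Q0 : Q != 0 by rewrite -size_poly_gt0 ltnW.
pose P (h : {poly tower n}) := (exists u : tower n.+1, @vanishes n.+1 (h - u * f)) /\
  exists k, ~ vanishes h`_k.
have nc (h : {poly tower n}) : ~ @vanishes n.+1 h -> exists k, ~ vanishes h`_k.
  move=> nh; apply: contrapT => no; apply: nh; apply: vanishes_coef => k.
  by apply: contrapT => nk; apply: no; exists k.
have Pex : exists h, P h by exists f; split; [exists 1; rewrite mul1r subrr => v _; exact: rmorph0|exact: nc].
have [h [[[u hu] [k hk]] mh]] := least_size Pex.
have h0 : h != 0.
  by apply/eqP => h0; apply: hk; rewrite h0 coef0 => v _; exact: rmorph0.
have nlh : ~ vanishes (lead_coef h).
  move=> vl; have [g [sg cg vg]] := drop_lead vl h0.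
  have : P g.
    split; last first.
      exists k => gk; apply: hk => v Sv; have := cg k v Sv; rewrite rmorphB gk // subr0 //.
    exists u; have -> : (g : tower n.+1) - u * f = (h - u * f) - (h - g).
      by rewrite opprB [RHS]addrC addrA subrK.
    exact: (vanishesD hu (vanishesN vg)).
  by move/mh; rewrite leqNgt sg.
have shQ : (size h < size Q)%N.
  (* reduce f modulo Q *)
  have E := Pdiv.Idomain.divp_eq (f : {poly tower n}) Q.
  have Pr : P ((f : {poly tower n}) %% Q).
    have fr : @vanishes n.+1 ((f : {poly tower n}) %% Q - (lead_coef Q ^+ scalp (f : {poly tower n}) Q)%:P * f).
      move=> v Sv; rewrite [X in _ - X]mul_polyC E opprD addrCA subrr addr0.
      by rewrite rmorphN rmorphM vQ // mulr0 oppr0.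
    split; first by exists ((lead_coef Q ^+ scalp (f : {poly tower n}) Q)%:P : {poly tower n}).
    apply: nc => vr; have : @vanishes n.+1 ((lead_coef Q ^+ scalp (f : {poly tower n}) Q)%:P * f).
      move=> v Sv; have := fr v Sv; rewrite rmorphB vr // sub0r => /eqP.
      by rewrite oppr_eq0 => /eqP.
    move/S_prime => [vl|//]; apply: nlQ; apply: (@vanishesX _ _ (scalp (f : {poly tower n}) Q)).
    by move=> v Sv; have := vl v Sv; rewrite /= /horner_eval map_polyC hornerC.
  exact: leq_ltn_trans (mh _ Pr) (ltn_modpN0 _ Q0).
have nvh : ~ @vanishes n.+1 h by move=> vh; exact: (not_vanishes_small mQ shQ nlh vh).
have [sh|sh] := leqP (size h) 1.
  have hE : h = (h`_0)%:P by exact: size1_polyC.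
  have nv0 : ~ vanishes h`_0 by move: nlh; rewrite hE lead_coefC coefC eqxx.
  have [|E [D [nD ED]]] := IH _ h`_0 nv0; first by apply/andP; split; [|exact: ltnW].
  exists ((E%:P : {poly tower n}) * u), D; split=> // v Sv.
  rewrite -ED // rmorphM -mulrA -rmorphM.
  have -> : tev n.+1 v (u * f) = tev n.+1 v h.
    by have := hu v Sv; rewrite rmorphB => /eqP; rewrite subr_eq0 => /eqP.
  by rewrite hE /= /horner_eval !map_polyC !hornerC coefC eqxx.
exfalso.
have E := Pdiv.Idomain.divp_eq Q h.
set q := Q %/ h in E; set r := Q %% h in E.
have qh : @vanishes n.+1 (q * h + r).
  by rewrite -E -mul_polyC; exact: (@vanishesMl n.+1 Q).
have vr l : vanishes r`_l.
  apply: contrapT => nl; suff : P r by move/mh; rewrite leqNgt ltn_modpN0.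
  split; last by exists l.
  exists (- (q : tower n.+1) * u).
  have -> : (r : tower n.+1) - - (q : tower n.+1) * u * f = (q * h + r) - q * (h - u * f).
    exact: (@combine_remainders (tower n.+1)).
  exact: (vanishesD qh (vanishesN (vanishesMl _ hu))).
have vqh : @vanishes n.+1 (q * h).
  move=> v Sv; have := qh v Sv; rewrite rmorphD (vanishes_coef vr Sv) addr0 //.
have [vq|//] := S_prime vqh.
have sq : (size q < size Q)%N.
  rewrite /q size_divp // ltn_subrL (ltnW sQ) andbT.
  by case: (size h) sh => [|[|]].
have cq := smQ q vq sq.
have top : vanishes (lead_coef h ^+ scalp Q h * lead_coef Q).
  move=> v Sv; have := congr1 (fun p : {poly tower n} => tev n v p`_(size Q).-1) E.
  rewrite coefZ coefD rmorphD (vanishes_coefM h cq) // vr // addr0 => <-.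
  by rewrite lead_coefE.
case: (S_prime top) => [/vanishesX|] //.
Qed.

(** Points over which the equations of the tower hold satisfy all the
    equations of the generic points. *)
Lemma vanishes_at n (Q : forall i, {poly tower i}) (v : nat -> K) : (m <= n <= N)%N ->
  (forall i, (m <= i < n)%N -> [/\ minimal_equation (Q i), tev i.+1 v (Q i) = 0 &
     exists (E : tower i) (D : tower m), tev m v D != 0 /\
       forall w, S w -> tev i w E * tev i w (lead_coef (Q i)) = tev m w D]) ->
  forall f : tower n, vanishes f -> tev n v f = 0.
Proof.
elim: n => [|n IH].
  rewrite leqn0 => /andP[/eqP m0 _] _; move: S_free; rewrite m0 => fr f /fr ->; exact: rmorph0.
move=> /andP[]; rewrite leq_eqVlt => /orP[/eqP mE _ _|mn nN H] f vf.
  by move: f vf; rewrite -mE => f /S_free ->; exact: rmorph0.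
have IHn : forall g : tower n, vanishes g -> tev n v g = 0.
  by apply: IH => [|i /andP[mi iN]]; [rewrite -ltnS mn ltnW|apply: H; rewrite mi ltnS ltnW].
have [|mQ Qv [E [D [Dv ED]]]] := H n; first by rewrite -ltnS mn ltnSn.
have := vanishes_pseudo mQ vf => vr.
have := congr1 (tev n.+1 v) (Pdiv.Idomain.divp_eq (f : {poly tower n}) (Q n)).
rewrite -mul_polyC rmorphM rmorphD rmorphM Qv mulr0 add0r.
rewrite [X in _ = X -> _]tevS big1 => [|i _]; last by rewrite IHn ?mul0r.
move=> /eqP; rewrite mulf_eq0 => /orP[|/eqP //].
rewrite tevC rmorphXn expf_eq0 => /andP[_ /eqP l0].
have [D2 D2E] := @tev_lift m n mn D.
have : tev n v (E * lead_coef (Q n) - D2) = 0.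
  by apply: IHn => w Sw; rewrite rmorphB rmorphM ED // D2E subrr.
by rewrite rmorphB rmorphM l0 mulr0 sub0r D2E => /eqP; rewrite oppr_eq0 (negbTE Dv).
Qed.

Lemma deriv_not_vanishes i (Q : {poly tower i}) : (forall k, k.+1%:R != 0 :> K) ->
  minimal_equation Q -> ~ @vanishes i.+1 Q^`().
Proof.
move=> char0 mQ vd; have sQ := minimal_size mQ; have [vQ nl smQ] := mQ.
have sd : (size Q^`() < size Q)%N by rewrite lt_size_deriv // -size_poly_gt0 ltnW.
have [s sE] : exists s, size Q = s.+2 by move: sQ; case: (size Q) => [|[|s]] // _; exists s.
apply: nl => v Sv; have := smQ _ vd sd s v Sv; rewrite coef_deriv rmorphMn lead_coefE sE /=.
by rewrite -mulr_natr => /eqP; rewrite mulf_eq0 (negbTE (char0 s)) orbF => /eqP.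
Qed.

End Generic.

Fixpoint slope (n : nat) (v1 v2 : nat -> K) (k : nat) : tower n -> K :=
  match n return tower n -> K with
  | 0 => fun=> 0
  | m.+1 => fun f : {poly tower m} =>
      if k == m then
        \sum_(i < size f) tev m v1 f`_i * \sum_(l < i) v2 m ^+ (i.-1 - l) * v1 m ^+ l
      else \sum_(i < size f) slope v1 v2 k f`_i * v2 m ^+ i
  end.

(** The increment of a polynomial function is the sum of the increments of the
    variables, multiplied by continuous functions. *)
Lemma tev_increment n v1 v2 (f : tower n) :
  tev n v2 f - tev n v1 f = \sum_(k < n) (v2 k - v1 k) * slope v1 v2 k f.
Proof.
elim: n f => [|n IH] f; first by rewrite big_ord0 subrr.
rewrite big_ord_recr /= eqxx.
rewrite -[X in X - _]/(tev n.+1 v2 f) -[X in _ - X]/(tev n.+1 v1 f) !tevS.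
under [X in _ = X + _]eq_bigr => k _ do rewrite (ltn_eqF (ltn_ord k)) mulr_sumr.
rewrite exchange_big /= mulr_sumr -big_split -sumrB /=; apply: eq_bigr => i _.
under eq_bigr => k _ do rewrite mulrA.
rewrite -mulr_suml -IH mulrCA -subrXX.
by ring.
Qed.

Lemma slope_top n v (f : {poly tower n}) :
  @slope n.+1 v v n f = tev n.+1 v (f^`() : {poly tower n}).
Proof.
rewrite (tev_lead v (leq_trans (size_poly _ _) (leqnn _) : size f^`() <= (size f).-1)%N) /= eqxx.
case: (size f) => [|s]; first by rewrite !big_ord0.
rewrite big_ord_recl big_ord0 mulr0 add0r /=; apply: eq_bigr => i _.
rewrite /bump /= add1n coef_deriv rmorphMn /= mulrnAl -mulrnAr; congr (_ * _).
rewrite (eq_bigr (fun=> v n ^+ i)); first by rewrite sumr_const card_ord.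
by move=> l _; rewrite -exprD add0n subnK //; exact: leq_ord.
Qed.

End Tower.

Record ultrafilter (J : Type) := Ultrafilter {
  ultra_set :> set J -> Prop;
  ultraP : UltraFilter (ultra_set : set_system J)
}.
Existing Instance ultraP.

Section UltraLimit.
Import Order.TTheory Num.Theory.
Variables (R : realType) (J : Type) (G : ultrafilter J).
Notation C := R[i].
Implicit Types (s t : J -> C) (l m : C).

Definition tends s l : Prop := forall e : C, 0 < e -> G [set n | `|s n - l| < e].

Lemma ae_and (P Q : set J) : G P -> G Q -> G (P `&` Q).
Proof. exact: filterI. Qed.

Lemma aeS (P Q : set J) : G P -> (forall n, P n -> Q n) -> G Q.
Proof. by move=> GP PQ; apply: filterS GP. Qed.

Lemma aeT (P : set J) : (forall n, P n) -> G P.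
Proof. by move=> h; apply: (filterS (P := setT)); [move=> x _; exact: h|exact: filterT]. Qed.

Lemma ae_false : ~ G set0.
Proof. exact: filter_not_empty. Qed.

Lemma ae_ex (P : set J) : G P -> exists n, P n.
Proof.
move=> GP; apply: contrapT => h; apply: ae_false; apply: (aeS GP) => n Pn.
by apply: h; exists n.
Qed.

Lemma aeN (P : set J) : ~ G P -> G (~` P).
Proof. by move=> nP; have [|] := in_ultra_setVsetC P (ultraP G). Qed.

Lemma tends_cst l : tends (fun=> l) l.
Proof. by move=> e e0; apply: aeT => n /=; rewrite subrr normr0. Qed.

Lemma tends_ext s t l : G [set n | s n = t n] -> tends s l -> tends t l.
Proof.
move=> st sl e e0; apply: (aeS (ae_and st (sl e e0))) => n [/= <- //].
Qed.

Lemma half_gt0 (e : C) : 0 < e -> 0 < e / 2.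
Proof. by move=> e0; rewrite divr_gt0 // ltr0n. Qed.

Lemma tendsD s t l m : tends s l -> tends t m -> tends (fun n => s n + t n) (l + m).
Proof.
move=> sl tm e e0; have e2 := half_gt0 e0.
apply: (aeS (ae_and (sl _ e2) (tm _ e2))) => n [/= h1 h2].
rewrite opprD addrACA; apply: le_lt_trans (ler_normD _ _) _.
have -> : e = e / 2 + e / 2 by field.
exact: ltrD.
Qed.

Lemma tends0Ml s t : (exists M : C, G [set n | `|s n| <= M]) -> tends t 0 ->
  tends (fun n => s n * t n) 0.
Proof.
move=> [M sM] t0 e e0.
have p : 0 < `|M| + 1.
  by apply: ltr_wpDl; [exact: normr_ge0|exact: ltr01].
apply: (aeS (ae_and sM (t0 (e / (`|M| + 1)) (divr_gt0 e0 p)))) => n [/= h1].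
rewrite !subr0 normrM => h2.
have h3 : `|s n| <= `|M| + 1.
  have M0 : 0 <= M by apply: le_trans h1; exact: normr_ge0.
  by apply: le_trans h1 _; rewrite ger0_norm // lerDl ler01.
apply: le_lt_trans (ler_wpM2r (normr_ge0 _) h3) _.
by rewrite mulrC -ltr_pdivlMr.
Qed.

Lemma tends_sub0 s l : tends s l <-> tends (fun n => s n - l) 0.
Proof. by split=> sl e e0; apply: (aeS (sl e e0)) => n /=; rewrite subr0. Qed.

Lemma tends_bounded s l : tends s l -> exists M : C, G [set n | `|s n| <= M].
Proof.
move=> sl; exists (1 + `|l|); apply: (aeS (sl 1 (@ltr01 _))) => n /= h.
rewrite -[s n](subrK l); apply: le_trans (ler_normD _ _) _.
by rewrite lerD2r ltW.
Qed.

Lemma tendsM s t l m : tends s l -> tends t m -> tends (fun n => s n * t n) (l * m).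
Proof.
move=> sl tm; apply/tends_sub0.
have h1 := tends0Ml (tends_bounded sl) ((tends_sub0 _ _).1 tm).
have h2 := tends0Ml (tends_bounded (tends_cst m)) ((tends_sub0 _ _).1 sl).
have := tendsD h1 h2; rewrite addr0; apply: tends_ext; apply: aeT => n /=.
by ring.
Qed.

Lemma tendsN s l : tends s l -> tends (fun n => - s n) (- l).
Proof.
move=> sl; have := tendsM (tends_cst (-1)) sl; rewrite mulN1r; apply: tends_ext.
by apply: aeT => n /=; rewrite mulN1r.
Qed.

Lemma tendsB s t l m : tends s l -> tends t m -> tends (fun n => s n - t n) (l - m).
Proof. by move=> sl /tendsN; exact: tendsD. Qed.

Lemma tendsX s l k : tends s l -> tends (fun n => s n ^+ k) (l ^+ k).
Proof.
move=> sl; elim: k => [|k IH]; first exact: tends_cst.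
rewrite exprS; have := tendsM sl IH; apply: tends_ext; apply: aeT => n /=.
by rewrite exprS.
Qed.

Lemma tends_sum (I : Type) (r : seq I) (s : I -> J -> C) (l : I -> C) :
  (forall i, tends (s i) (l i)) -> tends (fun n => \sum_(i <- r) s i n) (\sum_(i <- r) l i).
Proof.
move=> sl; elim: r => [|i r IH].
  by rewrite big_nil; apply: tends_ext (tends_cst 0); apply: aeT => n /=; rewrite big_nil.
rewrite big_cons; apply: tends_ext (tendsD (sl i) IH); apply: aeT => n /=.
by rewrite big_cons.
Qed.

Lemma tends_norm s l : tends s l -> tends (fun n => `|s n|) `|l|.
Proof.
move=> sl e e0; apply: (aeS (sl e e0)) => n /=.
by apply: le_lt_trans; exact: ler_dist_dist.
Qed.

Lemma tends_conj s l : tends s l -> tends (fun n => (s n)^*) l^*.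
Proof.
move=> sl e e0; apply: (aeS (sl e e0)) => n /=.
by rewrite -rmorphB norm_conjC.
Qed.

Lemma tends_neq0 s l : tends s l -> l != 0 -> G [set n | s n != 0].
Proof.
move=> sl l0; have p : 0 < `|l| by rewrite normr_gt0.
apply: (aeS (sl _ p)) => n /=; apply: contraTneq => ->.
by rewrite sub0r normrN ltxx.
Qed.

Lemma tends_far s l : tends s l -> l != 0 -> G [set n | `|l| / 2 <= `|s n|].
Proof.
move=> sl l0; have p : 0 < `|l| by rewrite normr_gt0.
apply: (aeS (sl _ (half_gt0 p))) => n /= h.
have h2 : `|l| <= `|s n| + `|s n - l|.
  rewrite -{1}[l](subKr (s n)).
  by apply: le_trans (ler_normD _ _) _; rewrite normrN.
rewrite -(lerD2r (`|l| / 2)).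
have -> : `|l| / 2 + `|l| / 2 = `|l| by field.
apply: le_trans h2 _.
by rewrite lerD2l ltW.
Qed.

Lemma tendsV s l : tends s l -> l != 0 -> tends (fun n => (s n)^-1) l^-1.
Proof.
move=> sl l0; apply/tends_sub0.
have p : 0 < `|l| by rewrite normr_gt0.
have b : exists M : C, G [set n | `|- ((s n)^-1 * l^-1)| <= M].
  exists ((`|l| / 2)^-1 * `|l|^-1); apply: (aeS (ae_and (tends_far sl l0) (tends_neq0 sl l0))) => n [/= h s0].
  rewrite normrN normrM !normfV.
  rewrite ler_pM2r ?invr_gt0 // lef_pV2 ?posrE //.
    by rewrite normr_gt0.
  by rewrite half_gt0.
have := tends0Ml b ((tends_sub0 _ _).1 sl); apply: tends_ext.
apply: (aeS (tends_neq0 sl l0)) => n /= s0; field.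
by rewrite l0 s0.
Qed.

Lemma tends_uniq s l m : tends s l -> tends s m -> l = m.
Proof.
move=> sl sm; apply/eqP; rewrite -subr_eq0; apply: contraT => d.
have := tendsB sl sm => /tends_far /(_ d) h.
have [n /=] := ae_ex h; rewrite subrr normr0 => h2.
have : 0 < `|l - m| / 2 by apply: half_gt0; rewrite normr_gt0.
by move/lt_le_trans => /(_ _ h2); rewrite ltxx.
Qed.

Lemma tends_ge0 s l : G [set n | 0 <= s n] -> tends s l -> 0 <= l.
Proof.
move=> s0 sl; have : `|l| = l.
  apply: (@tends_uniq s); last exact: sl.
  apply: tends_ext (tends_norm sl); apply: (aeS s0) => n /= h.
  by rewrite ger0_norm.
by move=> <-; exact: normr_ge0.
Qed.

Lemma tends_le s t l m : G [set n | s n <= t n] -> tends s l -> tends t m -> l <= m.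
Proof.
move=> st sl tm; rewrite -subr_ge0; apply: tends_ge0 (tendsB tm sl).
by apply: (aeS st) => n /=; rewrite subr_ge0.
Qed.

Lemma tends_squeeze s t : tends t 0 -> G [set n | `|s n| <= `|t n|] -> tends s 0.
Proof.
move=> t0 st e e0; apply: (aeS (ae_and st (t0 e e0))) => n [/= h].
by rewrite !subr0; exact: le_lt_trans.
Qed.

Lemma bounded_tendsR (f : J -> R) (M : R) : G [set n | `|f n| <= M] ->
  exists l : R, forall e : R, 0 < e -> G [set n | `|f n - l| < e].
Proof.
move=> fM; pose S := [set r | G [set n | r <= f n]].
have SM r : S r -> r <= M.
  move=> Sr; have [n [/= h1 h2]] := ae_ex (ae_and Sr fM).
  apply: le_trans h1 (le_trans _ h2).
  exact: ler_norm.
have S0 : S (- M).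
  apply: (aeS fM) => n /=; rewrite ler_norml; by case/andP.
have hs : has_sup S by split; [exists (- M)|exists M => r /SM].
exists (sup S) => e e0.
have [r Sr hr] := sup_adherent e0 hs.
have h2 : G [set n | f n < sup S + e].
  have : ~ G [set n | sup S + e <= f n].
    move=> h; have := sup_upper_bound hs (h : S _); rewrite gerDl.
    by rewrite leNgt e0.
  move=> h; apply: (aeS (aeN h)) => n /=.
  by move/negP; rewrite -ltNge.
apply: (aeS (ae_and Sr h2)) => n [/= h3 h4].
rewrite ltr_distl h4 andbT.
exact: lt_le_trans hr h3.
Qed.

Lemma tends_real (f : J -> R) (l : R) :
  (forall e : R, 0 < e -> G [set n | `|f n - l| < e]) -> tends (fun n => (f n)%:C%C) l%:C%C.
Proof.
move=> h e e0; have [er e1] : complex.Im e = 0 /\ 0 < complex.Re e.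
  by move: e0; rewrite ltcE /= => /andP[/eqP -> ->].
apply: (aeS (h _ e1)) => n /= h1.
rewrite -raddfB normc_def /= expr0n addr0 sqrtr_sqr.
by rewrite ltcE /= er eqxx.
Qed.

Lemma bounded_tends s (M : C) : G [set n | `|s n| <= M] -> exists l, tends s l.
Proof.
move=> sM.
have h1 : G [set n | `|complex.Re (s n)| <= complex.Re M /\ `|complex.Im (s n)| <= complex.Re M].
  apply: (aeS sM) => n /=; rewrite normc_def lecE /= => /andP[_ h].
  split; apply: le_trans h; rewrite -sqrtr_sqr ler_sqrt ?addr_ge0 ?sqr_ge0 //.
    by rewrite lerDl sqr_ge0.
  by rewrite lerDr sqr_ge0.
have [l1 t1] := @bounded_tendsR (fun n => complex.Re (s n)) _ (aeS h1 (fun n => @proj1 _ _)).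
have [l2 t2] := @bounded_tendsR (fun n => complex.Im (s n)) _ (aeS h1 (fun n => @proj2 _ _)).
exists (l1%:C%C + 'i%C * l2%:C%C).
apply: tends_ext (tendsD (tends_real t1) (tendsM (tends_cst 'i%C) (tends_real t2))).
by apply: aeT => n /=; rewrite [RHS]complexE.
Qed.

Lemma tends_pow0 (s : J -> C) d : (0 < d)%N -> tends (fun n => s n ^+ d) 0 -> tends s 0.
Proof.
move=> d0 sd e e0; apply: (aeS (sd (e ^+ d) (exprn_gt0 _ e0))) => n /=.
rewrite !subr0 normrX ltr_pXn2r // nnegrE ?normr_ge0 //; exact: ltW.
Qed.

Lemma tends_tev n (f : tower C n) (v : J -> nat -> C) (l : nat -> C) :
  (forall k, (k < n)%N -> tends (fun j => v j k) (l k)) ->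
  tends (fun j => tev n (v j) f) (tev n l f).
Proof.
elim: n f => [|n IH] f vl; first exact: tends_cst.
rewrite tevS; apply: (tends_ext (s := fun j =>
  \sum_(i < size (f : {poly tower C n})) tev n (v j) (f : {poly tower C n})`_i * v j n ^+ i)).
  by apply: aeT => j /=; rewrite -tevS.
apply: tends_sum => i; apply: tendsM; last by apply: tendsX; exact: vl.
by apply: IH => k kn; apply: vl; exact: ltnW.
Qed.

Lemma tends_slope n k (f : tower C n) (v1 v2 : J -> nat -> C) (l : nat -> C) :
  (forall k, (k < n)%N -> tends (fun j => v1 j k) (l k)) ->
  (forall k, (k < n)%N -> tends (fun j => v2 j k) (l k)) ->
  tends (fun j => slope (v1 j) (v2 j) k f) (slope l l k f).
Proof.
elim: n f => [|n IH] f h1 h2; first exact: tends_cst.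
rewrite /=; case: ifP => _; apply: tends_sum => i; apply: tendsM.
- by apply: tends_tev => k' kn; apply: h1; exact: ltnW.
- apply: tends_sum => a; apply: tendsM; apply: tendsX; [exact: h2|exact: h1].
- by apply: IH => k' kn; [apply: h1|apply: h2]; exact: ltnW.
- by apply: tendsX; exact: h2.
Qed.

(** A root at small distance from a point where the value is small. *)
Lemma close_root (p : {poly C}) (y : C) : (1 < size p)%N ->
  exists2 r, root p r & `|lead_coef p| * `|y - r| ^+ (size p).-1 <= `|p.[y]|.
Proof.
move=> sp; have [rs pE] := closed_field_poly_normal p.
have p0 : p != 0 by rewrite -size_poly_gt0 ltnW.
have srs : size rs = (size p).-1.
  have E : size p = (size rs).+1 by rewrite {1}pE size_scale ?lead_coef_eq0 // size_prod_XsubC.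
  by rewrite E.
have px : p.[y] = lead_coef p * \prod_(r <- rs) (y - r).
  by rewrite {1}pE hornerZ horner_prod; congr (_ * _); apply: eq_bigr => r _; rewrite hornerXsubC.
have min (t : seq C) : t != [::] -> exists2 r, r \in t & `|y - r| ^+ size t <= `|\prod_(z <- t) (y - z)|.
  elim: t => // a t IH _; have [->|t0] := eqVneq t [::].
    by exists a; rewrite ?mem_head // big_seq1 expr1.
  have [r rt hr] := IH t0; rewrite big_cons normrM.
  have [h|h] := real_leP (normr_real (y - a)) (normr_real (y - r)).
    exists a; first exact: mem_head.
    rewrite [size _]/= exprS.
    apply: ler_wpM2l; first exact: normr_ge0.
    by apply: le_trans hr; rewrite lerXn2r ?nnegrE ?normr_ge0.
  exists r; first by rewrite inE rt orbT.
  rewrite [size _]/= exprS.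
  apply: ler_pM; rewrite ?exprn_ge0 ?normr_ge0 //; exact: ltW.
have rs0 : rs != [::] by rewrite -size_eq0 srs; case: (size p) sp => [|[]].
have [r rrs hr] := min rs rs0; exists r.
  rewrite pE rootZ ?lead_coef_eq0 // root_prod_XsubC //.
by rewrite px normrM -srs; apply: ler_wpM2l => //; exact: normr_ge0.
Qed.

Lemma telescope_bound (d : R) (k : nat) : 0 < d -> d <= 1 ->
  d / (1 + (d * k%:R) ^+ 2) <= 4 * ((1 + d * k%:R)^-1 - (1 + d * k.+1%:R)^-1) /\
  d / (1 + (d * k.+1%:R) ^+ 2) <= 4 * ((1 + d * k%:R)^-1 - (1 + d * k.+1%:R)^-1).
Proof.
move=> d0 d1; have k0 : 0 <= k%:R :> R by exact: ler0n.
rewrite -(@nat1r R k); set x := d * k%:R; have x0 : 0 <= x by apply: mulr_ge0 => //; exact: ltW.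
have -> : d * (1 + k%:R) = x + d by rewrite mulrDr mulr1 addrC.
have p1 : 0 < 1 + x by lra.
have p2 : 0 < 1 + (x + d) by lra.
have -> : 4 * ((1 + x)^-1 - (1 + (x + d))^-1) = d * (4 / ((1 + x) * (1 + (x + d)))).
  by field; rewrite !gt_eqF.
have sq0 : 0 <= x ^+ 2 by exact: sqr_ge0.
have sq1 : 0 <= (x + d) ^+ 2 by exact: sqr_ge0.
have h1 : 0 <= (1 - d) * (1 + x) by apply: mulr_ge0; lra.
have h2 : 0 <= (x - 1) ^+ 2 by exact: sqr_ge0.
have h3 : 0 <= x * d by apply: mulr_ge0 => //; exact: ltW.
split; rewrite ler_pM2l // -[X in X <= _]mul1r ler_pdivrMr; try lra.
  rewrite mulrAC ler_pdivlMr ?mulr_gt0 // mul1r; nra.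
rewrite mulrAC ler_pdivlMr ?mulr_gt0 // mul1r; nra.
Qed.

Lemma grid_line (d : R) (P : nat) : 0 < d -> d <= 1 ->
  \sum_(p < P + P) d / (1 + (d * (p%:R - P%:R)) ^+ 2) <= 8.
Proof.
move=> d0 d1; rewrite big_split_ord /=; pose f k : R := (1 + d * k%:R)^-1.
have f0 k : 0 <= f k by rewrite invr_ge0 addr_ge0 ?mulr_ge0 // ltW.
have f1 : f 0%N = 1 by rewrite /f mulr0 addr0 invr1.
have -> : 8 = 4 + 4 :> R by rewrite -natrD.
apply: lerD.
  apply: (@le_trans _ _ (\sum_(p < P) 4 * (f (P - p.+1)%N - f (P - p)%N))).
    apply: ler_sum => p _; have [k kE] : exists k, (P - p = k.+1)%N.
      by exists (P - p.+1)%N; rewrite -subSn ?subSS.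
    have pE : (p%:R - P%:R : R) = - (P - p)%N%:R by rewrite natrB ?opprB // ltnW.
    rewrite pE mulrN sqrrN subnS kE /=; exact: (telescope_bound k d0 d1).2.
  rewrite -mulr_sumr -(big_mkord xpredT (fun p => f (P - p.+1)%N - f (P - p)%N)).
  rewrite (telescope_sumr (fun p => f (P - p)%N)) // subnn subn0 f1; have := f0 P; lra.
apply: (@le_trans _ _ (\sum_(p < P) 4 * (f p - f p.+1))).
  apply: ler_sum => p _; have E : ((P + p)%:R - P%:R : R) = p%:R by rewrite natrD addrC addKr.
  rewrite E; exact: (telescope_bound p d0 d1).1.
rewrite -mulr_sumr -(big_mkord xpredT (fun p => f p - f p.+1)).
have -> : \sum_(0 <= p < P) (f p - f p.+1) = - \sum_(0 <= p < P) (f p.+1 - f p).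
  by rewrite -sumrN; apply: eq_bigr => p _; rewrite opprB.
rewrite telescope_sumr // f1; have := f0 P; lra.
Qed.

Lemma grid_plane (d : R) (P : nat) : 0 < d -> d <= 1 ->
  d ^+ 2 * \sum_(p < P + P) \sum_(q < P + P)
    (1 + ((d * (p%:R - P%:R)) ^+ 2 + (d * (q%:R - P%:R)) ^+ 2))^-1 ^+ 2 <= 64.
Proof.
move=> d0 d1; have L := grid_line P d0 d1.
set S := \sum_(p < _) _ in L; have S0 : 0 <= S.
  by apply: sumr_ge0 => p _; rewrite divr_ge0 ?addr_ge0 ?sqr_ge0 // ltW.
apply: (@le_trans _ _ (S * S)); last by nra.
rewrite /S mulr_suml mulr_sumr; apply: ler_sum => p _.
rewrite !mulr_sumr; apply: ler_sum => q _.
set x := (d * _) ^+ 2; set y := (d * _) ^+ 2.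
have x0 : 0 <= x by exact: sqr_ge0.
have y0 : 0 <= y by exact: sqr_ge0.
rewrite [X in _ <= X]mulrACA -expr2 ler_pM2l ?exprn_gt0 // -invfM exprVn lef_pV2 ?posrE; nra.
Qed.
Definition lnC (z : C) : C := (exp.ln (complex.Re z))%:C%C.
Definition posC (z : C) : C := (Num.max 0 (complex.Re z))%:C%C.

Lemma real_Re (z : C) : z \is Num.real -> z = (complex.Re z)%:C%C.
Proof. by case: z => a b; rewrite complex_real /= => /eqP /= ->. Qed.

Lemma Re_gt0 (z : C) : 0 < z -> z = (complex.Re z)%:C%C /\ 0 < complex.Re z.
Proof. by move=> z0; split; [apply: real_Re; exact: gtr0_real|move: z0; rewrite ltcE => /andP[]]. Qed.

Lemma ln_increment (r1 r2 : R) : 0 < r1 -> 0 < r2 ->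
  (r2 - r1) / r2 <= exp.ln r2 - exp.ln r1 <= (r2 - r1) / r1.
Proof.
have up (a b : R) : 0 < a -> 0 < b -> exp.ln b - exp.ln a <= (b - a) / a.
  move=> a0 b0; rewrite -exp.ln_div ?posrE //; have -> : b / a = 1 + (b - a) / a by field; rewrite gt_eqF.
  apply: exp.le_ln1Dx; rewrite -subr_gt0 opprK addrC.
  by have -> : 1 + (b - a) / a = b / a; [field; rewrite gt_eqF|exact: divr_gt0].
move=> h1 h2; rewrite up // andbT; have := up r2 r1 h2 h1.
by rewrite -lerN2 opprB -mulNr opprB.
Qed.

Lemma ln_slope (a1 a2 : J -> C) (l : C) : 0 < l -> tends a1 l -> tends a2 l ->
  G [set n | 0 < a1 n] -> G [set n | 0 < a2 n] ->
  exists t, tends t l^-1 /\ G [set n | lnC (a2 n) - lnC (a1 n) = t n * (a2 n - a1 n)].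
Proof.
move=> l0 h1 h2 p1 p2.
pose t n : C := if a2 n == a1 n then (a1 n)^-1 else (lnC (a2 n) - lnC (a1 n)) / (a2 n - a1 n).
exists t; split; last first.
  apply: aeT => n; rewrite /= /t; case: eqP => [->|/eqP ne]; first by rewrite !subrr mulr0.
  by rewrite divfK // subr_eq0.
have l1 := tendsV h1 (lt0r_neq0 l0); have l2 := tendsV h2 (lt0r_neq0 l0).
have h : tends (fun n => t n - (a1 n)^-1) 0.
  have := tendsB l2 l1; rewrite subrr => l3; apply: (tends_squeeze l3).
  apply: (aeS (ae_and p1 p2)) => n [/= /Re_gt0[e1 q1] /Re_gt0[e2 q2]].
  rewrite /t e1 e2; case: eqP => [|/eqP ne]; first by rewrite subrr normr0 normr_ge0.
  rewrite /lnC /=; set r1 := complex.Re (a1 n) in q1 ne *; set r2 := complex.Re (a2 n) in q2 ne *.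
  rewrite -!(fmorphV (real_complex R)) -!(rmorphB (real_complex R)) -(fmorphV (real_complex R)).
  rewrite -(rmorphM (real_complex R)) -(rmorphB (real_complex R)) !normc_def /= !expr0n !addr0 !sqrtr_sqr lecR.
  have r12 : r2 - r1 != 0 by apply: contra ne; rewrite subr_eq0 => /eqP ->.
  have /andP[b1 b2] := ln_increment q1 q2.
  have [c1|c1] := ltP 0 (r2 - r1).
    have k1 : (exp.ln r2 - exp.ln r1) / (r2 - r1) <= r1^-1 by rewrite ler_pdivrMr // mulrC.
    have k2 : r2^-1 <= (exp.ln r2 - exp.ln r1) / (r2 - r1) by rewrite ler_pdivlMr // mulrC.
    by rewrite !ler0_norm ?subr_le0 // ?lerN2 ?lerB // (le_trans k2).
  have c2 : 0 < r1 - r2 by rewrite lt_def subr_eq0 eq_sym -subr_eq0 r12 -oppr_le0 opprB.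
  have eN : (exp.ln r2 - exp.ln r1) / (r2 - r1) = (exp.ln r1 - exp.ln r2) / (r1 - r2).
    by rewrite -[in RHS]opprB -[in X in _ = _ / X]opprB invrN mulrNN.
  have k1 : r1^-1 <= (exp.ln r2 - exp.ln r1) / (r2 - r1).
    rewrite eN ler_pdivlMr //; have := ln_increment q2 q1 => /andP[h3 _]; by rewrite mulrC.
  have k2 : (exp.ln r2 - exp.ln r1) / (r2 - r1) <= r2^-1.
    rewrite eN ler_pdivrMr //; have := ln_increment q2 q1 => /andP[_ h3]; by rewrite mulrC.
  by rewrite !ger0_norm ?subr_ge0 // ?lerB // (le_trans k1).
have := tendsD h l1; rewrite add0r; apply: tends_ext; apply: aeT => n /=.
by rewrite subrK.
Qed.

Lemma pos_increment (r1 r2 : R) : exists2 c : R, `|c| <= 1 &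
  Num.max 0 r2 - Num.max 0 r1 = c * (r2 - r1) /\ (0 < r1 -> 0 < r2 -> c = 1).
Proof.
have [->|ne] := eqVneq r1 r2; first by exists 1; rewrite ?normr1 // !subrr mulr0.
have d0 : r2 - r1 != 0 by rewrite subr_eq0 eq_sym.
exists ((Num.max 0 r2 - Num.max 0 r1) / (r2 - r1)).
  rewrite normrM normfV ler_pdivrMr ?normr_gt0 // mul1r.
  case: (leP 0 r2) => h2; case: (leP 0 r1) => h1 //; rewrite ?subrr ?normr0 ?normr_ge0 //.
    by rewrite subr0 (ger0_norm h2) ger0_norm; lra.
  by rewrite sub0r normrN distrC (ger0_norm h1) ger0_norm; lra.
split=> [|p1 p2]; first by rewrite divfK.
by rewrite !max_r ?ltW // divff.
Qed.

Lemma tends_pos (a : J -> C) (l : C) : l \is Num.real -> tends a l -> G [set n | a n \is Num.real] ->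
  tends (fun n => posC (a n)) (posC l).
Proof.
move=> lr al ar; apply/tends_sub0; have := (tends_sub0 _ _).1 al => h.
apply: (tends_squeeze h); apply: (aeS ar) => n /= nr.
have [c c1 [ce _]] := pos_increment (complex.Re l) (complex.Re (a n)).
rewrite /posC -rmorphB ce {2}(real_Re lr) {2}(real_Re nr) -rmorphB rmorphM normrM ler_piMl //.
by rewrite normc_def /= expr0n addr0 sqrtr_sqr lecR.
Qed.

Lemma pos_slope k (a1 a2 : J -> C) (l : C) : l \is Num.real -> tends a1 l -> tends a2 l ->
  G [set n | a1 n \is Num.real] -> G [set n | a2 n \is Num.real] ->
  exists t, tends t (k.+2%:R * posC l ^+ k.+1) /\
    G [set n | posC (a2 n) ^+ k.+2 - posC (a1 n) ^+ k.+2 = t n * (a2 n - a1 n)].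
Proof.
move=> lr h1 h2 r1 r2.
have ex n : exists c : R, [/\ `|c| <= 1, Num.max 0 (complex.Re (a2 n)) - Num.max 0 (complex.Re (a1 n)) = c * (complex.Re (a2 n) - complex.Re (a1 n)) &
    (0 < complex.Re (a1 n) -> 0 < complex.Re (a2 n) -> c = 1)].
  by have [c c1 [ce cp]] := pos_increment (complex.Re (a1 n)) (complex.Re (a2 n)); exists c.
have [ci cP] := choice ex.
have nC (r : R) : `|r%:C%C| = `|r|%:C%C :> C by rewrite normc_def /= expr0n addr0 sqrtr_sqr.
pose S n : C := \sum_(i < k.+2) posC (a2 n) ^+ (k.+1 - i) * posC (a1 n) ^+ i.
have tS : tends S (k.+2%:R * posC l ^+ k.+1).
  have -> : k.+2%:R * posC l ^+ k.+1 = \sum_(i < k.+2) posC l ^+ (k.+1 - i) * posC l ^+ i.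
    rewrite (eq_bigr (fun=> posC l ^+ k.+1)) => [|i _].
      by rewrite sumr_const card_ord mulr_natl.
    by rewrite -exprD subnK // -ltnS.
  by apply: tends_sum => i; apply: tendsM; apply: tendsX; exact: tends_pos.
exists (fun n => (ci n)%:C%C * S n); split; last first.
  apply: (aeS (ae_and r1 r2)) => n [/= q1 q2]; have [_ ce _] := cP n.
  rewrite subrXX mulrAC; congr (_ * _).
  by rewrite /posC -rmorphB ce {2}(real_Re q1) {2}(real_Re q2) -rmorphB rmorphM.
have [l0|l0] := real_leP lr (@real0 C).
  have z : posC l = 0.
    by rewrite /posC max_l //; move: l0; rewrite lecE => /andP[].
  rewrite z expr0n mulr0; apply: tends0Ml; last by move: tS; rewrite z expr0n mulr0.
  by exists 1; apply: aeT => n /=; rewrite nC lecR; have [] := cP n.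
apply: (tends_ext _ tS).
have far (a : J -> C) : tends a l -> G [set n | a n \is Num.real] -> G [set n | 0 < complex.Re (a n)].
  move=> al ar; apply: (aeS (ae_and (al _ l0) ar)) => n [/= h r].
  have : 0 < a n.
    have [an|//] := real_leP r (@real0 C); move: h; rewrite distrC ger0_norm ?subr_ge0; last exact: le_trans an (ltW l0).
    by rewrite gtrBl => /lt_le_trans /(_ an); rewrite ltxx.
  by case/Re_gt0.
apply: (aeS (ae_and (far _ h1 r1) (far _ h2 r2))) => n [/= q1 q2].
by have [_ _ ->] := cP n; rewrite // mul1r.
Qed.

Lemma tends_mpoly n (F : {mpoly C[n]}) (v : J -> 'I_n -> C) (l : 'I_n -> C) :
  (forall i, tends (fun k => v k i) (l i)) -> tends (fun k => F.@[v k]) F.@[l].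
Proof.
move=> vl; rewrite mevalE.
apply: (tends_ext (s := fun k => \sum_(m <- msupp F) F@_m * \prod_i v k i ^+ m i)).
  by apply: aeT => k /=; rewrite mevalE.
apply: tends_sum => m; apply: tendsM; first exact: tends_cst.
elim: (index_enum _) => [|i r IH].
  by rewrite big_nil; apply: (tends_ext _ (tends_cst 1)); apply: aeT => k; rewrite /= big_nil.
rewrite big_cons; apply: (tends_ext _ (tendsM (tendsX (m i) (vl i)) IH)).
by apply: aeT => k; rewrite /= big_cons.
Qed.

End UltraLimit.

Lemma free_ultrafilter : exists G : ultrafilter nat, forall n : nat, G [set k | (n <= k)%N].
Proof.
pose F : set_system nat := [set A | exists n, forall k, (n <= k)%N -> A k].
have FF : ProperFilter F.
  split=> [[n' /(_ n' (leqnn _))] //|]; split=> [|A B [k hk] [l hl]|A B AB [k hk]].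
  - by exists 0%N.
  - by exists (maxn k l) => i; rewrite geq_max => /andP[ki li]; split; [exact: hk|exact: hl].
  - by exists k => i ki; apply: AB; exact: hk.
by have [G [GU FG]] := ultraFilterLemma FF; exists (Ultrafilter GU) => k; apply: FG; exists k.
Qed.

Arguments aeT {J G P} _.
Arguments tends_cst {R J G} l.
Arguments tends_sub0 {R J G} s l.

Definition omega : ultrafilter nat := projT1 (cid free_ultrafilter).
Lemma G_free n : omega [set k | (n <= k)%N].
Proof. exact: (projT2 (cid free_ultrafilter) n). Qed.

Section LocalGeometry.
Variables (R : realType) (N : nat) (X : projective_variety R N).
Notation C := R[i].
Notation pts := (set_type (pv_set X)).
Notation op := (opens pts).
Implicit Types (x y z : pts) (U V W Z : op).

Section RegularFunctions.
Implicit Types (f g : pts -> C).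

Definition locally x (P : pts -> Prop) : Prop :=
  exists W : op, oset W x /\ forall y, oset W y -> P y.

Lemma locally_and x P Q : locally x P -> locally x Q ->
  locally x (fun y => P y /\ Q y).
Proof.
move=> [W [Wx WP]] [V [Vx VQ]]; exists (W ∩ V); split=> // y [Wy Vy].
by split; [exact: WP|exact: VQ].
Qed.

Lemma locally_mono x (P Q : pts -> Prop) :
  (forall y, P y -> Q y) -> locally x P -> locally x Q.
Proof. by move=> PQ [W [Wx WP]]; exists W; split=> // y /WP/PQ. Qed.

Lemma locally_all x (P : pts -> Prop) : (forall y, P y) -> locally x P.
Proof. by move=> PT; exists (opens_setT pts); split. Qed.

Lemma locally_at x (P : pts -> Prop) : locally x P -> P x.
Proof. by move=> [W [Wx WP]]; exact: WP. Qed.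

Lemma locally_in x (U : op) : oset U x -> locally x (oset U).
Proof. by move=> Ux; exists U. Qed.

Lemma locally_seq x (I : Type) (s : seq I) (P : I -> pts -> Prop) :
  (forall i, locally x (P i)) ->
  locally x (fun y => forall i, List.In i s -> P i y).
Proof.
move=> HP; elim: s => [|i s IH]; first exact: locally_all.
apply: locally_mono (locally_and (HP i) IH) => y [Pi Ps] j /= [<-//|]; exact: Ps.
Qed.

Lemma in_In (T : eqType) (x : T) s : x \in s -> List.In x s.
Proof.
elim: s => //= y s IH; rewrite inE => /orP[/eqP->|/IH]; first by left.
by right.
Qed.

Lemma locally_fin x (I : finType) (P : I -> pts -> Prop) :
  (forall i, locally x (P i)) -> locally x (fun y => forall i, P i y).
Proof.
move=> /(locally_seq (enum I)); apply: locally_mono => y Py i.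
by apply: Py; apply: in_In; rewrite mem_enum.
Qed.

Lemma locally_idem x P : locally x P -> locally x (fun y => locally y P).
Proof. by move=> [W [Wx WP]]; exists W; split=> // y Wy; exists W. Qed.

Definition regat x f : Prop := exists W : op, oset W x /\ regular_on W f.

Lemma regular_sub (U V : op) f : V `<=` U -> regular_on U f -> regular_on V f.
Proof.
move=> VU rf x Vx; have [W [Wx WU [d [F [H [hF hH FH]]]]]] := rf x (VU x Vx).
exists (W ∩ V); split=> //; first by move=> y [].
by exists d, F, H; split=> // y [Wy _]; exact: FH.
Qed.

Lemma regat_on (U : op) f : (forall x, oset U x -> regat x f) -> regular_on U f.
Proof.
move=> rf x Ux; have [W [Wx rW]] := rf x Ux.
have [V [Vx VW FH]] := regular_sub subl rW (conj Wx Ux).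
by exists V; split=> // y /VW[].
Qed.

Lemma regat_rf U x (f : regfun U) : oset U x -> regat x f.
Proof. by move=> Ux; exists U; split=> //; exact: rf_regular. Qed.

Lemma rf_evD U (u v : regfun U) x : rf_fun (u + v) x = u x + v x.
Proof. by []. Qed.

Lemma rf_evM U (u v : regfun U) x : rf_fun (u * v) x = u x * v x.
Proof. by []. Qed.

Lemma rf_ev0 U x : rf_fun (0 : regfun U) x = 0.
Proof. by rewrite /= /cutoff; case: asboolP. Qed.

Lemma rf_evN U (u : regfun U) x : rf_fun (- u) x = - u x.
Proof.
by apply/eqP; rewrite -addr_eq0 -[_ + _]/(rf_fun (- u + u) x) addNr rf_ev0.
Qed.

Lemma rf_evB U (u v : regfun U) x : rf_fun (u - v) x = u x - v x.
Proof. by rewrite rf_evD rf_evN. Qed.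

Lemma rf_ev_sum U (I : Type) (s : seq I) (F : I -> regfun U) x :
  rf_fun (\sum_(i <- s) F i) x = \sum_(i <- s) F i x.
Proof.
elim: s => [|i s IH]; first by rewrite !big_nil rf_ev0.
by rewrite !big_cons -IH.
Qed.

(** A function regular on [U], extended by zero. *)
Definition mk_rf U f (rf : regular_on U f) : regfun U :=
  RegFun (regular_res subxx rf) (@cutoff_out _ _ _ U f).

Lemma mk_rfE U f (rf : regular_on U f) x : oset U x -> mk_rf rf x = f x.
Proof. by move=> Ux; rewrite /= cutoff_in. Qed.

Lemma regat_nbhs x f : regat x f -> locally x (fun y => regat y f).
Proof. by move=> [W [Wx rW]]; exists W; split=> // y Wy; exists W. Qed.

Lemma regatD x f g : regat x f -> regat x g -> regat x (fun y => f y + g y).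
Proof.
move=> [W [Wx rW]] [V [Vx rV]]; exists (W ∩ V); split=> //.
apply: regular_add; first exact: (regular_sub subl rW).
exact: (regular_sub subr rV).
Qed.

Lemma regatM x f g : regat x f -> regat x g -> regat x (fun y => f y * g y).
Proof.
move=> [W [Wx rW]] [V [Vx rV]]; exists (W ∩ V); split=> //.
apply: regular_mul; first exact: (regular_sub subl rW).
exact: (regular_sub subr rV).
Qed.

Lemma eq_regat x f g : locally x (fun y => f y = g y) -> regat x f -> regat x g.
Proof.
move=> [V [Vx fg]] [W [Wx rW]]; exists (W ∩ V); split=> //.
move=> y [Wy Vy]; have [W' [W'y W'W [d [F [H [hF hH FH]]]]]] :=
  regular_sub subl rW (conj Wy Vy).
exists W'; split=> //; exists d, F, H; split=> // z W'z.
by rewrite -fg; [exact: FH|have [] := W'W z W'z].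
Qed.

Lemma regat_cst x (c : C) : regat x (fun=> c).
Proof.
exists (opens_setT pts); split=> //; apply: regat_on => y _.
apply: (@eq_regat _ (cutoff setT (fun=> c))).
  by apply: locally_all => z; rewrite cutoff_in.
by exists (opens_setT pts); split=> //; exact: (@regular_cst _ _ _ (opens_setT pts)).
Qed.

Lemma regatN x f : regat x f -> regat x (fun y => - f y).
Proof.
move=> rf; apply: eq_regat (regatM (regat_cst x (-1)) rf).
by apply: locally_all => y; rewrite mulN1r.
Qed.

Lemma regatB x f g : regat x f -> regat x g -> regat x (fun y => f y - g y).
Proof. by move=> rf rg; exact: regatD (regatN rg). Qed.

Lemma regat_sum x (I : Type) (s : seq I) (F : I -> pts -> C) :
  (forall i, regat x (F i)) -> regat x (fun y => \sum_(i <- s) F i y).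
Proof.
move=> rF; elim: s => [|i s IH].
  by under eq_fun do rewrite big_nil; exact: regat_cst.
by under eq_fun do rewrite big_cons; exact: regatD.
Qed.

Lemma regat_prod x (I : Type) (s : seq I) (F : I -> pts -> C) :
  (forall i, regat x (F i)) -> regat x (fun y => \prod_(i <- s) F i y).
Proof.
move=> rF; elim: s => [|i s IH].
  by under eq_fun do rewrite big_nil; exact: regat_cst.
by under eq_fun do rewrite big_cons; exact: regatM.
Qed.

Lemma open_hneq0 d (G : {mpoly C[N.+1]}) : G \is d.-homog ->
  open [set y : pts | heval G (val y) != 0].
Proof.
move=> hG; exists [set y : proj_space R N | heval G y != 0] => //.
by move=> y Gy; exists d, G; split.
Qed.

Lemma regat_frac x f : regat x f -> exists d, exists G H : {mpoly C[N.+1]},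
  [/\ G \is d.-homog, H \is d.-homog &
   locally x (fun y => heval H (val y) != 0 /\ f y = heval G (val y) / heval H (val y))].
Proof.
move=> [W [Wx rW]]; have [V [Vx VW [d [G [H [hG hH GH]]]]]] := rW x Wx.
by exists d, G, H; split=> //; exists V.
Qed.

Lemma frac_regat x f d (G H : {mpoly C[N.+1]}) :
  G \is d.-homog -> H \is d.-homog -> heval H (val x) != 0 ->
  locally x (fun y => f y = heval G (val y) / heval H (val y)) -> regat x f.
Proof.
move=> hG hH Hx [V [Vx fV]]; pose U := V ∩ (Opens (open_hneq0 hH)).
exists U; split=> // y [Vy Hy]; exists U; split=> //; exists d, G, H; split=> // z [Vz Hz].
by split=> //; exact: fV.
Qed.

Lemma regat_neq0 x f : regat x f -> f x != 0 -> locally x (fun y => f y != 0).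
Proof.
move=> /regat_frac[d [G [H [hG hH GH]]]] fx0.
have [Hx fx] := locally_at GH; have Gx : heval G (val x) != 0.
  by apply: contraNneq fx0 => Gx; rewrite fx Gx mul0r.
have := locally_and GH (locally_in (U := Opens (open_hneq0 hG)) Gx).
apply: locally_mono => y [[Hy ->] Gy]; by rewrite mulf_neq0 ?invr_eq0.
Qed.

Lemma regatV x f : regat x f -> f x != 0 -> regat x (fun y => (f y)^-1).
Proof.
move=> rf fx0; have /regat_frac[d [G [H [hG hH GH]]]] := rf.
have [Hx fx] := locally_at GH; have Gx : heval G (val x) != 0.
  by apply: contraNneq fx0 => Gx; rewrite fx Gx mul0r.
apply: (@frac_regat _ _ d H G) => //; apply: locally_mono GH => y [Hy ->].
by rewrite invf_div.
Qed.

(** Germs at [x] lying in the square of the maximal ideal. *)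
Definition sqideal x f : Prop :=
  exists m (g h : 'I_m -> pts -> C),
    (forall i, [/\ regat x (g i), regat x (h i), g i x = 0 & h i x = 0]) /\
    locally x (fun y => f y = \sum_i g i y * h i y).

Lemma eq_sqideal x f g : locally x (fun y => f y = g y) ->
  sqideal x f -> sqideal x g.
Proof.
move=> fg [m [a [b [ab E]]]]; exists m, a, b; split=> //.
by apply: locally_mono (locally_and fg E) => y [<-].
Qed.

Lemma sqidealD x f g : sqideal x f -> sqideal x g ->
  sqideal x (fun y => f y + g y).
Proof.
move=> [m [a [b [ab E]]]] [m' [a' [b' [ab' E']]]].
pose cat (u : 'I_m -> pts -> C) (u' : 'I_m' -> pts -> C) (i : 'I_(m + m')) :=
  match split i with inl j => u j | inr j => u' j end.
exists (m + m')%N, (cat a a'), (cat b b'); split.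
  by move=> i; rewrite /cat; case: (split i).
apply: locally_mono (locally_and E E') => y [-> ->].
rewrite big_split_ord; congr (_ + _); apply: eq_bigr => i _; rewrite /cat.
  by rewrite (unsplitK (inl i)).
by rewrite (unsplitK (inr i)).
Qed.

Lemma sqidealZ x f g : regat x f -> sqideal x g ->
  sqideal x (fun y => f y * g y).
Proof.
move=> rf [m [a [b [ab E]]]]; exists m, (fun i y => f y * a i y), b; split.
  move=> i; have [ra rb a0 b0] := ab i; split=> //; first exact: regatM.
  by rewrite a0 mulr0.
apply: locally_mono E => y ->; rewrite mulr_sumr.
by apply: eq_bigr => i _; rewrite mulrA.
Qed.

Lemma sqidealM x f g : regat x f -> regat x g -> f x = 0 -> g x = 0 ->
  sqideal x (fun y => f y * g y).
Proof.
move=> rf rg f0 g0; exists 1%N, (fun=> f), (fun=> g); split=> //.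
by apply: locally_all => y; rewrite big_ord1.
Qed.

Lemma sqideal0 x : sqideal x (fun=> 0).
Proof.
apply: eq_sqideal (sqidealM (regat_cst x 0) (regat_cst x 0) erefl erefl).
by apply: locally_all => y; rewrite mulr0.
Qed.

Record point_derivation n x (d : (pts -> C) -> 'rV[C]_n) : Prop := PointDerivation {
  dif_eq : forall f g, regat x f -> locally x (fun y => f y = g y) -> d f = d g;
  dif_D : forall f g, regat x f -> regat x g -> d (fun y => f y + g y) = d f + d g;
  dif_M : forall f g, regat x f -> regat x g ->
    d (fun y => f y * g y) = f x *: d g + g x *: d f;
  dif_cst : forall c, d (fun=> c) = 0
}.

(** The operators on germs sending [f] to the coordinates of its differential
    at [x], for a chosen basis of the cotangent space. *)
Record is_differential n x (d : (pts -> C) -> 'rV[C]_n) : Prop := IsDifferential {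
  dif_pd :> point_derivation x d;
  dif_ker : forall f, regat x f -> d f = 0 -> sqideal x (fun y => f y - f x);
  dif_surj : forall v, exists f, regat x f /\ d f = v
}.

Lemma in_max_ideal_sqE V x (u : regfun V) :
  oset V x -> in_max_ideal_sq x u <-> sqideal x u.
Proof.
move=> Vx; split.
  move=> [V' [V'V [gs [V'x gs0 E]]]].
  pose nt := nth (0, 0) gs.
  exists (size gs), (fun i => rf_fun (nt i).1), (fun i => rf_fun (nt i).2).
  split=> [i|].
    have [g1 g2] := gs0 _ (mem_nth (0, 0) (ltn_ord i)).
    by split=> //; exact: regat_rf.
  exists V'; split=> // y V'y; rewrite -(rf_resE V'V u V'y) E rf_ev_sum.
  by rewrite (big_nth (0, 0)) big_mkord.
move=> [m [a [b [ab E]]]].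
have ra i : regat x (a i) by have [] := ab i.
have rb i : regat x (b i) by have [] := ab i.
have [V1 [V1x HV1]] := locally_and E (locally_fin (fun i =>
  locally_and (regat_nbhs (ra i)) (regat_nbhs (rb i)))).
pose V' := V ∩ V1.
have rA i : regular_on V' (a i).
  by apply: regat_on => y [_ /HV1[_ /(_ i)[]]].
have rB i : regular_on V' (b i).
  by apply: regat_on => y [_ /HV1[_ /(_ i)[]]].
exists V', subl, [seq (mk_rf (rA i), mk_rf (rB i)) | i <- enum 'I_m].
split=> //.
  move=> g /mapP[i _ ->] /=; have [_ _ ai bi] := ab i.
  by rewrite !cutoff_in.
apply: regfun_eqP => y [Vy V1y]; rewrite rf_resE // (HV1 y V1y).1 rf_ev_sum.
rewrite big_map -big_enum /=; apply: eq_bigr => i _.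
by rewrite !cutoff_in.
Qed.

Definition has_parameters n x : Prop :=
  exists t : 'I_n -> pts -> C, (forall k, regat x (t k) /\ t k x = 0) /\
  forall f, regat x f -> f x = 0 ->
    exists! c : 'I_n -> C, sqideal x (fun y => f y - \sum_k c k * t k y).

Lemma nonsingular_parameters n x : nonsingular_at n x -> has_parameters n x.
Proof.
move=> [W [t [Wx tx Ht]]]; exists (fun k => t k); split.
  by move=> k; split=> //; exact: regat_rf.
move=> f rf f0; have [V1 [V1x rV1]] := rf; pose V := W ∩ V1.
have Vx : oset V x by [].
have rV : regular_on V f := regular_sub subr rV1.
have ux : mk_rf rV x = 0 by rewrite mk_rfE.
have [c [Hc uc]] := Ht V subl (mk_rf rV) Vx ux.
have E c' : locally x (fun y =>
  rf_fun (mk_rf rV - \sum_k rf_cst V (c' k) * rf_res subl (t k)) y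
    = f y - \sum_k c' k * t k y).
  exists V; split=> // y Vy; rewrite rf_evB mk_rfE // rf_ev_sum; congr (_ - _).
  by apply: eq_bigr => k _; rewrite rf_evM rf_cstE // rf_resE.
exists c; split.
  by apply: eq_sqideal (E c) _; apply/in_max_ideal_sqE.
move=> c' Hc'; apply: uc; apply/in_max_ideal_sqE => //.
apply: eq_sqideal Hc'; apply: locally_mono (E c') => y; exact: esym.
Qed.

Lemma meval_homog (K : comNzRingType) n d (G : {mpoly K[n]}) (c : K) (v : 'I_n -> K) :
  G \is d.-homog -> G.@[fun i => c * v i] = c ^+ d * G.@[v].
Proof.
move=> /dhomogP hG; rewrite !mevalE mulr_sumr; apply: eq_big_seq => m /hG <-.
rewrite mulrCA; congr (_ * _); rewrite -[c ^+ _]/(c ^+ mdeg m) mdegE -prodrXr -big_split /=.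
by apply: eq_bigr => i _; rewrite exprMn.
Qed.

Lemma cancel_fraction (K : fieldType) (c a b : K) :
  c != 0 -> (c * a) / (c * b) = a / b.
Proof. by move=> c0; rewrite invfM mulrACA divff // mul1r.
Qed.


Lemma differential_exists n x : @has_parameters n x ->
  exists d, @is_differential n x d.
Proof.
move=> [t [Ht uniq]].
have rt k : regat x (t k) by case: (Ht k).
have tx k : t k x = 0 by case: (Ht k).
pose rem f (c : 'rV[C]_n) y := f y - f x - \sum_k c 0 k * t k y.
have rs c : regat x (fun y => \sum_(k < n) c k * t k y).
  by apply: regat_sum => k; exact: (regatM (regat_cst x (c k))).
have ex f : exists c : 'rV[C]_n, regat x f -> sqideal x (rem f c) /\
    forall c', sqideal x (rem f c') -> c' = c.
  have [rf|nrf] := pselect (regat x f); last by exists 0.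
  have [//||c [Hc uc]] := uniq (fun y => f y - f x).
  - exact: regatB (regat_cst _ _).
  - exact: subrr.
  exists (\row_k c k) => _; split=> [|c' Hc'].
    apply: eq_sqideal Hc; apply: locally_all => y; congr (_ - _).
    by apply: eq_bigr => k _; rewrite mxE.
  apply/rowP => k; rewrite mxE; apply/esym.
  by have -> : c = (fun k => c' 0 k) by exact: uc.
pose d f := projT1 (cid (ex f)).
have dS f : regat x f -> sqideal x (rem f (d f)).
  by move=> rf; exact: (projT2 (cid (ex f)) rf).1.
have dU f c : regat x f -> sqideal x (rem f c) -> d f = c.
  by move=> rf Hc; apply/esym; exact: (projT2 (cid (ex f)) rf).2.
exists d; split; [split=> [f g rf fg|f g rf rg|f g rf rg|c]|move=> f rf df|move=> v].
- apply: dU => //; apply: eq_sqideal (dS g (eq_regat fg rf)).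
  have fx := locally_at fg.
  by apply: locally_mono fg => y fgy; rewrite /rem fgy fx.
- apply: dU; first exact: regatD.
  apply: eq_sqideal (sqidealD (dS f rf) (dS g rg)).
  apply: locally_all => y; rewrite /rem.
  have -> : \sum_k (d f + d g) 0 k * t k y
    = \sum_k d f 0 k * t k y + \sum_k d g 0 k * t k y.
    by rewrite -big_split; apply: eq_bigr => k _; rewrite mxE mulrDl.
  by ring.
- apply: dU; first exact: regatM.
  have r0 h : regat x h -> regat x (fun y => h y - h x).
    by move=> rh; exact: regatB (regat_cst _ _).
  apply: eq_sqideal (sqidealD (sqidealD (sqidealZ (regat_cst x (f x)) (dS g rg))
    (sqidealZ (regat_cst x (g x)) (dS f rf)))
    (sqidealM (r0 f rf) (r0 g rg) (subrr _) (subrr _))).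
  apply: locally_all => y; rewrite /rem.
  have -> : \sum_k (f x *: d g + g x *: d f) 0 k * t k y
    = f x * (\sum_k d g 0 k * t k y) + g x * \sum_k d f 0 k * t k y.
    by rewrite !mulr_sumr -big_split; apply: eq_bigr => k _; rewrite !mxE mulrDl !mulrA.
  by ring.
- apply: dU; first exact: regat_cst.
  apply: eq_sqideal (sqideal0 x); apply: locally_all => y.
  by rewrite /rem subrr big1 ?subrr // => k _; rewrite mxE mul0r.
- apply: eq_sqideal (dS f rf); apply: locally_all => y.
  by rewrite /rem df big1 ?subr0 // => k _; rewrite mxE mul0r.
exists (fun y => \sum_k v 0 k * t k y); split; first exact: rs.
apply: dU; first exact: rs.
apply: eq_sqideal (sqideal0 x); apply: locally_all => y.
rewrite /rem [X in _ - X - _]big1 ?subr0 ?subrr // => k _.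
by rewrite tx mulr0.
Qed.

Section DifferentialTheory.
Variables (n : nat) (x : pts) (d : (pts -> C) -> 'rV[C]_n).
Hypothesis hd : point_derivation x d.

Lemma dif_scale c f : regat x f -> d (fun y => c * f y) = c *: d f.
Proof.
by move=> rf; rewrite (dif_M hd (regat_cst x c) rf) (dif_cst hd) scaler0 addr0.
Qed.

Lemma dif_N f : regat x f -> d (fun y => - f y) = - d f.
Proof.
move=> rf; rewrite -scaleN1r -dif_scale //; congr d.
by apply: funext => y; rewrite mulN1r.
Qed.

Lemma dif_B f g : regat x f -> regat x g -> d (fun y => f y - g y) = d f - d g.
Proof. by move=> rf rg; rewrite (dif_D hd rf (regatN rg)) dif_N. Qed.

Lemma dif_sum (I : Type) (s : seq I) (F : I -> pts -> C) :
  (forall i, regat x (F i)) ->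
  d (fun y => \sum_(i <- s) F i y) = \sum_(i <- s) d (F i).
Proof.
move=> rF; elim: s => [|i s IH].
  by rewrite big_nil; under eq_fun do rewrite big_nil; exact: (dif_cst hd 0).
rewrite big_cons -IH -(dif_D hd) //; last exact: regat_sum.
by congr d; apply: funext => y; rewrite big_cons.
Qed.

Lemma dif_V f : regat x f -> f x != 0 ->
  d (fun y => (f y)^-1) = - ((f x)^-1 ^+ 2) *: d f.
Proof.
move=> rf fx0; have rV := regatV rf fx0.
have E : d (fun y => f y * (f y)^-1) = 0.
  rewrite -(dif_cst hd 1); apply: (dif_eq hd); first exact: regatM.
  by apply: locally_mono (regat_neq0 rf fx0) => y fy; rewrite divff.
move: E; rewrite (dif_M hd rf rV) => /eqP; rewrite addr_eq0 => /eqP E.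
apply: (scalerI fx0); rewrite E scalerA -scaleNr; congr (_ *: _).
by rewrite mulrN expr2 mulrA divff // mul1r.
Qed.

End DifferentialTheory.

Section Generation.
Variables (m : nat) (y : 'I_m -> pts -> C).

(** Near [x], the differential of [f] is a combination of the [d (y l)] with
    regular coefficients. *)
Definition generated x f : Prop := regat x f /\
  exists a : 'I_m -> pts -> C, (forall l, regat x (a l)) /\
    locally x (fun z => forall n (d : (pts -> C) -> 'rV[C]_n),
      point_derivation z d -> d f = \sum_l a l z *: d (y l)).

Lemma generated_cst x c : generated x (fun=> c).
Proof.
split; first exact: regat_cst.
exists (fun _ _ => 0); split=> [l|]; first exact: regat_cst.
apply: locally_all => z n d hd; rewrite (dif_cst hd) big1 // => l _.
exact: scale0r.
Qed.

Lemma generatedD x f g : generated x f -> generated x g ->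
  generated x (fun z => f z + g z).
Proof.
move=> [rf [a [ra Ea]]] [rg [b [rb Eb]]]; split; first exact: regatD.
exists (fun l z => a l z + b l z); split=> [l|]; first exact: regatD.
apply: locally_mono (locally_and (locally_and Ea Eb)
  (locally_and (regat_nbhs rf) (regat_nbhs rg))) => z [[da db] [rfz rgz]] n d hd.
rewrite (dif_D hd) // (da n d hd) (db n d hd) -big_split.
by apply: eq_bigr => l _; rewrite scalerDl.
Qed.

Lemma generatedM x f g : generated x f -> generated x g ->
  generated x (fun z => f z * g z).
Proof.
move=> [rf [a [ra Ea]]] [rg [b [rb Eb]]]; split; first exact: regatM.
exists (fun l z => f z * b l z + g z * a l z); split=> [l|].
  by apply: regatD; exact: regatM.
apply: locally_mono (locally_and (locally_and Ea Eb)
  (locally_and (regat_nbhs rf) (regat_nbhs rg))) => z [[da db] [rfz rgz]] n d hd.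
rewrite (dif_M hd) // (da n d hd) (db n d hd) !scaler_sumr -big_split.
by apply: eq_bigr => l _; rewrite scalerDl !scalerA.
Qed.

Lemma generatedV x f : generated x f -> f x != 0 ->
  generated x (fun z => (f z)^-1).
Proof.
move=> [rf [a [ra Ea]]] fx0; split; first exact: regatV.
exists (fun l z => - ((f z)^-1 ^+ 2) * a l z); split=> [l|].
  apply: regatM => //; apply: regatN; apply: eq_regat (regatM (regatV rf fx0) (regatV rf fx0)).
  by apply: locally_all => z; rewrite expr2.
apply: locally_mono (locally_and Ea
  (locally_and (regat_nbhs rf) (regat_neq0 rf fx0))) => z [da [rfz fz]] n d hd.
rewrite (dif_V hd) // (da n d hd) scaler_sumr.
by apply: eq_bigr => l _; rewrite scalerA.
Qed.

Lemma eq_generated x f g : locally x (fun z => f z = g z) ->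
  generated x f -> generated x g.
Proof.
move=> fg [rf [a [ra Ea]]]; split; first exact: eq_regat rf.
exists a; split=> //; apply: locally_mono (locally_and Ea
  (locally_and (regat_nbhs rf) (locally_idem fg))) => z [da [rfz fgz]] n d hd.
by rewrite -(dif_eq hd rfz fgz) da.
Qed.

Lemma generated_gen x l : regat x (y l) -> generated x (y l).
Proof.
move=> ry; split=> //; exists (fun k z => (k == l)%:R); split=> [k|].
  exact: regat_cst.
apply: locally_all => z n d hd; rewrite (bigD1 l) //= eqxx scale1r big1 ?addr0 //.
by move=> k /negbTE->; rewrite scale0r.
Qed.

Lemma generated_poly x (G : {mpoly C[m]}) : (forall l, regat x (y l)) ->
  generated x (fun z => G.@[fun l => y l z]).
Proof.
move=> ry; under eq_fun do rewrite mevalE.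
elim: (msupp G) => [|c s IH].
  by under eq_fun do rewrite big_nil; exact: generated_cst.
under eq_fun do rewrite big_cons; apply: generatedD => //.
apply: generatedM; first exact: generated_cst.
elim: (index_enum _) => [|l r IHr].
  by under eq_fun do rewrite big_nil; exact: generated_cst.
under eq_fun do rewrite big_cons; apply: generatedM => //.
elim: (c l) => [|k IHk]; first exact: generated_cst.
by under eq_fun do rewrite exprS; apply: generatedM => //; exact: generated_gen.
Qed.

End Generation.

(** The affine coordinates of the chart where the [b]-th homogeneous coordinate
    does not vanish. *)
Definition aff (b l : 'I_N.+1) : pts -> C :=
  fun z => vpick (val (val z)) 0 l / vpick (val (val z)) 0 b.

Lemma vpick_neq0 x : exists b, vpick (val (val x)) 0 b != 0.
Proof.
have vne : vpick (val (val x)) != 0.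
  by rewrite vpick0; apply: contraTneq (valP (val x)) => ->; rewrite dimv0.
by have /rV0Pn[b vb] := vne; exists b.
Qed.

Lemma heval_X (l : 'I_N.+1) (z : proj_space R N) : heval 'X_l z = vpick (val z) 0 l.
Proof. exact: mevalXU. Qed.

Lemma aff_regat x b l : vpick (val (val x)) 0 b != 0 -> regat x (aff b l).
Proof.
move=> xb; apply: (@frac_regat _ _ 1 'X_l 'X_b).
- by rewrite dhomogX; apply/eqP; exact: mdeg1.
- by rewrite dhomogX; apply/eqP; exact: mdeg1.
- by rewrite heval_X.
by apply: locally_all => z; rewrite !heval_X.
Qed.

Lemma locally_chart x b : vpick (val (val x)) 0 b != 0 ->
  locally x (fun z => vpick (val (val z)) 0 b != 0).
Proof.
move=> xb; have h : ('X_b : {mpoly C[N.+1]}) \is 1.-homog.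
  by rewrite dhomogX; apply/eqP; exact: mdeg1.
exists (Opens (open_hneq0 h)); split=> [|z /=]; first by rewrite /= heval_X.
by rewrite heval_X.
Qed.

Lemma heval_aff d (G : {mpoly C[N.+1]}) x b : G \is d.-homog ->
  vpick (val (val x)) 0 b != 0 ->
  heval G (val x) = vpick (val (val x)) 0 b ^+ d * G.@[fun l => aff b l x].
Proof.
move=> hG xb; rewrite -(meval_homog _ _ hG); congr (_.@[_]); apply: funext => l.
by rewrite /aff mulrCA divff // mulr1.
Qed.

Lemma regat_generated x b f : vpick (val (val x)) 0 b != 0 ->
  regat x f -> generated (aff b) x f.
Proof.
move=> xb /regat_frac[d [G [H [hG hH GH]]]].
have [Hx fx] := locally_at GH.
have ry l : regat x (aff b l) by exact: aff_regat.
apply: (@eq_generated _ _ _ (fun z => G.@[fun l => aff b l z] * (H.@[fun l => aff b l z])^-1)).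
  apply: locally_mono (locally_and GH (locally_chart xb)) => z [[Hz ->] zb].
  rewrite (heval_aff hG zb).
  rewrite (heval_aff hH zb).
  apply/esym.
  apply: cancel_fraction.
  by rewrite expf_neq0.
apply: generatedM; first exact: generated_poly.
apply: generatedV; first exact: generated_poly.
by move: Hx; rewrite (heval_aff hH xb) mulf_eq0 negb_or => /andP[].
Qed.

Variable n : nat.

Lemma regat_det x m (A : 'I_m -> 'I_m -> pts -> C) :
  (forall i j, regat x (A i j)) -> regat x (fun z => \det (\matrix_(i, j) A i j z)).
Proof.
move=> rA; apply: regat_sum => s; apply: regatM; first exact: regat_cst.
under eq_fun do under eq_bigr do rewrite mxE.
by apply: regat_prod => i; exact: rA.
Qed.

Lemma regat_adj x m (A : 'I_m -> 'I_m -> pts -> C) i j :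
  (forall i j, regat x (A i j)) -> regat x (fun z => (\adj (\matrix_(i, j) A i j z)) i j).
Proof.
case: m A i j => [|m] A i j rA; first by case: (i).
apply: (@eq_regat _ (fun z => (-1) ^+ (j + i) *
   \det (\matrix_(k, l) A (lift j k) (lift i l) z))).
  apply: locally_all => z; rewrite mxE; congr (_ * \det _).
  by apply/matrixP => k l; rewrite !mxE.
by apply: regatM; [exact: regat_cst|exact: regat_det].
Qed.

Lemma sqideal_generated x b f : vpick (val (val x)) 0 b != 0 -> sqideal x f ->
  exists e : 'I_N.+1 -> pts -> C, (forall l, regat x (e l) /\ e l x = 0) /\
    locally x (fun z => forall m (d : (pts -> C) -> 'rV[C]_m),
      is_differential z d -> d f = \sum_l e l z *: d (aff b l)).
Proof.
move=> xb [m [g [h [gh E]]]].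
have rg i : regat x (g i) by case: (gh i).
have rh i : regat x (h i) by case: (gh i).
have gen i : exists ab : ('I_N.+1 -> pts -> C) * ('I_N.+1 -> pts -> C),
    (forall l, regat x (ab.1 l) /\ regat x (ab.2 l)) /\
    locally x (fun z => forall m (d : (pts -> C) -> 'rV[C]_m), is_differential z d ->
      d (g i) = \sum_l ab.1 l z *: d (aff b l) /\
      d (h i) = \sum_l ab.2 l z *: d (aff b l)).
  have [_ [a [ra Ea]]] := regat_generated xb (rg i).
  have [_ [c [rc Ec]]] := regat_generated xb (rh i).
  exists (a, c); split=> //; apply: locally_mono (locally_and Ea Ec) => z [da dc] m' d hd.
  by split; [exact: (da _ _ hd)|exact: (dc _ _ hd)].
pose a i := (projT1 (cid (gen i))).1; pose c i := (projT1 (cid (gen i))).2.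
have ra i l : regat x (a i l) by have [] := (projT2 (cid (gen i))).1 l.
have rc i l : regat x (c i l) by have [] := (projT2 (cid (gen i))).1 l.
have Hac i := (projT2 (cid (gen i))).2.
exists (fun l z => \sum_i (g i z * c i l z + h i z * a i l z)); split=> [l|].
  split; first by apply: regat_sum => i; apply: regatD; exact: regatM.
  by apply: big1 => i _; have [_ _ -> ->] := gh i; rewrite !mul0r addr0.
apply: locally_mono (locally_and (locally_idem E) (locally_fin (fun i =>
  locally_and (Hac i) (locally_and (regat_nbhs (rg i)) (regat_nbhs (rh i)))))).
move=> z [Ez Hz] m' d hd.
have rgz i : regat z (g i) by have [_ []] := Hz i.
have rhz i : regat z (h i) by have [_ []] := Hz i.
have -> : d f = d (fun z => \sum_i g i z * h i z).
  apply/esym/(dif_eq hd); first by apply: regat_sum => i; exact: regatM.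
  by apply: locally_mono Ez => y ->.
rewrite (dif_sum hd) => [|i]; last exact: regatM.
transitivity (\sum_i \sum_l (g i z * c i l z + h i z * a i l z) *: d (aff b l)).
  apply: eq_bigr => i _; have [da dc] := (Hz i).1 m' d hd.
  rewrite (dif_M hd) // da dc !scaler_sumr -big_split.
  by apply: eq_bigr => l _; rewrite scalerDl !scalerA.
rewrite exchange_big; apply: eq_bigr => l _.
by rewrite scaler_suml.
Qed.

Variable dx : pts -> (pts -> C) -> 'rV[C]_n.
Hypothesis hdx : forall x, is_differential x (dx x).

Definition jacobian (t : 'I_n -> pts -> C) z : 'M[C]_n :=
  \matrix_(i, j) dx z (t i) 0 j.

(** The coefficients of the differential of [f] in the basis [d t_k]. *)
Definition partial (t : 'I_n -> pts -> C) (k : 'I_n) f : pts -> C :=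
  fun z => (dx z f *m invmx (jacobian t z)) 0 k.

Lemma local_parameters x0 : exists (W : op) (t : 'I_n -> pts -> C),
  [/\ oset W x0, (forall z, oset W z -> forall k, regat z (t k)),
      (forall z, oset W z -> jacobian t z \in unitmx) &
      (forall z, oset W z -> forall f k, regat z f -> regat z (partial t k f))].
Proof.
have [b x0b] := vpick_neq0 x0; pose y := @aff b.
have ry l : regat x0 (y l) by exact: aff_regat.
have ex k := dif_surj (hdx x0) (delta_mx 0 k : 'rV[C]_n).
pose t k := projT1 (cid (ex k)).
have rt k : regat x0 (t k) by have [] := projT2 (cid (ex k)).
have dt k : dx x0 (t k) = delta_mx 0 k by have [] := projT2 (cid (ex k)).
pose c j := dx x0 (y j); pose u j z := y j z - \sum_k c j 0 k * t k z.
have rs z j : (forall k, regat z (t k)) -> regat z (fun z => \sum_k c j 0 k * t k z).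
  move=> rtz; apply: regat_sum => k; apply: regatM => //; exact: regat_cst.
have du z j : (forall k, regat z (t k)) -> regat z (y j) ->
    dx z (u j) = dx z (y j) - \sum_k c j 0 k *: dx z (t k).
  move=> rtz ryz; rewrite (dif_B (hdx z)) //; last exact: rs.
  congr (_ - _); rewrite (dif_sum (hdx z)) => [|k].
    by apply: eq_bigr => k _; rewrite (dif_scale (hdx z)).
  by apply: regatM => //; exact: regat_cst.
have squ j : sqideal x0 (fun z => u j z - u j x0).
  apply: (dif_ker (hdx x0)); first by apply: regatB => //; exact: rs.
  rewrite du //; apply/eqP; rewrite subr_eq0; apply/eqP/rowP => k.
  rewrite summxE (bigD1 k) //= !mxE dt !mxE !eqxx mulr1 big1 ?addr0 // => l lk.
  by rewrite mxE dt mxE eqxx eq_sym (negbTE lk) mulr0.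
have exE j := sqideal_generated x0b (squ j).
pose e j := projT1 (cid (exE j)).
have re j l : regat x0 (e j l) by have [] := (projT2 (cid (exE j))).1 l.
have e0 j l : e j l x0 = 0 by have [] := (projT2 (cid (exE j))).1 l.
have He j := (projT2 (cid (exE j))).2.
pose m i j z : C := (i == j)%:R - e i j z.
have rm z i j : regat z (e i j) -> regat z (m i j).
  by move=> rez; apply: regatB => //; exact: regat_cst.
pose M z := \matrix_(i, j) m i j z.
have rdetM : regat x0 (fun z => \det (M z)).
  by apply: regat_det => i j; exact: rm.
have detM0 : \det (M x0) != 0.
  suff -> : M x0 = 1%:M by rewrite det1 oner_neq0.
  by apply/matrixP => i j; rewrite !mxE /m e0 subr0.
have [W [Wx0 HW]] : locally x0 (fun z => (\det (M z) != 0 /\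
    vpick (val (val z)) 0 b != 0) /\
    ((forall k, regat z (t k)) /\
    (forall j, (forall l, regat z (e j l)) /\ forall m (d : (pts -> C) -> 'rV[C]_m),
      is_differential z d -> d (fun z => u j z - u j x0) = \sum_l e j l z *: d (y l)))).
  apply: locally_and; first by apply: locally_and;
    [exact: regat_neq0|exact: locally_chart].
  apply: locally_and; first by apply: locally_fin => k; exact: regat_nbhs.
  apply: locally_fin => j; apply: locally_and => //.
  by apply: locally_fin => l; exact: regat_nbhs.
have ryW z j : oset W z -> regat z (y j).
  by move=> /HW[[_ zb] _]; exact: aff_regat.
pose Y z : 'M[C]_(N.+1, n) := \matrix_(j, k) dx z (y j) 0 k.
pose Cm : 'M[C]_(N.+1, n) := \matrix_(j, k) c j 0 k.
have rowY z j : row j (Y z) = dx z (y j) by apply/rowP => k; rewrite !mxE.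
have rowJ z k : row k (jacobian t z) = dx z (t k) by apply/rowP => l; rewrite !mxE.
have combE z (s : 'I_N.+1 -> C) :
    \sum_l s l *: dx z (y l) = (\row_l s l) *m Y z.
  by rewrite mulmx_sum_row; apply: eq_bigr => l _; rewrite rowY !mxE.
pose B z := invmx (M z) *m Cm.
have YB z : oset W z -> Y z = B z *m jacobian t z.
  move=> Wz; have [[detz zb] [rtz Hz]] := HW z Wz.
  have uM : M z \in unitmx by rewrite unitmxE unitfE.
  suff E : M z *m Y z = Cm *m jacobian t z by rewrite /B -mulmxA -E mulKmx.
  apply/row_matrixP => j; rewrite !row_mul !mulmx_sum_row.
  have [_ /(_ _ _ (hdx z))] := Hz j.
  rewrite (dif_B (hdx z)); first last.
  - exact: regat_cst.
  - by apply: regatB; [exact: ryW|exact: rs].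
  rewrite (dif_cst (hdx z)) subr0 du //; last exact: ryW.
  move=> /eqP; rewrite subr_eq => /eqP E.
  under eq_bigr do rewrite rowY !mxE /m scalerBl.
  under [RHS]eq_bigr do rewrite rowJ !mxE.
  rewrite sumrB (bigD1 j) //= eqxx scale1r big1 ?addr0 => [|l lj].
    by rewrite E addrAC subrr add0r.
  by rewrite eq_sym (negbTE lj) scale0r.
have uJ z : oset W z -> jacobian t z \in unitmx.
  move=> Wz; have ex1 k := dif_surj (hdx z) (delta_mx 0 k : 'rV[C]_n).
  have [[_ zb] _] := HW z Wz.
  have ex2 k : exists a : 'rV[C]_N.+1, a *m Y z = delta_mx 0 k.
    have [f [rf <-]] := ex1 k.
    have [_ [a [_ /locally_at/(_ _ _ (hdx z)) ->]]] := regat_generated zb rf.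
    by exists (\row_l a l z); rewrite combE.
  pose A : 'M[C]_(n, N.+1) := \matrix_(k, l) projT1 (cid (ex2 k)) 0 l.
  have : (A *m B z) *m jacobian t z = 1%:M.
    rewrite -mulmxA -YB //; apply/row_matrixP => k; rewrite row_mul row1.
    rewrite -(projT2 (cid (ex2 k))); congr (_ *m _).
    by apply/rowP => l; rewrite !mxE.
  by move=> /mulmx1_unit[].
exists W, t; split=> // z Wz; first by have [_ []] := HW z Wz.
move=> f k rf; have [[_ zb] _] := HW z Wz.
  have [_ [a [ra Ea]]] := regat_generated zb rf.
  pose G z' := ((\row_l a l z') *m ((\det (M z'))^-1 *: \adj (M z')) *m Cm) 0 k.
  have E : locally z (fun z' => G z' = partial t k f z').
    apply: locally_mono (locally_and Ea (locally_in Wz)) => z' [dfz Wz'].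
    have [[detz zb'] _] := HW z' Wz'.
    have uM : M z' \in unitmx by rewrite unitmxE unitfE.
    rewrite /G /partial (dfz _ _ (hdx z')) combE YB // -!mulmxA mulmxV ?uJ // mulmx1.
    by rewrite /B /invmx uM.
  apply: eq_regat E _; rewrite /G.
  have [_ [_ Hz]] := HW z Wz.
  have rmz i j : regat z (m i j) by apply: rm; have [] := Hz i.
  apply: (@eq_regat _ (fun z' => \sum_i (\sum_l a l z' *
     ((\det (M z'))^-1 * (\adj (M z')) l i)) * c i 0 k)).
    apply: locally_all => z'; rewrite mxE; apply: eq_bigr => i _.
    by rewrite !mxE; congr (_ * _); apply: eq_bigr => l _; rewrite !mxE.
  apply: regat_sum => i; apply: regatM; last exact: regat_cst.
  apply: regat_sum => l; apply: regatM => //; apply: regatM; last exact: regat_adj.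
  by apply: regatV; [exact: regat_det|have [[]] := HW z Wz].
Qed.

End RegularFunctions.

Section QuasiCompact.
Import Order.TTheory Num.Theory.
Notation hc x j := (vpick (val (val x)) 0 j).

Lemma closed_limit (F : set (proj_space R N)) (p : proj_space R N) : closed F -> ~ F p ->
  exists d (H : {mpoly C[N.+1]}), [/\ H \is d.-homog, heval H p != 0 &
    forall q, F q -> heval H q = 0].
Proof.
move=> cF nFp; have : open (~` F) by exact: closed_openC.
move=> /(_ p nFp) [d [H [hH Hp HF]]]; exists d, H; split=> // q Fq.
by apply: contrapT => /eqP /HF.
Qed.

(** Compactness of [X] for the classical topology. *)
Lemma proj_limit (J : Type) (G : ultrafilter J) (x : J -> pts) :
  exists (p : pts) (c : J -> C), (forall n, c n != 0) /\
    forall j, tends G (fun n => c n * hc (x n) j) (hc p j).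
Proof.
pose nm n : C := \sum_j `|hc (x n) j|.
have nm0 n : 0 < nm n.
  have [b hb] := vpick_neq0 (x n); rewrite /nm (bigD1 b) //=.
  by apply: ltr_wpDr; [exact: sumr_ge0|rewrite normr_gt0].
have lim j : exists l, tends G (fun n => (nm n)^-1 * hc (x n) j) l.
  apply: (bounded_tends (M := 1)); apply: aeT => n /=.
  rewrite normrM normfV (gtr0_norm (nm0 n)) mulrC ler_pdivrMr // mul1r /nm.
  by rewrite (bigD1 j) //= lerDl sumr_ge0.
have [l lE] := choice lim.
have l1 : \sum_j `|l j| = 1.
  apply: (tends_uniq (tends_sum _ (fun j => tends_norm (lE j)))).
  apply: (tends_ext _ (tends_cst 1)); apply: aeT => n /=.
  under eq_bigr do rewrite normrM normfV (gtr0_norm (nm0 n)).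
  by rewrite -mulr_sumr mulVf // gt_eqF.
pose v : 'rV[C]_N.+1 := \row_j l j.
have v0 : v != 0.
  apply/eqP => v0; have : (1 : C) != 0 by exact: oner_neq0.
  rewrite -l1 big1 ?eqxx // => j _; have := congr1 (fun w : 'rV_N.+1 => w 0 j) v0.
  by rewrite !mxE => ->; rewrite normr0.
have dv : \dim <[v]> == 1%N by rewrite dim_vline v0.
pose q : proj_space R N := exist _ <[v]>%VS dv.
have [c vc] : exists c, vpick (val q) = c *: v.
  by have /vlineP[c cE] := memv_pick (val q); exists c.
have c0 : c != 0.
  apply/eqP => c0; move: vc; rewrite c0 scale0r => /eqP; rewrite vpick0 /= => /eqP q0.
  by have := dv; rewrite q0 dimv0.
have cl j : tends G (fun n => (c / nm n) * hc (x n) j) (vpick (val q) 0 j).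
  rewrite vc !mxE; apply: (tends_ext _ (tendsM (tends_cst c) (lE j))).
  by apply: aeT => n /=; rewrite mulrA.
have Xq : pv_set X q.
  apply: contrapT => nX; have [d [H [hH Hq HX]]] := closed_limit (@pv_closed _ _ X) nX.
  have := tends_mpoly H (v := fun n j => c / nm n * hc (x n) j) cl.
  move=> /tends_neq0 /(_ Hq) /ae_ex [n /=].
  rewrite (meval_homog _ _ hH) -[X in _ * X]/(heval H (val (x n))) HX ?mulr0 ?eqxx //.
  exact: set_mem (valP (x n)).
exists (SigSub (mem_set Xq)), (fun n => c / nm n); split=> [n|//].
by rewrite mulf_neq0 // invr_eq0 gt_eqF.
Qed.

Lemma open_homog (W : op) (p : pts) : oset W p ->
  exists d (H : {mpoly C[N.+1]}), [/\ H \is d.-homog, heval H (val p) != 0 &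
    forall q : pts, heval H (val q) != 0 -> oset W q].
Proof.
move=> Wp; have [B oB BW] : exists2 B : set (proj_space R N), open B & val @^-1` B = oset W.
  exact: oset_open W.
have /oB[d [H [hH Hp HB]]] : B (val p) by rewrite -BW in Wp.
exists d, H; split=> // q Hq; rewrite -BW; exact: HB.
Qed.

Lemma tends_open (J : Type) (G : ultrafilter J) (x : J -> pts)
    (p : pts) (c : J -> C) (W : op) : (forall n, c n != 0) ->
  (forall j, tends G (fun n => c n * hc (x n) j) (hc p j)) ->
  oset W p -> G [set n | oset W (x n)].
Proof.
move=> c0 cl /open_homog[d [H [hH Hp HW]]].
have /tends_neq0 /(_ Hp) h := tends_mpoly H (v := fun n j => c n * hc (x n) j) cl.
apply: (aeS h) => n /=; rewrite (meval_homog _ _ hH) mulf_eq0 negb_or => /andP[_].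
exact: HW.
Qed.

Lemma In_nth (K : Type) (s : seq K) k0 k : List.In k s ->
  exists2 i, (i < size s)%N & nth k0 s i = k.
Proof.
elim: s => //= z u IH [->|/IH[i il <-]]; first by exists 0%N.
by exists i.+1.
Qed.

Lemma quasi_compact (K : Type) (W : K -> op) : covers W ->
  exists s : seq K, forall x, exists2 k, List.In k s & oset (W k) x.
Proof.
move=> cW; apply: contrapT => nfin.
pose F : set_system pts :=
  [set A | exists s : seq K, forall x, (forall k, List.In k s -> ~ oset (W k) x) -> A x].
have FF : ProperFilter F.
  split=> [[s h]|].
    apply: nfin; exists s => x; apply: contrapT => nx; apply: (h x) => k ks Wx.
    by apply: nx; exists k.
  split=> [|A B [s hs] [t ht]|A B AB [s hs]]; first by exists [::].
    exists (s ++ t) => x hx; split; [apply: hs|apply: ht] => k ks; apply: hx;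
      apply: List.in_or_app; by [left|right].
  by exists s => x /hs; exact: AB.
have [G0 [GU FG]] := ultraFilterLemma FF; pose G := Ultrafilter GU.
have [p [c [c0 cl]]]   := proj_limit G id.
have [k Wk] := cW p.
have h1 := tends_open c0 cl Wk.
have h2 : G [set x | ~ oset (W k) x].
  by apply: FG; exists [:: k] => x /= hx; apply: hx; left.
by have [n [h]] := ae_ex (ae_and h1 h2); apply.
Qed.

End QuasiCompact.

Variable n : nat.

Definition is_cst V (c : regfun V) : Prop := exists a : C, c = rf_cst V a.

Definition mder p V (P : seq (regfun V) -> regfun V) : Prop :=
  is_md (@is_cst V) p P.

Definition natural U (P : evaluation U) : Prop :=
  forall V W (VU : V `<=` U) (WU : W `<=` U) (WV : W `<=` V) fs,
    rf_res WV (P V VU fs) = P W WU [seq rf_res WV f | f <- fs].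

Definition multiderivative p U (P : evaluation U) : Prop :=
  natural P /\ forall V (VU : V `<=` U), mder p (P V VU).

Lemma der_cst U (D : derivation U) V (VU : V `<=` U) c : D V VU (rf_cst V c) = 0.
Proof.
have D1 : D V VU 1 = 0.
  have := der_M D VU 1 1; rewrite !mul1r => /eqP.
  by rewrite -subr_eq0 opprD addrA subrr add0r oppr_eq0 => /eqP.
by have := der_Z D VU c 1; rewrite mulr1 D1 mulr0.
Qed.

Lemma wedge_mder p U (D : 'I_p -> derivation U) V (VU : V `<=` U) :
  mder p (wedge D VU).
Proof.
pose M fs : 'M[regfun V]_p := \matrix_(j, i) D i V VU (nth 0 fs j).
have wE fs : wedge D VU fs = if size fs == p then \det (M fs) else 0.
  rewrite /wedge; case: ifP => // _; rewrite -det_tr; congr (\det _).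
  by apply/matrixP => i j; rewrite !mxE.
have nth_lf (l r : seq (regfun V)) f : nth 0 (l ++ f :: r) (size l) = f.
  by rewrite nth_cat ltnn subnn.
have nth_l (l r : seq (regfun V)) f f' (i : nat) : i != size l ->
    nth 0 (l ++ f :: r) i = nth 0 (l ++ f' :: r) i.
  move=> il; rewrite !nth_cat; case: ltnP => // li; case E: (i - size l)%N => //=.
  by move: il; rewrite eqn_leq li andbT -subn_eq0 E.
have sz (l r : seq (regfun V)) f f' : size (l ++ f :: r) = size (l ++ f' :: r).
  by rewrite !size_cat.
have row'E l r f f' (ip : (size l < p)%N) :
    row' (Ordinal ip) (M (l ++ f :: r)) = row' (Ordinal ip) (M (l ++ f' :: r)).
  apply/matrixP => i j; rewrite !mxE; congr (D j V VU _); apply: nth_l.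
  by have := neq_lift (Ordinal ip) i; rewrite eq_sym -val_eqE.
have rowE l r f (ip : (size l < p)%N) :
    row (Ordinal ip) (M (l ++ f :: r)) = \row_i D i V VU f.
  by apply/rowP => i; rewrite !mxE /= nth_lf.
have lt l (r : seq (regfun V)) f : size (l ++ f :: r) = p -> (size l < p)%N.
  by move <-; rewrite size_cat /= addnS leqNgt ltnS -leqNgt leq_addr.
split=> [fs /eqP/negbTE ne|l r f g|l r f g|l r c [a ->]|l r f]; rewrite !wE.
- by rewrite ne.
- rewrite -!(sz l r (f + g)); case: eqP => [/lt ip|_]; last by rewrite addr0.
  rewrite (determinant_multilinear (B := M (l ++ f :: r)) (C := M (l ++ g :: r))
    (i0 := Ordinal ip) (b := 1) (c := 1)) ?mul1r //.
  by rewrite !rowE; apply/rowP => i; rewrite !mxE !mul1r der_D.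
- rewrite -!(sz l r (f * g)); case: eqP => [/lt ip|_]; last by rewrite !mulr0 addr0.
  apply: (determinant_multilinear (i0 := Ordinal ip)) => //.
  by rewrite !rowE; apply/rowP => i; rewrite !mxE der_M.
- case: eqP => // /lt ip; set B := M _.
  rewrite (determinant_multilinear (A := B) (B := B) (C := B)
    (i0 := Ordinal ip) (b := 0) (c := 0)) ?mul0r ?addr0 //.
  by rewrite !rowE; apply/rowP => i; rewrite !mxE der_cst !mul0r addr0.
case: eqP => // sp; have ip := lt _ _ _ sp.
have ip1 : (size (rcons l f) < p)%N by apply: (lt _ r f); rewrite cat_rcons.
apply: (@determinant_alternate _ _ _ (Ordinal ip) (Ordinal ip1)).
  by rewrite -val_eqE /= size_rcons neq_ltn ltnSn.
move=> i; rewrite !mxE /= nth_lf; congr (D i V VU _).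
by rewrite -cat_rcons nth_lf.
Qed.

Lemma natural_polyvec p U (P : polyvec p U) : natural P.
Proof. exact: (pv_polyvec P).1. Qed.

(** Equality of regular functions is local. *)
Lemma regfun_local U (f g : regfun U) :
  (forall x, oset U x -> exists (W : op) (WU : W `<=` U),
     oset W x /\ rf_res WU f = rf_res WU g) -> f = g.
Proof.
move=> fg; apply: regfun_eqP => x /fg[W [WU [Wx E]]].
by rewrite -(rf_resE WU f Wx) E rf_resE.
Qed.

Lemma is_cst_res V W (WV : W `<=` V) c : is_cst c -> is_cst (rf_res WV c).
Proof. by move=> [a ->]; exists a; exact: rf_res_cst. Qed.

Lemma mder_local p U (P : evaluation U) : natural P ->
  (forall x, oset U x -> exists (W : op) (WU : W `<=` U), oset W x /\
     forall V (VW : V `<=` W), mder p (P V (VW >> WU))) ->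
  multiderivative p P.
Proof.
move=> nP lP; split=> // V VU.
have loc (f g : regfun V) : (forall W (WV : W `<=` V),
    mder p (P W (WV >> VU)) -> rf_res WV f = rf_res WV g) -> f = g.
  move=> fg; apply: regfun_local => x Vx; have [W [WU [Wx mP]]] := lP x (VU x Vx).
  exists (V ∩ W), subl; split=> //; apply: fg.
  by rewrite (irr (_ >> VU) (subr >> WU)).
have nE W (WV : W `<=` V) := nP V W VU (WV >> VU) WV.
have r0 W (WV : W `<=` V) : rf_res WV (0 : regfun V) = 0 by exact: rf_res0.
split=> [fs ne|l r f g|l r f g|l r c Kc|l r f]; apply: loc => W WV mP;
  rewrite ?(rf_resD, rf_resM, nE, r0) ?map_cat /=.
- by apply: (md_size mP); rewrite size_map.
- by rewrite rf_resD (md_D mP).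
- by rewrite rf_resM (md_M mP).
- by apply: (md_K mP); exact: is_cst_res.
- exact: (md_alt mP).
Qed.

Lemma polyvec_md p U (P : polyvec p U) : multiderivative p P.
Proof.
apply: mder_local; first exact: natural_polyvec.
move=> x Ux; have [W [WU [ts [Wx E]]]] := (pv_polyvec P).2 x Ux.
exists W, WU; split=> // V VW.
rewrite (_ : P V _ = fun fs => \sum_(t <- ts) rf_res VW t.1 * wedge t.2 VW fs).
  by apply: md_sum => t; apply: md_scale; exact: wedge_mder.
by apply: funext => fs; exact: E.
Qed.

Record frame (W : op) : Type := Frame {
  fr_t : 'I_n -> regfun W;
  fr_d : 'I_n -> derivation W;
  fr_dt : forall i j V (VW : V `<=` W),
    fr_d i V VW (rf_res VW (fr_t j)) = (i == j)%:R;
  fr_span : forall V (VW : V `<=` W) (D : derivation V) f,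
    D V subxx f
      = \sum_k D V subxx (rf_res VW (fr_t k)) * fr_d k V VW f
}.

Section SlotDerivation.
Variables (p : nat) (U : op) (P : evaluation U) (mP : multiderivative p P).
Variables (V : op) (VU : V `<=` U) (r : seq (regfun V)).
Arguments P : clear implicits.

Definition slot_fun (W : op) (WV : W `<=` V) (f : regfun W) : regfun W :=
  P W (WV >> VU) (f :: map (rf_res WV) r).

Lemma slot_der_D W (WV : W `<=` V) f g :
  slot_fun WV (f + g) = slot_fun WV f + slot_fun WV g.
Proof. exact: (md_D (mP.2 W _) [::]). Qed.
Lemma slot_der_M W (WV : W `<=` V) f g :
  slot_fun WV (f * g) = f * slot_fun WV g + g * slot_fun WV f.
Proof. exact: (md_M (mP.2 W _) [::]). Qed.
Lemma slot_der_Z W (WV : W `<=` V) (c : C) f :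
  slot_fun WV (rf_cst W c * f) = rf_cst W c * slot_fun WV f.
Proof.
rewrite slot_der_M [X in _ + _ * X](md_K (mP.2 W _) [::]) ?mulr0 ?addr0 //.
by exists c.
Qed.
Lemma slot_der_res W W' (WV : W `<=` V) (W'V : W' `<=` V) (W'W : W' `<=` W) f :
  rf_res W'W (slot_fun WV f) = slot_fun W'V (rf_res W'W f).
Proof.
rewrite /slot_fun (mP.1 _ _ _ (W'V >> VU)) /= -map_comp; congr (P _ _ (_ :: _)).
by apply: eq_map => g /=; rewrite (rf_res_comp WV W'W W'V).
Qed.

Definition slot_derivation : derivation V :=
  Derivation slot_der_D slot_der_Z slot_der_M slot_der_res.
End SlotDerivation.


Lemma sqideal_der V (D : derivation V) (f : regfun V) x : oset V x ->
  sqideal x f -> D V subxx f x = 0.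
Proof.
move=> Vx /(in_max_ideal_sqE f Vx)[W [WV [gs [Wx gs0 E]]]].
rewrite -(rf_resE WV _ Wx) (der_res D _ WV WV) E.
elim: gs gs0 {E} => [|g gs IH] gs0.
  rewrite big_nil -[0]/(rf_cst W 0) der_cst; exact: rf_ev0.
rewrite big_cons der_D rf_evD IH ?addr0 => [|h hgs]; last first.
  by apply: gs0; rewrite inE hgs orbT.
have [g1 g2] := gs0 g (mem_head _ _).
by rewrite der_M rf_evD !rf_evM g1 g2 !mul0r addr0.
Qed.

Hypothesis Xns : nonsingular X n.

Theorem frame_exists x : exists W : op, oset W x /\ inhabited (frame W).
Proof.
have ex z := differential_exists (nonsingular_parameters (Xns z)).
have [dx hdx] : exists dx : forall z : pts, (pts -> C) -> 'rV[C]_n,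
    forall z, is_differential z (dx z).
  by have [g gE] := choice ex; exists g.
have [W [t [Wx rt uJ rp]]] := local_parameters hdx x.
exists W; split=> //.
have rtW k : regular_on W (t k) by apply: regat_on => z Wz; exact: rt.
pose T k := mk_rf (rtW k).
have TE V (VW : V `<=` W) k z : oset V z -> rf_res VW (T k) z = t k z.
  by move=> Vz; rewrite rf_resE // mk_rfE //; exact: VW.
have rpV k V (VW : V `<=` W) (f : regfun V) : regular_on V (partial dx t k f).
  by apply: regat_on => z Vz; apply: rp; [exact: VW|exact: regat_rf].
pose Dk k V (VW : V `<=` W) f := mk_rf (@rpV k V VW f).
have DE k V (VW : V `<=` W) f z : oset V z -> Dk k V VW f z = partial dx t k f z.
  by move=> Vz; rewrite mk_rfE.
have DD k V VW (f g : regfun V) : Dk k V VW (f + g) = Dk k V VW f + Dk k V VW g.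
  apply: regfun_eqP => z Vz; rewrite rf_evD !DE // /partial.
  have -> : rf_fun (f + g) = fun y => f y + g y by [].
  rewrite (dif_D (hdx z) (regat_rf _ Vz) (regat_rf _ Vz)) mulmxDl.
  by rewrite [LHS]mxE.
have DM k V VW (f g : regfun V) :
    Dk k V VW (f * g) = f * Dk k V VW g + g * Dk k V VW f.
  apply: regfun_eqP => z Vz; rewrite rf_evD !rf_evM !DE // /partial.
  have -> : rf_fun (f * g) = fun y => f y * g y by [].
  rewrite (dif_M (hdx z) (regat_rf _ Vz) (regat_rf _ Vz)) mulmxDl -!scalemxAl.
  by rewrite [LHS]mxE [X in X + _ = _]mxE [X in _ + X = _]mxE.
have Dc k V VW c : Dk k V VW (rf_cst V c) = 0.
  apply: regfun_eqP => z Vz; rewrite DE // rf_ev0 /partial.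
  rewrite (dif_eq (hdx z) (g := fun=> c)) ?(dif_cst (hdx z)) ?mul0mx ?mxE //.
    exact: regat_rf.
  by exists V; split=> // y Vy; exact: rf_cstE.
have DZ k V VW c (f : regfun V) :
    Dk k V VW (rf_cst V c * f) = rf_cst V c * Dk k V VW f.
  by rewrite DM Dc mulr0 addr0.
have DR k V V' (VW : V `<=` W) (V'W : V' `<=` W) (V'V : V' `<=` V) f :
    rf_res V'V (Dk k V VW f) = Dk k V' V'W (rf_res V'V f).
  apply: regfun_eqP => z V'z; rewrite rf_resE // !DE //; last exact: V'V.
  rewrite /partial (dif_eq (hdx z) (g := rf_res V'V f)) //.
    by apply: regat_rf; exact: V'V.
  by exists V'; split=> // y V'y; rewrite rf_resE.
pose D k := Derivation (DD k) (DZ k) (DM k) (DR k).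
have dT V (VW : V `<=` W) z k : oset V z -> dx z (rf_res VW (T k)) = dx z (t k).
  move=> Vz; apply: (dif_eq (hdx z)); first exact: regat_rf.
  by exists V; split=> // y Vy; exact: TE.
constructor; exists T D => [i j V VW|V VW E f].
  apply: regfun_eqP => z Vz; rewrite [LHS]DE // /partial dT //.
  have -> : dx z (t j) = row j (jacobian dx t z) by apply/rowP => l; rewrite !mxE.
  rewrite -row_mul mulmxV; last by apply: uJ; exact: VW.
  rewrite row1 mxE eqxx /= eq_sym.
  by case: eqP => _; [apply/esym; exact: rf_cstE|rewrite rf_ev0].
apply: regfun_eqP => z Vz; have Wz := VW z Vz.
pose c k := partial dx t k f z.
pose g : regfun V := f - rf_cst V (f z) -
  \sum_k rf_cst V (c k) * (rf_res VW (T k) - rf_cst V (t k z)).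
have gz : dx z g = 0.
  have rr (u : regfun V) : regat z u by exact: regat_rf.
  have cE a : dx z (rf_cst V a) = 0.
    rewrite (dif_eq (hdx z) (g := fun=> a)) ?(dif_cst (hdx z)) //.
    by exists V; split=> // y Vy; exact: rf_cstE.
  have BE (u v : regfun V) : dx z (u - v) = dx z u - dx z v.
    rewrite -(dif_B (hdx z)) //; congr (dx z _); apply: funext => y; exact: rf_evB.
  have SE (F : 'I_n -> regfun V) : dx z (\sum_k F k) = \sum_k dx z (F k).
    rewrite -(dif_sum (hdx z)) //; congr (dx z _); apply: funext => y.
    exact: rf_ev_sum.
  have ZE a (u : regfun V) : dx z (rf_cst V a * u) = a *: dx z u.
    have -> : rf_fun (rf_cst V a * u) = fun y => rf_cst V a y * u y by [].
    by rewrite (dif_M (hdx z)) // cE scaler0 addr0 rf_cstE.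
  rewrite /g !BE cE subr0 SE.
  have -> : \sum_k dx z (rf_cst V (c k) * (rf_res VW (T k) - rf_cst V (t k z)))
     = (dx z f *m invmx (jacobian dx t z)) *m jacobian dx t z.
    rewrite mulmx_sum_row; apply: eq_bigr => k _.
    rewrite ZE BE cE subr0 dT //; congr (_ *: _).
    by apply/rowP => l; rewrite !mxE.
  by rewrite mulmxKV ?subrr //; exact: uJ.
have sqg : sqideal z g.
  have := dif_ker (hdx z) (regat_rf g Vz) gz; apply: eq_sqideal.
  apply: locally_all => y; suff -> : g z = 0 by rewrite subr0.
  rewrite /g !rf_evB rf_cstE // subrr add0r rf_ev_sum big1 ?oppr0 // => k _.
  by rewrite rf_evM rf_evB TE // rf_cstE // rf_cstE // subrr mulr0.
have dN (u v : regfun V) : E V subxx (u - v)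
    = E V subxx u - E V subxx v.
  by rewrite -[- v]/(rf_cst V (-1) * v) der_D der_Z.
have := sqideal_der E Vz sqg.
have dS (s : seq 'I_n) (F : 'I_n -> regfun V) : E V subxx (\sum_(k <- s) F k)
    = \sum_(k <- s) E V subxx (F k).
  elim: s => [|k s IH]; first by rewrite !big_nil; exact: (der_cst E _ 0).
  by rewrite !big_cons der_D IH.
rewrite /g !dN der_cst subr0 dS rf_evB => /eqP; rewrite subr_eq0 => /eqP ->.
rewrite !rf_ev_sum; apply: eq_bigr => k _.
by rewrite der_Z dN der_cst subr0 !rf_evM rf_cstE // mulrC [in RHS]DE.
Qed.


Section OnFrame.
Variables (W : op) (F : frame W).

Definition fr_res V (VW : V `<=` W) (k : 'I_n) : regfun V := rf_res VW (fr_t F k).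

Lemma fr_res_res V V' (VW : V `<=` W) (V'W : V' `<=` W) (V'V : V' `<=` V) (s : seq 'I_n) :
  map (rf_res V'V) (map (fr_res VW) s) = map (fr_res V'W) s.
Proof. by rewrite -map_comp; apply: eq_map => k; exact: rf_res_comp. Qed.

Lemma frame_vanish p V (VW : V `<=` W) (P : evaluation V) :
  multiderivative p P ->
  (forall s, P V subxx (map (fr_res VW) s) = 0) ->
  forall fs, P V subxx fs = 0.
Proof.
move=> mP P0 fs; elim: fs p P mP P0 => [|f fs IH] p P mP P0.
  exact: (P0 [::]).
have sE g : P V subxx (g :: fs)
    = slot_derivation mP subxx fs V subxx g.
  rewrite /= /slot_fun (irr (_ >> _) subxx).
  by congr (P _ _ (_ :: _)); rewrite map_id_in // => h _; apply: regfun_eqP => y Vy;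
    rewrite rf_resE.
rewrite sE (fr_span F VW); apply: big1 => k _; rewrite -sE.
suff -> : P V subxx (rf_res VW (fr_t F k) :: fs) = 0 by rewrite mul0r.
pose Q : evaluation V := fun V' V'V gs =>
  P V' V'V (rf_res V'V (rf_res VW (fr_t F k)) :: gs).
have QE gs : Q V subxx gs
    = P V subxx (rf_res VW (fr_t F k) :: gs).
  by rewrite /Q (rf_res_comp VW subxx VW).
rewrite -QE; apply: (IH p.-1) => [|s].
  split=> [V1 V2 V1V V2V V21 gs|V' V'V].
    by rewrite /Q (mP.1 _ _ _ V2V) /= (rf_res_comp V1V V21 V2V).
  exact: (md_slot _ (mP.2 V' V'V)).
by rewrite QE; exact: (P0 (k :: s)).
Qed.

Definition basis_der p (S : {set 'I_n}) (hS : #|S| = p) (i : 'I_p) : derivation W :=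
  fr_d F (enum_val (cast_ord (esym hS) i)).

Lemma basis_at p (S S' : {set 'I_n}) (hS : #|S| = p) V (VW : V `<=` W) :
  #|S'| = p ->
  wedge (basis_der hS) VW (map (fr_res VW) (enum S')) = (S == S')%:R.
Proof.
move=> hS'; rewrite /wedge size_map -cardE hS' eqxx.
have entry i (j : 'I_p) : basis_der hS i V VW (nth 0 (map (fr_res VW) (enum S')) j)
    = (enum_val (cast_ord (esym hS) i)
        == nth (enum_val (cast_ord (esym hS) i)) (enum S') j)%:R.
  rewrite (nth_map (enum_val (cast_ord (esym hS) i))); last by rewrite -cardE hS'.
  exact: fr_dt.
have [ES|nS] := eqVneq S S'.
  rewrite (_ : \matrix_(i, j) _ = 1%:M) ?det1 //; apply/matrixP => i j.
  rewrite !mxE entry -ES; set x0 := enum_val _.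
  rewrite {1}/x0 (enum_val_nth x0).
  have sE : size (enum S) = p by rewrite -cardE.
  by rewrite nth_uniq ?enum_uniq ?sE /=.
have [k kS kS'] : exists2 k, k \in S & k \notin S'.
  apply/subsetPn; apply: contra nS => sS.
  by rewrite eqEcard sS hS hS' leqnn.
pose i0 := cast_ord hS (enum_rank_in kS k).
rewrite (expand_det_row _ i0) big1 // => j _; rewrite !mxE entry /i0.
have -> : enum_val (cast_ord (esym hS) (cast_ord hS (enum_rank_in kS k))) = k.
  by rewrite (_ : cast_ord _ _ = enum_rank_in kS k) ?enum_rankK_in //; exact: val_inj.
case: eqP => [E|_]; last by rewrite mul0r.
by case/negP: kS'; rewrite E -mem_enum mem_nth // -cardE hS'.
Qed.

Definition basis_set p (k : 'I_('C(n, p))) : {S : {set 'I_n} | #|S| == p} :=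
  enum_val (cast_ord (esym (etrans (etrans (card_sig _) (esym (cardsE _)))
    (etrans (card_draws _ _) (congr1 (fun m => 'C(m, p)) (card_ord n))))) k).

Lemma basis_set_inj p : injective (@basis_set p).
Proof. by move=> k l /enum_val_inj/cast_ord_inj. Qed.

Lemma basis_set_surj p (S : {set 'I_n}) : #|S| = p ->
  exists k : 'I_('C(n, p)), val (basis_set k) = S.
Proof.
move=> hS; rewrite /basis_set; set e := esym _.
have hS' : #|S| == p by exact/eqP.
exists (cast_ord (esym e) (enum_rank (exist (fun S : {set 'I_n} => #|S| == p) S hS'))).
by rewrite cast_ordKV enum_rankK.
Qed.

Definition basis_fun p (k : 'I_('C(n, p))) : 'I_p -> derivation W :=
  basis_der (eqP (valP (basis_set k))).

Fact basis_proof p (k : 'I_('C(n, p))) : is_polyvec p (wedge (basis_fun k)).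
Proof.
split=> [V V' VW V'W V'V fs|x Wx].
  rewrite /wedge size_map; case: eqP => sp; last exact: rf_res0.
  have detR (m : nat) (M : 'M[regfun V]_m) :
      rf_res V'V (\det M) = \det (\matrix_(i, j) rf_res V'V (M i j)).
    rewrite /determinant rf_res_sum; apply: eq_bigr => s _; rewrite rf_resM.
    congr (_ * _).
      by rewrite signE [RHS]signE; case: ifP => _; [exact: rf_resN1|exact: rf_res_cst].
    rewrite (big_morph (rf_res V'V) (rf_resM V'V) (rf_res_cst V'V 1)).
    by apply: eq_bigr => i _; rewrite mxE.
  rewrite detR; congr (\det _); apply/matrixP => i j; rewrite !mxE.
  by rewrite (nth_map 0) ?sp // (der_res _ _ V'W).
exists W, subxx, [:: (1, basis_fun k)]; split=> // V VW fs.
rewrite big_seq1 /= (rf_res_cst VW 1).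
rewrite (irr (VW >> subxx) VW).
exact/esym/mul1r.
Qed.

Definition basis_pv p (k : 'I_('C(n, p))) : polyvec p W := Polyvec (basis_proof k).

Lemma basis_pv_at p (k : 'I_('C(n, p))) (S : {set 'I_n}) V (VW : V `<=` W) :
  #|S| = p ->
  basis_pv k _ VW (map (fr_res VW) (enum S)) = (val (basis_set k) == S)%:R.
Proof. exact: basis_at. Qed.

Lemma basis_expand p V (VW : V `<=` W) (P : evaluation V) : multiderivative p P ->
  forall V' (V'V : V' `<=` V) fs,
  P V' V'V fs = \sum_k rf_res V'V (P V subxx
      (map (fr_res VW) (enum (val (@basis_set p k)))))
    * basis_pv k _ (V'V >> VW) fs.
Proof.
move=> mP V' V'V fs; apply/eqP; rewrite -subr_eq0 -mulN1r; apply/eqP.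
have V'W := V'V >> VW.
pose c k : regfun V' := rf_res V'V (P V subxx
      (map (fr_res VW) (enum (val (@basis_set p k))))).
pose Q : evaluation V' := fun V1 V1V' gs =>
  P V1 (V1V' >> V'V) gs + -1 * \sum_k rf_res V1V' (c k) * basis_pv k _ (V1V' >> V'W) gs.
have cE V1 (V1V' : V1 `<=` V') k : rf_res V1V' (c k)
    = P V1 (V1V' >> V'V) (map (fr_res (V1V' >> V'W)) (enum (val (@basis_set p k)))).
  rewrite /c (rf_res_comp V'V V1V' (V1V' >> V'V)).
  by rewrite (mP.1 _ _ _ (V1V' >> V'V)) (fr_res_res _ (V1V' >> V'W)).
have mQ : multiderivative p Q.
  split=> [V1 V2 V1V' V2V' V21 gs|V1 V1V'].
    rewrite /Q rf_resD rf_resM rf_resN1 rf_res_sum.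
    rewrite (mP.1 _ _ _ (V2V' >> V'V)); congr (_ + _ * _).
    apply: eq_bigr => k _; rewrite rf_resM (rf_res_comp V1V' V21 V2V').
    by rewrite (natural_polyvec (basis_pv k) _ (V2V' >> V'W)).
  apply: md_add; first exact: mP.2.
  apply: md_scale; apply: md_sum => k; apply: md_scale.
  exact: (polyvec_md (basis_pv k)).2.
have := @frame_vanish p V' V'W Q mQ.
have E gs : Q V' subxx gs = P V' V'V gs + -1 * \sum_k c k * basis_pv k _ (V'V >> VW) gs.
  rewrite /Q (irr (_ >> V'V) V'V); congr (_ + _ * _).
  apply: eq_bigr => k _; congr (_ * _).
    by apply: regfun_eqP => y Vy; rewrite rf_resE.
  by congr (pv_fun (basis_pv k) _ _); exact: irr.
move=> H; rewrite -[LHS]E; apply: H.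
apply: md_sets (mQ.2 V' _) _ => S hS; rewrite E.
have [k0 k0S] := basis_set_surj hS.
rewrite (bigD1 k0) //= big1 ?addr0 => [|k kk0].
  rewrite -[wedge _ _ _]/(basis_pv k0 _ _ _) -(irr V'W (V'V >> VW)).
  rewrite basis_pv_at // k0S eqxx mulr1 /c k0S (mP.1 _ _ _ V'V).
  by rewrite (fr_res_res _ V'W) mulN1r subrr.
rewrite -[wedge _ _ _]/(basis_pv k _ _ _) -(irr V'W (V'V >> VW)).
rewrite basis_pv_at //; case: eqP => [kS|_]; last exact: mulr0.
by case/eqP: kk0; apply: basis_set_inj; apply: val_inj; rewrite /= kS k0S.
Qed.

Lemma basis_uniq p V (VW : V `<=` W) (P : evaluation V) (c : 'I_('C(n, p)) -> regfun V) :
  (forall fs, P V subxx fs = \sum_k c k * basis_pv k _ VW fs) ->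
  forall k, c k = P V subxx (map (fr_res VW) (enum (val (basis_set k)))).
Proof.
move=> E k; rewrite E (bigD1 k) //= big1 ?addr0 => [|l lk].
  rewrite -[wedge _ _ _]/(basis_pv k _ _ _) basis_pv_at ?eqxx ?mulr1 //.
  exact/eqP/(valP (basis_set k)).
rewrite -[wedge _ _ _]/(basis_pv l _ _ _) basis_pv_at; last exact/eqP/(valP (basis_set k)).
case: eqP => [kl|_]; last exact: mulr0.
by case/eqP: lk; apply: basis_set_inj; apply: val_inj.
Qed.

End OnFrame.


Lemma md_polyvec p U (P : evaluation U) : multiderivative p P -> is_polyvec p P.
Proof.
move=> mP; split; first exact: mP.1.
move=> x Ux; have [W [Wx [F]]] := frame_exists x.
pose V := U ∩ W; pose VU : V `<=` U := subl.
pose VW : V `<=` W := subr.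
pose Q : evaluation V := fun V1 V1V gs => P V1 (V1V >> VU) gs.
have mQ : multiderivative p Q.
  by split=> [V1 V2 V1V V2V V21 gs|V1 V1V]; [exact: mP.1|exact: mP.2].
exists V, VU, [seq (Q V subxx
      (map (fr_res F VW) (enum (val (@basis_set p k)))),
    fun i => der_restrict VW (basis_fun F k i)) | k <- enum 'I_('C(n, p))].
split=> // V1 V1V fs; rewrite -[LHS]/(Q V1 V1V fs) (basis_expand F VW mQ).
by rewrite big_map -big_enum; apply: eq_bigr.
Qed.

Definition mk_pv p U (P : evaluation U) (mP : multiderivative p P) : polyvec p U :=
  Polyvec (md_polyvec mP).

Lemma wedgeT_free p x : exists (W : op) (e : 'I_('C(n, p)) -> polyvec p W),
  oset W x /\ forall (V : op) (VW : V `<=` W) (s : polyvec p V),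
    exists! c : 'I_('C(n, p)) -> regfun V, s = \sum_k c k *: pv_res VW (e k).
Proof.
have [W [Wx [F]]] := frame_exists x.
exists W, (basis_pv F (p := p)); split=> // V VW s.
have sumE V' (V'V : V' `<=` V) fs (c : 'I_('C(n, p)) -> regfun V) :
  (\sum_k c k *: pv_res VW (basis_pv F k)) V' V'V fs
    = \sum_k rf_res V'V (c k) * basis_pv F k _ (V'V >> VW) fs.
  elim: (index_enum _) => [|k r IH]; first by rewrite !big_nil.
  by rewrite !big_cons -IH.
exists (fun k => s V subxx (map (fr_res F VW) (enum (val (basis_set k))))).
split=> [|c sE].
  apply: polyvec_ext => V' V'V fs; rewrite sumE.
  exact: (basis_expand F VW (polyvec_md s)).
apply: funext => k; apply/esym; apply: (basis_uniq (P := s)) => fs.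
rewrite {1}sE sumE; apply: eq_bigr => l _; congr (_ * _).
  by apply: regfun_eqP => y Vy; rewrite rf_resE.
by congr (pv_fun (basis_pv F l) _ _); exact: irr.
Qed.


Lemma regfun_glue (U : op) (I : Type) (V : I -> op) (VU : forall i, V i `<=` U)
  (cov : forall x, oset U x -> exists i, oset (V i) x) (s : forall i, regfun (V i)) :
  (forall i j x, oset (V i) x -> oset (V j) x -> s i x = s j x) ->
  exists t : regfun U, forall i x, oset (V i) x -> t x = s i x.
Proof.
move=> comp; have ex x : exists c : C, forall i, oset (V i) x -> c = s i x.
  have [[i Vix]|nV] := pselect (exists i, oset (V i) x); last first.
    by exists 0 => i Vix; case: nV; exists i.
  by exists (s i x) => j Vjx; exact: comp.
pose g x := projT1 (cid (ex x)).
have gE i x : oset (V i) x -> g x = s i x by exact: projT2 (cid (ex x)) i.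
have rg : regular_on U g.
  apply: regat_on => x /cov[i Vix]; apply: eq_regat (regat_rf (s i) Vix).
  by exists (V i); split=> // y Viy; rewrite (gE i).
by exists (mk_rf rg) => i x Vix; rewrite mk_rfE ?(gE i) //; exact: VU Vix.
Qed.

Lemma rf_res_point U V (VU : V `<=` U) (f : regfun U) (g : regfun V) :
  (forall x, oset V x -> f x = g x) -> rf_res VU f = g.
Proof. by move=> fg; apply: regfun_eqP => x Vx; rewrite rf_resE ?fg. Qed.

Lemma polyvec_sheaf p : is_sheaf (@pv_res _ _ X p).
Proof.
move=> U I V VU cov s comp.
pose Vi W i := W ∩ V i.
have WVi W i : Vi W i `<=` V i := subr.
have ViW W i : Vi W i `<=` W := subl.
have covW W (WU : W `<=` U) x : oset W x -> exists i, oset (Vi W i) x.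
  by move=> Wx; have [i Vix] := cov x (WU x Wx); exists i.
have compE i j W (Wi : W `<=` V i) (Wj : W `<=` V j) fs : s i W Wi fs = s j W Wj fs.
  have := comp i j W Wi Wj => /(congr1 (fun P : polyvec p W => P W subxx fs)) /=.
  by rewrite (irr (_ >> Wi) Wi) (irr (_ >> Wj) Wj).
have ex W (WU : W `<=` U) fs : exists t : regfun W, forall i x, oset (Vi W i) x ->
    t x = s i (Vi W i) (WVi W i) (map (rf_res (ViW W i)) fs) x.
  apply: (regfun_glue (ViW W) (covW W WU)) => i j x Vix Vjx.
  pose Z := (Vi W i) ∩ (Vi W j).
  have Zx : oset Z x by [].
  have Zi : Z `<=` Vi W i := subl.
  have Zj : Z `<=` Vi W j := subr.
  rewrite -(rf_resE Zi _ Zx) -[RHS](rf_resE Zj _ Zx).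
  rewrite (natural_polyvec (s i) _ (Zi >> (WVi W i))).
  rewrite (natural_polyvec (s j) _ (Zj >> (WVi W j))) -!map_comp.
  rewrite (compE i j Z _ (Zj >> (WVi W j))).
  congr (rf_fun (s j _ _ _) x); apply: eq_map => f /=.
  by rewrite !(rf_res_comp _ _ (Zi >> (ViW W i))).
pose t : evaluation U := fun W WU fs => projT1 (cid (ex W WU fs)).
have tE W (WU : W `<=` U) fs i x : oset W x -> oset (V i) x ->
    t W WU fs x = s i (Vi W i) (WVi W i) (map (rf_res (ViW W i)) fs) x.
  by move=> Wx Vix; apply: (projT2 (cid (ex W WU fs))).
have ts W (WU : W `<=` U) i (Wi : W `<=` V i) fs : t W WU fs = s i W Wi fs.
  apply: regfun_eqP => x Wx; rewrite (tE _ _ _ i) //; last exact: Wi.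
  have Vix : oset (Vi W i) x by split=> //; exact: Wi.
  rewrite -[RHS](rf_resE (ViW W i) _ Vix) (natural_polyvec (s i) Wi (WVi W i)).
  by [].
have tn : natural t.
  move=> W W' WU W'U W'W fs; apply: rf_res_point => x W'x.
  have [i Vix] := cov x (W'U x W'x); have Wx := W'W x W'x.
  rewrite (tE _ _ _ i _ Wx Vix) (tE _ _ _ i _ W'x Vix).
  have Z : Vi W' i `<=` Vi W i by move=> y [W'y Viy]; split=> //; exact: W'W.
  have Zx : oset (Vi W' i) x by [].
  rewrite -(rf_resE Z _ Zx) (natural_polyvec (s i) (WVi W i) (WVi W' i)) -!map_comp.
  congr (rf_fun (s i _ _ _) x); apply: eq_map => f /=.
  by rewrite !(rf_res_comp _ _ ((ViW W' i) >> W'W)).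
have pt : is_polyvec p t.
  split=> // x Ux; have [i Vix] := cov x Ux.
  have [W [WV [ts' [Wx Hts]]]] := (pv_polyvec (s i)).2 x Vix.
  exists W, (WV >> (VU i)), ts'; split=> // V' V'W fs.
  by rewrite -Hts; exact: ts.
exists (Polyvec pt); split=> [i|t' Ht'].
  by apply: polyvec_ext => W WV fs; exact: ts.
apply: polyvec_ext => W WU fs; apply: regfun_eqP => x Wx.
have [i Vix] := cov x (WU x Wx).
have Zx : oset (Vi W i) x by [].
rewrite -(rf_resE (ViW W i) _ Zx) -[RHS](rf_resE (ViW W i) _ Zx).
rewrite (natural_polyvec t' _ ((ViW W i) >> WU)).
rewrite -[t]/(pv_fun (Polyvec pt)) (natural_polyvec (Polyvec pt) _ ((ViW W i) >> WU)).
rewrite /= (ts _ _ i (WVi W i)) -(Ht' i) /=.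
by rewrite (irr ((WVi W i) >> (VU i)) ((ViW W i) >> WU)).
Qed.

Lemma insertionE q U (P Q : evaluation U) V (VU : V `<=` U) fs :
  insertion q P Q VU fs = insert q (P V VU) (Q V VU) fs.
Proof. exact: (shuffle_sumE q (fun s r => P V VU (Q V VU s :: r))). Qed.

Lemma schoutenE p q U (P Q : evaluation U) V (VU : V `<=` U) fs :
  schouten p q P Q VU fs = sbracket p q (P V VU) (Q V VU) fs.
Proof. by rewrite /schouten /sbracket !insertionE. Qed.

Lemma shuffle_sum_res V W (WV : W `<=` V) r (F : seq (regfun V) -> seq (regfun V) -> regfun V) G gs :
  (forall s t, rf_res WV (F s t) = G (map (rf_res WV) s) (map (rf_res WV) t)) ->
  rf_res WV (shuffle_sum r F gs) = shuffle_sum r G (map (rf_res WV) gs).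
Proof.
elim: gs r F G => [|g gs IH] r F G FG /=.
  by case: ifP => _; [exact: FG|exact: rf_res0].
rewrite rf_resD rf_resM (IH r _ (fun s t => G s (rf_res WV g :: t))) //; congr (_ + _ * _).
  case: r {FG}(FG) => [|r] FG; first exact: rf_res0.
  by apply: IH => s t; exact: FG.
by rewrite !signE; case: ifP => _; [exact: rf_resN1|exact: rf_res_cst].
Qed.

Lemma insertion_natural q U (P Q : evaluation U) : natural P -> natural Q ->
  natural (insertion q P Q).
Proof.
move=> nP nQ V W VU WU WV fs; rewrite !insertionE /insert.
by apply: shuffle_sum_res => s t; rewrite (nP _ _ _ WU) /= (nQ _ _ _ WU).
Qed.

Lemma schouten_natural p q U (P Q : evaluation U) : natural P -> natural Q ->
  natural (schouten p q P Q).
Proof.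
move=> nP nQ V W VU WU WV fs; rewrite /schouten rf_resD.
rewrite -[- (_ * _)]mulN1r rf_resM rf_resN1 mulN1r rf_resM.
rewrite (insertion_natural q nP nQ VU WU) (insertion_natural p nQ nP VU WU).
congr (_ - _ * _).
by rewrite !signE; case: ifP => _; [exact: rf_resN1|exact: rf_res_cst].
Qed.

Lemma schouten_md p q U (P Q : evaluation U) : multiderivative p P ->
  multiderivative q Q -> multiderivative (p + q).-1 (schouten p q P Q).
Proof.
move=> [nP mP] [nQ mQ]; split; first exact: schouten_natural.
move=> V VU; have -> : schouten p q P Q VU = sbracket p q (P V VU) (Q V VU).
  by apply: funext => fs; exact: schoutenE.
exact: (md_sbracket (mP _ _) (mQ _ _)).
Qed.

Lemma regfun_two V (a : regfun V) : a + a = 0 -> a = 0.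
Proof.
move=> /(congr1 (fun f => rf_fun f)) aa; apply: regfun_eqP => x _.
have := congr1 (fun f => f x) aa; rewrite !rf_ev0 rf_evD => /eqP.
by rewrite -mulr2n Num.Theory.mulrn_eq0 /= => /eqP.
Qed.

Section Contraction.
Variables (A : comPzRingType) (K : A -> Prop).
Implicit Types (P Q B b : seq A -> A) (fs : seq A) (ts : seq (A * A)).

(** The contraction with the 1-form [\sum_t t.1 d(t.2)]. *)
Definition contract ts b : seq A -> A :=
  fun fs => \sum_(t <- ts) t.1 * slot t.2 b fs.

Lemma md_contract p b ts : is_md K p b ->
  is_md K p.-1 (contract ts b).
Proof. by move=> mb; apply: md_sum => t; apply: md_scale; exact: md_slot. Qed.

Lemma wprod_scalel a u P Q fs : wprod a (fun s => u * P s) Q fs = u * wprod a P Q fs.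
Proof.
by rewrite /wprod -shuffle_sumZ; apply: eq_shuffle_sum => s r _ _; rewrite mulrA.
Qed.

Lemma wprod_scaler a u P Q fs : wprod a P (fun s => u * Q s) fs = u * wprod a P Q fs.
Proof.
by rewrite /wprod -shuffle_sumZ; apply: eq_shuffle_sum => s r _ _; rewrite mulrCA.
Qed.

Lemma wprodDl a P P' Q fs :
  wprod a (fun s => P s + P' s) Q fs = wprod a P Q fs + wprod a P' Q fs.
Proof.
by rewrite /wprod -shuffle_sumD; apply: eq_shuffle_sum => s r _ _; rewrite mulrDl.
Qed.

Lemma wprodDr a P Q Q' fs :
  wprod a P (fun s => Q s + Q' s) fs = wprod a P Q fs + wprod a P Q' fs.
Proof.
by rewrite /wprod -shuffle_sumD; apply: eq_shuffle_sum => s r _ _; rewrite mulrDr.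
Qed.

Lemma wprod_suml a (I : Type) (r : seq I) (F : I -> seq A -> A) Q fs :
  wprod a (fun s => \sum_(i <- r) F i s) Q fs = \sum_(i <- r) wprod a (F i) Q fs.
Proof.
elim: r => [|i r IH].
  rewrite big_nil /wprod; apply: shuffle_sum0 => s t _ _; by rewrite big_nil mul0r.
rewrite big_cons -IH -wprodDl; apply: eq_shuffle_sum => s t _ _.
by rewrite big_cons.
Qed.

Lemma wprod_sumr a (I : Type) (r : seq I) (F : I -> seq A -> A) P fs :
  wprod a P (fun s => \sum_(i <- r) F i s) fs = \sum_(i <- r) wprod a P (F i) fs.
Proof.
elim: r => [|i r IH].
  rewrite big_nil /wprod; apply: shuffle_sum0 => s t _ _; by rewrite big_nil mulr0.
rewrite big_cons -IH -wprodDr; apply: eq_shuffle_sum => s t _ _.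
by rewrite big_cons.
Qed.

(** The contraction with a 1-form is compatible with the brackets up to the
    terms in the exterior derivative of the form. *)
Lemma contract_sbracket p B b ts fs : is_md K 2 B ->
  is_md K p.+1 b ->
  sbracket 2 p B (contract ts b) fs
    + (-1) ^+ p * sbracket 1 p.+1 (contract ts B) b fs
  = contract ts (sbracket 2 p.+1 B b) fs
    + \sum_(t <- ts) (wprod p (slot t.2 b) (slot t.1 B) fs
                      - wprod p (slot t.1 b) (slot t.2 B) fs).
Proof.
move=> mB mb; elim: ts => [|t ts IH].
  rewrite {3}/contract !big_nil addr0.
  have E0 Q : contract [::] Q = fun=> 0 by apply: funext => s; exact: big_nil.
  by rewrite !E0 (sbracket_zeror _ _ mB) (sbracket_zerol _ _ mb) mulr0 addr0.
have Ec Q : contract (t :: ts) Q = fun s => t.1 * slot t.2 Q s + contract ts Q s.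
  by apply: funext => s; exact: big_cons.
rewrite !Ec big_cons (sbracketDr _ _ _ _ mB) (sbracketDl _ _ _ _ mb).
rewrite mulrDr addrACA IH (sbracketZr _ _ _ _ mB) (sbracketZl _ _ _ _ mb).
rewrite (slot_sbracket t.2 mB mb).
rewrite (wprodC _ (md_slot t.2 mB) (md_slot t.1 mb)) /=.
by sign_ring.
Qed.

Lemma slot_inv p P u h : is_md K p P -> K 1 -> u * h = 1 ->
  slot u P = fun fs => - (u ^+ 2) * slot h P fs.
Proof.
move=> mP K1 uh; apply: funext => fs; rewrite /slot.
have := md_M mP [::] fs u h; rewrite uh (md_K mP [::]) //= => /eqP.
rewrite eq_sym addr_eq0 => /eqP E.
have -> : P (u :: fs) = (u * h) * P (u :: fs) by rewrite uh mul1r.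
by rewrite -mulrA -[h * _]opprK -E; ring.
Qed.

Lemma dlog_sbracket p B b u h fs : is_md K 2 B ->
  is_md K p.+1 b -> K 1 -> u * h = 1 ->
  sbracket 2 p B (contract [:: (u, h)] b) fs
    + (-1) ^+ p * sbracket 1 p.+1 (contract [:: (u, h)] B) b fs
  = contract [:: (u, h)] (sbracket 2 p.+1 B b) fs.
Proof.
move=> mB mb K1 uh; rewrite contract_sbracket // big_seq1 /=.
rewrite (slot_inv mb K1 uh) (slot_inv mB K1 uh) wprod_scalel wprod_scaler.
by rewrite subrr addr0.
Qed.

Lemma sbracket_cstr p q u P Q fs : is_md K p P -> K u ->
  sbracket p q P (fun s => u * Q s) fs = u * sbracket p q P Q fs.
Proof.
move=> mP Ku; rewrite (sbracketZr _ _ _ _ mP) (slotK mP Ku).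
by rewrite /wprod shuffle_sum0 ?addr0 // => s r _ _; rewrite mulr0.
Qed.

Lemma contract1 u h b fs : contract [:: (u, h)] b fs = u * b (h :: fs).
Proof. exact: big_seq1. Qed.

Lemma dlogM p b u h u' h' fs : is_md K p b ->
  u * h = 1 -> u' * h' = 1 ->
  contract [:: (u * u', h * h')] b fs
    = contract [:: (u, h)] b fs + contract [:: (u', h')] b fs.
Proof.
move=> mb uh uh'; rewrite !contract1 (md_M mb [::]) /= mulrDr.
rewrite mulrACA uh mul1r addrC; congr (_ + _).
by rewrite [u * u']mulrC mulrACA uh' mul1r.
Qed.

End Contraction.

Section TrivializationTheory.
Variables (Lambda : polyvec 2 (opens_setT pts)) (L : poisson_invertible_sheaf Lambda).
Variable tau : trivialization L.
Notation I := (tr_index tau).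
Notation U_ := (@tr_open _ _ _ _ L tau).
Notation e_ := (@tr_frame _ _ _ _ L tau).

Notation LV V := (Lambda V (@inT _ _ X V)).

Lemma frame_inj (i : I) V (Vi : V `<=` U_ i) (f g : regfun V) :
  f *: om_res Vi (e_ i) = g *: om_res Vi (e_ i) -> f = g.
Proof.
move=> E; have [h [_ uh]] := tr_frameP Vi (f *: om_res Vi (e_ i)).
by rewrite -(uh f erefl) (uh g E).
Qed.

Lemma frame_change (i j : I) V (Vi : V `<=` U_ i) (Vj : V `<=` U_ j) :
  om_res Vj (e_ j) = tr_hres Vi Vj *: om_res Vi (e_ i).
Proof.
have := congr1 (om_res (subII Vi Vj)) (tr_hP i j).
rewrite om_resZ (om_res_comp _ _ Vj) => ->; congr (_ *: _).
by rewrite (om_res_comp _ _ Vi).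
Qed.

Lemma tr_hresM (i j k : I) V (Vi : V `<=` U_ i) (Vj : V `<=` U_ j) (Vk : V `<=` U_ k) :
  tr_hres Vi Vj * tr_hres Vj Vk = tr_hres Vi Vk.
Proof.
apply: (frame_inj (Vi := Vi)).
by rewrite -(frame_change Vi Vk) (frame_change Vj Vk) (frame_change Vi Vj) scalerA mulrC.
Qed.

Lemma tr_hres_id (i : I) V (Vi : V `<=` U_ i) : tr_hres Vi Vi = 1.
Proof. by apply: (frame_inj (Vi := Vi)); rewrite -frame_change scale1r. Qed.

Lemma tr_hresV (i j : I) V (Vi : V `<=` U_ i) (Vj : V `<=` U_ j) :
  tr_hres Vi Vj * tr_hres Vj Vi = 1.
Proof. by rewrite tr_hresM tr_hres_id. Qed.

Lemma tr_hres_res (i j : I) V W (Vi : V `<=` U_ i) (Vj : V `<=` U_ j) (WV : W `<=` V) :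
  rf_res WV (tr_hres Vi Vj) = tr_hres (WV >> Vi) (WV >> Vj).
Proof. exact: rf_res_comp. Qed.

Lemma is_cst1 V : is_cst (1 : regfun V).
Proof. by exists 1. Qed.

Lemma Lambda_md V : mder 2 (LV V).
Proof. exact: (polyvec_md Lambda).2. Qed.

Lemma tr_T_md (i : I) V (Vi : V `<=` U_ i) : mder 1 (tr_T i V Vi).
Proof. exact: (polyvec_md (tr_T i)).2. Qed.

Lemma tr_T_change (i j : I) V (Vi : V `<=` U_ i) (Vj : V `<=` U_ j) f :
  tr_T j V Vj [:: f] = tr_T i V Vi [:: f]
    - tr_hres Vj Vi * pbracket Lambda (tr_hres Vi Vj) f.
Proof.
have := tr_TP Vj f; rewrite (frame_change Vi Vj) pl_br_Mr.
rewrite tr_TP !scalerA -scalerDl => /frame_inj E.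
have sw : pbracket Lambda f (tr_hres Vi Vj) = - pbracket Lambda (tr_hres Vi Vj) f.
  exact: (md_swap [::] [::] _ _ (Lambda_md V)).
have ab := tr_hresV Vi Vj.
rewrite -[LHS]mulr1 -ab mulrA -E sw mulrDl mulNr addrC mulrAC ab mul1r.
by congr (_ - _); rewrite mulrC.
Qed.

Lemma tr_T_poisson (i : I) V (Vi : V `<=` U_ i) fs :
  sbracket 2 1 (LV V) (tr_T i V Vi) fs = 0.
Proof.
have mL := Lambda_md V; have mT := tr_T_md Vi.
have [s2|ns2] := eqVneq (size fs) 2%N; last first.
  by apply: (sbracket_size mL mT); exact/eqP.
case: fs s2 => [//|f [//|g [|//]]] _.
rewrite sbracketC (lie_cons _ _ mT mL) (lie_cons _ _ mT (md_slot f mL)).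
rewrite lie_nil /= /slot.
pose T h := tr_T i V Vi [:: h].
have := pl_flat f g (om_res Vi (e_ i)); rewrite !tr_TP !pl_br_Mr !tr_TP !scalerA -!scalerDl.
move=> /frame_inj.
rewrite -/(T f) -/(T g) /pbracket -/(LV V).
rewrite (md_swap [::] [::] (T f) g mL) /= => E.
move: E; rewrite addrA [T g * T f]mulrC => /addIr ->.
by rewrite opprK opprD addrA subrr add0r addNr mulr0.
Qed.


Section PolyvecOperations.
Variable U : op.

Fact pv_contract_md p (u h : regfun U) (b : polyvec p.+1 U) :
  multiderivative p (fun V VU fs =>
    contract [:: (rf_res VU u, rf_res VU h)] (b V VU) fs : regfun V).
Proof.
split=> [V W VU WU WV fs|V VU].
  rewrite !contract1 rf_resM (rf_res_comp VU WV WU).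
  by rewrite (natural_polyvec b VU WU WV) /= (rf_res_comp VU WV WU).
exact: (md_contract _ ((polyvec_md b).2 V VU)).
Qed.

(** The contraction of a polyvector field with the form [u dh]. *)
Definition pv_contract p (u h : regfun U) (b : polyvec p.+1 U) : polyvec p U :=
  mk_pv (pv_contract_md u h b).

Definition pv_schouten p q (P : polyvec p U) (Q : polyvec q U) :
    polyvec (p + q).-1 U :=
  mk_pv (schouten_md (polyvec_md P) (polyvec_md Q)).

Lemma pv_schoutenE p q (P : polyvec p U) (Q : polyvec q U) V VU fs :
  pv_schouten P Q V VU fs = sbracket p q (P V VU) (Q V VU) fs.
Proof. exact: schoutenE. Qed.

Definition Lam := pv_res (@inT _ _ X U) Lambda.

Lemma LamE V (VU : V `<=` U) : Lam V VU = LV V.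
Proof. by rewrite /= (irr (VU >> (@inT _ _ X U)) (@inT _ _ X V)). Qed.
End PolyvecOperations.

Lemma polyvec_local p U (P Q : polyvec p U) :
  (forall x, oset U x -> exists (W : op) (WU : W `<=` U),
     oset W x /\ pv_res WU P = pv_res WU Q) -> P = Q.
Proof.
move=> PQ; apply: polyvec_ext => V VU fs; apply: regfun_local => x Vx.
have [W [WU [Wx E]]] := PQ x (VU x Vx); exists (V ∩ W), subl.
split=> //; rewrite !(natural_polyvec _ VU (subl >> VU)).
have := congr1 (fun P : polyvec p W => P _ subr
  [seq rf_res subl f | f <- fs]) E => /=.
by rewrite (irr (_ >> WU) (subl >> VU)).
Qed.

Lemma es_glue_aE p U (s : esec tau p U) i j V (Vi : V `<=` U ∩ U_ i)
    (Vj : V `<=` U ∩ U_ j) (Wi : V `<=` U_ i) (Wj : V `<=` U_ j) fs :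
  es_a s j V Vj fs = es_a s i V Vi fs
    + contract [:: (tr_hres Wj Wi, tr_hres Wi Wj)] (es_b s i V Vi) fs.
Proof.
apply/eqP; rewrite addrC -subr_eq; apply/eqP; rewrite contract1.
rewrite (es_glue_a s Vi Vj); congr (_ * es_b s i _ _ (_ :: _)); exact: tr_hres_irr.
Qed.

Lemma es_glue_bE p U (s : esec tau p U) i j V (Vi : V `<=` U ∩ U_ i)
    (Vj : V `<=` U ∩ U_ j) : es_b s i V Vi = es_b s j V Vj.
Proof. by apply: funext => fs; exact: es_glue_b. Qed.

Lemma dlog_hresD p i j k V (Vi : V `<=` U_ i) (Vj : V `<=` U_ j) (Vk : V `<=` U_ k)
    (b : seq (regfun V) -> regfun V) fs : mder p b ->
  contract [:: (tr_hres Vk Vi, tr_hres Vi Vk)] b fs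
    = contract [:: (tr_hres Vj Vi, tr_hres Vi Vj)] b fs
      + contract [:: (tr_hres Vk Vj, tr_hres Vj Vk)] b fs.
Proof.
move=> mb; rewrite -(dlogM _ mb (tr_hresV _ _) (tr_hresV _ _)).
by rewrite tr_hresM [tr_hres Vj Vi * _]mulrC tr_hresM.
Qed.

Section LocalSections.
Variables (p : nat) (j : I) (U : op) (Uj : U `<=` U_ j).
Variables (a : polyvec p U) (b : polyvec p.+1 U).

Notation UI i := (@subIl _ U (U_ i)).
Notation Ui i := (@Defs.subIr _ U (U_ i)).
Notation UIj i := ((UI i) >> Uj).

Definition mk_a i : polyvec p (U ∩ U_ i) :=
  pv_res (UI i) a + pv_contract (tr_hres (Ui i) (UIj i)) (tr_hres (UIj i) (Ui i))
    (pv_res (UI i) b).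
Definition mk_b i : polyvec p.+1 (U ∩ U_ i) := pv_res (UI i) b.

Lemma mk_aE i V (Vi : V `<=` U ∩ U_ i) (VU : V `<=` U)
    (Wi : V `<=` U_ i) (Wj : V `<=` U_ j) fs :
  mk_a i V Vi fs = a V VU fs
    + contract [:: (tr_hres Wi Wj, tr_hres Wj Wi)] (b V VU) fs.
Proof.
rewrite /= !tr_hres_res (irr (Vi >> (UI i)) VU).
by rewrite (tr_hres_irr _ Wi _ Wj) (tr_hres_irr _ Wj _ Wi).
Qed.

Definition mk_esec : esec tau p U.
Proof.
refine (@ESec _ _ _ _ _ tau p U mk_a mk_b _ _) => i k V Vi Vk fs.
  rewrite /=; congr (pv_fun b _ _); exact: irr.
have VU := Vi >> (UI i).
have Wi := Vi >> (Ui i); have Wk := Vk >> (Ui k).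
have Wj := VU >> Uj.
rewrite (mk_aE Vk VU Wk Wj) (mk_aE Vi VU Wi Wj).
rewrite (dlog_hresD Wj Wi Wk fs ((polyvec_md b).2 V VU)).
rewrite addrA [X in X - _]addrC addrK.
rewrite contract1 /mk_b /= (irr (Vi >> _) VU).
by congr (_ * pv_fun b _ (_ :: _)); exact: tr_hres_irr.
Defined.

Lemma mk_esec_a V (Vj : V `<=` U ∩ U_ j) (VU : V `<=` U) fs :
  es_a mk_esec j V Vj fs = a V VU fs.
Proof.
have Wj := VU >> Uj; rewrite [LHS](mk_aE Vj VU Wj Wj) contract1 tr_hres_id.
by rewrite (md_K ((polyvec_md b).2 V VU) [::]) ?mulr0 ?addr0 //; exact: is_cst1.
Qed.

Lemma mk_esec_b i V (Vi : V `<=` U ∩ U_ i) (VU : V `<=` U) fs :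
  es_b mk_esec i V Vi fs = b V VU fs.
Proof. by rewrite /=; congr (pv_fun b _ _); exact: irr. Qed.

End LocalSections.

(** Over an open subset of [U_ j], a section is determined by its [j]-th
    components. *)
Lemma esec_eq p j U (Uj : U `<=` U_ j) (s t : esec tau p U) :
  (forall V (Vj : V `<=` U ∩ U_ j), es_a s j V Vj = es_a t j V Vj) ->
  (forall V (Vj : V `<=` U ∩ U_ j), es_b s j V Vj = es_b t j V Vj) ->
  s = t.
Proof.
move=> Ea Eb; apply: esec_ext => i; apply: polyvec_ext => V Vi fs.
  have VU := Vi >> subl.
  have Vj : V `<=` U ∩ U_ j by apply: subII => //; exact: subset_trans Uj.
  have Wi := Vi >> subr.
  have Wj := VU >> Uj.
  by rewrite !(es_glue_aE _ Vj Vi Wj Wi) Ea Eb.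
have VU := Vi >> subl.
have Vj : V `<=` U ∩ U_ j by apply: subII => //; exact: subset_trans Uj.
by rewrite !(es_glue_bE _ Vi Vj) Eb.
Qed.


Lemma atiyah_is_sheaf p : is_sheaf (@es_res _ _ _ _ _ tau p).
Proof.
move=> U J V VU cov s comp.
pose UI i := U ∩ U_ i; pose VI l i := (V l) ∩ U_ i.
have VIU l i : VI l i `<=` UI i := @openIS _ _ _ U (V l) (U_ i) (VU l).
have covI i x : oset (UI i) x -> exists l, oset (VI l i) x.
  by move=> [Ux Uix]; have [l Vlx] := cov x Ux; exists l.
have compA i l l' W (Wl : W `<=` VI l i) (Wl' : W `<=` VI l' i) :
    pv_res Wl (es_a (s l) i) = pv_res Wl' (es_a (s l') i) /\
    pv_res Wl (es_b (s l) i) = pv_res Wl' (es_b (s l') i).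
  have E := comp l l' W (Wl >> subl) (Wl' >> subl).
  have WW : W `<=` W ∩ U_ i by apply: subII => // y /Wl[].
  have Ea := congr1 (fun t => pv_res WW (es_a t i)) E.
  have Eb := congr1 (fun t => pv_res WW (es_b t i)) E.
  move: Ea Eb => /=; rewrite !(pv_res_comp _ _ Wl) !(pv_res_comp _ _ Wl').
  by split.
have exa i := polyvec_sheaf (VIU ^~ i) (covI i)
  (fun l l' W Wl Wl' => (compA i l l' W Wl Wl').1).
have exb i := polyvec_sheaf (VIU ^~ i) (covI i)
  (fun l l' W Wl Wl' => (compA i l l' W Wl Wl').2).
pose a i := projT1 (cid (exa i)); pose b i := projT1 (cid (exb i)).
have aE i l : pv_res (VIU l i) (a i) = es_a (s l) i by exact: (projT2 (cid (exa i))).1.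
have bE i l : pv_res (VIU l i) (b i) = es_b (s l) i by exact: (projT2 (cid (exb i))).1.
have aP i l W (Wi : W `<=` UI i) (Wl : W `<=` VI l i) : a i W Wi = es_a (s l) i W Wl.
  by rewrite -aE /=; congr (pv_fun (a i) _); exact: irr.
have bP i l W (Wi : W `<=` UI i) (Wl : W `<=` VI l i) : b i W Wi = es_b (s l) i W Wl.
  by rewrite -bE /=; congr (pv_fun (b i) _); exact: irr.
have glue_b i j W (Wi : W `<=` UI i) (Wj : W `<=` UI j) fs : b i W Wi fs = b j W Wj fs.
  apply: regfun_local => x Wx; have [Ux _] := Wi x Wx; have [l Vlx] := cov x Ux.
  pose Z := W ∩ V l.
  have ZW : Z `<=` W := subl.
  have Zi : Z `<=` VI l i by move=> y [/Wi[]].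
  have Zj : Z `<=` VI l j by move=> y [/Wj[]].
  exists Z, ZW; split=> //.
  rewrite (natural_polyvec (b i) Wi (ZW >> Wi)).
  rewrite (natural_polyvec (b j) Wj (ZW >> Wj)).
  by rewrite (bP i l _ _ Zi) (bP j l _ _ Zj); exact: es_glue_b.
have glue_a i j W (Wi : W `<=` UI i) (Wj : W `<=` UI j) fs :
    a j W Wj fs - a i W Wi fs
      = tr_hres (Wj >> subr) (Wi >> subr)
        * b i W Wi (tr_hres (Wi >> subr)
                     (Wj >> subr) :: fs).
  apply: regfun_local => x Wx; have [Ux _] := Wi x Wx; have [l Vlx] := cov x Ux.
  pose Z := W ∩ V l.
  have ZW : Z `<=` W := subl.
  have Zi : Z `<=` VI l i by move=> y [/Wi[]].
  have Zj : Z `<=` VI l j by move=> y [/Wj[]].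
  exists Z, ZW; split=> //.
  rewrite rf_resD rf_resM -[- (a i W Wi fs)]mulN1r rf_resM rf_resN1 mulN1r.
  rewrite (natural_polyvec (a i) Wi (ZW >> Wi)).
  rewrite (natural_polyvec (a j) Wj (ZW >> Wj)).
  rewrite (natural_polyvec (b i) Wi (ZW >> Wi)) /= !tr_hres_res.
  rewrite (bP i l _ _ Zi) (aP i l _ _ Zi) (aP j l _ _ Zj) (es_glue_a (s l) Zi Zj).
  by congr (_ * es_b (s l) i _ _ (_ :: _)); exact: tr_hres_irr.
exists (ESec glue_b glue_a); split=> [l|t Ht].
  have opE i := irr (@openIS _ _ _ U (V l) (U_ i) (VU l)) (VIU l i).
  by apply: esec_ext => i /=; rewrite opE; [exact: aE|exact: bE].
apply: esec_ext => i /=.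
  apply: (projT2 (cid (exa i))).2 => l; rewrite -(Ht l) /=.
  by rewrite (irr (VIU l i) (@openIS _ _ _ U (V l) (U_ i) (VU l))).
apply: (projT2 (cid (exb i))).2 => l; rewrite -(Ht l) /=.
by rewrite (irr (VIU l i) (@openIS _ _ _ U (V l) (U_ i) (VU l))).
Qed.

Section Differential.
Variables (p : nat) (U : op) (s : esec tau p U).
Notation UI i := (U ∩ U_ i).

Definition pv_sign (W : op) q (P : polyvec q W) (m : nat) : polyvec q W :=
  rf_cst W ((-1) ^+ m) *: P.

Lemma rf_cst_sign W m : rf_cst W ((-1) ^+ m) = (-1) ^+ m.
Proof.
by rewrite !signE; case: ifP => // _; apply: regfun_eqP => y Wy;
  rewrite rf_cstE // rf_evN; congr (- _); apply/esym; exact: rf_cstE.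
Qed.

Lemma pv_signE W q (P : polyvec q W) m V (VW : V `<=` W) fs :
  pv_sign P m V VW fs = (-1) ^+ m * P V VW fs.
Proof. by rewrite -[LHS]/(rf_res VW (rf_cst W _) * _) (rf_res_cst VW) rf_cst_sign. Qed.

Definition d_a i : polyvec p.+1 (UI i) :=
  pv_schouten (Lam (UI i)) (es_a s i)
  + pv_sign (pv_schouten (pv_res subr (tr_T i)) (es_b s i)) p.+1.
Definition d_b i : polyvec p.+2 (UI i) := pv_schouten (Lam (UI i)) (es_b s i).

Lemma d_bE i V (Vi : V `<=` UI i) fs :
  d_b i V Vi fs = sbracket 2 p.+1 (LV V) (es_b s i V Vi) fs.
Proof. by rewrite [LHS]pv_schoutenE LamE. Qed.

Lemma d_aE i V (Vi : V `<=` UI i) (Wi : V `<=` U_ i) fs :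
  d_a i V Vi fs = sbracket 2 p (LV V) (es_a s i V Vi) fs
    + (-1) ^+ p.+1 * sbracket 1 p.+1 (tr_T i V Wi) (es_b s i V Vi) fs.
Proof.
have -> : tr_T i V Wi = pv_res subr (tr_T i) V Vi.
  by rewrite /= (irr (Vi >> _) Wi).
by rewrite -[LHS]/(_ + _) pv_signE !pv_schoutenE LamE.
Qed.

Definition d_esec : esec tau p.+1 U.
Proof.
refine (@ESec _ _ _ _ _ tau p.+1 U d_a d_b _ _) => i j V Vi Vj fs.
  by rewrite !d_bE (es_glue_bE s Vi Vj).
have Wi := Vi >> subr.
have Wj := Vj >> subr.
rewrite (d_aE Vi Wi) (d_aE Vj Wj) -(es_glue_bE s Vi Vj).
have mL := Lambda_md V; set b := es_b s i V Vi.
have mb : mder p.+1 b := (polyvec_md (es_b s i)).2 V Vi.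
have -> : es_a s j V Vj = fun gs => es_a s i V Vi gs
    + contract [:: (tr_hres Wj Wi, tr_hres Wi Wj)] b gs.
  by apply: funext => gs; exact: es_glue_aE.
have -> : tr_T j V Wj = fun gs => tr_T i V Wi gs
    + - contract [:: (tr_hres Wj Wi, tr_hres Wi Wj)] (LV V) gs.
  apply: funext => gs; have [|ne] := eqVneq (size gs) 1%N.
    case: gs => [//|f [|//]] _; rewrite contract1; exact: tr_T_change.
  rewrite (md_size (tr_T_md Wj)); last exact/eqP.
  rewrite (md_size (tr_T_md Wi)); last exact/eqP.
  rewrite (md_size (md_contract _ mL)) ?subrr //; exact/eqP.
rewrite (sbracketDr _ _ _ _ mL) (sbracketDl _ _ _ _ mb) (sbracketNl _ _ _ mb).
have := dlog_sbracket fs mL mb (is_cst1 V) (tr_hresV Wj Wi).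
rewrite contract1 => E.
transitivity (tr_hres Wj Wi * slot (tr_hres Wi Wj) (sbracket 2 p.+1 (LV V) b) fs).
  rewrite -E exprS; set x := sbracket 2 p _ _ _; set y := sbracket 1 _ _ _ _.
  set z := sbracket 2 _ _ _ _; set t := sbracket 1 _ _ _ _; set e := _ ^+ p.
  by ring.
rewrite d_bE /slot (tr_hres_irr (Vj >> _) Wj (Vi >> _) Wi).
by rewrite (tr_hres_irr (Vi >> _) Wi (Vj >> _) Wj).
Defined.

End Differential.


Definition dT p U (P : polyvec p U) : polyvec p.+1 U := pv_schouten (Lam U) P.

Lemma dTE p U (P : polyvec p U) V (VU : V `<=` U) fs :
  dT P V VU fs = sbracket 2 p (LV V) (P V VU) fs.
Proof. by rewrite [LHS]pv_schoutenE LamE. Qed.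

Fact dT_D p U (P Q : polyvec p U) : dT (P + Q) = dT P + dT Q.
Proof.
apply: polyvec_ext => V VU fs; rewrite -[RHS]/(_ + _) !dTE.
exact: (sbracketDr _ _ _ _ (Lambda_md V)).
Qed.

Fact dT_Z p U (c : C) (P : polyvec p U) : dT (rf_cst U c *: P) = rf_cst U c *: dT P.
Proof.
apply: polyvec_ext => V VU fs; rewrite -[RHS]/(rf_res VU _ * _) !dTE.
apply: (sbracket_cstr _ _ _ (Lambda_md V)); exists c; exact: rf_res_cst.
Qed.

Fact dT_nat p U V (VU : V `<=` U) (P : polyvec p U) :
  pv_res VU (dT P) = dT (pv_res VU P).
Proof. by apply: polyvec_ext => W WV fs; rewrite -[LHS]/(dT P W _ fs) !dTE. Qed.

Definition d_chom p : chom (forget (wedgeT X p)) (forget (wedgeT X p.+1)) :=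
  @CHom _ _ _ (forget (wedgeT X p)) (forget (wedgeT X p.+1)) (@dT p) (@dT_D p) (@dT_Z p) (@dT_nat p).

Fact d_esec_D p U (s t : esec tau p U) : d_esec (s + t) = d_esec s + d_esec t.
Proof.
apply: esec_ext => i; apply: polyvec_ext => V Vi fs; last first.
  rewrite -[LHS]/(d_b _ _ _ _ _) -[RHS]/(d_b s i V Vi fs + d_b t i V Vi fs) !d_bE.
  exact: (sbracketDr _ _ _ _ (Lambda_md V)).
have Wi := Vi >> subr.
rewrite -[LHS]/(d_a _ _ _ _ _) -[RHS]/(d_a s i V Vi fs + d_a t i V Vi fs) !(d_aE _ Vi Wi).
rewrite (sbracketDr _ _ _ _ (Lambda_md V)) (sbracketDr _ _ _ _ (tr_T_md Wi)).
by rewrite mulrDr addrACA.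
Qed.

Fact d_esec_Z p U (c : C) (s : esec tau p U) :
  d_esec (rf_cst U c *: s) = rf_cst U c *: d_esec s.
Proof.
have Kc V (VU : V `<=` U) : is_cst (rf_res VU (rf_cst U c)) by exists c; exact: rf_res_cst.
apply: esec_ext => i; apply: polyvec_ext => V Vi fs.
  have Wi := Vi >> subr.
  have VU := Vi >> subl.
  rewrite -[RHS]/(rf_res Vi (rf_res _ _) * d_a s i V Vi fs) (rf_res_comp _ _ VU).
  rewrite -[LHS]/(d_a _ _ _ _ _) !(d_aE _ Vi Wi).
  have -> : es_a (rf_cst U c *: s) i V Vi = fun gs => rf_res VU (rf_cst U c) * es_a s i V Vi gs.
    by apply: funext => gs; rewrite -[LHS]/(rf_res Vi (rf_res _ _) * _) (rf_res_comp _ _ VU).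
  have -> : es_b (rf_cst U c *: s) i V Vi = fun gs => rf_res VU (rf_cst U c) * es_b s i V Vi gs.
    by apply: funext => gs; rewrite -[LHS]/(rf_res Vi (rf_res _ _) * _) (rf_res_comp _ _ VU).
  rewrite (sbracket_cstr _ _ _ (Lambda_md V)) // (sbracket_cstr _ _ _ (tr_T_md Wi)) //.
  by rewrite [RHS]mulrDr; congr (_ + _); exact: mulrCA.
have VU := Vi >> subl.
rewrite -[RHS]/(rf_res Vi (rf_res _ _) * d_b s i V Vi fs) (rf_res_comp _ _ VU).
rewrite -[LHS]/(d_b _ _ _ _ _) !d_bE.
have -> : es_b (rf_cst U c *: s) i V Vi = fun gs => rf_res VU (rf_cst U c) * es_b s i V Vi gs.
  by apply: funext => gs; rewrite -[LHS]/(rf_res Vi (rf_res _ _) * _) (rf_res_comp _ _ VU).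
by rewrite (sbracket_cstr _ _ _ (Lambda_md V)).
Qed.

Fact d_esec_nat p U V (VU : V `<=` U) (s : esec tau p U) :
  es_res VU (d_esec s) = d_esec (es_res VU s).
Proof.
apply: esec_ext => i; apply: polyvec_ext => W Wi fs.
  have WUi := Wi >> subr.
  by rewrite -[RHS]/(d_a _ _ _ _ _) -[LHS]/(d_a s i W _ fs) !(d_aE _ _ WUi).
by rewrite -[RHS]/(d_b _ _ _ _ _) -[LHS]/(d_b s i W _ fs) !d_bE.
Qed.

Definition dE_chom p : chom (forget (atiyah_sheaf tau p)) (forget (atiyah_sheaf tau p.+1)) :=
  @CHom _ _ _ (forget (atiyah_sheaf tau p)) (forget (atiyah_sheaf tau p.+1))
    (@d_esec p) (@d_esec_D p) (@d_esec_Z p) (@d_esec_nat p).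

Definition iota_esec p U (a : polyvec p U) : esec tau p U.
Proof.
refine (@ESec _ _ _ _ _ tau p U (fun i => pv_res subl a) (fun=> 0) _ _) => // i j V Vi Vj fs.
rewrite -[RHS]/(_ * 0) mulr0 /=; apply/eqP; rewrite subr_eq0; apply/eqP.
by congr (pv_fun a _ _); exact: irr.
Defined.

Fact iota_D p U (a b : polyvec p U) : iota_esec (a + b) = iota_esec a + iota_esec b.
Proof.
apply: esec_ext => i /=; first exact: pv_resD.
by rewrite addr0.
Qed.
Fact iota_Z p U f (a : polyvec p U) : iota_esec (f *: a) = f *: iota_esec a.
Proof.
apply: esec_ext => i /=; first exact: pv_resZ.
by rewrite scaler0.
Qed.
Fact iota_nat p U V (VU : V `<=` U) (a : polyvec p U) :
  es_res VU (iota_esec a) = iota_esec (pv_res VU a).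
Proof.
apply: esec_ext => i /=; last exact: polyvec_ext.
by rewrite !(pv_res_comp _ _ (subl >> VU)).
Qed.

Definition iota_hom p : ohom (wedgeT X p) (atiyah_sheaf tau p) :=
  @OHom _ _ _ (wedgeT X p) (atiyah_sheaf tau p) (@iota_esec p) (@iota_D p) (@iota_Z p) (@iota_nat p).

Lemma pi_exists p U (s : esec tau p U) :
  exists! b : polyvec p.+1 U, forall i, pv_res subl b = es_b s i.
Proof.
apply: (polyvec_sheaf (fun i => @subIl _ U (U_ i))).
  by move=> x Ux; have [i Uix] := tr_cover tau x; exists i.
by move=> i j W Wi Wj; apply: polyvec_ext => V VW fs; exact: es_glue_b.
Qed.

Definition pi_esec p U (s : esec tau p U) : polyvec p.+1 U := projT1 (cid (pi_exists s)).

Lemma pi_esecE p U (s : esec tau p U) i :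
  pv_res subl (pi_esec s) = es_b s i.
Proof. exact: (projT2 (cid (pi_exists s))).1. Qed.

Lemma pi_uniq p U (s : esec tau p U) b :
  (forall i, pv_res subl b = es_b s i) -> pi_esec s = b.
Proof. exact: (projT2 (cid (pi_exists s))).2. Qed.

Fact pi_D p U (s t : esec tau p U) : pi_esec (s + t) = pi_esec s + pi_esec t.
Proof. by apply: pi_uniq => i; rewrite pv_resD !pi_esecE. Qed.
Fact pi_Z p U f (s : esec tau p U) : pi_esec (f *: s) = f *: pi_esec s.
Proof. by apply: pi_uniq => i; rewrite pv_resZ !pi_esecE. Qed.
Fact pi_nat p U V (VU : V `<=` U) (s : esec tau p U) :
  pv_res VU (pi_esec s) = pi_esec (es_res VU s).
Proof.
apply/esym/pi_uniq => i; rewrite /= -pi_esecE.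
by rewrite !(pv_res_comp _ _ (subl >> VU)).
Qed.

Definition pi_hom p : ohom (atiyah_sheaf tau p) (wedgeT X p.+1) :=
  @OHom _ _ _ (atiyah_sheaf tau p) (wedgeT X p.+1) (@pi_esec p) (@pi_D p) (@pi_Z p) (@pi_nat p).

Lemma atiyah_dataP : is_atiyah_data dE_chom iota_hom pi_hom.
Proof.
split=> [p U s k V Vk fs ds LambdaU TU|p U a k|p U s k].
- split; last by rewrite schoutenE [LHS]d_bE LamE.
  have Wk := Vk >> subr.
  rewrite !schoutenE [LHS](d_aE _ Vk Wk) LamE.
  by rewrite /TU /= (irr (Vk >> _) Wk).
- by [].
exact: pi_esecE.
Qed.

Hypothesis Lambda_poisson : is_poisson Lambda.

Lemma Lambda_sq V fs : sbracket 2 2 (LV V) (LV V) fs = 0.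
Proof. by rewrite -schoutenE; exact: Lambda_poisson. Qed.

Lemma dT_dT p U (P : polyvec p U) : dT (dT P) = 0.
Proof.
apply: polyvec_ext => V VU fs; rewrite dTE.
have -> : dT P V VU = sbracket 2 p (LV V) (P V VU) by apply: funext => gs; exact: dTE.
apply: (jacobi22 _ (@regfun_two V) (Lambda_md V) (@Lambda_sq V)).
exact: (polyvec_md P).2.
Qed.

Lemma d_esec_d_esec p U (s : esec tau p U) : d_esec (d_esec s) = 0.
Proof.
apply: esec_ext => i; apply: polyvec_ext => V Vi fs; have mL := Lambda_md V.
  have Wi := Vi >> subr.
  have mT := tr_T_md Wi; have mb : mder p.+1 _ := (polyvec_md (es_b s i)).2 V Vi.
  have ma : mder p _ := (polyvec_md (es_a s i)).2 V Vi.
  rewrite -[LHS]/(d_a _ _ _ _ _) -[RHS]/(0 : regfun V) (d_aE _ Vi Wi).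
  have -> : es_a (d_esec s) i V Vi = fun gs => sbracket 2 p (LV V) (es_a s i V Vi) gs
    + (-1) ^+ p.+1 * sbracket 1 p.+1 (tr_T i V Wi) (es_b s i V Vi) gs.
    by apply: funext => gs; exact: d_aE.
  have -> : es_b (d_esec s) i V Vi = sbracket 2 p.+1 (LV V) (es_b s i V Vi).
    by apply: funext => gs; exact: d_bE.
  rewrite (sbracketDr _ _ _ _ mL) (sbracket_signr _ _ _ _ mL).
  rewrite (jacobi22 _ (@regfun_two V) mL (@Lambda_sq V) ma) add0r.
  rewrite (jacobi12 _ mT mL mb).
  have -> : sbracket 1 2 (tr_T i V Wi) (LV V) = fun=> 0.
    by apply: funext => gs; rewrite sbracketC tr_T_poisson mulr0.
  by rewrite (sbracket_zerol _ _ mb) add0r [(-1) ^+ p.+2]exprS mulN1r mulNr subrr.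
rewrite -[LHS]/(d_b _ _ _ _ _) -[RHS]/(0 : regfun V) d_bE.
have -> : es_b (d_esec s) i V Vi = sbracket 2 p.+1 (LV V) (es_b s i V Vi).
  by apply: funext => gs; exact: d_bE.
apply: (jacobi22 _ (@regfun_two V) mL (@Lambda_sq V)).
exact: (polyvec_md (es_b s i)).2.
Qed.

Section Components.
Variables (p : nat) (j : I) (V : op) (Vj : V `<=` U_ j).

Let VVj : V `<=` V ∩ U_ j := subII subxx Vj.

Definition comp_a (s : esec tau p V) : polyvec p V := pv_res VVj (es_a s j).
Definition comp_b (s : esec tau p V) : polyvec p.+1 V := pv_res VVj (es_b s j).

Lemma comp_inj s t : comp_a s = comp_a t -> comp_b s = comp_b t -> s = t.
Proof.
move=> Ea Eb; apply: (esec_eq Vj) => W Wj; have WV := Wj >> subl.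
  have := congr1 (fun P : polyvec p V => P W WV) Ea => /=.
  by rewrite (irr (WV >> VVj) Wj).
have := congr1 (fun P : polyvec p.+1 V => P W WV) Eb => /=.
by rewrite (irr (WV >> VVj) Wj).
Qed.

Lemma comp_a_mk a b : comp_a (mk_esec Vj a b) = a.
Proof. by apply: polyvec_ext => W WV fs; exact: mk_esec_a. Qed.

Lemma comp_b_mk a b : comp_b (mk_esec Vj a b) = b.
Proof. by apply: polyvec_ext => W WV fs; exact: mk_esec_b. Qed.

Lemma comp_aD s t : comp_a (s + t) = comp_a s + comp_a t.
Proof. exact: pv_resD. Qed.
Lemma comp_bD s t : comp_b (s + t) = comp_b s + comp_b t.
Proof. exact: pv_resD. Qed.
Lemma rf_res_refl (f : regfun V) (VV : V `<=` V) : rf_res VV f = f.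
Proof. by apply: regfun_eqP => y Vy; rewrite rf_resE. Qed.
Lemma comp_aZ f s : comp_a (f *: s) = f *: comp_a s.
Proof.
by rewrite [LHS]pv_resZ (rf_res_comp _ _ subxx) rf_res_refl.
Qed.
Lemma comp_bZ f s : comp_b (f *: s) = f *: comp_b s.
Proof.
by rewrite [LHS]pv_resZ (rf_res_comp _ _ subxx) rf_res_refl.
Qed.
Lemma comp_a0 : comp_a 0 = 0. Proof. exact: polyvec_ext. Qed.
Lemma comp_b0 : comp_b 0 = 0. Proof. exact: polyvec_ext. Qed.

Lemma comp_a_sum (T : Type) (r : seq T) (F : T -> esec tau p V) :
  comp_a (\sum_(k <- r) F k) = \sum_(k <- r) comp_a (F k).
Proof.
elim: r => [|k r IH]; first by rewrite !big_nil comp_a0.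
by rewrite !big_cons comp_aD IH.
Qed.
Lemma comp_b_sum (T : Type) (r : seq T) (F : T -> esec tau p V) :
  comp_b (\sum_(k <- r) F k) = \sum_(k <- r) comp_b (F k).
Proof.
elim: r => [|k r IH]; first by rewrite !big_nil comp_b0.
by rewrite !big_cons comp_bD IH.
Qed.
Lemma comp_aB s t : comp_a (s - t) = comp_a s - comp_a t.
Proof. by apply/eqP; rewrite eq_sym subr_eq -comp_aD subrK. Qed.
Lemma comp_bB s t : comp_b (s - t) = comp_b s - comp_b t.
Proof. by apply/eqP; rewrite eq_sym subr_eq -comp_bD subrK. Qed.
End Components.

Lemma comp_a_res p j V W (Vj : V `<=` U_ j) (Wj : W `<=` U_ j) (WV : W `<=` V)
  (s : esec tau p V) : comp_a Wj (es_res WV s) = pv_res WV (comp_a Vj s).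
Proof.
by apply: polyvec_ext => Z ZW fs /=; congr (pv_fun (es_a s j) _ _); exact: irr.
Qed.
Lemma comp_b_res p j V W (Vj : V `<=` U_ j) (Wj : W `<=` U_ j) (WV : W `<=` V)
  (s : esec tau p V) : comp_b Wj (es_res WV s) = pv_res WV (comp_b Vj s).
Proof.
by apply: polyvec_ext => Z ZW fs /=; congr (pv_fun (es_b s j) _ _); exact: irr.
Qed.

Lemma comp_b_pi p j V (Vj : V `<=` U_ j) (s : esec tau p V) : comp_b Vj s = pi_esec s.
Proof.
by rewrite /comp_b -pi_esecE (pv_res_comp _ _ subxx) pv_res_id.
Qed.

Lemma comp_a_iota p j V (Vj : V `<=` U_ j) (a : polyvec p V) :
  comp_a Vj (iota_esec a) = a.
Proof. by rewrite /comp_a /= (pv_res_comp _ _ subxx) pv_res_id. Qed.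

Lemma comp_b_iota p j V (Vj : V `<=` U_ j) (a : polyvec p V) :
  comp_b Vj (iota_esec a) = 0.
Proof. exact: polyvec_ext. Qed.

Lemma atiyah_exact p : short_exact (forget_hom (iota_hom p)) (forget_hom (pi_hom p)).
Proof.
split=> [U a|U s|U b x Ux].
- move=> /= a0; apply: polyvec_local => x Ux; have [i Uix] := tr_cover tau x.
  exists (U ∩ U_ i), subl; split=> //.
  have := congr1 (fun s : esec tau p U => es_a s i) a0 => /= ->.
  by apply: polyvec_ext.
- split=> /= [s0 x Ux|loc].
    have [i Uix] := tr_cover tau x.
    exists (U ∩ U_ i), subl; split=> //.
    exists (comp_a subr (es_res subl s)).
    apply: (comp_inj (Vj := @Defs.subIr _ U (U_ i))); first exact: comp_a_iota.
    rewrite [LHS]comp_b_iota [RHS]comp_b_pi.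
    rewrite -(pi_nat subl s) s0.
    exact: polyvec_ext.
  apply: polyvec_local => x Ux; have [W [WU [Wx [a E]]]] := loc x Ux.
  exists W, WU; split=> //; rewrite pi_nat.
  have -> : es_res WU s = iota_esec a by [].
  apply: (etrans (y := 0)); last exact: polyvec_ext.
  apply: pi_uniq => i; exact: polyvec_ext.
have [i Uix] := tr_cover tau x.
exists (U ∩ U_ i), subl; split=> //.
exists (mk_esec subr 0 (pv_res subl b)) => /=.
by rewrite -(comp_b_pi subr) comp_b_mk.
Qed.

Lemma atiyah_free p : locally_free (atiyah_sheaf tau p) ('C(n, p) + 'C(n, p.+1)).
Proof.
move=> x; have [j Ujx] := tr_cover tau x.
have [W1 [e1 [W1x H1]]] := wedgeT_free p x.
have [W2 [e2 [W2x H2]]] := wedgeT_free p.+1 x.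
pose W := (opens_setI W1 W2) ∩ U_ j.
have WW1 : W `<=` W1 by move=> y [[]].
have WW2 : W `<=` W2 by move=> y [[]].
have Wj : W `<=` U_ j by move=> y [].
pose e (k : 'I_('C(n, p) + 'C(n, p.+1))) : esec tau p W :=
  match split k with
  | inl k => mk_esec Wj (pv_res WW1 (e1 k)) 0
  | inr k => mk_esec Wj 0 (pv_res WW2 (e2 k)) end.
exists W, e; split=> // V VW s; have Vj := VW >> Wj.
have VW1 := VW >> WW1; have VW2 := VW >> WW2.
have SE (c : 'I_('C(n, p) + 'C(n, p.+1)) -> regfun V) :
    comp_a Vj (\sum_k c k *: es_res VW (e k)) = \sum_k c (lshift _ k) *: pv_res VW1 (e1 k)
    /\ comp_b Vj (\sum_k c k *: es_res VW (e k)) = \sum_k c (rshift _ k) *: pv_res VW2 (e2 k).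
  have eL k : e (lshift _ k) = mk_esec Wj (pv_res WW1 (e1 k)) 0.
    by rewrite /e (unsplitK (inl k)).
  have eR k : e (rshift _ k) = mk_esec Wj 0 (pv_res WW2 (e2 k)).
    by rewrite /e (unsplitK (inr k)).
  have z q : pv_res VW (0 : polyvec q W) = 0 by exact: polyvec_ext.
  rewrite comp_a_sum comp_b_sum !big_split_ord /=; split.
    rewrite [X in _ + X]big1 ?addr0 => [|k _]; last first.
      by rewrite comp_aZ (comp_a_res Wj) eR comp_a_mk z scaler0.
    apply: eq_bigr => k _.
    by rewrite comp_aZ (comp_a_res Wj) eL comp_a_mk (pv_res_comp _ _ VW1).
  rewrite big1 ?add0r => [|k _]; last first.
    by rewrite comp_bZ (comp_b_res Wj) eL comp_b_mk z scaler0.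
  apply: eq_bigr => k _.
  by rewrite comp_bZ (comp_b_res Wj) eR comp_b_mk (pv_res_comp _ _ VW2).
have [c1 [E1 u1]] := H1 V VW1 (comp_a Vj s).
have [c2 [E2 u2]] := H2 V VW2 (comp_b Vj s).
exists (fun k => match split k with inl k => c1 k | inr k => c2 k end); split.
  apply: (comp_inj (Vj := Vj)).
    rewrite (SE _).1 E1; apply: eq_bigr => k _; congr (_ *: _).
    by rewrite (unsplitK (inl k)).
  rewrite (SE _).2 E2; apply: eq_bigr => k _; congr (_ *: _).
  by rewrite (unsplitK (inr k)).
move=> c sE; have [Ea Eb] := SE c.
have {}u1 := u1 (fun k => c (lshift _ k)); have {}u2 := u2 (fun k => c (rshift _ k)).
have F1 : c1 = fun k => c (lshift _ k) by apply: u1; rewrite -Ea -sE.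
have F2 : c2 = fun k => c (rshift _ k) by apply: u2; rewrite -Eb -sE.
apply: funext => k; rewrite F1 F2; have := splitK k.
by case: (split k) => k' /= <-.
Qed.

Lemma dlog_hE i j V (Vi : V `<=` U_ i) (Vj : V `<=` U_ j)
    (Vij : V `<=` (U_ i) ∩ U_ j) (P : polyvec 1 V) :
  dlog_h i j V Vij P = contract [:: (tr_hres Vj Vi, tr_hres Vi Vj)] (P V subxx) [::].
Proof.
rewrite contract1 /= /vdu_fun tr_hres_res (tr_hres_irr _ Vj _ Vi).
by rewrite (irr Vij (subII Vi Vj)).
Qed.

Lemma dlog_h_cocycle : is_cocycle (chern_cochain tau).
Proof.
move=> i j k V Vi Vj Vk P.
rewrite -[LHS]/(dlog_h i j V (subII Vi Vj) P + dlog_h j k V (subII Vj Vk) P).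
rewrite -[RHS]/(dlog_h i k V (subII Vi Vk) P).
rewrite (dlog_hE Vi Vj) (dlog_hE Vj Vk) (dlog_hE Vi Vk).
by rewrite -(dlog_hresD Vi Vj Vk [::] ((polyvec_md P).2 V _)).
Qed.

Lemma dlog_hresN p i j V (Vi : V `<=` U_ i) (Vj : V `<=` U_ j)
    (b : seq (regfun V) -> regfun V) fs : mder p b ->
  contract [:: (tr_hres Vi Vj, tr_hres Vj Vi)] b fs
    = - contract [:: (tr_hres Vj Vi, tr_hres Vi Vj)] b fs.
Proof.
move=> mb; apply/eqP; rewrite -addr_eq0 addrC -(dlog_hresD Vi Vj Vi fs mb).
by rewrite tr_hres_id contract1 (md_K mb [::]) ?mulr0 //; exact: is_cst1.
Qed.

Lemma chern_cochain_class : chern_class L (chern_cochain tau).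
Proof.
split; first exact: dlog_h_cocycle.
exists tau, I, U_, id, id, (fun k => @subset_refl _ _), (fun k => @subset_refl _ _).
exists (fun k => vdu 0 0); split; first exact: tr_cover.
by move=> k l V Vk Vl P; rewrite subrr /= /vdu_fun !rf_res0 !mul0r subrr.
Qed.

Lemma atiyah_class : is_extension_of_class (chern_class L) (iota_hom 0) (pi_hom 0).
Proof.
split; first exact: atiyah_exact.
exists (chern_cochain tau); split; first exact: chern_cochain_class.
exists (fun k V (Vk : V `<=` U_ k) (P : polyvec 1 V) => mk_esec Vk 0 P).
split=> [k V Vk f P Q|k V W Vk Wk WV P|k V Vk P|k l V Vk Vl P].
- apply: (comp_inj (Vj := Vk)).
    by rewrite comp_aD comp_aZ !comp_a_mk scaler0 addr0.
  by rewrite comp_bD comp_bZ !comp_b_mk.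
- apply: (comp_inj (Vj := Wk)).
    rewrite [LHS](comp_a_res Vk) !comp_a_mk; exact: polyvec_ext.
  by rewrite [LHS](comp_b_res Vk) !comp_b_mk.
- by rewrite -[LHS](comp_b_pi Vk) comp_b_mk.
have mP W (WV : W `<=` V) : mder 1 (P W WV) := (polyvec_md P).2 W WV.
apply: (comp_inj (Vj := Vk)); last first.
  rewrite [RHS]comp_b_iota comp_bB comp_b_mk comp_b_pi -(comp_b_pi Vl) comp_b_mk.
  exact: subrr.
rewrite [RHS]comp_a_iota comp_aB comp_a_mk sub0r.
apply: polyvec_ext => W WV fs; have Wk := WV >> Vk; have Wl := WV >> Vl.
have -> : (- comp_a Vk (mk_esec Vl 0 P)) W WV fs = - (comp_a Vk (mk_esec Vl 0 P) W WV fs).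
  by apply/eqP; rewrite -addr_eq0 -[_ + _]/((- comp_a Vk (mk_esec Vl 0 P)
    + comp_a Vk (mk_esec Vl 0 P)) W WV fs) addNr.
have -> : comp_a Vk (mk_esec Vl 0 P) W WV fs
    = contract [:: (tr_hres Wk Wl, tr_hres Wl Wk)] (P W WV) fs.
  rewrite -[RHS]add0r.
  exact: (@mk_aE 0 l V Vl 0 P k W (WV >> (subII subxx Vk)) WV Wk Wl fs).
rewrite (dlog_hresN Wk Wl fs (mP W WV)) opprK.
rewrite -[RHS]/(if size fs == 0%N then _ else _).
case: fs => [|f fs] /=; last by rewrite contract1 (md_size (mP W WV)) ?mulr0.
rewrite (fm_res (dlog_h k l) (subII Vk Vl) (subII Wk Wl) WV) (dlog_hE Wk Wl).
by rewrite /= (irr (_ >> WV) WV).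
Qed.

Lemma poisson_atiyah_extension :
  is_extension (poisson_atiyah d_chom dE_chom iota_hom pi_hom).
Proof.
split=> [|p U a|p U s|p]; last exact: atiyah_exact.
- split=> [p|p U s]; first exact: atiyah_is_sheaf.
  exact: d_esec_d_esec.
- apply: esec_ext => i; apply: polyvec_ext => V Vi fs.
    have Wi := Vi >> subr.
    rewrite -[RHS]/(d_a _ _ _ _ _) (d_aE _ Vi Wi).
    rewrite (sbracket_zeror _ _ (tr_T_md Wi)) mulr0 addr0.
    exact: dTE.
  by rewrite -[RHS]/(d_b _ _ _ _ _) d_bE (sbracket_zeror _ _ (Lambda_md V)).
apply: pi_uniq => i; apply: polyvec_ext => V Vi fs.
rewrite -[RHS]/(d_b _ _ _ _ _) d_bE -(pi_esecE s i).
exact: dTE.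
Qed.

Lemma d_chom_poisson : is_poisson_differential Lambda d_chom.
Proof. by move=> p U P V VU fs; rewrite schoutenE LamE; exact: dTE. Qed.

Lemma O_complexP : is_ccomplex (O_complex d_chom).
Proof.
split=> [p|p U s]; first exact: polyvec_sheaf.
exact: dT_dT.
Qed.

Lemma T_complexP : is_ccomplex (T_complex d_chom).
Proof.
split=> [p|p U s]; first exact: polyvec_sheaf.
exact: dT_dT.
Qed.

Lemma hyper_cocycle : is_hyper_cocycle Lambda (poisson_chern_cochain tau).
Proof.
split; first exact: dlog_h_cocycle.
move=> i j x Uijx; pose W := (U_ i) ∩ U_ j.
pose Wi : W `<=` U_ i := subl.
pose Wj : W `<=` U_ j := subr.
exists W, subxx, [:: (tr_hres Wj Wi, tr_hres Wi Wj)].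
split=> // [V VW P|V VW k]; rewrite big_seq1 /= !tr_hres_res.
  by rewrite [LHS](dlog_hE (VW >> Wi) (VW >> Wj)) contract1.
have := tr_T_change (VW >> Wi) (VW >> Wj) k.
rewrite (irr ((VW >> _) >> _) (VW >> Wi)).
rewrite (irr ((VW >> _) >> _) (VW >> Wj)).
by move=> ->; rewrite opprB addrCA subrr addr0.
Qed.

End TrivializationTheory.

Variable Lambda : polyvec 2 (opens_setT pts).

Lemma trivialization_exists (L : poisson_invertible_sheaf Lambda) : inhabited (trivialization L).
Proof.
pose good (We : {W : op & L W}) := forall (V : op) (VW : V `<=` projT1 We) (s : L V),
  exists! f : regfun V, s = f *: om_res VW (projT2 We).
have ex x : exists We : {W : op & L W}, oset (projT1 We) x /\ good We.
  have [W [e [Wx He]]] := pl_invertible L x.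
  exists (existT _ W (e ord0)); split=> // V VW s.
  have [c [sE uc]] := He V VW s; exists (c ord0); split.
    by rewrite sE big_ord1.
  move=> f fE; have -> : c = fun=> f by apply: uc; rewrite big_ord1.
  by [].
have [s sP] : exists s : seq pts, forall y, exists2 x, List.In x s &
    oset (projT1 (projT1 (cid (ex x)))) y.
  apply: quasi_compact => x; exists x; by case: (projT2 (cid (ex x))).
have [x0 Xx0] := (pv_irreducible X).1; pose y0 : pts := SigSub (mem_set Xx0).
(* The index type has to lie in a small universe. *)
pose We (i : nat) := projT1 (cid (ex (nth y0 s i))).
have Hx i : good (We i) by case: (projT2 (cid (ex (nth y0 s i)))).
pose U_ i := projT1 (We i); pose e_ i : L (U_ i) := projT2 (We i).
have exh i j : exists h : regfun ((U_ i) ∩ U_ j),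
    om_res subr (e_ j) = h *: om_res subl (e_ i).
  by have [h [E _]] := Hx i _ subl (om_res subr (e_ j)); exists h.
have inj i (V : op) (Vi : V `<=` U_ i) (f g : regfun V) :
    f *: om_res Vi (e_ i) = g *: om_res Vi (e_ i) -> f = g.
  move=> E; have [h [_ uh]] := Hx i V Vi (f *: om_res Vi (e_ i)).
  by rewrite -(uh f erefl) (uh g E).
have exT i (V : op) (Vi : V `<=` U_ i) (f : regfun V) : exists g : regfun V,
    pl_br f (om_res Vi (e_ i)) = g *: om_res Vi (e_ i).
  by have [g [E _]] := Hx i V Vi (pl_br f (om_res Vi (e_ i))); exists g.
pose t i V Vi f := projT1 (cid (exT i V Vi f)).
have tE i V Vi f : pl_br f (om_res Vi (e_ i)) = t i V Vi f *: om_res Vi (e_ i).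
  exact: projT2 (cid (exT i V Vi f)).
have tD i V Vi f g : t i V Vi (f + g) = t i V Vi f + t i V Vi g.
  by apply: (inj i V Vi); rewrite -tE pl_br_Dl scalerDl -!tE.
have tZ i V Vi c f : t i V Vi (rf_cst V c * f) = rf_cst V c * t i V Vi f.
  by apply: (inj i V Vi); rewrite -tE pl_br_Zl -scalerA -tE.
have tM i V Vi f g : t i V Vi (f * g) = f * t i V Vi g + g * t i V Vi f.
  by apply: (inj i V Vi); rewrite -tE pl_br_Ml scalerDl -!scalerA -!tE.
have tR i (V W : op) (Vi : V `<=` U_ i) (Wi : W `<=` U_ i) (WV : W `<=` V) f :
    rf_res WV (t i V Vi f) = t i W Wi (rf_res WV f).
  apply: (inj i W Wi); rewrite -tE -(om_res_comp Vi WV Wi) -pl_br_res tE om_resZ.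
  by rewrite (om_res_comp Vi WV Wi).
pose D i : derivation (U_ i) := Derivation (tD i) (tZ i) (tM i) (tR i).
have pT i : is_polyvec 1 (@wedge _ _ X 1 (U_ i) (fun=> D i)).
  apply: md_polyvec; split; last by move=> V VU; exact: wedge_mder.
  move=> V W VU WU WV fs; rewrite /wedge size_map; case: eqP => s1; last exact: rf_res0.
  rewrite !det_mx11 !mxE (nth_map 0) ?s1 //; exact: tR.
pose T i : polyvec 1 (U_ i) := Polyvec (pT i).
have TE i V Vi f : T i V Vi [:: f] = t i V Vi f.
  by rewrite /= /wedge /= det_mx11 mxE.
have cov : covers U_.
  move=> y; have [x xs Wy] := sP y; have [i _ xi] := In_nth y0 xs.
  by exists i; rewrite /U_ /We xi.
have TP i (V : op) (Vi : V `<=` U_ i) (f : regfun V) :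
    pl_br f (om_res Vi (e_ i)) = T i V Vi [:: f] *: om_res Vi (e_ i).
  by rewrite TE.
pose Tr := @Trivialization _ _ _ _ L nat U_ cov e_ Hx
  (fun i j => projT1 (cid (exh i j))) (fun i j => projT2 (cid (exh i j))) T TP.
exact (inhabits Tr).
Qed.


Lemma der_pv_md U (D : derivation U) : multiderivative 1 (@wedge _ _ X 1 U (fun=> D)).
Proof.
split; last by move=> V VU; exact: wedge_mder.
move=> V W VU WU WV fs; rewrite /wedge size_map; case: eqP => s1; last exact: rf_res0.
rewrite !det_mx11 !mxE (nth_map 0) ?s1 //; exact: der_res.
Qed.

Definition der_pv U (D : derivation U) : polyvec 1 U := mk_pv (der_pv_md D).

Lemma der_pvE U (D : derivation U) V (VU : V `<=` U) f :
  der_pv D V VU [:: f] = D V VU f.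
Proof. by rewrite /= /wedge /= det_mx11 mxE. Qed.

Definition represents U (theta : form1 U) W (WU : W `<=` U)
    (ts : seq (regfun W * regfun W)) : Prop :=
  forall V (VW : V `<=` W) (P : polyvec 1 V),
    theta V (VW >> WU) P
      = \sum_(t <- ts) rf_res VW t.1 * P V subxx [:: rf_res VW t.2].

Definition res_ts V W (WV : W `<=` V) (ts : seq (regfun V * regfun V)) :=
  [seq (rf_res WV t.1, rf_res WV t.2) | t <- ts].

Section Form.
Variables (W : op) (theta : form1 W) (p : nat).

Definition form_fun U (UW : U `<=` W) (b : polyvec p.+1 U) : evaluation U :=
  fun V VU fs => theta V (VU >> UW)
    (der_pv (slot_derivation (polyvec_md b) VU fs)).

Lemma form_fun_rep U (UW : U `<=` W) (b : polyvec p.+1 U) W' (W'W : W' `<=` W) ts :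
  represents theta W'W ts ->
  forall V (VU : V `<=` U) (VW' : V `<=` W') fs,
  form_fun UW b VU fs = contract (res_ts VW' ts) (b V VU) fs.
Proof.
move=> rep V VU VW' fs; rewrite /form_fun.
rewrite (irr (VU >> UW) (VW' >> W'W)) rep.
rewrite /contract big_map; apply: eq_bigr => t _; rewrite der_pvE /= /slot_fun.
rewrite (irr (_ >> VU) VU); congr (_ * b _ _ (_ :: _)).
by rewrite map_id_in // => f _; apply: regfun_eqP => y Vy; rewrite rf_resE.
Qed.

Lemma form_fun_natural U (UW : U `<=` W) (b : polyvec p.+1 U) : natural (form_fun UW b).
Proof.
move=> V V' VU V'U V'V fs; rewrite /form_fun.
rewrite (fm_res theta _ (V'U >> UW)); congr (fm theta _ _).
apply: polyvec_ext => Z ZV' [|f [|g gs]] /=; rewrite /wedge //= !det_mx11 !mxE /=.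
rewrite /slot_fun (irr ((ZV' >> V'V) >> VU) (ZV' >> V'U)).
congr (b _ _ (_ :: _)); rewrite -map_comp; apply: eq_map => h /=.
by rewrite (rf_res_comp V'V ZV' (ZV' >> V'V)).
Qed.

Lemma form_fun_md U (UW : U `<=` W) (b : polyvec p.+1 U) : multiderivative p (form_fun UW b).
Proof.
apply: mder_local; first exact: form_fun_natural.
move=> x Ux; have [W' [W'W [ts [W'x rep]]]] := fm_local theta (UW x Ux).
exists (U ∩ W'), subl; split=> // V VI.
have VW' := VI >> subr.
rewrite (_ : form_fun _ _ _ = contract (res_ts VW' ts) (b V (VI >> subl))).
  exact: (md_contract _ ((polyvec_md b).2 V _)).
by apply: funext => fs; exact: form_fun_rep.
Qed.

Definition form_pv U (UW : U `<=` W) (b : polyvec p.+1 U) : polyvec p U :=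
  mk_pv (form_fun_md UW b).

Lemma form_pv_lin U (UW : U `<=` W) (f : regfun U) (b b' : polyvec p.+1 U) :
  form_pv UW (f *: b + b') = f *: form_pv UW b + form_pv UW b'.
Proof.
apply: polyvec_local => x Ux.
have [W' [W'W [ts [W'x rep]]]] := fm_local theta (UW x Ux).
exists (U ∩ W'), subl; split=> //.
apply: polyvec_ext => V VI fs; have VW' := VI >> subr.
have VU := VI >> subl.
rewrite -[LHS]/(form_fun UW _ (VI >> subl) fs).
rewrite -[RHS]/(rf_res (VI >> subl) f
  * form_fun UW b (VI >> subl) fs
  + form_fun UW b' (VI >> subl) fs).
rewrite !(form_fun_rep _ _ rep _ VW') /contract !big_map mulr_sumr -big_split.
apply: eq_bigr => t _; rewrite /slot -[X in _ * X]/(_ * _ + _) mulrDr.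
by rewrite mulrCA.
Qed.
End Form.

(** Closedness of a 1-form, tested on its local expressions. *)
Definition closed_form U (theta : form1 U) : Prop :=
  forall W (WU : W `<=` U) ts, represents theta WU ts ->
  forall D E : derivation W,
  \sum_(t <- ts) (D W subxx t.1 * E W subxx t.2
    - E W subxx t.1 * D W subxx t.2) = 0.

Lemma represents_res U (theta : form1 U) W (WU : W `<=` U) ts V (VW : V `<=` W) :
  represents theta WU ts -> represents theta (VW >> WU) (res_ts VW ts).
Proof.
move=> rep Z ZV P; have ZW := ZV >> VW.
rewrite (irr (ZV >> VW >> WU) (ZW >> WU)) rep.
by rewrite big_map; apply: eq_bigr => t _; rewrite /= !(rf_res_comp VW ZV ZW).
Qed.

Lemma closed_wedge U (theta : form1 U) W (WU : W `<=` U) ts p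
    (B : polyvec 2 W) (b : polyvec p.+1 W) fs :
  closed_form theta -> represents theta WU ts ->
  \sum_(t <- ts)
    (wprod p (slot t.2 (b W subxx)) (slot t.1 (B W subxx)) fs
     - wprod p (slot t.1 (b W subxx)) (slot t.2 (B W subxx)) fs) = 0.
Proof.
move=> cl rep; apply: regfun_local => x Wx.
have [W1 [W1x [F]]] := frame_exists x.
pose V := W ∩ W1; pose VW : V `<=` W := subl.
pose VW1 : V `<=` W1 := subr.
exists V, VW; split=> //; rewrite rf_res0 rf_res_sum.
have wR q (P Q : seq (regfun W) -> regfun W) (P' Q' : seq (regfun V) -> regfun V) gs :
    (forall s, rf_res VW (P s) = P' (map (rf_res VW) s)) ->
    (forall s, rf_res VW (Q s) = Q' (map (rf_res VW) s)) ->
    rf_res VW (wprod q P Q gs) = wprod q P' Q' (map (rf_res VW) gs).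
  move=> PP QQ; apply: shuffle_sum_res => s t; by rewrite rf_resM PP QQ.
pose b' := b V VW; pose B' := B V VW.
have sb q (P : polyvec q W) f s : rf_res VW (slot f (P W subxx) s)
    = slot (rf_res VW f) (P V VW) (map (rf_res VW) s).
  by rewrite /slot (natural_polyvec P _ VW).
pose gs := map (rf_res VW) fs.
transitivity (\sum_(t <- res_ts VW ts) (wprod p (slot t.2 b') (slot t.1 B') gs
   - wprod p (slot t.1 b') (slot t.2 B') gs)).
  rewrite big_map; apply: eq_bigr => t _.
  rewrite rf_resD -[X in _ + rf_res _ X]mulN1r rf_resM rf_resN1 mulN1r.
  by rewrite (wR _ _ _ _ _ _ (sb _ b t.2) (sb _ B t.1)) (wR _ _ _ _ _ _ (sb _ b t.1) (sb _ B t.2)).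
pose d k f := fr_d F k V VW1 f.
have ex q (P : polyvec q W) f : slot f (P V VW) = fun s =>
    \sum_k d k f * slot (rf_res VW1 (fr_t F k)) (P V VW) s.
  apply: funext => s; have := fr_span F VW1 (slot_derivation (polyvec_md P) VW s) f.
  rewrite /= /slot_fun (irr (_ >> VW) VW) map_id_in; last first.
    by move=> h _; apply: regfun_eqP => y Vy; rewrite rf_resE.
  by rewrite /slot => ->; apply: eq_bigr => k _; rewrite mulrC.
pose w k l := wprod p (slot (rf_res VW1 (fr_t F k)) b') (slot (rf_res VW1 (fr_t F l)) B') gs.
have wE f g : wprod p (slot f b') (slot g B') gs = \sum_k \sum_l d k f * d l g * w k l.
  rewrite (ex _ b f) (ex _ B g) wprod_suml; apply: eq_bigr => k _.
  rewrite wprod_scalel wprod_sumr mulr_sumr; apply: eq_bigr => l _.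
  by rewrite wprod_scaler mulrA.
have := represents_res VW rep => rep'.
under eq_bigr do rewrite !wE -sumrB.
rewrite exchange_big big1 // => k _.
under eq_bigr do rewrite -sumrB.
rewrite exchange_big big1 // => l _.
under eq_bigr do rewrite -mulrBl.
rewrite -mulr_suml.
have := cl V _ _ rep' (der_restrict VW1 (fr_d F l)) (der_restrict VW1 (fr_d F k)).
rewrite /= (irr (_ >> VW1) VW1) => E.
rewrite (_ : \sum_(i <- _) _ = 0) ?mul0r // -[RHS]E.
by apply: eq_bigr => t _; rewrite /d [X in X - _]mulrC.
Qed.

Notation LV V := (Lambda V (@inT _ _ X V)).

(** The contraction of a polyvector field on [U] with a 1-form on [W], over
    an open subset of both. *)
Definition form_at W (theta : form1 W) p U (b : polyvec p.+1 U) V (VW : V `<=` W)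
    (VU : V `<=` U) (fs : seq (regfun V)) : regfun V :=
  theta V VW (der_pv (slot_derivation (polyvec_md b) VU fs)).

Lemma der_pv_slot p U (b : polyvec p.+1 U) V (VU : V `<=` U) fs f :
  der_pv (slot_derivation (polyvec_md b) VU fs) V subxx [:: f]
    = b V VU (f :: fs).
Proof.
rewrite der_pvE /= /slot_fun (irr (_ >> VU) VU).
by rewrite map_id_in // => g _; apply: regfun_eqP => y Vy; rewrite rf_resE.
Qed.

Lemma form_at_rep W (theta : form1 W) p U (b : polyvec p.+1 U) W' (W'W : W' `<=` W) ts :
  represents theta W'W ts ->
  forall V (VW : V `<=` W) (VU : V `<=` U) (VW' : V `<=` W') fs,
  form_at theta b VW VU fs = contract (res_ts VW' ts) (b V VU) fs.
Proof.
move=> rep V VW VU VW' fs; rewrite /form_at (irr VW (VW' >> W'W)) rep.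
rewrite /contract big_map; apply: eq_bigr => t _; by rewrite der_pv_slot.
Qed.

Lemma form_at_pv W (theta : form1 W) p U (b : polyvec p.+1 U) V (VW : V `<=` W)
    (VU : V `<=` U) V' (V'V : V' `<=` V) (V'W : V' `<=` W) (V'U : V' `<=` U) fs :
  form_pv theta VW (pv_res VU b) V' V'V fs = form_at theta b V'W V'U fs.
Proof.
rewrite /form_pv /= /form_fun /form_at.
rewrite (irr (V'V >> VW) V'W); congr (fm theta _ _).
apply: polyvec_ext => Z ZV [|f [|g gs]] /=; rewrite /wedge //= !det_mx11 !mxE /= /slot_fun /=.
by congr (b _ _ _); exact: irr.
Qed.

Lemma rf_resN U V (VU : V `<=` U) (f : regfun U) : rf_res VU (- f) = - rf_res VU f.
Proof. by apply: regfun_eqP => y Vy; rewrite rf_evN !rf_resE // rf_evN. Qed.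

Definition form_opp W (theta : form1 W) : form1 W.
Proof.
refine (@Form1 _ _ X W (fun V VU P => - theta V VU P) _ _) => [V V' VU V'U V'V P|x Wx].
  by rewrite rf_resN (fm_res theta VU V'U V'V).
have [W' [W'W [fg [W'x H]]]] := fm_local theta Wx.
exists W', W'W, [seq (- t.1, t.2) | t <- fg]; split=> // V VW P.
rewrite H -sumrN big_map; apply: eq_bigr => t _ /=.
by rewrite rf_resN mulNr.
Defined.

Section TwoSheaves.
Variables (L L' : poisson_invertible_sheaf Lambda).
Variables (tau : trivialization L) (tau' : trivialization L').
Notation U_ := (@tr_open _ _ _ _ L tau).
Notation U'_ := (@tr_open _ _ _ _ L' tau').
Variables (K : Type) (W : K -> opens (set_type (pv_set X))) (r : K -> tr_index tau) (r' : K -> tr_index tau').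
Variables (Wr : forall k, W k `<=` U_ (r k)) (Wr' : forall k, W k `<=` U'_ (r' k)).
Variable theta : forall k, form1 (W k).

Definition form_comparison : Prop :=
  [/\ covers W, @cobounds _ _ _ (chern_cochain tau) (chern_cochain tau') _ _ _ _ Wr Wr' theta &
      forall k, is_contraction Lambda (theta k) (fun V VU f =>
          @tr_T _ _ _ _ L' tau' (r' k) V (VU >> (@Wr' k)) [:: f]
          - @tr_T _ _ _ _ L tau (r k) V (VU >> (@Wr k)) [:: f])].

Definition transfers p U (s : esec tau p U) (s' : esec tau' p U) : Prop :=
  (forall i i' V (Vi : V `<=` U ∩ U_ i) (Vi' : V `<=` U ∩ U'_ i'),
     es_b s' i' V Vi' = es_b s i V Vi) /\
  (forall k V (VW : V `<=` W k) (VU : V `<=` U) (Vi : V `<=` U ∩ (U_ (r k)))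
     (Vi' : V `<=` U ∩ (U'_ (r' k))) fs,
     es_a s' (r' k) V Vi' fs = es_a s (r k) V Vi fs - form_at (theta k) (pi_esec s) VW VU fs).

Lemma pi_esec_b p U (s : esec tau p U) i V (Vi : V `<=` U ∩ U_ i) (VU : V `<=` U) :
  pi_esec s V VU = es_b s i V Vi.
Proof.
rewrite -(pi_esecE s i) /=; congr (pv_fun _ _); exact: irr.
Qed.

Hypothesis cmp : form_comparison.

Lemma form_at_change k l p U (b : polyvec p.+1 U) V (Vk : V `<=` W k) (Vl : V `<=` W l)
    (VU : V `<=` U) (Ik : V `<=` U_ (r k)) (Il : V `<=` U_ (r l))
    (Ik' : V `<=` U'_ (r' k)) (Il' : V `<=` U'_ (r' l)) fs :
  contract [:: (tr_hres Il Ik, tr_hres Ik Il)] (b V VU) fs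
  - contract [:: (tr_hres Il' Ik', tr_hres Ik' Il')] (b V VU) fs
  = form_at (theta l) b Vl VU fs - form_at (theta k) b Vk VU fs.
Proof.
case: cmp => _ cob _.
have := cob k l V Vk Vl (der_pv (slot_derivation (polyvec_md b) VU fs)) => <-.
congr (_ - _); apply/esym; [rewrite [LHS](dlog_hE Ik Il)|rewrite [LHS](dlog_hE Ik' Il')];
  by rewrite !contract1 der_pv_slot.
Qed.

Lemma transfers_uniq p U (s : esec tau p U) (s1 s2 : esec tau' p U) :
  transfers s s1 -> transfers s s2 -> s1 = s2.
Proof.
case: cmp => cov _ _ [b1 a1] [b2 a2].
have [||t [_ ut]] := @atiyah_is_sheaf _ _ tau' p U K (fun k => U ∩ W k)
   (fun k => @subIl _ U (W k)) _ (fun k => es_res subl s1).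
- by move=> x Ux; have [k Wx] := cov x; exists k.
- move=> i j V Vi Vj; rewrite !(es_res_comp _ _ (Vi >> subl)) //.
- have E1 : t = s1 by exact: ut.
  rewrite -E1; apply: ut => k.
have Vj : U ∩ W k `<=` U'_ (r' k) := subr >> (@Wr' k).
have Vi : U ∩ W k `<=` U_ (r k) := subr >> (@Wr k).
apply: (esec_eq Vj) => V VI /=.
  have VU := (VI >> subl) >> subl.
  have VW := (VI >> subl) >> subr.
  apply: funext => fs.
  by rewrite (a1 k V VW VU (subII VU (VW >> (@Wr k)))) (a2 k V VW VU (subII VU (VW >> (@Wr k)))).
have VU := (VI >> subl) >> subl.
have VW := (VI >> subl) >> subr.
by rewrite (b1 (r k) _ _ (subII VU (VW >> (@Wr k)))) (b2 (r k) _ _ (subII VU (VW >> (@Wr k)))).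
Qed.

Lemma es_a_res (t : trivialization L') p U V (VU : V `<=` U) (s : esec t p U) i Z
  (Zi : Z `<=` V ∩ (@tr_open _ _ _ _ L' t i)) :
  es_a (es_res VU s) i Z Zi = es_a s i Z (Zi >> (openIS VU)).
Proof. by []. Qed.

Lemma transfers_exist p U (s : esec tau p U) : exists s' : esec tau' p U, transfers s s'.
Proof.
case: cmp => cov _ _.
pose V_ k := U ∩ W k.
pose VU k : V_ k `<=` U := subl; pose VW k : V_ k `<=` W k := subr.
pose Vr k : V_ k `<=` U_ (r k) := (VW k) >> (@Wr k).
pose Vr' k : V_ k `<=` U'_ (r' k) := (VW k) >> (@Wr' k).
pose b := pi_esec s.
pose a k : polyvec p (V_ k) := comp_a (Vr k) (es_res (VU k) s)
  - form_pv (theta k) (VW k) (pv_res (VU k) b).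
have aE k V (VV : V `<=` V_ k) (VUk : V `<=` U) (Vk : V `<=` W k)
    (Vi : V `<=` U ∩ (U_ (r k))) fs :
    a k V VV fs = es_a s (r k) V Vi fs - form_at (theta k) b Vk VUk fs.
  rewrite -[LHS]/(_ + rf_res VV (-1) * _) rf_resN1 mulN1r (form_at_pv _ _ _ _ _ Vk VUk).
  by congr (_ - _); rewrite /comp_a /=; congr (pv_fun _ _); exact: irr.
have [||s' [s'E _]] := @atiyah_is_sheaf _ _ tau' p U K V_ VU _
   (fun k => mk_esec (Vr' k) (a k) (pv_res (VU k) b)).
- by move=> x Ux; have [k Wx] := cov x; exists k.
- move=> k l V Vk Vl; have VUV := Vk >> (VU k).
  have Ik := Vk >> (Vr' k); have Il := Vl >> (Vr' l).
  apply: (esec_eq Ik) => Z ZI; apply: funext => fs; last first.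
    by rewrite /=; congr (b _ _ _); exact: irr.
  rewrite !es_a_res.
  have ZV : Z `<=` V := ZI >> subl.
  have Zk := ZV >> Vk; have Zl := ZV >> Vl.
  have ZU := ZV >> VUV.
  have Wk := Zk >> (VW k); have Wl := Zl >> (VW l).
  have Zik := Wk >> (@Wr k); have Zil := Wl >> (@Wr l).
  have Zik' := Wk >> (@Wr' k); have Zil' := Wl >> (@Wr' l).
  rewrite (mk_esec_a _ _ _ _ Zk) [RHS](mk_aE _ _ _ _ Zl Zik' Zil').
  rewrite (aE k Z Zk ZU Wk (subII ZU Zik)) (aE l Z Zl ZU Wl (subII ZU Zil)).
  rewrite (es_glue_aE s (subII ZU Zil) (subII ZU Zik) Zil Zik).
  have := form_at_change b Wl Wk ZU Zil Zik Zil' Zik' fs.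
  rewrite -(pi_esec_b s (subII ZU Zil) ZU) -/b.
  have -> : pv_res (VU l) b Z Zl = b Z ZU by rewrite /=; congr (pv_fun b _); exact: irr.
  move=> /eqP; rewrite subr_eq addrAC => /eqP ->; by ring.
have bE k Z (ZV : Z `<=` V_ k) (ZU : Z `<=` U) i' (Zi' : Z `<=` U ∩ U'_ i') :
    es_b s' i' Z Zi' = b Z ZU.
  have Zi'2 : Z `<=` (V_ k) ∩ U'_ i' := subII ZV (Zi' >> subr).
  have := congr1 (fun t : esec tau' p (V_ k) => es_b t i' Z Zi'2) (s'E k) => /=.
  have -> : subset_trans Zi'2 (openIS (VU k)) = Zi' by exact: irr.
  move=> E; apply: funext => fs; rewrite [LHS](congr1 (fun g => g fs) E).
  by congr (b _ _ _); exact: irr.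
exists s'; split=> [i i' V Vi Vi'|k V Vk VUk Vi Vi' fs]; last first.
  have VVk : V `<=` V_ k := subII VUk Vk.
  rewrite -(aE k V VVk VUk Vk Vi).
  have Vi2 : V `<=` (V_ k) ∩ (U'_ (r' k)) := subII VVk (Vi' >> subr).
  have := congr1 (fun t : esec tau' p (V_ k) => es_a t (r' k) V Vi2 fs) (s'E k).
  rewrite es_a_res (irr (Vi2 >> _) Vi') => ->.
  by rewrite (mk_esec_a _ _ _ _ VVk).
have VUV := Vi >> subl; rewrite -(pi_esec_b s Vi VUV) -/b.
apply: funext => fs; apply: regfun_local => x Vx; have [k Wkx] := cov x.
pose Z := V ∩ W k; exists Z, subl; split=> //.
rewrite (natural_polyvec (es_b s' i') Vi' (subl >> Vi')).
rewrite (natural_polyvec b VUV (subl >> VUV)).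
rewrite (bE k Z (subII (subl >> VUV) subr)
  (subl >> VUV)) //.
Qed.

Lemma form_at_lin W0 (th : form1 W0) p U (f : regfun U) (b b' : polyvec p.+1 U) V (VW : V `<=` W0)
    (VU : V `<=` U) fs :
  form_at th (f *: b + b') VW VU fs
    = rf_res VU f * form_at th b VW VU fs + form_at th b' VW VU fs.
Proof.
rewrite -!(form_at_pv th _ VW VU subxx).
have -> : pv_res VU (f *: b + b') = rf_res VU f *: pv_res VU b + pv_res VU b'.
  by rewrite -pv_resZ -pv_resD.
rewrite form_pv_lin -[LHS]/(_ * _ + _); congr (_ * _ + _).
by apply: regfun_eqP => y Vy; rewrite rf_resE.
Qed.

Lemma transfers_lin p U (f : regfun U) (s t : esec tau p U) (s' t' : esec tau' p U) :
  transfers s s' -> transfers t t' -> transfers (f *: s + t) (f *: s' + t').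
Proof.
move=> [bs as_] [bt at_]; split=> [i i' V Vi Vi'|k V VW VU Vi Vi' fs].
  apply: funext => fs; rewrite -[LHS]/(rf_res Vi' (rf_res _ f) * _ + _) -[RHS]/(rf_res Vi (rf_res _ f) * _ + _).
  by rewrite !(rf_res_comp _ _ (Vi >> subl)) (bs _ _ _ Vi) (bt _ _ _ Vi).
have -> : pi_esec (f *: s + t) = f *: pi_esec s + pi_esec t by rewrite pi_D pi_Z.
rewrite form_at_lin.
rewrite -[LHS]/(rf_res Vi' (rf_res _ f) * _ + _) -[X in X - _]/(rf_res Vi (rf_res _ f) * _ + _).
rewrite !(rf_res_comp _ _ VU) (as_ k V VW VU Vi) (at_ k V VW VU Vi).
by ring.
Qed.

Lemma transfers_res p U V (VU : V `<=` U) (s : esec tau p U) (s' : esec tau' p U) :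
  transfers s s' -> transfers (es_res VU s) (es_res VU s').
Proof.
move=> [bs as_]; split=> [i i' Z Zi Zi'|k Z ZW ZV Zi Zi' fs] /=.
  exact: bs.
rewrite (as_ k Z ZW (ZV >> VU) (Zi >> (openIS VU))).
congr (_ - _); rewrite /form_at; congr (theta _ _ _); apply: polyvec_ext => Y YZ gs.
rewrite /= /wedge; case: eqP => // sz; rewrite !det_mx11 !mxE /= /slot_fun /=.
rewrite -(pi_nat VU s) /=; congr (pi_esec _ _ _ _); exact: irr.
Qed.

Lemma transfers_iota p U (a : polyvec p U) :
  transfers (iota_esec tau a) (iota_esec tau' a).
Proof.
split=> // k V VW VU Vi Vi' fs.
have -> : pi_esec (iota_esec tau a) = 0.
  by apply: pi_uniq => i; apply: polyvec_ext.
have -> : form_at (theta k) (0 : polyvec p.+1 U) VW VU fs = 0.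
  have := form_at_lin (theta k) (-1) (0 : polyvec p.+1 U) 0 VW VU fs.
  by rewrite (@scaler0 _ (polyvec p.+1 U)) addr0 rf_resN1 mulN1r addNr.
by rewrite subr0 /=; congr (a _ _ _); exact: irr.
Qed.

Lemma transfers_pi p U (s : esec tau p U) (s' : esec tau' p U) :
  transfers s s' -> pi_esec s' = pi_esec s.
Proof.
move=> [bs _]; apply: pi_uniq => i'; apply: polyvec_ext => V Vi' fs.
apply: regfun_local => x Vx; have [i Ux] := tr_cover tau x.
pose Z := V ∩ U_ i; pose ZV : Z `<=` V := subl; exists Z, ZV; split=> //.
have ZU : Z `<=` U := ZV >> (Vi' >> subl).
rewrite /= (natural_polyvec (pi_esec s) _ ZU) (natural_polyvec (es_b s' i') Vi' (ZV >> Vi')).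
by rewrite (bs i i' Z (subII ZU subr)) -(pi_esec_b s _ ZU).
Qed.

Hypothesis theta_closed : forall k, closed_form (theta k).

Lemma transfers_d p U (s : esec tau p U) (s' : esec tau' p U) :
  transfers s s' -> transfers (d_esec s) (d_esec s').
Proof.
move=> [bs as_]; split=> [i i' V Vi Vi'|k V VW VU Vi Vi' fs].
  apply: funext => fs; rewrite -[LHS]/(d_b s' i' V Vi' fs).
  by rewrite -[RHS]/(d_b s i V Vi fs) !d_bE (bs i i' V Vi).
apply: regfun_local => x Vx; case: cmp => _ _ ctr.
have [W' [W'W [ts [W'x rep Trep]]]] := ctr k x (VW x Vx).
pose Z := V ∩ W'; pose ZV : Z `<=` V := subl.
pose ZW' : Z `<=` W' := subr; exists Z, ZV; split=> //.
have ZU := ZV >> VU; have ZW := ZV >> VW.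
have Zr := ZW >> (@Wr k); have Zr' := ZW >> (@Wr' k).
pose gs := map (rf_res ZV) fs; pose ts' := res_ts ZW' ts.
have repZ : represents (theta k) ZW ts'.
  by rewrite (irr ZW (ZW' >> W'W)); exact: represents_res.
rewrite rf_resD rf_resN (natural_polyvec (es_a (d_esec s') (r' k)) Vi' (ZV >> Vi')).
rewrite (natural_polyvec (es_a (d_esec s) (r k)) Vi (ZV >> Vi)).
pose pds := pi_esec (d_esec s).
have -> : rf_res ZV (form_at (theta k) pds VW VU fs) = form_at (theta k) pds ZW ZU gs.
  have := form_at_pv (theta k) pds VW VU subxx VW VU fs => <-.
  rewrite (natural_polyvec _ subxx ZV).
  exact: form_at_pv.
rewrite (form_at_rep pds rep ZW ZU ZW') -/ts' -/gs.
rewrite -[LHS]/(d_a s' (r' k) Z _ gs) (d_aE s' _ Zr').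
rewrite -[X in X - _]/(d_a s (r k) Z _ gs) (d_aE s _ Zr).
pose ZI := ZV >> Vi; pose ZI' := ZV >> Vi'.
pose b := es_b s (r k) Z ZI.
have bE : pi_esec s Z ZU = b by exact: pi_esec_b.
have pE : pds Z ZU = sbracket 2 p.+1 (LV Z) b.
  rewrite (pi_esec_b _ ZI); apply: funext => hs; exact: (d_bE s).
rewrite pE (bs _ _ _ ZI) -/b.
have -> : es_a s' (r' k) Z (ZV >> Vi')
    = fun hs => es_a s (r k) Z (ZV >> Vi) hs + (- contract ts' b hs).
  apply: funext => hs; rewrite (as_ k Z ZW ZU ZI) -bE.
  by rewrite (form_at_rep (pi_esec s) rep ZW ZU ZW').
have mL := Lambda_md Lambda Z.
have mb : mder p.+1 b := (polyvec_md (es_b s (r k))).2 Z ZI.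
have -> : @tr_T _ _ _ _ _ tau' (r' k) Z Zr'
    = fun hs => @tr_T _ _ _ _ _ tau (r k) Z Zr hs + contract ts' (LV Z) hs.
  apply: funext => hs; have [|ne] := eqVneq (size hs) 1%N.
    case: hs => [//|f [|//]] _.
    have := Trep Z ZW' f; rewrite /contract big_map => E.
    apply/eqP; rewrite addrC -subr_eq; apply/eqP.
    rewrite -[RHS]/(\sum_(t <- ts) rf_res ZW' t.1 * pbracket Lambda (rf_res ZW' t.2) f) -E.
    by congr (_ - _); congr (pv_fun _ _ _); exact: irr.
  rewrite (md_size (tr_T_md Zr')); last exact/eqP.
  rewrite (md_size (tr_T_md Zr)); last exact/eqP.
  rewrite add0r /contract big1 // => t _; rewrite /slot (md_size mL) ?mulr0 //=.
  by apply/eqP; rewrite eqSS.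
rewrite (sbracketDr _ _ _ _ mL) (sbracketDl _ _ _ _ mb) (sbracketNr _ _ _ mL).
have := contract_sbracket ts' gs mL mb.
have -> : \sum_(t <- ts') (wprod p (slot t.2 b) (slot t.1 (LV Z)) gs
    - wprod p (slot t.1 b) (slot t.2 (LV Z)) gs) = 0.
  have := closed_wedge (pv_res (@inT _ _ X Z) Lambda) (pv_res ZU (pi_esec s)) gs (@theta_closed k) repZ.
  rewrite /= (irr (subxx >> ZU) ZU) bE.
  by rewrite (irr (subxx >> (@inT _ _ X Z)) (@inT _ _ X Z)).
rewrite addr0 => <-; rewrite exprS; ring.
Qed.

End TwoSheaves.
Notation "D @@ f" := (der D subxx f) (at level 30).

Definition der_comm U (D E : derivation U) : derivation U.
Proof.
refine (@Derivation _ _ X U (fun V VU f => D V VU (E V VU f) - E V VU (D V VU f)) _ _ _ _).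
- by move=> V VU f g; rewrite !der_D; ring.
- by move=> V VU c f; rewrite !der_Z mulrBr.
- by move=> V VU f g; rewrite !(der_M, der_D); ring.
- by move=> V V' VU V'U V'V f; rewrite rf_resD rf_resN !(der_res _ VU V'U V'V).
Defined.

Lemma der0 U (D : derivation U) V (VU : V `<=` U) : D V VU 0 = 0.
Proof. by rewrite -[X in D _ _ X](mul0r 0) der_M !mul0r addr0. Qed.

Lemma der_sum U (D : derivation U) V (VU : V `<=` U) (I : Type) (s : seq I) F :
  D V VU (\sum_(i <- s) F i) = \sum_(i <- s) D V VU (F i).
Proof.
elim: s => [|i s IH]; first by rewrite !big_nil der0.
by rewrite !big_cons der_D IH.
Qed.

Definition ext_der W (ts : seq (regfun W * regfun W)) (D E : derivation W) : regfun W :=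
  \sum_(t <- ts) (D @@ t.1 * E @@ t.2 - E @@ t.1 * D @@ t.2).

Lemma represents_der U (theta : form1 U) W (WU : W `<=` U) ts : represents theta WU ts ->
  forall F : derivation W, theta W WU (der_pv F) = \sum_(t <- ts) t.1 * F @@ t.2.
Proof.
move=> rep F; have := rep W subxx (der_pv F).
rewrite (irr (_ >> WU) WU) => ->; apply: eq_bigr => t _.
by rewrite der_pvE !rf_res_refl.
Qed.

(** Cartan's formula, which does not depend on the representation. *)
Lemma cartan U (theta : form1 U) W (WU : W `<=` U) ts : represents theta WU ts ->
  forall D E : derivation W, ext_der ts D E
   = D @@ theta W WU (der_pv E) - E @@ theta W WU (der_pv D)
     - theta W WU (der_pv (der_comm D E)).
Proof.
move=> rep D E; rewrite !(represents_der rep) !der_sum -!sumrB.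
by apply: eq_bigr => t _; rewrite !der_M /=; ring.
Qed.

Lemma ext_der_res W V (VW : V `<=` W) ts (D E : derivation W) :
  rf_res VW (ext_der ts D E) = ext_der (res_ts VW ts) (der_restrict VW D) (der_restrict VW E).
Proof.
rewrite rf_res_sum /ext_der big_map; apply: eq_bigr => t _ /=.
rewrite rf_resD rf_resN !rf_resM !(der_res _ subxx VW VW).
by rewrite (irr (_ >> VW) VW).
Qed.

Lemma closed_locally U (theta : form1 U) :
  (forall x, oset U x -> exists W (WU : W `<=` U) ts, [/\ oset W x, represents theta WU ts &
     forall V (VW : V `<=` W) (D E : derivation V), ext_der (res_ts VW ts) D E = 0]) ->
  closed_form theta.
Proof.
move=> loc W WU ts rep D E; apply: regfun_local => x Wx.
have [W' [W'U [ts' [W'x rep' z]]]] := loc x (WU x Wx).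
pose V := W ∩ W'; pose VW : V `<=` W := subl.
pose VW' : V `<=` W' := subr.
exists V, VW; split=> //; rewrite rf_res0 -[X in rf_res _ X]/(ext_der ts D E) ext_der_res.
rewrite (cartan (represents_res VW rep)) (irr (VW >> WU) (VW' >> W'U)).
by rewrite -(cartan (represents_res VW' rep')) z.
Qed.

Lemma vdu_represents U (v u : regfun U) : represents (vdu v u) subxx [:: (v, u)].
Proof.
move=> V VU P; rewrite big_seq1 /= /vdu_fun.
by rewrite (irr (VU >> _) VU).
Qed.

Lemma dlog_closed U (v u : regfun U) : v * u = 1 -> closed_form (vdu v u).
Proof.
move=> vu; apply: closed_locally => x Ux; exists U, subxx, [:: (v, u)].
split=> // [|V VU D E]; first exact: vdu_represents.
rewrite /ext_der /res_ts /= big_seq1 /=.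
set v' := rf_res VU v; set u' := rf_res VU u.
have vu' : v' * u' = 1 by rewrite -rf_resM vu; exact: rf_res_cst.
have dv (F : derivation V) : F @@ v' = - (v' ^+ 2) * F @@ u'.
  have : F @@ (v' * u') = 0.
    by rewrite vu' -[1]/(rf_cst V 1) der_cst.
  rewrite der_M => /eqP; rewrite addr_eq0 => /eqP E1.
  have -> : F @@ v' = v' * (u' * F @@ v') by rewrite mulrA vu' mul1r.
  by rewrite -[X in v' * X]opprK -E1; ring.
by rewrite !dv; ring.
Qed.



Lemma atiyah_data_uniq (L : poisson_invertible_sheaf Lambda) (tau : trivialization L) dE iota pi :
  @is_atiyah_data _ _ _ _ _ tau dE iota pi ->
  [/\ forall p U s, dE p U s = d_esec s,
      forall p U a, iota p U a = iota_esec tau a &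
      forall p U s, pi p U s = pi_esec s].
Proof.
move=> [dP iP pP]; have [dP0 _ _] := atiyah_dataP tau; split=> [p U s|p U a|p U s].
- apply: esec_ext => i; apply: polyvec_ext => V Vi fs.
    by rewrite (dP p U s i V Vi fs).1 -(dP0 p U s i V Vi fs).1.
  by rewrite (dP p U s i V Vi fs).2 -(dP0 p U s i V Vi fs).2.
- by apply: esec_ext => i; rewrite ?(iP p U a i).1 ?(iP p U a i).2.
- by apply/esym/pi_uniq => i; exact: pP.
Qed.

Section OneComparison.
Variables (L L' : poisson_invertible_sheaf Lambda).
Variables (tau : trivialization L) (tau' : trivialization L').
Notation U_ := (@tr_open _ _ _ _ L tau).
Notation U'_ := (@tr_open _ _ _ _ L' tau').
Variables (K : Type) (W : K -> opens (set_type (pv_set X)))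
  (r : K -> tr_index tau) (r' : K -> tr_index tau').
Variables (Wr : forall k, W k `<=` U_ (r k)) (Wr' : forall k, W k `<=` U'_ (r' k)).
Variable theta : forall k, form1 (W k).
Hypothesis cmp : form_comparison Wr Wr' theta.
Hypothesis theta_closed : forall k, closed_form (theta k).

Lemma comparison_sym : form_comparison Wr' Wr (fun k => form_opp (theta k)).
Proof.
case: cmp => cov cob ctr; split=> // [k l V Vk Vl P|k x Wx].
  rewrite -[RHS]/(- theta l V Vl P - - theta k V Vk P) -opprD -(cob k l V Vk Vl P).
  by rewrite opprB.
have [W' [W'W [ts [W'x rep H]]]] := ctr k x Wx.
exists W', W'W, [seq (- t.1, t.2) | t <- ts]; split=> // [V VW P|V VW g].
  rewrite -[LHS]/(- theta k V _ P) rep big_map -sumrN; apply: eq_bigr => t _ /=.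
  by rewrite rf_resN mulNr.
rewrite -[LHS]opprB H big_map -sumrN; apply: eq_bigr => t _ /=.
by rewrite rf_resN mulNr.
Qed.

Lemma transfers_sym p U (s : esec tau p U) (s' : esec tau' p U) :
  transfers r r' theta s s' ->
  transfers r' r (fun k => form_opp (theta k)) s' s.
Proof.
move=> t; have pE := transfers_pi t; case: t => bs as_.
split=> [i' i V Vi' Vi|k V VW VU Vi' Vi fs]; first by rewrite (bs i i' V Vi).
rewrite (as_ k V VW VU Vi Vi') pE -[X in _ = _ - X]/(- form_at _ _ _ _ _).
by rewrite opprK subrK.
Qed.

Lemma transfers_fun_exists : exists phi : forall p, chom (forget (atiyah_sheaf tau p)) (forget (atiyah_sheaf tau' p)),
  forall p U (s : esec tau p U), transfers r r' theta s (phi p U s).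
Proof.
pose f p U (s : esec tau p U) := projT1 (cid (transfers_exist cmp s)).
have fP p U (s : esec tau p U) : transfers r r' theta s (f p U s).
  exact: projT2 (cid (transfers_exist cmp s)).
have uq p U (s : esec tau p U) s' : transfers r r' theta s s' -> f p U s = s'.
  by move=> t; exact: (transfers_uniq cmp (fP p U s) t).
have fD p U (s t : esec tau p U) : f p U (s + t) = f p U s + f p U t.
  apply: uq; have := transfers_lin 1 (fP p U s) (fP p U t); by rewrite !scale1r.
have f0 p U : f p U 0 = 0.
  by apply: (addrI (f p U 0)); rewrite -fD !addr0.
have fZ p U (c : C) (s : esec tau p U) : f p U (rf_cst U c *: s) = rf_cst U c *: f p U s.
  apply: uq; have := transfers_lin (rf_cst U c) (fP p U s) (fP p U 0).
  by rewrite f0 !addr0.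
have fN p U V (VU : V `<=` U) (s : esec tau p U) : es_res VU (f p U s) = f p V (es_res VU s).
  by apply/esym/uq; exact: transfers_res.
exists (fun p => @CHom _ _ _ (forget (atiyah_sheaf tau p)) (forget (atiyah_sheaf tau' p))
  (f p) (fD p) (fZ p) (fN p)).
exact: fP.
Qed.

End OneComparison.

Lemma comparison_ext_iso (L L' : poisson_invertible_sheaf Lambda)
    (tau : trivialization L) (tau' : trivialization L')
    (K : Type) (W : K -> opens (set_type (pv_set X)))
    (r : K -> tr_index tau) (r' : K -> tr_index tau')
    (Wr : forall k, W k `<=` @tr_open _ _ _ _ L tau (r k))
    (Wr' : forall k, W k `<=` @tr_open _ _ _ _ L' tau' (r' k))
    (theta : forall k, form1 (W k)) d dE iota pi dE' iota' pi' :
  form_comparison Wr Wr' theta -> (forall k, closed_form (theta k)) ->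
  @is_atiyah_data _ _ _ _ _ tau dE iota pi ->
  @is_atiyah_data _ _ _ _ _ tau' dE' iota' pi' ->
  ext_iso (poisson_atiyah d dE iota pi) (poisson_atiyah d dE' iota' pi').
Proof.
move=> cmp cl /atiyah_data_uniq[dP iP pP] /atiyah_data_uniq[dP' iP' pP'].
have cmp' := comparison_sym cmp.
have [phi phiP] := transfers_fun_exists cmp.
have [psi psiP] := transfers_fun_exists cmp'.
have uq p U (s : esec tau p U) s' : transfers r r' theta s s' -> phi p U s = s'.
  by move=> t; exact: (transfers_uniq cmp (phiP p U s) t).
have uq' p U (s : esec tau' p U) s' :
    transfers r' r (fun k => form_opp (theta k)) s s' -> psi p U s = s'.
  by move=> t; exact: (transfers_uniq cmp' (psiP p U s) t).
exists phi; split=> [p U|p U s|p U a|p U s].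
- exists (psi p U) => s.
    by apply: uq'; exact: transfers_sym.
  apply: uq; have [h1 h2] := transfers_sym (psiP p U s); split=> // k V VW VU Vi Vi' fs.
  rewrite (h2 k V VW VU Vi Vi') /form_at /= ; by rewrite opprK.
- rewrite -[cx_d _ _ _ _]/(dE p U s) -[RHS]/(dE' p U (phi p U s)) dP dP'.
  by apply: uq; exact: (transfers_d cmp cl (phiP p U s)).
- rewrite -[ext_in _ _ _ _]/(iota p U a) -[RHS]/(iota' p U a) iP iP'.
  by apply: uq; exact: transfers_iota.
- rewrite -[LHS]/(pi' p U (phi p U s)) -[RHS]/(pi p U s) pP pP'.
  exact: transfers_pi (phiP p U s).
Qed.

Lemma ext_iso_trans (A B : ccomplex X) (e1 e2 e3 : extension A B) :
  ext_iso e1 e2 -> ext_iso e2 e3 -> ext_iso e1 e3.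
Proof.
move=> [phi [b1 d1 i1 o1]] [psi [b2 d2 i2 o2]].
pose c p := @CHom _ _ _ (ext_mid e1 p) (ext_mid e3 p) (fun U s => psi p U (phi p U s)).
have cD p U s t : psi p U (phi p U (s + t)) = psi p U (phi p U s) + psi p U (phi p U t).
  by rewrite !ch_D.
have cZ p U (a : C) s : psi p U (phi p U (a *: s)) = a *: psi p U (phi p U s).
  by rewrite !ch_Z.
have cN p U V (VU : V `<=` U) s :
    cs_res VU (psi p U (phi p U s)) = psi p V (phi p V (cs_res VU s)).
  by rewrite !ch_nat.
exists (fun p => @CHom _ _ _ (ext_mid e1 p) (ext_mid e3 p) _ (cD p) (cZ p) (cN p)).
split=> [p U|p U s|p U a|p U s] /=.
- exact: bij_comp (b2 p U) (b1 p U).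
- by rewrite d1 d2.
- by rewrite i1 i2.
- by rewrite o2 o1.
Qed.

(** Two trivializations of the same sheaf differ by the logarithmic
    differentials of the changes of frames. *)
Lemma same_sheaf_comparison (L : poisson_invertible_sheaf Lambda) (tau tau' : trivialization L) :
  exists (K : Type) (W : K -> op) (r : K -> tr_index tau) (r' : K -> tr_index tau')
    (Wr : forall k, W k `<=` @tr_open _ _ _ _ L tau (r k))
    (Wr' : forall k, W k `<=` @tr_open _ _ _ _ L tau' (r' k))
    (theta : forall k, form1 (W k)),
    form_comparison Wr Wr' theta /\ (forall k, closed_form (theta k)).
Proof.
pose K := (tr_index tau * tr_index tau')%type.
pose W (k : K) : op := (@tr_open _ _ _ _ L tau k.1) ∩ (@tr_open _ _ _ _ L tau' k.2).
pose Wr (k : K) : W k `<=` @tr_open _ _ _ _ L tau k.1 := subl.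
pose Wr' (k : K) : W k `<=` @tr_open _ _ _ _ L tau' k.2 := subr.
pose e k := om_res (Wr k) (@tr_frame _ _ _ _ L tau k.1).
pose e' k := om_res (Wr' k) (@tr_frame _ _ _ _ L tau' k.2).
have exv k : exists v, e k = v *: e' k.
  by have [v [E _]] := @tr_frameP _ _ _ _ L tau' k.2 (W k) (Wr' k) (e k); exists v.
have exu k : exists u, e' k = u *: e k.
  by have [u [E _]] := @tr_frameP _ _ _ _ L tau k.1 (W k) (Wr k) (e' k); exists u.
pose v k := projT1 (cid (exv k)); pose u k := projT1 (cid (exu k)).
have vE k : e k = v k *: e' k by exact: projT2 (cid (exv k)).
have uE k : e' k = u k *: e k by exact: projT2 (cid (exu k)).
have uv k : u k * v k = 1.
  apply: (frame_inj (Vi := Wr' k)); rewrite -/(e' k) -scalerA -vE -uE scale1r //.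
exists K, W, fst, snd, Wr, Wr', (fun k => vdu (u k) (v k)); split; last first.
  by move=> k; apply: dlog_closed; exact: uv.
split.
- move=> x; have [i Ux] := tr_cover tau x; have [j Ux'] := tr_cover tau' x.
  by exists (i, j); split.
- move=> k l V Vk Vl P.
  pose Ik := Vk >> (Wr k); pose Il := Vl >> (Wr l).
  pose Ik' := Vk >> (Wr' k); pose Il' := Vl >> (Wr' l).
  rewrite -[LHS]/(dlog_h _ _ V (subII Ik Il) P - dlog_h _ _ V (subII Ik' Il') P).
  rewrite (dlog_hE Ik Il) (dlog_hE Ik' Il') -[RHS]/(_ * _ - _ * _) -!contract1.
  have mP : mder 1 (P V subxx) := (polyvec_md P).2 V _.
  apply/eqP; rewrite subr_eq addrAC eq_sym subr_eq; apply/eqP.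
  have uvr j (Vj : V `<=` W j) : rf_res Vj (u j) * rf_res Vj (v j) = 1.
    by rewrite -rf_resM uv; exact: rf_res_cst.
  rewrite -!(dlogM _ mP) ?tr_hresV ?uvr //.
  have HH : rf_res Vl (v l) * tr_hres Ik' Il' = tr_hres Ik Il * rf_res Vk (v k).
    apply: (frame_inj (Vi := Ik')).
    rewrite -scalerA -(frame_change Ik' Il') -scalerA.
    have er j (Vj : V `<=` W j) (Ij : V `<=` @tr_open _ _ _ _ L tau j.1)
        (Ij' : V `<=` @tr_open _ _ _ _ L tau' j.2) :
      rf_res Vj (v j) *: om_res Ij' (@tr_frame _ _ _ _ L tau' j.2) = om_res Ij (@tr_frame _ _ _ _ L tau j.1).
      by rewrite -(om_res_comp (Wr' j) Vj Ij') -om_resZ -(vE j) (om_res_comp (Wr j) Vj Ij).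
    by rewrite (er l Vl Il Il') (er k Vk Ik Ik') -(frame_change Ik Il).
  rewrite HH; congr (contract [:: (_, _)] _ _).
  have E1 : (rf_res Vl (u l) * tr_hres Il' Ik') * (tr_hres Ik Il * rf_res Vk (v k)) = 1.
    by rewrite -HH mulrACA uvr mul1r tr_hresV.
  have E2 : (tr_hres Il Ik * rf_res Vk (u k)) * (tr_hres Ik Il * rf_res Vk (v k)) = 1.
    by rewrite mulrACA tr_hresV mul1r uvr.
  by rewrite -[LHS]mulr1 -E2 mulrCA E1 mulr1.
- move=> k x Wx; exists (W k), (@subset_refl _ (W k)), [:: (u k, v k)]; split=> //.
    exact: vdu_represents.
  move=> V VW f; rewrite big_seq1 /=.
  set v' := rf_res VW (v k); set u' := rf_res VW (u k).
  have uv' : u' * v' = 1 by rewrite -rf_resM uv; exact: rf_res_cst.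
  pose Ik := VW >> (Wr k); pose Ik' := VW >> (Wr' k).
  rewrite (irr ((VW >> _) >> (Wr k)) Ik).
  rewrite (irr ((VW >> _) >> (Wr' k)) Ik').
  have er : om_res Ik (@tr_frame _ _ _ _ L tau k.1) = v' *: om_res Ik' (@tr_frame _ _ _ _ L tau' k.2).
    by rewrite -(om_res_comp (Wr' k) VW Ik') -om_resZ -(vE k) (om_res_comp (Wr k) VW Ik).
  have := @tr_TP _ _ _ _ L tau k.1 V Ik f; rewrite er pl_br_Mr.
  rewrite (@tr_TP _ _ _ _ L tau' k.2 V Ik' f) !scalerA -scalerDl.
  move=> /(frame_inj (Vi := Ik')) E.
  have mL := Lambda_md Lambda V.
  have -> : pbracket Lambda v' f = - pbracket Lambda f v'.
    exact: (md_swap [::] [::] _ _ mL).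
  have := congr1 (fun g => u' * g) E => /=.
  rewrite mulrDr mulrA uv' mul1r mulrCA uv' mulr1 => <-; by ring.
Qed.

End LocalGeometry.

Section AnalyticGeometry.
Variables (R : realType) (N : nat) (X : projective_variety R N).
Notation C := R[i].
Notation pts := (set_type (pv_set X)).
Notation op := (opens pts).
Notation hc x j := (vpick (val (val x)) 0 j).

Section AffineChart.
Implicit Types (x y : pts) (f g : pts -> C) (U V W : op).

Lemma opens_meet U V x y : oset U x -> oset V y -> exists z, oset U z /\ oset V z.
Proof.
move=> Ux Vy; apply: contrapT => no.
have [B oB BU] : exists2 B : set (proj_space R N), open B & val @^-1` B = oset U.
  exact: oset_open U.
have [B' oB' BV] : exists2 B : set (proj_space R N), open B & val @^-1` B = oset V.
  exact: oset_open V.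
have [_ irr] := pv_irreducible X.
have cov : pv_set X `<=` ~` B `|` ~` B'.
  move=> p Xp; have [Bp|] := pselect (B p); last by left.
  have [B'p|] := pselect (B' p); last by right.
  exfalso; apply: no; exists (SigSub (mem_set Xp)); split; first by rewrite -BU.
  by rewrite -BV.
have [h|h] := irr _ _ (open_closedC oB) (open_closedC oB') cov.
  by apply: (h (val x)); [exact: set_mem (valP x)|rewrite -BU in Ux].
by apply: (h (val y)); [exact: set_mem (valP y)|rewrite -BV in Vy].
Qed.

Lemma opens_meet_seq (I : Type) (s : seq I) (W : I -> op) U x : oset U x ->
  (forall i, List.In i s -> exists y, oset (W i) y) ->
  exists V z, [/\ oset V z, V `<=` U & forall i, List.In i s -> V `<=` W i].
Proof.
move=> Ux; elim: s => [|i s IH] h; first by exists U, x; split.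
have [V [z [Vz VU VW]]] := IH (fun j js => h j (or_intror js)).
have [y Wy] := h i (or_introl erefl).
have [w [Vw Ww]] := opens_meet Vz Wy.
exists (V ∩ W i), w; split=> // [t [/VU //]|j [<-|/VW Vj]].
  by move=> t [].
by move=> t [/Vj].
Qed.

Lemma regular_zero_product U f g : (forall x, oset U x -> regat x f) ->
  (forall x, oset U x -> regat x g) -> (forall x, oset U x -> f x * g x = 0) ->
  (forall x, oset U x -> f x = 0) \/ (forall x, oset U x -> g x = 0).
Proof.
move=> rf rg fg; apply: contrapT => /not_orP[/existsNP[x /not_implyP[Ux /eqP fx]]].
move=> /existsNP[y /not_implyP[Uy /eqP gy]].
have [A [Ax AP]] := locally_and (locally_in Ux) (regat_neq0 (rf x Ux) fx).
have [B [By BP]] := locally_and (locally_in Uy) (regat_neq0 (rg y Uy) gy).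
have [z [/AP[Uz fz] /BP[_ gz]]] := opens_meet Ax By.
by have /eqP := fg z Uz; rewrite mulf_eq0 (negbTE fz) (negbTE gz).
Qed.

Lemma tower_var n k : (k < n)%N -> exists f : tower C n, forall v, tev n v f = v k.
Proof.
move=> kn; have [g gE] := tev_lift kn ('X : {poly tower C k}).
by exists g => v; rewrite gE /= /horner_eval map_polyX hornerX.
Qed.

Lemma tower_cst n (c : C) : exists f : tower C n, forall v, tev n v f = c.
Proof. by have [g gE] := @tev_lift C 0 n (leq0n n) c; exists g => v; rewrite gE. Qed.

Lemma tower_mpoly n k (F : {mpoly C[k]}) (idx : 'I_k -> nat) : (forall i, (idx i < n)%N) ->
  exists f : tower C n, forall v, tev n v f = F.@[fun i => v (idx i)].
Proof.
move=> idn; have [X_ XE] : exists X_ : 'I_k -> tower C n, forall i v, tev n v (X_ i) = v (idx i).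
  by have [X_ hX] := choice (fun i => tower_var (idn i)); exists X_.
have [c cE] : exists c : C -> tower C n, forall a v, tev n v (c a) = a.
  by have [c hc] := choice (tower_cst n); exists c.
exists (\sum_(mm <- msupp F) c F@_mm * \prod_i X_ i ^+ mm i) => v.
rewrite rmorph_sum mevalE; apply: eq_bigr => mm _; rewrite rmorphM cE; congr (_ * _).
by rewrite rmorph_prod; apply: eq_bigr => i _; rewrite rmorphXn XE.
Qed.

Variable b : 'I_N.+1.

Definition coords (s : seq 'I_N.+1) (x : pts) (k : nat) : C :=
  if (k < size s)%N then aff b (nth b s k) x else 0.

Lemma coords_regat s x n (f : tower C n) : hc x b != 0 ->
  regat x (fun y => tev n (coords s y) f).
Proof.
move=> xb; elim: n f => [|n IH] f; first exact: regat_cst.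
under eq_fun do rewrite tevS; apply: regat_sum => i; apply: regatM; first exact: IH.
have rc : regat x (fun y => coords s y n).
  have -> : (coords s)^~ n = if (n < size s)%N then aff b (nth b s n) else fun=> 0.
    by apply: funext => y; rewrite /coords; case: ifP.
  by case: ifP => _; [exact: aff_regat|exact: regat_cst].
elim: (nat_of_ord i) => [|j IHj]; first exact: regat_cst.
by under eq_fun do rewrite exprS; exact: regatM.
Qed.

Fact homog_X (l : 'I_N.+1) : ('X_l : {mpoly C[N.+1]}) \is 1.-homog.
Proof. by rewrite dhomogX; apply/eqP; exact: mdeg1. Qed.

Definition chart_op : op := Opens (@open_hneq0 _ _ X 1 'X_b (homog_X b)).

Lemma chart_opE x : oset chart_op x <-> hc x b != 0.
Proof. by rewrite /= heval_X. Qed.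

Hypothesis chart_ex : exists x : pts, hc x b != 0.

(** The coordinates of the points of the chart, in the order given by [s]. *)
Definition chart_points (s : seq 'I_N.+1) : set (nat -> C) :=
  [set v | exists2 x : pts, hc x b != 0 & v = coords s x].

Lemma chart_prime s n (f g : tower C n) :
  vanishes (chart_points s) (f * g) -> vanishes (chart_points s) f \/ vanishes (chart_points s) g.
Proof.
move=> fg; have [|||h|h] := @regular_zero_product chart_op (fun x => tev n (coords s x) f)
    (fun x => tev n (coords s x) g).
- by move=> x /chart_opE; exact: coords_regat.
- by move=> x /chart_opE; exact: coords_regat.
- by move=> x /chart_opE xb; rewrite -rmorphM fg //; exists x.
- by left => v [x xb ->]; apply: h; apply/chart_opE.
- by right => v [x xb ->]; apply: h; apply/chart_opE.
Qed.

Lemma chart_points_ex s : exists v, chart_points s v.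
Proof. by have [x xb] := chart_ex; exists (coords s x), x. Qed.

Definition independent (s : seq 'I_N.+1) : Prop :=
  uniq s /\ forall f : tower C (size s), vanishes (chart_points s) f -> f = 0.

Lemma coords_cat s t x k : (k < size s)%N -> coords (s ++ t) x k = coords s x k.
Proof. by move=> ks; rewrite /coords size_cat ks ltn_addr // nth_cat ks. Qed.

(** A maximal family of algebraically independent coordinates. *)
Lemma max_independent : exists s, independent s /\ forall t, independent t -> (size t <= size s)%N.
Proof.
have bd t : independent t -> (size t <= N.+1)%N.
  by move=> [ut _]; have := max_card (mem t); rewrite (card_uniqP ut) card_ord.
pose P k := `[< exists s, independent s /\ size s = k >].
have i0 : independent [::].
  split=> // f vf; have [x xb] := chart_ex; by apply: (vf (coords [::] x)); exists x.
have exP : exists k, P k by exists 0%N; apply/asboolP; exists [::].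
have ubP k : P k -> (k <= N.+1)%N by move=> /asboolP[s [/bd + <-]].
have [k /asboolP[s [si <-]] mk] := ex_maxnP exP ubP.
by exists s; split=> // t ti; apply: mk; apply/asboolP; exists t.
Qed.

Lemma chart_tower : exists (s : seq 'I_N.+1) (m : nat),
  [/\ uniq s, size s = N.+1, (m <= N.+1)%N,
      forall f : tower C m, vanishes (chart_points s) f -> f = 0 &
      forall i, (m <= i < N.+1)%N -> exists f : {poly tower C i},
        @vanishes _ (chart_points s) i.+1 f /\ exists k, ~ vanishes (chart_points s) f`_k].
Proof.
have [t [[ut ind] mt]] := max_independent.
pose s := t ++ [seq l <- enum 'I_N.+1 | l \notin t].
have us : uniq s.
  rewrite cat_uniq ut filter_uniq ?enum_uniq // andbT; apply/hasPn => l.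
  by rewrite mem_filter => /andP[].
have ss : size s = N.+1.
  rewrite -[RHS]card_ord -(card_uniqP us); apply: eq_card => l.
  by rewrite inE mem_cat mem_filter mem_enum andbT orbN.
have free n (f : tower C n) : (n <= size t)%N -> vanishes (chart_points s) f <-> vanishes (chart_points t) f.
  move=> nt; split=> vf v [x xb ->].
    rewrite -(@tev_ext _ n (coords s x)) ?vf //; first by exists x.
    by move=> k kn; rewrite coords_cat // (leq_trans kn).
  rewrite (@tev_ext _ n _ (coords t x)) ?vf //; first by exists x.
  by move=> k kn; rewrite coords_cat // (leq_trans kn).
exists s, (size t); split=> //.
- by have := leq_addr (size [seq l <- enum 'I_N.+1 | l \notin t]) (size t); rewrite -size_cat ss.
- by move=> f /free-/(_ (leqnn _)) /ind.
move=> i /andP[ti iN]; pose c := nth b s i.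
have nct : c \notin t.
  have : c \in drop (size t) s.
    rewrite /c -(subnKC ti) -nth_drop mem_nth // size_drop ss ltn_sub2r //.
    exact: leq_ltn_trans ti iN.
  by rewrite drop_size_cat // mem_filter => /andP[].
have : ~ independent (rcons t c).
  by move=> /mt; rewrite size_rcons ltnn.
move=> /not_andP[|/existsNP[p /not_implyP[vp p0]]]; first by rewrite rcons_uniq nct ut.
move: p vp p0; rewrite size_rcons => p vp /eqP p0.
have h (q : tower C (size t)) := tev_lift ti q.
have [L LE] := choice h.
pose f : {poly tower C i} := \poly_(k < size (p : {poly tower C (size t)})) L (p : {poly tower C (size t)})`_k.
exists f; split.
  move=> v [x xb ->]; rewrite (tev_lead _ (size_poly _ _)).
  have := vp (coords (rcons t c) x) (ex_intro2 _ _ x xb erefl).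
  rewrite tevS => E; rewrite -[RHS]E; apply: eq_bigr => k _.
  rewrite coef_poly ltn_ord LE; congr (_ * _ ^+ _).
    by apply: tev_ext => l lt; rewrite -cats1 !coords_cat.
  rewrite /coords size_rcons ltnSn ss iN nth_rcons ltnn eqxx //.
exists (size (p : {poly tower C (size t)})).-1 => vf.
have sp : (0 < size (p : {poly tower C (size t)}))%N by rewrite size_poly_gt0.
have : (p : {poly tower C (size t)})`_(size (p : {poly tower C (size t)})).-1 = 0.
  apply: ind => v tv; have [x xb vE] := tv.
  have := vf (coords s x) (ex_intro2 _ _ x xb erefl).
  rewrite coef_poly prednK // leqnn LE => E; rewrite -[RHS]E vE.
  by apply: tev_ext => l lt; rewrite coords_cat.
by move/eqP; rewrite -lead_coefE lead_coef_eq0 (negbTE p0).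
Qed.

(** Values of the coordinates satisfying all the equations come from a point. *)
Lemma chart_closed s (v : nat -> C) : uniq s -> size s = N.+1 ->
  (forall f : tower C N.+1, vanishes (chart_points s) f -> tev N.+1 v f = 0) ->
  exists2 x : pts, hc x b != 0 & forall k, (k < N.+1)%N -> coords s x k = v k.
Proof.
move=> us ss Hv.
have ins l : l \in s.
  have sub : {subset s <= enum 'I_N.+1} by move=> j _; rewrite mem_enum.
  have sz : (size (enum 'I_N.+1) <= size s)%N by rewrite ss size_enum_ord.
  by have [_ ->] := uniq_min_size us sub sz; rewrite mem_enum.
have idx l : (index l s < N.+1)%N by have := ins l; rewrite -index_mem ss.
have cE x l : coords s x (index l s) = aff b l x.
  by rewrite /coords index_mem ins nth_index.
pose w : 'rV[C]_N.+1 := \row_l v (index l s).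
have wb : w 0 b = 1.
  have [f fE] := tower_mpoly ('X_b - 1 : {mpoly C[N.+1]}) idx.
  have : tev N.+1 v f = 0.
    apply: Hv => _ [x xb ->]; rewrite fE rmorphB rmorph1 /= mevalXU cE /aff divff ?subrr //.
  by rewrite fE rmorphB rmorph1 /= mevalXU mxE => /eqP; rewrite subr_eq0 => /eqP.
have w0 : w != 0 by apply/eqP => w0; have := oner_neq0 C; rewrite -wb w0 mxE eqxx.
have dw : \dim <[w]> == 1%N by rewrite dim_vline w0.
pose q : proj_space R N := exist _ <[w]>%VS dw.
have [c vc] : exists c, vpick (val q) = c *: w.
  by have /vlineP[c cE'] := memv_pick (val q); exists c.
have c0 : c != 0.
  apply/eqP => c0; move: vc; rewrite c0 scale0r => /eqP; rewrite vpick0 /= => /eqP q0.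
  by have := dw; rewrite q0 dimv0.
have Xq : pv_set X q.
  apply: contrapT => nX; have [d [H [hH Hq HX]]] := closed_limit (@pv_closed _ _ X) nX.
  have [f fE] := tower_mpoly H idx.
  have : tev N.+1 v f = 0.
    apply: Hv => _ [x xb ->]; rewrite fE; under meval_eq do rewrite cE.
    have := HX (val x) (set_mem (valP x)); rewrite (heval_aff hH xb) => /eqP.
    by rewrite mulf_eq0 expf_eq0 (negbTE xb) andbF => /eqP.
  rewrite fE => H0; move: Hq; rewrite /heval.
  have -> : (fun j => vpick (val q) 0 j) = (fun j => c * v (index j s)).
    by apply: funext => j; rewrite vc !mxE.
  by rewrite (meval_homog _ _ hH) H0 mulr0 eqxx.
exists (SigSub (mem_set Xq)).
  by rewrite /= -[vpick _]/(vpick (val q)) vc mxE wb mulr1.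
move=> k kN; have kE : k = index (nth b s k) s by rewrite index_uniq // ss.
have hq l : vpick (val q) 0 l = c * w 0 l by rewrite vc mxE.
rewrite {1}kE cE -[LHS]/(vpick (val q) 0 (nth b s k) / vpick (val q) 0 b) !hq wb mulr1.
by rewrite mulrAC divff // mul1r mxE -kE.
Qed.

End AffineChart.

Import Order.TTheory Num.Theory.
Section Sheets.

(** A chart, seen as a tower of algebraic equations over the complement of the
    zeros of [D] in an affine space. *)
Record sheeted : Type := Sheeted {
  sh_b : 'I_N.+1;
  sh_s : seq 'I_N.+1;
  sh_m : nat;
  sh_D : tower C sh_m;
  sh_Q : forall i, {poly tower C i};
  sh_uniq : uniq sh_s;
  sh_size : size sh_s = N.+1;
  sh_mN : (sh_m <= N.+1)%N;
  sh_ex : exists x : pts, hc x sh_b != 0;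
  sh_free : forall f : tower C sh_m, vanishes (chart_points sh_b sh_s) f -> f = 0;
  sh_min : forall i, (sh_m <= i < N.+1)%N -> minimal_equation (chart_points sh_b sh_s) (sh_Q i);
  sh_lead : forall i, (sh_m <= i < N.+1)%N -> exists E : tower C i,
    forall w, chart_points sh_b sh_s w -> tev i w E * tev i w (lead_coef (sh_Q i)) = tev sh_m w sh_D;
  sh_deriv : forall i, (sh_m <= i < N.+1)%N -> exists E : tower C i.+1,
    forall w, chart_points sh_b sh_s w ->
      tev i.+1 w E * tev i.+1 w ((sh_Q i)^`() : {poly tower C i}) = tev sh_m w sh_D
}.

Variable H : sheeted.
Notation b := (sh_b H).
Notation m := (sh_m H).
Notation D := (sh_D H).
Notation Q := (sh_Q H).
Notation S := (chart_points b (sh_s H)).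

Definition cr (x : pts) : nat -> C := coords b (sh_s H) x.

Definition X0 (x : pts) : Prop := hc x b != 0 /\ tev m (cr x) D != 0.

Lemma X0_S x : X0 x -> S (cr x).
Proof. by move=> [xb _]; exists x. Qed.

Lemma X0_eq x i : X0 x -> (m <= i < N.+1)%N -> tev i.+1 (cr x) (Q i) = 0.
Proof. by move=> /X0_S Sx /(sh_min (s := H))[+ _ _]; apply. Qed.

Lemma X0_lead x i : X0 x -> (m <= i < N.+1)%N -> tev i (cr x) (lead_coef (Q i)) != 0.
Proof.
move=> Xx /(sh_lead (s := H))[E /(_ _ (X0_S Xx)) h].
by case: Xx => _; rewrite -h mulf_eq0 negb_or => /andP[].
Qed.

Lemma X0_slope x i : X0 x -> (m <= i < N.+1)%N -> @slope C i.+1 (cr x) (cr x) i (Q i) != 0.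
Proof.
move=> Xx /(sh_deriv (s := H))[E /(_ _ (X0_S Xx)) h]; rewrite slope_top.
by case: Xx => _; rewrite -h mulf_eq0 negb_or => /andP[].
Qed.

Lemma cr_inj (x y : pts) : hc x b != 0 -> hc y b != 0 -> (forall k, (k < N.+1)%N -> cr x k = cr y k) -> x = y.
Proof.
move=> xb yb E; do 2 apply: val_inj.
have ins l : l \in sh_s H.
  have sub : {subset sh_s H <= enum 'I_N.+1} by move=> j _; rewrite mem_enum.
  have sz : (size (enum 'I_N.+1) <= size (sh_s H))%N by rewrite sh_size size_enum_ord.
  by have [_ ->] := uniq_min_size (sh_uniq H) sub sz; rewrite mem_enum.
have aE l : aff b l x = aff b l y.
  have lN : (index l (sh_s H) < N.+1)%N by have := ins l; rewrite -index_mem sh_size.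
  by have := E _ lN; rewrite /cr /coords sh_size lN nth_index.
have wE : vpick (val (val x)) = (hc x b / hc y b) *: vpick (val (val y)).
  apply/rowP => l; rewrite mxE; have := aE l; rewrite /aff => /(congr1 (fun t => t * hc x b)).
  by rewrite mulfVK // => ->; rewrite mulrAC [in RHS]mulrC mulrA.
have h (w : pts) : <[vpick (val (val w))]>%VS = val (val w).
  apply/eqP; rewrite eqEdim -memvE memv_pick (eqP (valP (val w))) dim_vline.
  have [c wc] := vpick_neq0 w; rewrite lt0b; apply: contraNneq wc => ->.
  by rewrite mxE.
rewrite -(h x) -(h y); apply/eqP; rewrite eqEdim wE -memvE memvZ ?memv_line //.
have v0 (w : pts) : vpick (val (val w)) != 0.
  have [c wc] := vpick_neq0 w; by apply: contraNneq wc => ->; rewrite mxE.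
by rewrite -wE !dim_vline !v0.
Qed.

Lemma fibre_finite : exists B : nat, forall z : nat -> C, exists l : seq pts,
  [/\ uniq l, (size l <= B)%N &
   forall x, (x \in l) <-> X0 x /\ forall k, (k < m)%N -> cr x k = z k].
Proof.
have step i : (m <= i <= N.+1)%N -> exists B : nat, forall z : nat -> C, exists l : seq (seq C),
    (size l <= B)%N /\ forall x, X0 x -> (forall k, (k < m)%N -> cr x k = z k) -> mkseq (cr x) i \in l.
  elim: i => [|i IH].
    rewrite leqn0 => /andP[/eqP m0 _]; exists 1%N => z; by exists [:: [::]]; split.
  move=> /andP[]; rewrite leq_eqVlt => /orP[/eqP mi _|mi iN].
    exists 1%N => z; exists [:: mkseq z i.+1]; split=> // x _ xz; rewrite mem_seq1.
    apply/eqP; apply: (@eq_from_nth _ 0); rewrite !size_mkseq // => k ki.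
    by rewrite !nth_mkseq // xz // mi.
  have mi' : (m <= i < N.+1)%N by rewrite -ltnS mi.
  have [B HB] := IH (introT andP (conj (mi : (m <= i)%N) (ltnW iN))).
  exists (B * size (Q i))%N => z; have [l [sl lP]] := HB z.
  pose P (w : seq C) : {poly C} := map_poly (tev i (nth 0 w)) (Q i).
  have rt w : exists r : seq C, (size r <= size (Q i))%N /\ (P w != 0 -> forall y : C, root (P w) y -> y \in r).
    have [r pE] := closed_field_poly_normal (P w).
    have [P0|Pn0] := eqVneq (P w) 0; first by exists [::].
    exists r; split=> [|_ y]; last by rewrite {1}pE rootZ ?lead_coef_eq0 // root_prod_XsubC.
    have : size (P w) = (size r).+1 by rewrite {1}pE size_scale ?lead_coef_eq0 // size_prod_XsubC.
    move=> E; apply: ltnW; rewrite -E; exact: size_poly.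
  have [r rP] := choice rt.
  exists [seq rcons w y | w <- l, y <- r w]; split.
    rewrite size_allpairs_dep; apply: leq_trans (leq_mul sl (leqnn _)).
    elim: (l) => //= w l' IHl; rewrite mulSn leq_add //; exact: (rP w).1.
  move=> x Xx xz; have wl := lP x Xx xz; rewrite mkseqS; apply/allpairsPdep.
  exists (mkseq (cr x) i), (cr x i); split=> //; apply: (rP _).2.
    have ev : tev i (nth 0 (mkseq (cr x) i)) (lead_coef (Q i)) != 0.
      rewrite (@tev_ext _ i _ (cr x)) ?(X0_lead Xx) // => k ki; by rewrite nth_mkseq.
    by rewrite /P -lead_coef_eq0 lead_coef_map_id0 // rmorph0.
  rewrite /root; have := X0_eq Xx mi' => /= E.
  apply/eqP; rewrite -[RHS]E /horner_eval /P; congr (_.[_]).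
  by apply: eq_map_poly => g; apply: tev_ext => k ki; rewrite nth_mkseq.
have [B HB] := step N.+1 (introT andP (conj (sh_mN H) (leqnn _))).
exists B => z; have [l [sl lP]] := HB z.
pose inl (w : seq C) (x : pts) := X0 x /\ (forall k, (k < m)%N -> cr x k = z k) /\ mkseq (cr x) N.+1 = w.
pose f (w : seq C) : seq pts := if pselect (exists x, inl w x) is left h then [:: projT1 (cid h)] else [::].
pose l' := undup (flatten [seq f w | w <- l]).
have fP w x : x \in f w -> inl w x.
  rewrite /f; case: pselect => // h; rewrite mem_seq1 => /eqP ->; exact: projT2 (cid h).
exists l'; split; first exact: undup_uniq.
  apply: leq_trans (size_undup _) (leq_trans _ sl).
  elim: (l) => //= w t IHt; rewrite size_cat -[X in (_ <= X)%N]add1n leq_add //.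
  by rewrite /f; case: pselect.
move=> x; rewrite mem_undup; split=> [/flattenP[t /mapP[w wl ->] /fP[Xx [xz _]]]|[Xx xz]] //.
apply/flattenP; exists (f (mkseq (cr x) N.+1)); first by apply: map_f; exact: lP.
rewrite /f; case: pselect => [h|[]]; last by exists x.
have [Xy [yz E]] := projT2 (cid h); rewrite mem_seq1; apply/eqP; apply: cr_inj; [by case: Xx|by case: Xy|].
move=> k kN; have := congr1 (fun t : seq C => nth 0 t k) E; by rewrite !nth_mkseq.
Qed.

Section Limits.
Variables (J : Type) (G : ultrafilter J).

Definition conv (xs : J -> pts) x : Prop :=
  forall k, (k < N.+1)%N -> tends G (fun n => cr (xs n) k) (cr x k).

Lemma conv_tev xs x n (f : tower C n) : (n <= N.+1)%N -> conv xs x ->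
  tends G (fun j => tev n (cr (xs j)) f) (tev n (cr x) f).
Proof. by move=> nN xx; apply: tends_tev => k kn; apply: xx; exact: leq_trans nN. Qed.

Lemma sheet_exists x (z : J -> nat -> C) : X0 x ->
  (forall k, (k < m)%N -> tends G (fun n => z n k) (cr x k)) ->
  exists xs : J -> pts, conv xs x /\
    G [set n | X0 (xs n) /\ forall k, (k < m)%N -> cr (xs n) k = z n k].
Proof.
move=> Xx zx.
have step i : (m <= i <= N.+1)%N -> exists w : J -> nat -> C,
    [/\ forall n k, (k < m)%N -> w n k = z n k,
        forall k, (k < i)%N -> tends G (fun n => w n k) (cr x k) &
        G [set n | forall k, (m <= k < i)%N -> tev k.+1 (w n) (Q k) = 0]].
  elim: i => [|i IH].
    rewrite leqn0 => /andP[/eqP m0 _]; exists z; split=> //.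
    by apply: aeT => n k; rewrite ltn0 andbF.
  move=> /andP[]; rewrite leq_eqVlt => /orP[/eqP mi _|mi iN].
    exists z; split=> // [k ki|]; first by apply: zx; rewrite mi.
    apply: aeT => n k; rewrite mi => /andP[h1 h2].
    by have := leq_trans h2 h1; rewrite ltnn.
  have mi' : (m <= i < N.+1)%N by rewrite -ltnS mi.
  have [w [wz wx wQ]] := IH (introT andP (conj (mi : (m <= i)%N) (ltnW iN))).
  pose P n : {poly C} := map_poly (tev i (w n)) (Q i).
  have lead : tends G (fun n => tev i (w n) (lead_coef (Q i))) (tev i (cr x) (lead_coef (Q i))).
    exact: tends_tev.
  have lead0 := tends_neq0 lead (X0_lead Xx mi').
  have sQ : (1 < size (Q i))%N.
    exact: minimal_size (sh_min mi').
  have rt n : exists r, tev i (w n) (lead_coef (Q i)) != 0 -> root (P n) r /\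
      `|tev i (w n) (lead_coef (Q i))| * `|cr x i - r| ^+ (size (Q i)).-1 <= `|(P n).[cr x i]|.
    have [->|l0] := eqVneq (tev i (w n) (lead_coef (Q i))) 0; first by exists 0.
    have sP : size (P n) = size (Q i) by rewrite size_map_poly_id0.
    have [|r rr hr] := @close_root R (P n) (cr x i); first by rewrite sP.
    exists r => _; split=> //; move: hr.
    by rewrite sP lead_coef_map_id0 ?rmorph0.
  have [r rP] := choice rt.
  have P0 : tends G (fun n => (P n).[cr x i]) 0.
    pose w' n k := if k == i then cr x i else w n k.
    have : tends G (fun n => tev i.+1 (w' n) (Q i)) (tev i.+1 (cr x) (Q i)).
      apply: tends_tev => k; rewrite ltnS leq_eqVlt /w' => /orP[/eqP ->|ki].
        by rewrite eqxx; exact: tends_cst.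
      by rewrite ltn_eqF //; exact: wx.
    rewrite (X0_eq Xx mi'); apply: tends_ext; apply: aeT => n /=.
    rewrite /horner_eval /w' eqxx; congr (_.[_]); apply: eq_map_poly => g.
    by apply: tev_ext => k ki; rewrite ltn_eqF.
  have rx : tends G r (cr x i).
    have h : tends G (fun n => (tev i (w n) (lead_coef (Q i)))^-1 * (P n).[cr x i]) 0.
      have := tendsM (tendsV lead (X0_lead Xx mi')) P0; by rewrite mulr0.
    have : tends G (fun n => (cr x i - r n) ^+ (size (Q i)).-1) 0.
      apply: (tends_squeeze h); apply: (aeS lead0) => n /= l0.
      rewrite normrM normfV normrX mulrC ler_pdivlMr ?normr_gt0 // mulrC.
      by have [] := rP n l0.
    move/tends_pow0 => /(_ _) h2; have := h2 ltac:(by case: (size (Q i)) sQ => [|[]]).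
    move=> h3; have := tendsB (tends_cst (cr x i)) h3; rewrite subr0.
    by apply: tends_ext; apply: aeT => n /=; rewrite subKr.
  exists (fun n k => if k == i then r n else w n k); split.
  - by move=> n k km; rewrite ltn_eqF ?wz // (leq_trans km).
  - move=> k; rewrite ltnS leq_eqVlt => /orP[/eqP ->|ki]; first by rewrite eqxx.
    by rewrite ltn_eqF //; exact: wx.
  apply: (aeS (ae_and wQ lead0)) => n [Qn l0] k /andP[mk]; rewrite ltnS leq_eqVlt.
  move=> /orP[/eqP ->|ki].
    have [+ _] := rP n l0; rewrite /root => /eqP; rewrite /= /horner_eval eqxx => E; rewrite -[RHS]E.
    congr (_.[_]); apply: eq_map_poly => g; apply: tev_ext => k' ki; by rewrite ltn_eqF.
  rewrite -[RHS](Qn k (introT andP (conj mk ki))); apply: (@tev_ext _ k.+1) => k' kk.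
  by rewrite ltn_eqF // (leq_trans kk).
have [w [wz wx wQ]] := step N.+1 (introT andP (conj (sh_mN H) (leqnn _))).
have Dw : G [set n | tev m (w n) D != 0].
  apply: (tends_neq0 (l := tev m (cr x) D)); last by case: Xx.
  by apply: tends_tev => k km; apply: wx; exact: leq_trans (sh_mN H).
have good : G [set n | exists y, X0 y /\ forall k, (k < N.+1)%N -> cr y k = w n k].
  apply: (aeS (ae_and wQ Dw)) => n [Qn Dn].
  have [|y yb yw] := @chart_closed b (sh_s H) (w n) (sh_uniq H) (sh_size H).
    move=> f; apply: (@vanishes_at C S m N.+1 (@sh_free H) N.+1 Q).
      by rewrite (sh_mN H) leqnn.
    move=> i mi; split; [exact: sh_min|exact: Qn|].
    by have [E hE] := sh_lead mi; exists E, D.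
  exists y; split=> //; split=> //; rewrite (@tev_ext _ m _ (w n)) // => k km.
  by apply: yw; exact: leq_trans (sh_mN H).
pose xs n := if pselect (exists y, X0 y /\ forall k, (k < N.+1)%N -> cr y k = w n k) is left h
  then projT1 (cid h) else x.
have xsP : G [set n | X0 (xs n) /\ forall k, (k < N.+1)%N -> cr (xs n) k = w n k].
  apply: (aeS good) => n /=; rewrite /xs; case: pselect => // h _; exact: projT2 (cid h).
exists xs; split=> [k kN|].
  apply: (tends_ext _ (wx k kN)); apply: (aeS xsP) => n [/= _ ->] //.
apply: (aeS xsP) => n [/= Xn E]; split=> // k km; rewrite E ?wz //.
exact: leq_trans (sh_mN H).
Qed.

(** The increments of the coordinates along a sheet. *)
Lemma sheet_increment x (x1 x2 : J -> pts) i : X0 x -> conv x1 x -> conv x2 x ->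
  G [set n | X0 (x1 n)] -> G [set n | X0 (x2 n)] -> (m <= i < N.+1)%N ->
  exists t : nat -> J -> C, (forall k, (k < i)%N ->
      tends G (t k) (- (@slope C i.+1 (cr x) (cr x) i (Q i))^-1 * @slope C i.+1 (cr x) (cr x) k (Q i))) /\
    G [set n | cr (x2 n) i - cr (x1 n) i = \sum_(k < i) (cr (x2 n) k - cr (x1 n) k) * t k n].
Proof.
move=> Xx c1 c2 X1 X2 mi; have /andP[_ iN] := mi.
pose sl k n := @slope C i.+1 (cr (x1 n)) (cr (x2 n)) k (Q i).
have slx k : tends G (sl k) (@slope C i.+1 (cr x) (cr x) k (Q i)).
  by apply: tends_slope => l li; [apply: c1|apply: c2]; exact: leq_trans iN.
have top0 := tends_neq0 (slx i) (X0_slope Xx mi).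
exists (fun k n => - (sl i n)^-1 * sl k n); split=> [k ki|].
  apply: (tendsM _ (slx k)); apply: tendsN; exact: (tendsV (slx i) (X0_slope Xx mi)).
apply: (aeS (ae_and top0 (ae_and X1 X2))) => n [/= t0 [X1n X2n]].
have := @tev_increment C i.+1 (cr (x1 n)) (cr (x2 n)) (Q i).
rewrite !X0_eq // subrr big_ord_recr => E0.
have E : (cr (x2 n) i - cr (x1 n) i) * sl i n
    = - \sum_(k < i) (cr (x2 n) k - cr (x1 n) k) * sl k n.
  by apply/eqP; rewrite -addr_eq0 addrC; apply/eqP/esym.
apply: (mulIf t0); rewrite E mulr_suml -sumrN; apply: eq_bigr => k _ /=.
by field.
Qed.

Lemma sheet_unique x (x1 x2 : J -> pts) : X0 x -> conv x1 x -> conv x2 x ->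
  G [set n | X0 (x1 n)] -> G [set n | X0 (x2 n)] ->
  G [set n | forall k, (k < m)%N -> cr (x1 n) k = cr (x2 n) k] -> G [set n | x1 n = x2 n].
Proof.
move=> Xx c1 c2 X1 X2 e12.
have step i : (m <= i <= N.+1)%N -> G [set n | forall k, (k < i)%N -> cr (x1 n) k = cr (x2 n) k].
  elim: i => [_|i IH]; first exact: aeT.
  move=> /andP[]; rewrite leq_eqVlt => /orP[/eqP <- _ //|mi iN].
  have mi' : (m <= i < N.+1)%N by rewrite -ltnS mi.
  have [t [_ tE]] := sheet_increment Xx c1 c2 X1 X2 mi'.
  apply: (aeS (ae_and tE (IH (introT andP (conj (mi : (m <= i)%N) (ltnW iN)))))) => n [/= E En].
  move=> k; rewrite ltnS leq_eqVlt => /orP[/eqP ->|/En //].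
  apply/eqP; rewrite eq_sym -subr_eq0 E big1 // => l _.
  by rewrite En // subrr mul0r.
have h := step N.+1 (introT andP (conj (sh_mN H) (leqnn _))).
apply: (aeS (ae_and h (ae_and X1 X2))) => n [/= E [[b1 _] [b2 _]]].
exact: cr_inj.
Qed.
End Limits.
End Sheets.
Section SheetCalculus.
Implicit Types (x y : pts) (a c : pts -> C).
Variable H : sheeted.
Notation G := omega.
Notation m := (sh_m H).
Notation hb x := (vpick (val (val x)) 0 (sh_b H)).

Definition X0_seq x (xs : nat -> pts) : Prop := conv H G xs x /\ G [set n | X0 H (xs n)].

Definition sheet_pair (j : nat) x (x1 x2 : nat -> pts) (h : nat -> C) : Prop :=
  [/\ X0_seq x x1, X0_seq x x2, tends G h 0 &
      G [set n | forall k, (k < m)%N -> cr H (x2 n) k = cr H (x1 n) k + h n * (k == j)%:R]].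

Definition cont x a : Prop := forall xs, X0_seq x xs -> tends G (fun n => a (xs n)) (a x).

(** [d] and [db] are the derivatives of [a] at [x] with respect to the [j]-th
    free coordinate and to its conjugate. *)
Definition wirtinger j x a (d db : C) : Prop := forall (x1 x2 : nat -> pts) h, sheet_pair j x x1 x2 h ->
  exists p q : nat -> C, [/\ tends G p d, tends G q db &
    G [set n | a (x2 n) - a (x1 n) = h n * p n + (h n)^* * q n]].

Lemma cont_cst x e : cont x (fun=> e).
Proof. by move=> xs _; exact: tends_cst. Qed.
Lemma contD x a c : cont x a -> cont x c -> cont x (fun y => a y + c y).
Proof. by move=> ca cc xs h; apply: tendsD; [exact: ca|exact: cc]. Qed.
Lemma contM x a c : cont x a -> cont x c -> cont x (fun y => a y * c y).
Proof. by move=> ca cc xs h; apply: tendsM; [exact: ca|exact: cc]. Qed.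
Lemma contN x a : cont x a -> cont x (fun y => - a y).
Proof. by move=> ca xs h; apply: tendsN; exact: ca. Qed.
Lemma contV x a : a x != 0 -> cont x a -> cont x (fun y => (a y)^-1).
Proof. by move=> a0 ca xs h; apply: tendsV => //; exact: ca. Qed.
Lemma cont_conj x a : cont x a -> cont x (fun y => (a y)^*).
Proof. by move=> ca xs h; apply: tends_conj; exact: ca. Qed.
Lemma contX x a k : cont x a -> cont x (fun y => a y ^+ k).
Proof. by move=> ca xs h; apply: tendsX; exact: ca. Qed.
Lemma cont_norm x a : cont x a -> cont x (fun y => `|a y|).
Proof. by move=> ca xs h; apply: tends_norm; exact: ca. Qed.

Lemma wirtinger_cst j x e : wirtinger j x (fun=> e) 0 0.
Proof.
move=> x1 x2 h _; exists (fun=> 0), (fun=> 0); split; try exact: tends_cst.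
by apply: aeT => n /=; rewrite !mulr0 subrr addr0.
Qed.

Lemma wirtingerD j x a c d db e eb : wirtinger j x a d db -> wirtinger j x c e eb ->
  wirtinger j x (fun y => a y + c y) (d + e) (db + eb).
Proof.
move=> ha hb x1 x2 h hp; have [p [q [pd qd E]]] := ha _ _ _ hp.
have [p' [q' [pd' qd' E']]] := hb _ _ _ hp.
exists (fun n => p n + p' n), (fun n => q n + q' n); split; try exact: tendsD.
apply: (aeS (ae_and E E')) => n [/= e1 e2].
by rewrite opprD addrACA e1 e2; ring.
Qed.

Lemma wirtingerM j x a c d db e eb : cont x a -> cont x c ->
  wirtinger j x a d db -> wirtinger j x c e eb ->
  wirtinger j x (fun y => a y * c y) (a x * e + c x * d) (a x * eb + c x * db).
Proof.
move=> ca cc ha hb x1 x2 h hp; have [p [q [pd qd E]]] := ha _ _ _ hp.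
have [p' [q' [pd' qd' E']]] := hb _ _ _ hp; have [h1 h2 _ _] := hp.
exists (fun n => a (x1 n) * p' n + c (x2 n) * p n), (fun n => a (x1 n) * q' n + c (x2 n) * q n); split.
- by apply: tendsD; apply: tendsM => //; [exact: ca|exact: cc].
- by apply: tendsD; apply: tendsM => //; [exact: ca|exact: cc].
apply: (aeS (ae_and E E')) => n [/= e1 e2].
have -> : a (x2 n) * c (x2 n) - a (x1 n) * c (x1 n)
   = a (x1 n) * (c (x2 n) - c (x1 n)) + c (x2 n) * (a (x2 n) - a (x1 n)) by ring.
by rewrite e1 e2; ring.
Qed.

Lemma wirtinger_conj j x a d db : wirtinger j x a d db ->
  wirtinger j x (fun y => (a y)^*) db^* d^*.
Proof.
move=> ha x1 x2 h hp; have [p [q [pd qd E]]] := ha _ _ _ hp.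
exists (fun n => (q n)^*), (fun n => (p n)^*); split; try exact: tends_conj.
apply: (aeS E) => n /= e1; rewrite -rmorphB e1 rmorphD !rmorphM /= conjCK.
by rewrite addrC.
Qed.

Lemma wirtinger_ext j x a c d db : (forall xs, X0_seq x xs -> G [set n | a (xs n) = c (xs n)]) ->
  wirtinger j x a d db -> wirtinger j x c d db.
Proof.
move=> ac ha x1 x2 h hp; have [p [q [pd qd E]]] := ha _ _ _ hp; have [h1 h2 _ _] := hp.
exists p, q; split=> //; apply: (aeS (ae_and E (ae_and (ac _ h1) (ac _ h2)))) => n [/= e1 [<- <-]] //.
Qed.

(** Composition with a function which has a slope. *)
Lemma wirtinger_comp j x a (f : C -> C) d db (s : C) : wirtinger j x a d db ->
  (forall x1 x2 : nat -> pts, X0_seq x x1 -> X0_seq x x2 -> exists t, tends G t s /\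
     G [set n | f (a (x2 n)) - f (a (x1 n)) = t n * (a (x2 n) - a (x1 n))]) ->
  wirtinger j x (fun y => f (a y)) (s * d) (s * db).
Proof.
move=> ha hf x1 x2 h hp; have [p [q [pd qd E]]] := ha _ _ _ hp; have [h1 h2 _ _] := hp.
have [t [ts tE]] := hf _ _ h1 h2.
exists (fun n => t n * p n), (fun n => t n * q n); split; try exact: tendsM.
by apply: (aeS (ae_and E tE)) => n [/= e1 e2]; rewrite e2 e1; ring.
Qed.

Lemma wirtingerV j x a d db : cont x a -> a x != 0 -> wirtinger j x a d db ->
  wirtinger j x (fun y => (a y)^-1) (- (a x)^-1 ^+ 2 * d) (- (a x)^-1 ^+ 2 * db).
Proof.
move=> ca a0 ha; apply: (wirtinger_comp (f := GRing.inv)) ha _ => x1 x2 h1 h2.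
have t1 := ca _ h1; have t2 := ca _ h2.
exists (fun n => - ((a (x1 n))^-1 * (a (x2 n))^-1)); split.
  by rewrite expr2; apply: tendsN; apply: tendsM; exact: tendsV.
apply: (aeS (ae_and (tends_neq0 t1 a0) (tends_neq0 t2 a0))) => n [/= e1 e2].
by field; rewrite e1 e2.
Qed.

Lemma wirtingerN j x a d db : wirtinger j x a d db -> wirtinger j x (fun y => - a y) (- d) (- db).
Proof.
move=> ha x1 x2 h hp; have [p [q [pd qd E]]] := ha _ _ _ hp.
exists (fun n => - p n), (fun n => - q n); split; try exact: tendsN.
by apply: (aeS E) => n /= e1; rewrite -[LHS]opprD e1; ring.
Qed.

Lemma delta_gt0 n : 0 < (n.+1%:R^-1 : C).
Proof. by rewrite invr_gt0 ltr0Sn. Qed.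

Lemma tends_delta : tends G (fun n => n.+1%:R^-1 : C) 0.
Proof.
move=> e e0.
have [k hk] : exists k : nat, e^-1 < k%:R.
  have e1 : 0 <= e^-1 by rewrite invr_ge0 ltW.
  have [er ei] : 0 <= complex.Re e^-1 /\ complex.Im e^-1 = 0.
    by move: e1; rewrite lecE /= => /andP[/eqP <- ->].
  exists (Num.truncn (complex.Re e^-1)).+1.
  rewrite -(raddfMn (complex.real_complex R)) /= ltcE /= ei eqxx /= .
  by rewrite Num.Theory.truncnS_gt.
apply: (aeS (G_free k)) => n /= kn; rewrite subr0 ger0_norm; last exact: ltW (delta_gt0 n).
rewrite -[e]invrK ltf_pV2 ?posrE ?ltr0Sn ?invr_gt0 //.
by apply: lt_le_trans hk _; rewrite ler_nat ltnW.
Qed.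

Lemma X0_seq_cst x : X0 H x -> X0_seq x (fun=> x).
Proof. by move=> Xx; split=> [k _|]; [exact: tends_cst|exact: aeT]. Qed.

Lemma pair_exists j x h : X0 H x -> tends G h 0 -> exists x2 : nat -> pts, sheet_pair j x (fun=> x) x2 h.
Proof.
move=> Xx h0; pose z n k := cr H x k + h n * (k == j)%:R.
have [|xs [cx Ex]] := @sheet_exists _ _ omega x z Xx.
  move=> k _; rewrite -[X in tends G _ X]addr0; apply: tendsD; first exact: tends_cst.
  by have := tendsM h0 (tends_cst ((k == j)%:R)); rewrite mul0r.
exists xs; split=> //; first exact: X0_seq_cst.
  by split=> //; apply: (aeS Ex) => n [].
by apply: (aeS Ex) => n [_ /=] E k km; rewrite E.
Qed.

Lemma wirtinger_uniq j x a d db e eb : X0 H x ->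
  wirtinger j x a d db -> wirtinger j x a e eb -> d = e /\ db = eb.
Proof.
move=> Xx ha hb.
have lim (u : C) : `|u| = 1 -> d + u^* / u * db = e + u^* / u * eb.
  move=> u1; have u0 : u != 0 by rewrite -normr_gt0 u1 ltr01.
  pose h n : C := u * n.+1%:R^-1.
  have h0 : tends G h 0 by have := tendsM (tends_cst u) tends_delta; rewrite mulr0.
  have [x2 hp] := pair_exists j Xx h0.
  have [p [q [pd qd E]]] := ha _ _ _ hp; have [p' [q' [pd' qd' E']]] := hb _ _ _ hp.
  have t1 := tendsD pd (tendsM (tends_cst (u^* / u)) qd).
  have t2 := tendsD pd' (tendsM (tends_cst (u^* / u)) qd').
  apply: (tends_uniq t1); apply: (tends_ext _ t2).
  apply: (aeS (ae_and E E')) => n [/= -> e2].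
  have hn : h n != 0 := mulf_neq0 u0 (lt0r_neq0 (delta_gt0 n)).
  have hc0 : (h n)^* = h n * (u^* / u).
    rewrite /h rmorphM /= fmorphV rmorph_nat.
    by field; rewrite u0 nat1r pnatr_eq0.
  have E3 : h n * (p n + u^* / u * q n) = h n * (p' n + u^* / u * q' n).
    have aux r : h n * (u^* / u * r) = (h n)^* * r by rewrite mulrA -hc0.
    by rewrite !mulrDr !aux.
  by apply/esym; move/(mulfI hn): E3.
have l1 := lim 1 (normr1 _); have l2 := lim 'i (normCi _).
move: l1 l2; rewrite conjC1 divr1 !mul1r conjCi mulNr divff ?neq0Ci // !mulN1r => l1 l2.
have hd : d = e.
  have : d + d = e + e.
    have -> : d + d = (d + db) + (d - db) by ring.
    by rewrite l1 l2; ring.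
  by move/eqP; rewrite -!mulr2n eqrMn2r // => /eqP.
by split=> //; move: l1; rewrite hd => /addrI.
Qed.

(** ** Regular functions *)

Lemma regat_tower x (f : pts -> C) : hb x != 0 -> regat x f ->
  exists p q : tower C N.+1, tev N.+1 (cr H x) q != 0 /\
    locally x (fun y => tev N.+1 (cr H y) q != 0 /\ f y = tev N.+1 (cr H y) p / tev N.+1 (cr H y) q).
Proof.
move=> xb /regat_frac[d [P [Q [hP hQ PQ]]]].
have ins l : l \in sh_s H.
  have sub : {subset sh_s H <= enum 'I_N.+1} by move=> j _; rewrite mem_enum.
  have sz : (size (enum 'I_N.+1) <= size (sh_s H))%N by rewrite sh_size size_enum_ord.
  by have [_ ->] := uniq_min_size (sh_uniq H) sub sz; rewrite mem_enum.
have idx l : (index l (sh_s H) < N.+1)%N by have := ins l; rewrite -index_mem sh_size.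
have cE y l : cr H y (index l (sh_s H)) = aff (sh_b H) l y.
  by rewrite /cr /coords index_mem ins nth_index.
have [p pE] := tower_mpoly P idx; have [q qE] := tower_mpoly Q idx.
have pv y F : F.@[fun i => cr H y (index i (sh_s H))] = F.@[fun l => aff (sh_b H) l y].
  by congr (_.@[_]); apply: funext => l; exact: cE.
have E y : hb y != 0 -> heval Q (val y) != 0 -> f y = heval P (val y) / heval Q (val y) ->
    tev N.+1 (cr H y) q != 0 /\ f y = tev N.+1 (cr H y) p / tev N.+1 (cr H y) q.
  move=> yb Qy ->; rewrite pE qE !pv (heval_aff hP yb) (heval_aff hQ yb).
  split; first by move: Qy; rewrite (heval_aff hQ yb) mulf_eq0 negb_or => /andP[].
  by rewrite cancel_fraction // expf_neq0.
exists p, q; split; first by have [Qx fx] := locally_at PQ; have [] := E x xb Qx fx.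
apply: locally_mono (locally_and PQ (locally_chart xb)) => y [[Qy fy] yb]; exact: E.
Qed.

Lemma locally_ae x (P : pts -> Prop) xs : hb x != 0 -> locally x P -> X0_seq x xs ->
  G [set n | P (xs n)].
Proof.
move=> xb [W [Wx WP]] [cx X0n]; have [d [F [hF Fx FW]]] := open_homog Wx.
have ins l : l \in sh_s H.
  have sub : {subset sh_s H <= enum 'I_N.+1} by move=> j _; rewrite mem_enum.
  have sz : (size (enum 'I_N.+1) <= size (sh_s H))%N by rewrite sh_size size_enum_ord.
  by have [_ ->] := uniq_min_size (sh_uniq H) sub sz; rewrite mem_enum.
have idx l : (index l (sh_s H) < N.+1)%N by have := ins l; rewrite -index_mem sh_size.
have [p pE] := tower_mpoly F idx.
have pF y : hb y != 0 -> heval F (val y) = hb y ^+ d * tev N.+1 (cr H y) p.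
  move=> yb; rewrite (heval_aff hF yb) pE; congr (_ * _.@[_]); apply: funext => l.
  by rewrite /cr /coords index_mem ins nth_index.
have px : tev N.+1 (cr H x) p != 0 by move: Fx; rewrite (pF x xb) mulf_eq0 negb_or => /andP[].
have h := tends_neq0 (conv_tev p (leqnn _) cx) px.
apply: (aeS (ae_and h X0n)) => n [/= pn [bn _]]; apply/WP/FW.
by rewrite (pF _ bn) mulf_neq0 // expf_neq0.
Qed.

Lemma cont_tev x n (f : tower C n) : (n <= N.+1)%N -> cont x (fun y => tev n (cr H y) f).
Proof. by move=> nN xs [cx _]; exact: conv_tev. Qed.

Lemma regat_cont x a : X0 H x -> regat x a -> cont x a.
Proof.
move=> Xx ra xs h; have [p [q [q0 E]]] := regat_tower Xx.1 ra.
have h1 := locally_ae Xx.1 E h; have [_ ->] := locally_at E.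
apply: (tends_ext (s := fun n => tev N.+1 (cr H (xs n)) p / tev N.+1 (cr H (xs n)) q)).
  by apply: (aeS h1) => n [/= _ ->].
by apply: tendsM; [|apply: tendsV => //]; exact: (cont_tev _ (leqnn _)).
Qed.

Lemma wirtinger_cr j x : X0 H x -> exists d : nat -> C,
  (forall k, (k < N.+1)%N -> wirtinger j x (fun y => cr H y k) (d k) 0) /\
  forall k, (k < N.+1)%N -> d k = if (k < m)%N then (k == j)%:R else
   - (@slope C k.+1 (cr H x) (cr H x) k (sh_Q H k))^-1 *
     \sum_(l < k) @slope C k.+1 (cr H x) (cr H x) l (sh_Q H k) * d l.
Proof.
move=> Xx.
have step n : (n <= N.+1)%N -> exists d : nat -> C,
  (forall k, (k < n)%N -> wirtinger j x (fun y => cr H y k) (d k) 0) /\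
  forall k, (k < n)%N -> d k = if (k < m)%N then (k == j)%:R else
   - (@slope C k.+1 (cr H x) (cr H x) k (sh_Q H k))^-1 *
     \sum_(l < k) @slope C k.+1 (cr H x) (cr H x) l (sh_Q H k) * d l.
  elim: n => [_|n IH nN]; first by exists (fun=> 0).
  have [d [dw dE]] := IH (ltnW nN).
  pose dn := if (n < m)%N then (n == j)%:R else
   - (@slope C n.+1 (cr H x) (cr H x) n (sh_Q H n))^-1 *
     \sum_(l < n) @slope C n.+1 (cr H x) (cr H x) l (sh_Q H n) * d l.
  have wn : wirtinger j x (fun y => cr H y n) dn 0.
    move=> x1 x2 h hp; have [[c1 X1] [c2 X2] h0 E] := hp.
    rewrite /dn; case: ltnP => [nm|mn].
      exists (fun=> (n == j)%:R), (fun=> 0); split; try exact: tends_cst.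
      by apply: (aeS E) => k /= ->; rewrite // mulr0 addr0 addrC addKr.
    have mnN : (m <= n < N.+1)%N by rewrite mn.
    have [t [tl tE]] := sheet_increment Xx c1 c2 X1 X2 mnN.
    have pq l : exists pq : (nat -> C) * (nat -> C), (l < n)%N -> [/\ tends G pq.1 (d l), tends G pq.2 0 &
        G [set k | cr H (x2 k) l - cr H (x1 k) l = h k * pq.1 k + (h k)^* * pq.2 k]].
      have [ln|ln] := boolP (l < n)%N; last by exists (fun=> 0, fun=> 0).
      by have [p [q [pd qd pqE]]] := dw l ln _ _ _ hp; exists (p, q).
    have [pq' PQ] := choice pq; pose P l := (pq' l).1; pose Q l := (pq' l).2.
    exists (fun k => \sum_(l < n) P l k * t l k), (fun k => \sum_(l < n) Q l k * t l k); split.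
    - rewrite mulr_sumr; apply: tends_sum => l; have [p1 _ _] := PQ l (ltn_ord l).
      have := tendsM p1 (tl l (ltn_ord l)).
      rewrite (_ : d l * _ = - (@slope C n.+1 (cr H x) (cr H x) n (sh_Q H n))^-1 * (@slope C n.+1 (cr H x) (cr H x) l (sh_Q H n) * d l)) //.
      ring.
    - have := @tends_sum _ _ _ _ (index_enum 'I_n) (fun l k => Q l k * t l k) (fun=> 0).
      rewrite big1 //; apply => l; have [_ q1 _] := PQ l (ltn_ord l).
      have := tendsM q1 (tl l (ltn_ord l)); by rewrite !mul0r.
    have all : G [set k | forall l, (l < n)%N -> cr H (x2 k) l - cr H (x1 k) l = h k * P l k + (h k)^* * Q l k].
      have h' i : (i <= n)%N -> G [set k | forall l, (l < i)%N -> cr H (x2 k) l - cr H (x1 k) l = h k * P l k + (h k)^* * Q l k].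
        elim: i => [_|i IHi iN]; first exact: aeT.
        have [_ _ Ei] := PQ i iN.
        apply: (aeS (ae_and Ei (IHi (ltnW iN)))) => k [/= e1 e2] l.
        by rewrite ltnS leq_eqVlt => /orP[/eqP ->|/e2].
      exact: h'.
    apply: (aeS (ae_and tE all)) => k [/= -> El].
    rewrite !mulr_sumr -big_split; apply: eq_bigr => l _ /=.
    by rewrite El //; ring.
  have wE k : (k < n.+1)%N -> (k == n) = ~~ (k < n)%N.
    by move=> kn; rewrite -leqNgt eqn_leq -ltnS kn.
  exists (fun k => if k == n then dn else d k); split=> k kn.
    by case: eqP => [->//|/eqP kne]; apply: dw; move: kne; rewrite wE // negbK.
  have sumE i : (i <= n)%N -> \sum_(l < i) @slope C i.+1 (cr H x) (cr H x) l (sh_Q H i) * (if (l : nat) == n then dn else d l)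
     = \sum_(l < i) @slope C i.+1 (cr H x) (cr H x) l (sh_Q H i) * d l.
    by move=> iN; apply: eq_bigr => l _; rewrite ltn_eqF // (leq_trans (ltn_ord l)).
  case: eqP => [->|/eqP kne]; first by rewrite /dn sumE.
  have kn' : (k < n)%N by move: kne; rewrite wE // negbK.
  by rewrite sumE ?(ltnW kn') // dE.
exact: step.
Qed.

Lemma wirtinger_tev j x (d : nat -> C) n (f : tower C n) : (n <= N.+1)%N ->
  (forall k, (k < n)%N -> wirtinger j x (fun y => cr H y k) (d k) 0) ->
  wirtinger j x (fun y => tev n (cr H y) f) (\sum_(k < n) slope (cr H x) (cr H x) k f * d k) 0.
Proof.
move=> nN dw x1 x2 h hp; have [[c1 X1] [c2 X2] h0 E] := hp.
have pq (l : 'I_n) : exists pq : (nat -> C) * (nat -> C), [/\ tends G pq.1 (d l), tends G pq.2 0 &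
        G [set k | cr H (x2 k) l - cr H (x1 k) l = h k * pq.1 k + (h k)^* * pq.2 k]].
  by have [p [q [pd qd pqE]]] := dw l (ltn_ord l) _ _ _ hp; exists (p, q).
have [pq' PQ] := choice pq; pose P l := (pq' l).1; pose Q l := (pq' l).2.
pose s l k := slope (cr H (x1 k)) (cr H (x2 k)) l f.
have sl l : tends G (s l) (slope (cr H x) (cr H x) l f).
  by apply: tends_slope => k kn; [apply: c1|apply: c2]; exact: leq_trans nN.
exists (fun k => \sum_(l < n) s l k * P l k), (fun k => \sum_(l < n) s l k * Q l k); split.
- by apply: tends_sum => l; have [p1 _ _] := PQ l; exact: tendsM.
- have := @tends_sum _ _ _ _ (index_enum 'I_n) (fun l k => s l k * Q l k) (fun=> 0).
  rewrite big1 //; apply => l; have [_ q1 _] := PQ l.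
  by have := tendsM (sl l) q1; rewrite mulr0.
have all : G [set k | forall l : 'I_n, cr H (x2 k) l - cr H (x1 k) l = h k * P l k + (h k)^* * Q l k].
  have h' (r : seq 'I_n) : G [set k | forall l, l \in r -> cr H (x2 k) l - cr H (x1 k) l = h k * P l k + (h k)^* * Q l k].
    elim: r => [|i r IHi]; first exact: aeT.
    have [_ _ Ei] := PQ i.
    apply: (aeS (ae_and Ei IHi)) => k [/= e1 e2] l.
    by rewrite inE => /orP[/eqP ->|/e2].
  by apply: (aeS (h' (enum 'I_n))) => k /= E' l; apply: E'; rewrite mem_enum.
apply: (aeS all) => k /= El; rewrite tev_increment.
rewrite !mulr_sumr -big_split; apply: eq_bigr => l _ /=.
by rewrite El -/(s l k); ring.
Qed.

Lemma wirtinger_regat j x a : X0 H x -> regat x a -> exists d, wirtinger j x a d 0.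
Proof.
move=> Xx ra; have [p [q [q0 E]]] := regat_tower Xx.1 ra.
have [d [dw _]] := wirtinger_cr j Xx.
have wp := wirtinger_tev p (leqnn _) dw; have wq := wirtinger_tev q (leqnn _) dw.
have cq := cont_tev q (leqnn _) (x := x).
have wqV := wirtingerV cq q0 wq.
have := wirtingerM (cont_tev p (leqnn _)) (contV q0 cq) wp wqV; rewrite !mulr0 addr0 => w.
eexists; apply: wirtinger_ext w => xs h.
by apply: (aeS (locally_ae Xx.1 E h)) => n [/= _ ->].
Qed.


Definition contF a : Prop := forall x, X0 H x -> cont x a.
Definition smooth j a (d db : pts -> C) : Prop :=
  forall x, X0 H x -> wirtinger j x a (d x) (db x).

Section Partial.
Notation cr := (cr H).
Implicit Types (f g : pts -> C) (U V W : op).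

Lemma cr_regat x n (f : tower C n) : hb x != 0 -> regat x (fun y => tev n (cr y) f).
Proof. exact: coords_regat. Qed.

Lemma X0_open x : X0 H x -> locally x (X0 H).
Proof.
move=> [xb D0]; apply: locally_mono (locally_and (locally_chart xb) (regat_neq0 (cr_regat (sh_D H) xb) D0)).
by move=> y [].
Qed.

Fact X0op_open : open [set x | X0 H x].
Proof.
have -> : [set x | X0 H x] = \bigcup_(W in [set W : op | oset W `<=` [set x | X0 H x]]) oset W.
  apply/seteqP; split=> [x Xx|x [W WX Wx]]; last exact: WX.
  by have [W [Wx WX]] := X0_open Xx; exists W.
by apply: bigcup_open => W _; exact: oset_open.
Qed.
Definition X0op : op := Opens X0op_open.

Definition hol f : Prop := forall x, X0 H x -> regat x f.

Definition pdv j f x : C := if pselect (exists d, wirtinger j x f d 0) is left h then projT1 (cid h) else 0.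

Lemma pdv_eq j f x d : X0 H x -> wirtinger j x f d 0 -> pdv j f x = d.
Proof.
move=> Xx w; rewrite /pdv; case: pselect => [h|[]]; last by exists d.
by have [] := wirtinger_uniq Xx (projT2 (cid h)) w.
Qed.

Lemma pdvP j f x : X0 H x -> regat x f -> wirtinger j x f (pdv j f x) 0.
Proof. by move=> Xx rf; have [d w] := wirtinger_regat j Xx rf; rewrite (pdv_eq Xx w). Qed.

Lemma cr_regat1 x k : hb x != 0 -> regat x (fun y => cr y k).
Proof.
move=> xb; case: (ltnP k (size (sh_s H))) => ks.
  apply: (eq_regat (f := aff (sh_b H) (nth (sh_b H) (sh_s H) k))); last exact: aff_regat.
  by apply: locally_all => y; rewrite -[RHS]/(coords _ _ _ _) /coords ks.
apply: (eq_regat (f := fun=> 0)); last exact: regat_cst.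
by apply: locally_all => y; rewrite -[RHS]/(coords _ _ _ _) /coords ltnNge ks.
Qed.

Lemma slope_regat x n k (f : tower C n) : hb x != 0 ->
  regat x (fun y => slope (cr y) (cr y) k f).
Proof.
move=> xb; have rX (l e : nat) : regat x (fun y => cr y l ^+ e).
  elim: e => [|e IH]; first exact: regat_cst.
  by under eq_fun do rewrite exprS; apply: regatM => //; exact: cr_regat1.
elim: n f => [|n IH] f; first exact: regat_cst.
rewrite /=; case: (k == n); apply: regat_sum => i.
  by apply: regatM; [exact: cr_regat|apply: regat_sum => l; exact: regatM].
by apply: regatM.
Qed.

Lemma pdv_cr j x k : X0 H x -> (k < N.+1)%N -> pdv j (fun y => cr y k) x = if (k < m)%N then (k == j)%:R else
   - (@slope C k.+1 (cr x) (cr x) k (sh_Q H k))^-1 *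
     \sum_(l < k) @slope C k.+1 (cr x) (cr x) l (sh_Q H k) * pdv j (fun y => cr y l) x.
Proof.
move=> Xx kN; have [d [dw dE]] := wirtinger_cr j Xx.
rewrite (pdv_eq Xx (dw k kN)) dE //; case: ltnP => // mk; congr (_ * _).
apply: eq_bigr => l _; by rewrite (pdv_eq Xx (dw l (ltn_trans (ltn_ord l) kN))).
Qed.

Lemma pdv_cr_regat j x k : X0 H x -> (k < N.+1)%N -> regat x (pdv j (fun y => cr y k)).
Proof.
move=> Xx; suff h n : forall l, (l < n)%N -> (l < N.+1)%N -> regat x (pdv j (fun y => cr y l)) by exact: (h k.+1).
elim: n => // n IH l; rewrite ltnS leq_eqVlt => /orP[/eqP -> nN|/IH h /h //].
have [nm|mn] := ltnP n m.
  apply: (eq_regat (f := fun=> (n == j)%:R)); last exact: regat_cst.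
  by apply: locally_mono (X0_open Xx) => y Xy; rewrite pdv_cr // nm.
apply: (eq_regat (f := fun y => - (@slope C n.+1 (cr y) (cr y) n (sh_Q H n))^-1 *
     \sum_(l < n) @slope C n.+1 (cr y) (cr y) l (sh_Q H n) * pdv j (fun y => cr y l) y)).
  by apply: locally_mono (X0_open Xx) => y Xy; rewrite pdv_cr // ltnNge mn.
apply: regatM; last first.
  apply: regat_sum => i; apply: regatM; first exact: (slope_regat i (sh_Q H n : tower C n.+1) Xx.1).
  by apply: IH => //; exact: ltn_trans nN.
apply: regatN; apply: regatV; first exact: (slope_regat n (sh_Q H n : tower C n.+1) Xx.1).
by apply: X0_slope => //; rewrite mn.
Qed.

Lemma pdv_tev j x (p : tower C N.+1) : X0 H x ->
  wirtinger j x (fun y => tev N.+1 (cr y) p) (\sum_(k < N.+1) slope (cr x) (cr x) k p * pdv j (fun y => cr y k) x) 0.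
Proof.
move=> Xx; apply: (wirtinger_tev (d := fun k => pdv j (fun y => cr y k) x) p (leqnn _)) => k kN; apply: pdvP => //; exact: (cr_regat1 _ Xx.1).
Qed.

Lemma pdv_regat j x f : X0 H x -> regat x f -> regat x (pdv j f).
Proof.
move=> Xx rf; have [p [q [q0 E]]] := regat_tower Xx.1 rf.
pose P' y := \sum_(k < N.+1) slope (cr y) (cr y) k p * pdv j (fun y => cr y k) y.
pose Q' y := \sum_(k < N.+1) slope (cr y) (cr y) k q * pdv j (fun y => cr y k) y.
have rP' (t : tower C N.+1) : regat x (fun y => \sum_(k < N.+1) slope (cr y) (cr y) k t * pdv j (fun y => cr y k) y).
  by apply: regat_sum => k; apply: regatM; [exact: slope_regat Xx.1|exact: pdv_cr_regat].
have rq : regat x (fun y => (tev N.+1 (cr y) q)^-1) by apply: regatV => //; exact: cr_regat Xx.1.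
apply: (eq_regat (f := fun y => tev N.+1 (cr y) p * (- ((tev N.+1 (cr y) q)^-1 * (tev N.+1 (cr y) q)^-1) * Q' y) + (tev N.+1 (cr y) q)^-1 * P' y)).
  apply: locally_mono (locally_and (X0_open Xx) (locally_idem E)) => y [Xy Ey].
  have [qy _] := locally_at Ey; apply/esym/(pdv_eq Xy).
  have wq := wirtingerV (cont_tev q (leqnn _) (x := y)) qy (pdv_tev (j := j) q Xy).
  have := wirtingerM (cont_tev p (leqnn _)) (contV qy (cont_tev q (leqnn _))) (pdv_tev (j := j) p Xy) wq.
  rewrite !mulr0 addr0 expr2 => w; apply: (wirtinger_ext _ w) => xs hs.
  by apply: (aeS (locally_ae Xy.1 Ey hs)) => n [/= _ ->].
apply: regatD; last by apply: regatM => //; exact: rP'.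
apply: regatM; first exact: cr_regat Xx.1.
by apply: regatM; [apply: regatN; exact: regatM|exact: rP'].
Qed.

Lemma pdvD j f g x : X0 H x -> regat x f -> regat x g ->
  pdv j (fun y => f y + g y) x = pdv j f x + pdv j g x.
Proof.
move=> Xx rf rg; apply: pdv_eq => //.
by have := wirtingerD (pdvP (j := j) Xx rf) (pdvP (j := j) Xx rg); rewrite addr0.
Qed.

Lemma pdvM j f g x : X0 H x -> regat x f -> regat x g ->
  pdv j (fun y => f y * g y) x = f x * pdv j g x + g x * pdv j f x.
Proof.
move=> Xx rf rg; apply: pdv_eq => //.
have := wirtingerM (regat_cont Xx rf) (regat_cont Xx rg) (pdvP (j := j) Xx rf) (pdvP (j := j) Xx rg).
by rewrite !mulr0 addr0.
Qed.

Lemma pdv_cst j (c : C) x : X0 H x -> pdv j (fun=> c) x = 0.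
Proof. by move=> Xx; apply: pdv_eq => //; exact: wirtinger_cst. Qed.

Lemma pdv_ext j f g x : X0 H x -> regat x f -> locally x (fun y => f y = g y) -> pdv j f x = pdv j g x.
Proof.
move=> Xx rf fg; apply/esym/(pdv_eq Xx); apply: (wirtinger_ext _ (pdvP (j := j) Xx rf)) => xs hs.
exact: (locally_ae Xx.1 fg hs).
Qed.

Fact pd_regular j V (VU : V `<=` X0op) (f : regfun V) : regular_on V (pdv j f).
Proof. by apply: regat_on => x Vx; apply: pdv_regat; [exact: VU|exact: regat_rf]. Qed.

Definition pd_fun j V (VU : V `<=` X0op) (f : regfun V) : regfun V := mk_rf (pd_regular j VU f).

Lemma pd_funE j V (VU : V `<=` X0op) (f : regfun V) x : oset V x -> pd_fun j VU f x = pdv j f x.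
Proof. exact: mk_rfE. Qed.

Definition pd_der (j : nat) : derivation X0op.
Proof.
refine (@Derivation _ _ X X0op (pd_fun j) _ _ _ _).
- move=> V VU f g; apply: regfun_eqP => x Vx.
  by rewrite rf_evD !pd_funE // -(pdvD _ (VU x Vx)) //; exact: regat_rf.
- move=> V VU c f; apply: regfun_eqP => x Vx.
  rewrite rf_evM !pd_funE // rf_cstE //.
  transitivity (pdv j (fun y => rf_cst V c y * f y) x); first by [].
  rewrite pdvM; [|exact: VU|exact: regat_rf|exact: regat_rf].
  have -> : pdv j (rf_cst V c) x = 0.
    transitivity (pdv j (fun=> c) x); last by apply: pdv_cst; exact: VU.
    apply: pdv_ext; [exact: VU|exact: regat_rf|].
    by apply: locally_mono (locally_in Vx) => y Vy; rewrite rf_cstE.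
  by rewrite rf_cstE // mulr0 addr0.
- move=> V VU f g; apply: regfun_eqP => x Vx.
  by rewrite rf_evD !rf_evM !pd_funE // -(pdvM _ (VU x Vx)) //; exact: regat_rf.
- move=> V W VU WU WV f; apply: regfun_eqP => x Wx.
  rewrite rf_resE // !pd_funE //; last exact: WV.
  apply: pdv_ext; [exact: WU|by apply: regat_rf; exact: WV|].
  by apply: locally_mono (locally_in Wx) => y Wy; rewrite rf_resE.
Defined.

Lemma pd_derE j V (VU : V `<=` X0op) (f : regfun V) x : oset V x -> pd_der j V VU f x = pdv j f x.
Proof. exact: pd_funE. Qed.

(** ** Derivations which annihilate the free coordinates *)

Fact tev_regular V (VU : V `<=` X0op) n (f : tower C n) : regular_on V (fun y => tev n (cr y) f).
Proof. by apply: regat_on => x /VU[xb _]; exact: cr_regat. Qed.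
Definition rtev V (VU : V `<=` X0op) n (f : tower C n) : regfun V := mk_rf (tev_regular VU f).

Fact zz_regular V (VU : V `<=` X0op) k : regular_on V (fun y => cr y k).
Proof. by apply: regat_on => x /VU[xb _]; exact: cr_regat1. Qed.
Definition zz V (VU : V `<=` X0op) k : regfun V := mk_rf (zz_regular VU k).

Lemma rtevS V (VU : V `<=` X0op) n (f : tower C n.+1) d : (size (f : {poly tower C n}) <= d)%N ->
  rtev VU f = \sum_(i < d) rtev VU ((f : {poly tower C n})`_i) * zz VU n ^+ i.
Proof.
move=> fd; apply: regfun_eqP => x Vx; rewrite rf_ev_sum mk_rfE // (tev_lead _ fd).
apply: eq_bigr => i _; rewrite rf_evM mk_rfE //; congr (_ * _).
elim: (nat_of_ord i) => [|l IH]; first by rewrite !expr0; exact/esym/(rf_cstE 1 Vx).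
by rewrite !exprS rf_evM mk_rfE // IH.
Qed.

Section Annihilation.
Variables (U : op) (UX : U `<=` X0op) (F : derivation U).
Hypothesis F0 : forall V (VU : V `<=` U) k, (k < m)%N -> F V VU (zz (VU >> UX) k) = 0.

Lemma derX V (VU : V `<=` U) (u : regfun V) k : F V VU (u ^+ k) = u ^+ k.-1 * F V VU u *+ k.
Proof.
elim: k => [|k IH]; first by rewrite expr0 mulr0n -[1]/(rf_cst V 1) der_cst.
rewrite exprS der_M IH; case: k {IH} => [|k]; first by rewrite mulr0n mulr0 add0r.
by rewrite /= mulrnAr mulrA -exprS [RHS]mulrSr.
Qed.

Lemma annihilates_tev V (VU : V `<=` U) n : (forall k, (k < n)%N -> F V VU (zz (VU >> UX) k) = 0) ->
  forall f : tower C n, F V VU (rtev (VU >> UX) f) = 0.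
Proof.
elim: n => [|n IH] h f.
  by rewrite (_ : rtev _ f = rf_cst V f) ?der_cst //; apply: regfun_eqP => x Vx; rewrite mk_rfE // rf_cstE.
rewrite (rtevS _ (leqnn _)) der_sum; apply: big1 => i _.
rewrite der_M derX h // mulr0 mul0rn mulr0 add0r IH ?mulr0 // => k kn; apply: h; exact: ltnW.
Qed.

Lemma annihilates_zz V (VU : V `<=` U) k : (k < N.+1)%N -> F V VU (zz (VU >> UX) k) = 0.
Proof.
suff h n : forall l, (l < n)%N -> (l < N.+1)%N -> F V VU (zz (VU >> UX) l) = 0 by exact: (h k.+1).
elim: n => // n IH l; rewrite ltnS leq_eqVlt => /orP[/eqP -> nN|/IH h /h //].
have [nm|mn] := ltnP n m; first exact: F0.
have mnN : (m <= n < N.+1)%N by rewrite mn.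
pose VX := VU >> UX; pose Q : {poly tower C n} := sh_Q H n.
have at_ : forall f : tower C n, F V VU (rtev VX f) = 0.
  by apply: annihilates_tev => k' kn; apply: IH => //; exact: ltn_trans nN.
have Q0 : rtev VX (Q : tower C n.+1) = 0.
  by apply: regfun_eqP => x Vx; rewrite mk_rfE // rf_ev0; exact: (X0_eq (VX x Vx) mnN).
have e : rtev VX (Q^`() : tower C n.+1) * F V VU (zz VX n) = 0.
  have := congr1 (F V VU) Q0; rewrite (rtevS _ (leqnn _)) der_sum der0 => e.
  have [s sQ] : exists s, size Q = s.+1 by exists (size Q).-1; rewrite prednK // ltnW // (minimal_size (sh_min mnN)).
  have sQ' : (size Q^`() <= s)%N by rewrite -ltnS -sQ lt_size_deriv // -size_poly_gt0 sQ.
  rewrite -[RHS]e sQ big_ord_recl der_M derX mulr0n mulr0 add0r at_ mulr0 add0r.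
  rewrite (rtevS _ sQ') mulr_suml; apply: eq_bigr => i _; rewrite der_M at_ mulr0 addr0 derX coef_deriv.
  have -> : rtev VX (Q`_i.+1 *+ i.+1) = rtev VX Q`_i.+1 *+ i.+1.
    apply: regfun_eqP => x Vx; rewrite mk_rfE // rmorphMn /=.
    move: (Q`_i.+1) => c0; elim: (i.+1) => [|e1 IHl]; first by rewrite !mulr0n rf_ev0.
    by rewrite !mulrS IHl rf_evD mk_rfE.
  rewrite /= /bump /= add1n; ring.
apply: regfun_eqP => x Vx; have := congr1 (fun g : regfun V => g x) e.
rewrite rf_evM !rf_ev0 mk_rfE // => /eqP; rewrite mulf_eq0 => /orP[|/eqP //].
have := X0_slope (VX x Vx) mnN; rewrite slope_top => /negbTE -> //.
Qed.

Lemma annihilates V (VU : V `<=` U) (f : regfun V) : F V VU f = 0.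
Proof.
apply: regfun_eqP => x Vx; rewrite rf_ev0.
have Xx : X0 H x by exact: (UX (VU x Vx)).
have [p [q [q0 [W [Wx E]]]]] := regat_tower Xx.1 (regat_rf f Vx).
pose Z := V ∩ W; pose ZV : Z `<=` V := subl; pose ZW : Z `<=` W := subr.
pose ZU := ZV >> VU; pose ZX := ZU >> UX.
have at_ : forall t : tower C N.+1, F Z ZU (rtev ZX t) = 0.
  by apply: annihilates_tev => k kN; exact: annihilates_zz.
have e : rtev ZX q * rf_res ZV f = rtev ZX p.
  apply: regfun_eqP => y Zy; rewrite rf_evM (rf_resE ZV f Zy) (mk_rfE (tev_regular ZX p) Zy) (mk_rfE (tev_regular ZX q) Zy).
  by have [qy ->] := E y (ZW y Zy); rewrite mulrC divfK.
have := congr1 (F Z ZU) e; rewrite der_M !at_ mulr0 addr0.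
move=> /(congr1 (fun g : regfun Z => g x)); have Zx : oset Z x by [].
rewrite rf_evM mk_rfE // rf_ev0 => /eqP; rewrite mulf_eq0 (negbTE q0) /= => /eqP.
by rewrite -(der_res _ VU ZU ZV) rf_resE.
Qed.
End Annihilation.

Lemma pd_zz l k V (VU : V `<=` X0op) x : (k < m)%N -> oset V x -> pd_der l V VU (zz VU k) x = (k == l)%:R.
Proof.
move=> km Vx; rewrite pd_derE //; have Xx : X0 H x by exact: VU.
have := pdv_cr l Xx (leq_trans km (sh_mN H)); rewrite km => <-.
apply: pdv_ext => //; first exact: regat_rf.
by apply: locally_mono (locally_in Vx) => y Vy; rewrite mk_rfE.
Qed.

Lemma comm_annihilates i j V (VU : V `<=` X0op) (f : regfun V) : der_comm (pd_der i) (pd_der j) V VU f = 0.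
Proof.
have UX : X0op `<=` X0op by [].
apply: (@annihilates X0op UX (der_comm (pd_der i) (pd_der j))) => W WU k km.
have c l : pd_der l W WU (zz (WU >> UX) k) = rf_cst W (k == l)%:R.
  by apply: regfun_eqP => x Wx; rewrite pd_zz // rf_cstE.
rewrite -[LHS]/(pd_der i W WU (pd_der j W WU (zz _ k)) - pd_der j W WU (pd_der i W WU (zz _ k))).
by rewrite !c !der_cst subrr.
Qed.

Lemma pdv_comm i j f x : hol f -> X0 H x -> pdv i (pdv j f) x = pdv j (pdv i f) x.
Proof.
move=> hf Xx; have Xop : oset X0op x by [].
have UX : X0op `<=` X0op by [].
have rf : regular_on X0op f by apply: regat_on => y Xy; exact: hf.
pose F := mk_rf rf.
have FE l : locally x (fun y => pd_der l X0op UX F y = pdv l f y).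
  apply: locally_mono (locally_in Xop) => y Xy; rewrite pd_derE //; apply: pdv_ext => //; first exact: regat_rf.
  by apply: locally_mono (locally_in Xy) => t Xt; rewrite mk_rfE.
have := congr1 (fun g : regfun X0op => g x) (comm_annihilates i j UX F).
rewrite rf_ev0 -[LHS]/((pd_der i X0op UX (pd_der j X0op UX F) - pd_der j X0op UX (pd_der i X0op UX F) : regfun X0op) x).
rewrite rf_evB !pd_derE // => /eqP; rewrite subr_eq0 => /eqP.
by rewrite (pdv_ext i Xx _ (FE j)) ?(pdv_ext j Xx _ (FE i)) //; exact: regat_rf.
Qed.

End Partial.

Section Calculus.
Implicit Types (d db e eb f : pts -> C).

Lemma contF_cst (z : C) : contF (fun=> z).
Proof. by move=> x _; exact: cont_cst. Qed.
Lemma contFD a c : contF a -> contF c -> contF (fun x => a x + c x).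
Proof. by move=> ha h x Xx; apply: contD => //; [exact: ha|exact: h]. Qed.
Lemma contFM a c : contF a -> contF c -> contF (fun x => a x * c x).
Proof. by move=> ha h x Xx; apply: contM => //; [exact: ha|exact: h]. Qed.
Lemma contFN a : contF a -> contF (fun x => - a x).
Proof. by move=> ha x Xx; apply: contN => //; exact: ha. Qed.
Lemma contFX a k : contF a -> contF (fun x => a x ^+ k).
Proof. by move=> ha x Xx; apply: contX => //; exact: ha. Qed.
Lemma contF_conj a : contF a -> contF (fun x => (a x)^*).
Proof. by move=> ha x Xx; apply: cont_conj => //; exact: ha. Qed.
Lemma contF_norm a : contF a -> contF (fun x => `|a x|).
Proof. by move=> ha x Xx; apply: cont_norm => //; exact: ha. Qed.
Lemma contFV a : (forall x, X0 H x -> a x != 0) -> contF a -> contF (fun x => (a x)^-1).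
Proof. by move=> a0 ha x Xx; apply: contV => //; [exact: a0|exact: ha]. Qed.
Lemma smooth_ext j a c d db : (forall x, X0 H x -> a x = c x) -> smooth j a d db -> smooth j c d db.
Proof.
move=> ac h x Xx; apply: (wirtinger_ext _ (h x Xx)) => xs hs.
by apply: (aeS hs.2) => n Xn; exact: ac.
Qed.
Lemma smooth_eq j a d db e eb : (forall x, X0 H x -> d x = e x) -> (forall x, X0 H x -> db x = eb x) ->
  smooth j a d db -> smooth j a e eb.
Proof. by move=> h1 h2 h x Xx; rewrite -h1 // -h2 //; exact: h. Qed.
Lemma smoothD j a c d db e eb : smooth j a d db -> smooth j c e eb ->
  smooth j (fun x => a x + c x) (fun x => d x + e x) (fun x => db x + eb x).
Proof. by move=> h1 h2 x Xx; apply: wirtingerD => //; [exact: h1|exact: h2]. Qed.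
Lemma smoothM j a c d db e eb : contF a -> contF c -> smooth j a d db -> smooth j c e eb ->
  smooth j (fun x => a x * c x) (fun x => a x * e x + c x * d x) (fun x => a x * eb x + c x * db x).
Proof. by move=> ca cc h1 h2 x Xx; apply: wirtingerM => //; [exact: ca|exact: cc|exact: h1|exact: h2]. Qed.
Lemma smoothN j a d db : smooth j a d db -> smooth j (fun x => - a x) (fun x => - d x) (fun x => - db x).
Proof. by move=> h x Xx; apply: wirtingerN => //; exact: h. Qed.
Lemma smooth_cst j (z : C) : smooth j (fun=> z) (fun=> 0) (fun=> 0).
Proof. by move=> x Xx; exact: wirtinger_cst. Qed.
Lemma smooth_conj j a d db : smooth j a d db ->
  smooth j (fun x => (a x)^*) (fun x => (db x)^*) (fun x => (d x)^*).
Proof. by move=> h x Xx; apply: wirtinger_conj => //; exact: h. Qed.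
Lemma smoothV j a d db : (forall x, X0 H x -> a x != 0) -> contF a -> smooth j a d db ->
  smooth j (fun x => (a x)^-1) (fun x => - (a x)^-1 ^+ 2 * d x) (fun x => - (a x)^-1 ^+ 2 * db x).
Proof. by move=> a0 ca h x Xx; apply: wirtingerV => //; [exact: ca|exact: a0|exact: h]. Qed.
Lemma smoothZ j (z : C) a d db : smooth j a d db ->
  smooth j (fun x => z * a x) (fun x => z * d x) (fun x => z * db x).
Proof.
move=> h x Xx; apply: (wirtinger_comp (h x Xx)) => x1 x2 h1 h2; exists (fun=> z); split; first exact: tends_cst.
by apply: aeT => n /=; rewrite mulrBr.
Qed.

Lemma contF_hol f : hol f -> contF f.
Proof. by move=> hf x Xx; apply: regat_cont => //; exact: hf. Qed.
Lemma smooth_hol j f : hol f -> smooth j f (pdv j f) (fun=> 0).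
Proof. by move=> hf x Xx; apply: pdvP => //; exact: hf. Qed.
Lemma hol_pdv j f : hol f -> hol (pdv j f).
Proof. by move=> hf x Xx; apply: pdv_regat => //; exact: hf. Qed.
Lemma hol_div f a : hol f -> hol a -> (forall x, X0 H x -> a x != 0) -> hol (fun x => f x / a x).
Proof. by move=> hf ha a0 x Xx; apply: regatM; [exact: hf|apply: regatV; [exact: ha|exact: a0]]. Qed.

Lemma contF_ln f : (forall x, X0 H x -> 0 < f x) -> contF f -> contF (fun x => lnC (f x)).
Proof.
move=> f0 cf x Xx xs hs; have h := cf x Xx xs hs.
have [t [tl tE]] := ln_slope (f0 x Xx) (tends_cst (f x)) h (aeT (fun=> f0 x Xx)) (aeS hs.2 (fun n Xn => f0 _ Xn)).
apply/tends_sub0; have := tendsM tl ((tends_sub0 _ _).1 h); rewrite mulr0.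
by apply: tends_ext; apply: (aeS tE) => n /= ->.
Qed.

Lemma smooth_ln j f d db : (forall x, X0 H x -> 0 < f x) -> contF f -> smooth j f d db ->
  smooth j (fun x => lnC (f x)) (fun x => (f x)^-1 * d x) (fun x => (f x)^-1 * db x).
Proof.
move=> f0 cf h x Xx; apply: (wirtinger_comp (h x Xx)) => x1 x2 h1 h2.
apply: (ln_slope (f0 x Xx) (cf x Xx x1 h1) (cf x Xx x2 h2)).
  by apply: (aeS h1.2) => n Xn; exact: f0.
by apply: (aeS h2.2) => n Xn; exact: f0.
Qed.

Lemma contF_pos f : (forall x, X0 H x -> f x \is Num.real) -> contF f -> contF (fun x => posC (f x)).
Proof.
move=> fr cf x Xx xs hs; apply: (tends_pos (fr x Xx) (cf x Xx xs hs)).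
by apply: (aeS hs.2) => n Xn; exact: fr.
Qed.

Lemma smooth_pos j k f d db : (forall x, X0 H x -> f x \is Num.real) -> contF f -> smooth j f d db ->
  smooth j (fun x => posC (f x) ^+ k.+2) (fun x => k.+2%:R * posC (f x) ^+ k.+1 * d x)
    (fun x => k.+2%:R * posC (f x) ^+ k.+1 * db x).
Proof.
move=> fr cf h x Xx; apply: (wirtinger_comp (f := fun z => posC z ^+ k.+2) (h x Xx)) => x1 x2 h1 h2.
apply: (pos_slope k (fr x Xx) (cf x Xx x1 h1) (cf x Xx x2 h2)).
  by apply: (aeS h1.2) => n Xn; exact: fr.
by apply: (aeS h2.2) => n Xn; exact: fr.
Qed.
End Calculus.

Local Hint Resolve contF_cst contFD contFM contFN contFX contF_conj contF_norm contF_hol hol_pdv : cts.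
Local Hint Extern 0 (contF _) => solve [auto 12 with cts nocore] : core.

Section Slices.
Notation cr := (cr H).
Variables (o : pts) (j1 j2 : nat).
Hypothesis j1m : (j1 < m)%N.
Hypothesis j2m : (j2 < m)%N.
Hypothesis j12 : j1 <> j2.

Definition slice x : Prop :=
  X0 H x /\ forall k, (k < m)%N -> k <> j1 -> k <> j2 -> cr x k = cr o k.
Hypothesis so : slice o.

Section Integration.
Variable E : pts -> C.
Definition supp M a : Prop := forall x, X0 H x -> a x != 0 -> E x <= M.

Hypothesis E_cont : contF E.
Hypothesis E_real : forall x, E x \is Num.real.
Hypothesis E_proper : forall M (xs : nat -> pts), G [set n | slice (xs n) /\ E (xs n) <= M] ->
  exists2 x, X0 H x & X0_seq x xs.

Lemma ae_all (T : eqType) (s : seq T) (P : T -> nat -> Prop) :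
  (forall t, t \in s -> G [set n | P t n]) -> G [set n | forall t, t \in s -> P t n].
Proof.
elim: s => [|u s IH] h; first exact: aeT.
have h1 := h u (mem_head _ _).
have h2 : G [set n | forall t, t \in s -> P t n] by apply: IH => t ts; apply: h; rewrite inE ts orbT.
by apply: (aeS (ae_and h1 h2)) => n [/= p1 p2] t; rewrite inE => /orP[/eqP ->|/p2].
Qed.

Lemma compact_bound M a : contF a -> exists K : C, forall x, slice x -> E x <= M -> `|a x| <= K.
Proof.
move=> ca; apply: contrapT => no.
have bad n : exists x, [/\ slice x, E x <= M & n%:R <= `|a x|].
  apply: contrapT => h; apply: no; exists n%:R => x sx Ex.
  have [|/ltW h2] := real_leP (normr_real (a x)) (realn _ n); first by [].
  by case: h; exists x.
have [xs xsP] := choice bad.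
have [|x Xx sx] := E_proper (M := M) (xs := xs).
  by apply: aeT => n; have [] := xsP n.
have h1 := ca x Xx xs sx.
have := tendsM tends_delta (tends_norm h1); rewrite mul0r => h2.
have := tends_le _ (tends_cst (2^-1)) h2.
move=> /(_ _) h3; have : (2^-1 : C) <= 0.
  apply: h3; apply: (aeS (G_free 1)) => n /= n1; have [_ _ h4] := xsP n.
  rewrite mulrC ler_pdivlMr ?ltr0Sn //; apply: le_trans h4.
  rewrite mulrC ler_pdivrMr ?ltr0Sn // -natrM ler_nat muln2 -addnn -addn1 leq_add2l.
  exact: n1.
have p : 0 < (2^-1 : C) by rewrite invr_gt0 ltr0Sn.
by move=> /(lt_le_trans p); rewrite ltxx.
Qed.

(** ** The grid *)

Definition dl n : C := n.+1%:R^-1.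
Definition P_ n : nat := (n.+1 ^ 2)%N.
Definition gp n (u : nat * nat) : C := dl n * ((u.1%:R - (P_ n)%:R) + 'i * (u.2%:R - (P_ n)%:R)).
Definition grid := ((nat * nat) * (nat * nat))%type.
Implicit Types (i : grid).
Definition gz n i (k : nat) : C := cr o k + (k == j1)%:R * gp n i.1 + (k == j2)%:R * gp n i.2.
Definition sum4 n (F : grid -> C) : C :=
  dl n ^+ 4 * \sum_(p < P_ n + P_ n) \sum_(q < P_ n + P_ n) \sum_(r < P_ n + P_ n) \sum_(s < P_ n + P_ n)
    F ((p : nat, q : nat), (r : nat, s : nat)).

Definition wt (z : C) : C := (1 + `|z| ^+ 2)^-1 ^+ 2.
Definition wt2 n i : C := wt (gp n i.1) * wt (gp n i.2).
Definition hh x : C := wt (cr x j1 - cr o j1) * wt (cr x j2 - cr o j2).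

Lemma wt_gt0 z : 0 < wt z.
Proof. by rewrite exprn_gt0 // invr_gt0 ltr_wpDr ?exprn_ge0 ?normr_ge0 ?ltr01. Qed.

Lemma dl_gt0 n : 0 < dl n. Proof. by rewrite invr_gt0 ltr0Sn. Qed.
Lemma dl_le1 n : dl n <= 1. Proof. by rewrite invf_le1 ?ltr0Sn // ler1n. Qed.

Definition vol : C := 64 * 64.
Lemma vol_gt0 : 0 < vol. Proof. by rewrite mulr_gt0 ?ltr0Sn. Qed.

Lemma sum4_wt n : sum4 n (wt2 n) <= vol.
Proof.
pose d : R := n.+1%:R^-1.
have dE : dl n = d%:C%C by rewrite /dl /d fmorphV rmorph_nat.
have nE u : `|gp n u| ^+ 2 = ((d * (u.1%:R - (P_ n)%:R)) ^+ 2 + (d * (u.2%:R - (P_ n)%:R)) ^+ 2)%:C%C.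
  rewrite normCK /gp dE rmorphM rmorphD rmorphM rmorphB !rmorph_nat /= conjCi rmorphB !rmorph_nat.
  have -> : (d%:C%C)^* = d%:C%C by apply/CrealP; rewrite complex_real.
  have i2 : 'i * 'i = -1 :> C by rewrite -expr2 sqrCi.
  rewrite rmorphD !rmorphXn !rmorphM !rmorphB !rmorph_nat.
  set a := _ - _; set b := _ - _.
  transitivity (d%:C%C ^+ 2 * (a ^+ 2 - 'i * 'i * b ^+ 2)); [by ring|by rewrite i2; ring].
have S : dl n ^+ 2 * \sum_(p < P_ n + P_ n) \sum_(q < P_ n + P_ n) wt (gp n (p : nat, q : nat)) <= 64.
  have d0 : 0 < d by rewrite invr_gt0 ltr0Sn.
  have d1 : d <= 1 by rewrite invf_le1 ?ltr0Sn // ler1n.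
  have := grid_plane (P_ n) d0 d1; rewrite -(lecR _ 64) rmorph_nat; apply: le_trans.
  have C2 t : (d ^+ 2 * t)%:C%C = dl n ^+ 2 * t%:C%C by rewrite dE -rmorphXn -rmorphM.
  rewrite C2 ler_pM2l ?exprn_gt0 ?dl_gt0 // rmorph_sum.
  apply: ler_sum => p _; rewrite rmorph_sum; apply: ler_sum => q _.
  have WC t : ((1 + t)^-1 ^+ 2)%:C%C = (1 + t%:C%C)^-1 ^+ 2 :> C by rewrite rmorphXn fmorphV rmorphD.
  by rewrite /wt nE -WC.
have S0 : 0 <= dl n ^+ 2 * \sum_(p < P_ n + P_ n) \sum_(q < P_ n + P_ n) wt (gp n (p : nat, q : nat)).
  apply: mulr_ge0; first exact: ltW (exprn_gt0 2 (dl_gt0 n)).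
  apply: sumr_ge0 => p _; apply: sumr_ge0 => q _.
  exact: ltW (wt_gt0 _).
apply: le_trans (ler_pM S0 S0 S S); rewrite mulrACA -exprD le_eqVlt; apply/orP; left; apply/eqP.
rewrite /sum4; congr (_ * _).
rewrite mulr_suml; apply: eq_bigr => p _; rewrite mulr_suml; apply: eq_bigr => q _.
by rewrite mulr_sumr; apply: eq_bigr => r _; rewrite mulr_sumr.
Qed.

Lemma dl4_ge0 n : 0 <= dl n ^+ 4.
Proof. exact: ltW (exprn_gt0 4 (dl_gt0 n)). Qed.

Lemma sum4D n (F F' : grid -> C) : sum4 n (fun i => F i + F' i) = sum4 n F + sum4 n F'.
Proof.
rewrite /sum4 -mulrDr; congr (_ * _); rewrite -big_split; apply: eq_bigr => p _ /=.
rewrite -big_split; apply: eq_bigr => q _ /=; rewrite -big_split; apply: eq_bigr => r _ /=.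
by rewrite -big_split.
Qed.

Lemma sum4Z n (c : C) (F : grid -> C) : sum4 n (fun i => c * F i) = c * sum4 n F.
Proof.
rewrite /sum4 mulrCA; congr (_ * _); rewrite mulr_sumr; apply: eq_bigr => p _.
rewrite mulr_sumr; apply: eq_bigr => q _; rewrite mulr_sumr; apply: eq_bigr => r _.
by rewrite mulr_sumr.
Qed.

Lemma sum4_le n (F F' : grid -> C) : (forall i, F i <= F' i) -> sum4 n F <= sum4 n F'.
Proof.
move=> le; apply: (ler_wpM2l (dl4_ge0 n)); do 4 (apply: ler_sum => ? _).
exact: le.
Qed.

Lemma sum4_norm n (F F' : grid -> C) : (forall i, `|F i| <= F' i) -> `|sum4 n F| <= sum4 n F'.
Proof.
move=> le; rewrite /sum4 normrM (ger0_norm (dl4_ge0 n)); apply: (ler_wpM2l (dl4_ge0 n)).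
do 4 (apply: (le_trans (ler_norm_sum _ _ _)); apply: ler_sum => ? _).
exact: le.
Qed.

(** Elementary shifts of the grid, in the directions of [u] on the [j]-th axis. *)
Definition is_shift (sh : grid -> grid) (u : C) (j : nat) : Prop :=
  [/\ u * u^* = 1, j = j1 \/ j = j2,
  (forall n i k, gz n (sh i) k = gz n i k + dl n * u * (k == j)%:R) &
  (forall n F, (forall i, n.+1%:R <= `|gp n i.1| \/ n.+1%:R <= `|gp n i.2| -> F i = 0) ->
     sum4 n (fun i => F (sh i) - F i) = 0)].

Lemma gp_edge n (u : nat * nat) : (u.1 = 0%N \/ u.1 = (P_ n + P_ n)%N) \/ (u.2 = 0%N \/ u.2 = (P_ n + P_ n)%N) ->
  n.+1%:R <= `|gp n u|.
Proof.
have PE : dl n * (P_ n)%:R = n.+1%:R.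
  by rewrite /P_ natrX expr2 /dl mulrA mulVf ?mul1r // pnatr_eq0.
have edge (a : nat) : (a = 0%N \/ a = (P_ n + P_ n)%N) -> `|a%:R - (P_ n)%:R : C| = (P_ n)%:R.
  by case=> ->; rewrite ?sub0r ?normrN ?natrD ?addrK normr_nat.
have re (x y : C) : x \is Num.real -> y \is Num.real -> `|x| <= `|x + 'i * y| /\ `|y| <= `|x + 'i * y|.
  move=> xr yr; have sq : `|x + 'i * y| ^+ 2 = `|x| ^+ 2 + `|y| ^+ 2.
    have cE : (x + 'i * y)^* = x - 'i * y by rewrite rmorphD rmorphM /= conjCi (CrealP xr) (CrealP yr) mulNr.
    rewrite normCK cE !real_normK //.
    have i2 : 'i * 'i = -1 :> C by rewrite -expr2 sqrCi.
    transitivity (x ^+ 2 - 'i * 'i * y ^+ 2); [by ring|by rewrite i2; ring].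
  by split; rewrite -(@ler_pXn2r _ 2) // ?nnegrE ?normr_ge0 // sq ?lerDl ?lerDr exprn_ge0 ?normr_ge0.
have rl (a : nat) : (a%:R - (P_ n)%:R : C) \is Num.real by rewrite realB ?realn.
rewrite /gp normrM (gtr0_norm (dl_gt0 n)) -PE (ler_pM2l (dl_gt0 n)) => -[/edge {1}<-|/edge {1}<-].
  by have [] := re _ _ (rl u.1) (rl u.2).
by have [] := re _ _ (rl u.1) (rl u.2).
Qed.

Lemma shifts : [/\ is_shift (fun i => ((i.1.1.+1, i.1.2), i.2)) 1 j1,
  is_shift (fun i => ((i.1.1, i.1.2.+1), i.2)) 'i j1,
  is_shift (fun i => (i.1, (i.2.1.+1, i.2.2))) 1 j2 &
  is_shift (fun i => (i.1, (i.2.1, i.2.2.+1))) 'i j2].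
Proof.
have tele n (f : nat -> C) : f 0%N = 0 -> f (P_ n + P_ n)%N = 0 ->
    \sum_(p < P_ n + P_ n) (f p.+1 - f p) = 0.
  move=> f0 f1; rewrite -(big_mkord xpredT (fun p => f p.+1 - f p)) telescope_sumr //.
  by rewrite f0 f1 subrr.
have u1 : 1 * 1^* = 1 :> C by rewrite conjC1 mulr1.
have ui : 'i * 'i^* = 1 :> C by rewrite conjCi mulrN -expr2 sqrCi opprK.
have sb (I : finType) (F F' : I -> C) : \sum_i (F i - F' i) = \sum_i F i - \sum_i F' i by rewrite sumrB.
split; split=> //; try by [left|right].
- by move=> n i k; rewrite /gz /gp /= -(@nat1r C); ring.
- move=> n F F0; rewrite /sum4; apply/eqP; rewrite mulf_eq0; apply/orP; right; apply/eqP.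
  pose f p : C := \sum_(q < P_ n + P_ n) \sum_(r < P_ n + P_ n) \sum_(s < P_ n + P_ n) F ((p, q : nat), (r : nat, s : nat)).
  rewrite -[RHS](tele n f).
  + by apply: eq_bigr => p _; do 3 (rewrite -sumrB; apply: eq_bigr => ? _).
  + by do 3 (apply: big1 => ? _); apply: F0; left; apply: gp_edge => /=; left; left.
  + by do 3 (apply: big1 => ? _); apply: F0; left; apply: gp_edge => /=; left; right.
- by move=> n i k; rewrite /gz /gp /= -(@nat1r C); ring.
- move=> n F F0; rewrite /sum4; apply/eqP; rewrite mulf_eq0; apply/orP; right; apply/eqP.
  apply: big1 => p _; pose f q : C := \sum_(r < P_ n + P_ n) \sum_(s < P_ n + P_ n) F ((p : nat, q), (r : nat, s : nat)).
  rewrite -[RHS](tele n f).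
  + by apply: eq_bigr => q _; do 2 (rewrite -sumrB; apply: eq_bigr => ? _).
  + by do 2 (apply: big1 => ? _); apply: F0; left; apply: gp_edge => /=; right; left.
  + by do 2 (apply: big1 => ? _); apply: F0; left; apply: gp_edge => /=; right; right.
- by move=> n i k; rewrite /gz /gp /= -(@nat1r C); ring.
- move=> n F F0; rewrite /sum4; apply/eqP; rewrite mulf_eq0; apply/orP; right; apply/eqP.
  apply: big1 => p _; apply: big1 => q _.
  rewrite -[RHS](tele n (fun r => \sum_(s < P_ n + P_ n) F ((p : nat, q : nat), (r, s : nat)))).
  + by apply: eq_bigr => r _; rewrite -sumrB; apply: eq_bigr => ? _.
  + by apply: big1 => ? _; apply: F0; right; apply: gp_edge => /=; left; left.
  + by apply: big1 => ? _; apply: F0; right; apply: gp_edge => /=; left; right.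
- by move=> n i k; rewrite /gz /gp /= -(@nat1r C); ring.
- move=> n F F0; rewrite /sum4; apply/eqP; rewrite mulf_eq0; apply/orP; right; apply/eqP.
  apply: big1 => p _; apply: big1 => q _; apply: big1 => r _.
  rewrite -[RHS](tele n (fun s => F ((p : nat, q : nat), (r : nat, s)))) //.
  + by apply: F0; right; apply: gp_edge => /=; right; left.
  + by apply: F0; right; apply: gp_edge => /=; right; right.
Qed.

(** ** Sums over the fibres *)

Definition fibre_bound : nat := projT1 (cid (fibre_finite H)).
Definition fib (z : nat -> C) : seq pts := projT1 (cid (projT2 (cid (fibre_finite H)) z)).
Lemma fibP z : [/\ uniq (fib z), (size (fib z) <= fibre_bound)%N &
   forall x, (x \in fib z) <-> X0 H x /\ forall k, (k < m)%N -> cr x k = z k].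
Proof. exact: projT2 (cid (projT2 (cid (fibre_finite H)) z)). Qed.

Definition trace a (z : nat -> C) : C := \sum_(x <- fib z) a x.

Lemma fib_slice n i x : x \in fib (gz n i) -> slice x /\
  (cr x j1 - cr o j1 = gp n i.1 /\ cr x j2 - cr o j2 = gp n i.2).
Proof.
have [_ _ h] := fibP (gz n i); move=> /h[Xx xz]; split.
  by split=> // k km /eqP k1 /eqP k2; rewrite xz // /gz (negbTE k1) (negbTE k2) !mul0r !addr0.
have n12 : (j1 == j2) = false by apply/eqP.
rewrite !xz // /gz !eqxx n12 eq_sym n12 !mul0r !mul1r; split; ring.
Qed.

Lemma trace_limit a M (z : nat -> nat -> C) (zl : nat -> C) (xs : pts -> nat -> pts) : supp M a ->
  (forall n x, x \in fib (z n) -> slice x) ->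
  (forall k, (k < m)%N -> tends G (fun n => z n k) (zl k)) ->
  (forall p, p \in fib zl -> X0_seq p (xs p) /\ G [set n | forall k, (k < m)%N -> cr (xs p n) k = z n k]) ->
  G [set n | trace a (z n) = \sum_(p <- fib zl) a (xs p n)].
Proof.
move=> sa zs zz hx; have [ul _ fl] := fibP zl.
have h1 : G [set n | forall p, p \in fib zl -> xs p n \in fib (z n)].
  apply: ae_all => p pl; have [[_ X0n] E1] := hx p pl.
  apply: (aeS (ae_and X0n E1)) => n [/= Xn En]; have [_ _ fz] := fibP (z n).
  by apply/fz.
have h2 : G [set n | forall p, p \in fib zl -> forall q, q \in fib zl -> xs p n = xs q n -> p = q].
  apply: ae_all => p pl; apply: ae_all => q ql.
  have [[cp _] _] := hx p pl; have [[cq _] _] := hx q ql.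
  have [Xp _] := (fl p).1 pl; have [Xq _] := (fl q).1 ql.
  have [->|pq] := eqVneq p q; first exact: aeT.
  have [k kN kd] : exists2 k, (k < N.+1)%N & cr p k != cr q k.
    apply: contrapT => nk; case/eqP: pq; apply: (@cr_inj H); [exact: Xp.1|exact: Xq.1|].
    by move=> k kN; apply/eqP; apply: contraT => kd; case: nk; exists k.
  have := tends_neq0 (tendsB (cp k kN) (cq k kN)); rewrite subr_eq0 => /(_ kd) h.
  by apply: (aeS h) => n /= + e; rewrite e subrr eqxx.
have h3 : G [set n | forall x, x \in fib (z n) -> x \notin [seq xs p n | p <- fib zl] -> a x = 0].
  apply: contrapT => /aeN bad.
  have ex n : exists x, (~ forall x, x \in fib (z n) -> x \notin [seq xs p n | p <- fib zl] -> a x = 0) ->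
      [/\ x \in fib (z n), x \notin [seq xs p n | p <- fib zl] & a x != 0].
    have [h|h] := pselect (forall x, x \in fib (z n) -> x \notin [seq xs p n | p <- fib zl] -> a x = 0).
      by exists o.
    apply: contrapT => h'; apply: h => x x1 x2; apply/eqP; apply: contraT => ax; case: h'.
    by exists x.
  have [w wP'] := choice ex.
  have wP : G [set n | [/\ w n \in fib (z n), w n \notin [seq xs p n | p <- fib zl] & a (w n) != 0]] by exact: aeS bad wP'.
  have [|x Xx cx] := E_proper (M := M) (xs := w).
    apply: (aeS wP) => n [/= wz _ aw]; split; first exact: zs wz.
    by apply: sa aw; exact: (zs _ _ wz).1.
  have xl : x \in fib zl.
    apply/fl; split=> // k km; have := zz k km; apply: tends_uniq.
    apply: (tends_ext _ (cx.1 k (leq_trans km (sh_mN H)))); apply: (aeS wP) => n [/= wz _ _].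
    by have [_ _ fz] := fibP (z n); have [_ ->] := (fz _).1 wz.
  have [[c1 X1] E1] := hx x xl; have [c2 X2] := cx.
  have e : G [set n | forall k, (k < m)%N -> cr (xs x n) k = cr (w n) k].
    apply: (aeS (ae_and E1 wP)) => n [/= e1 [wz _ _]] k km.
    by have [_ _ fz] := fibP (z n); have [_ ->] := (fz _).1 wz; rewrite // e1.
  have := sheet_unique Xx c1 c2 X1 X2 e => e2.
  have [n [/= [_ + _]]] := ae_ex (ae_and wP e2).
  by move=> nin e3; move: nin; rewrite -e3 map_f.
apply: (aeS (ae_and h1 (ae_and h2 h3))) => n [/= g1 [g2 g3]].
have [uz _ _] := fibP (z n).
rewrite /trace (bigID (fun x => x \in [seq xs p n | p <- fib zl])) /= [X in _ + X]big_seq_cond.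
rewrite [X in _ + X]big1 => [|x /andP[x1 x2]]; last exact: g3.
rewrite addr0 -big_filter -(big_map (fun p => xs p n) xpredT a); apply: perm_big.
apply: uniq_perm; first exact: filter_uniq.
  by rewrite map_inj_in_uniq // => p q pl ql; exact: g2.
move=> x; rewrite mem_filter andb_idr // => /mapP[p pl ->]; exact: g1.
Qed.

(** ** The integral over the slice *)

Definition Rsum a n : C := sum4 n (fun i => trace a (gz n i)).

Definition integrable a : Prop := exists c : C, forall x, slice x -> `|a x| <= c * hh x.

Lemma hh_gt0 x : 0 < hh x. Proof. by rewrite mulr_gt0 ?wt_gt0. Qed.

Lemma trace_bound a (c : C) n i : (forall x, slice x -> `|a x| <= c * hh x) -> 0 <= c ->
  `|trace a (gz n i)| <= (c * fibre_bound%:R) * wt2 n i.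
Proof.
move=> ac c0; have [_ sz _] := fibP (gz n i).
apply: le_trans (ler_norm_sum _ _ _) _.
apply: (@le_trans _ _ (\sum_(x <- fib (gz n i)) c * wt2 n i)).
  rewrite big_seq [X in _ <= X]big_seq; apply: ler_sum => x /fib_slice[sx [e1 e2]].
  by apply: le_trans (ac x sx) _; rewrite /hh e1 e2.
rewrite big_const_seq count_predT iter_addr_0 -[X in X <= _]mulr_natr mulrAC.
have w0 : 0 <= wt2 n i by apply: ltW; rewrite mulr_gt0 ?wt_gt0.
apply: (ler_wpM2r w0); apply: (ler_wpM2l c0); by rewrite ler_nat.
Qed.

Lemma Rsum_bound a (c : C) n : (forall x, slice x -> `|a x| <= c * hh x) -> 0 <= c ->
  `|Rsum a n| <= c * fibre_bound%:R * vol.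
Proof.
move=> ac c0; have cb : 0 <= c * fibre_bound%:R by rewrite mulr_ge0 // ler0n.
apply: (@le_trans _ _ (sum4 n (fun i => (c * fibre_bound%:R) * wt2 n i))).
  by apply: sum4_norm => i; exact: trace_bound.
by rewrite sum4Z; apply: (ler_wpM2l cb); exact: sum4_wt.
Qed.

Definition is_integral a (l : C) : Prop := tends G (Rsum a) l.

Lemma bound_ge0 a (c : C) : (forall x, slice x -> `|a x| <= c * hh x) -> 0 <= c.
Proof.
move=> ac; have := le_trans (normr_ge0 _) (ac o so).
by rewrite pmulr_lge0 ?hh_gt0.
Qed.

Lemma integral_ex a : integrable a -> exists l, is_integral a l.
Proof.
move=> [c ac]; apply: bounded_tends; apply: aeT => n.
exact: (Rsum_bound n ac (bound_ge0 ac)).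
Qed.

Definition I a : C := if pselect (exists l, is_integral a l) is left h then projT1 (cid h) else 0.

Lemma I_is a : integrable a -> is_integral a (I a).
Proof. by move=> /integral_ex h; rewrite /I; case: pselect => // h'; exact: projT2 (cid h'). Qed.

Lemma I_eq a l : is_integral a l -> I a = l.
Proof.
move=> al; rewrite /I; case: pselect => [h|[]]; last by exists l.
exact: (tends_uniq (projT2 (cid h)) al).
Qed.

Lemma Rsum_ext a c n : (forall x, slice x -> a x = c x) -> Rsum a n = Rsum c n.
Proof.
move=> ac; rewrite /Rsum /sum4; congr (_ * _); do 4 (apply: eq_bigr => ? _).
by rewrite /trace !big_seq; apply: eq_bigr => x /fib_slice[/ac].
Qed.

Lemma RsumD a c n : Rsum (fun x => a x + c x) n = Rsum a n + Rsum c n.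
Proof.
rewrite /Rsum -sum4D /sum4; congr (_ * _); do 4 (apply: eq_bigr => ? _).
by rewrite /trace big_split.
Qed.

Lemma RsumZ a (k : C) n : Rsum (fun x => k * a x) n = k * Rsum a n.
Proof.
rewrite /Rsum -sum4Z /sum4; congr (_ * _); do 4 (apply: eq_bigr => ? _).
by rewrite /trace mulr_sumr.
Qed.

Lemma Rsum_le a c n : (forall x, slice x -> a x <= c x) -> Rsum a n <= Rsum c n.
Proof.
move=> ac; apply: (ler_wpM2l (dl4_ge0 n)); do 4 (apply: ler_sum => ? _).
by rewrite /trace !big_seq; apply: ler_sum => x /fib_slice[/ac].
Qed.

Lemma I_ext a c : (forall x, slice x -> a x = c x) -> integrable a -> I a = I c.
Proof.
move=> ac /I_is h; apply/esym/I_eq; apply: (tends_ext _ h).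
by apply: aeT => n; apply: Rsum_ext.
Qed.

Lemma ID a c : integrable a -> integrable c -> I (fun x => a x + c x) = I a + I c.
Proof.
move=> /I_is ha /I_is h; apply: I_eq; apply: (tends_ext _ (tendsD ha h)).
by apply: aeT => n; rewrite /= RsumD.
Qed.

Lemma IZ k a : integrable a -> I (fun x => k * a x) = k * I a.
Proof.
move=> /I_is ha; apply: I_eq; apply: (tends_ext _ (tendsM (tends_cst k) ha)).
by apply: aeT => n; rewrite /= RsumZ.
Qed.

Lemma I_le a c : integrable a -> integrable c -> (forall x, slice x -> a x <= c x) -> I a <= I c.
Proof.
move=> /I_is ha /I_is h ac; apply: (tends_le _ ha h).
by apply: aeT => n; exact: Rsum_le.
Qed.

Lemma I_bound a (c : C) : (forall x, slice x -> `|a x| <= c * hh x) -> `|I a| <= c * (fibre_bound%:R * vol).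
Proof.
move=> ac; have ia : integrable a by exists c.
apply: (tends_le _ (tends_norm (I_is ia)) (tends_cst _)).
by apply: aeT => n; rewrite /= mulrA; exact: (Rsum_bound n ac (bound_ge0 ac)).
Qed.

Lemma wt_cont j : (j < m)%N -> contF (fun x => wt (cr x j - cr o j)).
Proof.
move=> jm x Xx; have jN := leq_trans jm (sh_mN H).
have h : cont x (fun y => 1 + `|cr y j - cr o j| ^+ 2).
  apply: contD => //; first exact: cont_cst.
  apply: contX => //; apply: cont_norm => //; apply: contD => //; last exact: cont_cst.
  by move=> xs [cx _]; exact: cx.
apply: contX => //; apply: contV => //.
by rewrite gt_eqF // ltr_wpDr ?exprn_ge0 ?normr_ge0 ?ltr01.
Qed.

Lemma compact_integrable M a : contF a -> supp M a -> integrable a.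
Proof.
move=> ca sa; have [|K hK] := compact_bound M (a := fun x => a x * (hh x)^-1).
  move=> x Xx; apply: contM => //; first exact: ca.
  apply: contV => //; first by rewrite gt_eqF // hh_gt0.
  by apply: contM => //; exact: wt_cont.
exists `|K| => x sx; have [->|ax] := eqVneq (a x) 0.
  by rewrite normr0 mulr_ge0 ?normr_ge0 // ltW // hh_gt0.
have h := hK x sx (sa x sx.1 ax); rewrite (ger0_norm (le_trans (normr_ge0 _) h)).
by move: h; rewrite normrM normfV (gtr0_norm (hh_gt0 x)) ler_pdivrMr ?hh_gt0.
Qed.

(** ** Integration by parts *)

Lemma deriv_supp j M a d db : (j < m)%N -> smooth j a d db -> supp M a -> M \is Num.real ->
  supp M d /\ supp M db.
Proof.
move=> jm sm sa Mr; suff h x : X0 H x -> ~~ (E x <= M) -> d x = 0 /\ db x = 0.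
  by split=> x Xx dx; apply: contraT => Ex; have [e1 e2] := h x Xx Ex; rewrite ?e1 ?e2 eqxx in dx.
move=> Xx; rewrite -real_ltNge // => Mx.
apply: (wirtinger_uniq Xx (sm x Xx)).
apply: (@wirtinger_ext j x (fun=> 0)); last exact: wirtinger_cst.
move=> xs hs.
have e0 : 0 < E x - M by rewrite subr_gt0.
apply: (aeS (ae_and (E_cont Xx hs e0) hs.2)) => n [/= h1 Xn].
apply/esym/eqP; apply: contraT => an; have := sa _ Xn an => h2; move: h1.
rewrite distrC ger0_norm; last by rewrite subr_ge0 (le_trans h2) // ltW.
by rewrite ltrD2l ltrN2 => /(le_lt_trans h2); rewrite ltxx.
Qed.

Lemma stokes_shift sh u j a d db M : is_shift sh u j -> smooth j a d db ->
  contF a -> contF d -> contF db -> supp M a -> M \is Num.real ->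
  is_integral (fun x => u * d x + u^* * db x) 0.
Proof.
move=> [uu jj gsh zsh] sm ca cd cdb sa Mr.
have jm : (j < m)%N by case: jj => ->.
have [sd sdb] := deriv_supp jm sm sa Mr.
pose a' x := u * d x + u^* * db x.
have sa' : supp M a'.
  move=> x Xx; have [d0|d0 _] := eqVneq (d x) 0; last exact: sd.
  rewrite /a' d0 mulr0 add0r mulf_eq0 negb_or => /andP[_]; exact: sdb.
have ca' : contF a'.
  move=> x Xx; apply: contD => //; apply: contM => //; try exact: cont_cst; [exact: cd|exact: cdb].
pose tm n i := (trace a (gz n (sh i)) - trace a (gz n i)) / dl n - trace a' (gz n i).
have [K [K0 hK]] : exists K : C, 0 <= K /\ forall x, slice x -> E x <= M -> `|cr x j1 - cr o j1| <= K /\ `|cr x j2 - cr o j2| <= K.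
  have cc k : (k < m)%N -> contF (fun x => cr x k - cr o k).
    move=> km x Xx xs [cx _]; apply: (tendsB (cx k (leq_trans km (sh_mN H))) (tends_cst _)).
  have [K1 h1] := compact_bound M (cc j1 j1m); have [K2 h2] := compact_bound M (cc j2 j2m).
  exists (`|K1| + `|K2|); split=> [|x sx Ex]; first by rewrite addr_ge0 ?normr_ge0.
  have h1' := h1 x sx Ex; have h2' := h2 x sx Ex.
  split; [apply: (le_trans h1')|apply: (le_trans h2')].
    by rewrite (ger0_norm (le_trans (normr_ge0 _) h1')) lerDl.
  by rewrite (ger0_norm (le_trans (normr_ge0 _) h2')) lerDr.
have tr_small c n i : supp M c -> trace c (gz n i) != 0 -> `|gp n i.1| <= K /\ `|gp n i.2| <= K.
  move=> sc tn; have [x xf cx] : exists2 x, x \in fib (gz n i) & c x != 0.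
    apply: contrapT => no; case/eqP: tn; rewrite /trace big_seq; apply: big1 => x xf.
    by apply/eqP; apply: contraT => cx; case: no; exists x.
  have [sx [<- <-]] := fib_slice xf; apply: hK => //; exact: sc sx.1 cx.
have main : forall e : C, 0 < e -> G [set n | forall i, `|tm n i| <= e * wt2 n i].
  move=> e e0; apply: contrapT => /aeN bad.
  have nu : `|u| = 1.
    have : `|u| ^+ 2 = 1 by rewrite normCK.
    by move=> /eqP; rewrite pexpr_eq1 ?normr_ge0 // => /eqP.
  have w0 n i : 0 < wt2 n i by rewrite mulr_gt0 ?wt_gt0.
  have ex n : exists i, (~ forall i, `|tm n i| <= e * wt2 n i) -> e * wt2 n i < `|tm n i|.
    have [h|h] := pselect (forall i, `|tm n i| <= e * wt2 n i); first by exists ((0, 0), (0, 0))%N.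
    move/existsNP: h => [i hi]; exists i => _; rewrite real_ltNge ?normr_real //; first exact/negP.
    by apply: ger0_real; rewrite mulr_ge0 ?ltW.
  have [ii iiP'] := choice ex.
  have iiP : G [set n | e * wt2 n (ii n) < `|tm n (ii n)|] by exact: aeS bad iiP'.
  have n12 : (j1 == j2) = false by apply/eqP.
  have gpE n i : gp n i.1 = gz n i j1 - cr o j1 /\ gp n i.2 = gz n i j2 - cr o j2.
    by rewrite /gz !eqxx n12 eq_sym n12 !mul0r !mul1r; split; ring.
  have step n : `|dl n * u| <= 1 by rewrite normrM nu mulr1 (gtr0_norm (dl_gt0 n)) dl_le1.
  have dstep n k : `|dl n * u * (k == j)%:R| <= 1.
    by case: (k == j); rewrite ?mulr1 // mulr0 normr0 ler01.
  have K1 : K <= K + 1 by rewrite lerDl ler01.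
  have sm1 : G [set n | `|gp n (ii n).1| <= K + 1 /\ `|gp n (ii n).2| <= K + 1].
    apply: (aeS iiP) => n /= hn.
    have [t1|] := eqVneq (trace a (gz n (ii n))) 0; last first.
      by move=> /(tr_small _ _ _ sa)[g1 g2]; split; [exact: le_trans g1 K1|exact: le_trans g2 K1].
    have [t2|] := eqVneq (trace a' (gz n (ii n))) 0; last first.
      by move=> /(tr_small _ _ _ sa')[g1 g2]; split; [exact: le_trans g1 K1|exact: le_trans g2 K1].
    have [t3|] := eqVneq (trace a (gz n (sh (ii n)))) 0.
      by move: hn; rewrite /tm t1 t2 t3 !subrr mul0r subr0 normr0 => /(lt_trans (mulr_gt0 e0 (w0 _ _))); rewrite ltxx.
    move=> /(tr_small _ _ _ sa)[]; rewrite !(gpE n _).1 !(gpE n _).2 !gsh => g1 g2.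
    have tri (x y : C) : `|x + y| <= K -> `|y| <= 1 -> `|x| <= K + 1.
      move=> h1 h2; rewrite -[x](addrK y); apply: le_trans (ler_normB _ _) _; exact: lerD.
    by split; apply: (tri _ _ _ (dstep n _)); rewrite addrAC; [exact: g1|exact: g2].
  pose z n := gz n (ii n); pose z' n := gz n (sh (ii n)).
  have zb k : exists l, tends G (fun n => z n k) l.
    apply: (bounded_tends (M := `|cr o k| + (K + 1) + (K + 1))).
    apply: (aeS sm1) => n [/= g1 g2]; rewrite /z /gz.
    have bt (t : bool) (x : C) : `|x| <= K + 1 -> `|t%:R * x| <= K + 1.
      by case: t => h; rewrite ?mul1r // mul0r normr0 addr_ge0 // ler01.
    apply: le_trans (ler_normD _ _) (lerD _ (bt _ _ g2)).
    by apply: le_trans (ler_normD _ _) (lerD _ (bt _ _ g1)).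
  have [zl zlP] := choice zb.
  have zlP' k : tends G (fun n => z' n k) (zl k).
    have h := tendsM tends_delta (tends_cst (u * (k == j)%:R)).
    have := tendsD (zlP k) h; rewrite mul0r addr0; apply: tends_ext; apply: aeT => n /=.
    by rewrite /z' gsh mulrA.
  have [_ _ fl] := fibP zl.
  have lift (zz : nat -> nat -> C) : (forall k, tends G (fun n => zz n k) (zl k)) ->
      exists xs : pts -> nat -> pts, forall p, p \in fib zl -> X0_seq p (xs p) /\
        G [set n | forall k, (k < m)%N -> cr (xs p n) k = zz n k].
    move=> hz; have ex' p : exists xs : nat -> pts, p \in fib zl -> X0_seq p xs /\
        G [set n | forall k, (k < m)%N -> cr (xs n) k = zz n k].
      have [pl|] := boolP (p \in fib zl); last by exists (fun=> o).
      have [Xp pz] := (fl p).1 pl; have [|xs [cx Ex]] := @sheet_exists _ _ omega p zz Xp.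
        by move=> k km; rewrite pz.
      exists xs => _; split; first by split=> //; apply: (aeS Ex) => n [].
      by apply: (aeS Ex) => n [].
    by have [xs xsP] := choice ex'; exists xs.
  have [xs xsP] := lift z zlP; have [ys ysP] := lift z' zlP'.
  have t1 := trace_limit sa (fun n x xf => (fib_slice xf).1) (fun k _ => zlP' k) ysP.
  have t2 := trace_limit sa (fun n x xf => (fib_slice xf).1) (fun k _ => zlP k) xsP.
  have t3 := trace_limit sa' (fun n x xf => (fib_slice xf).1) (fun k _ => zlP k) xsP.
  have lim : tends G (fun n => tm n (ii n)) 0.
    pose s p n := if p \in fib zl then (a (ys p n) - a (xs p n)) / dl n - a' (xs p n) else 0.
    have hs p : tends G (s p) 0.
      rewrite /s; have [pl|_] := boolP (p \in fib zl); last exact: tends_cst.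
      have [Xp _] := (fl p).1 pl; have [s1 e1] := xsP p pl; have [s2 e2] := ysP p pl.
      have pr : sheet_pair j p (xs p) (ys p) (fun n => dl n * u).
        split=> //; first by have := tendsM tends_delta (tends_cst u); rewrite mul0r.
        apply: (aeS (ae_and e1 e2)) => n [/= g1 g2] k km.
        by rewrite g1 // g2 // /z' gsh.
      have [P [Q [Pd Qd PQ]]] := sm p Xp _ _ _ pr.
      have h1 := tendsD (tendsM (tends_cst u) Pd) (tendsM (tends_cst u^*) Qd).
      have := tendsB h1 (ca' p Xp _ s1); rewrite subrr; apply: tends_ext.
      apply: (aeS PQ) => n /= ->; congr (_ - _).
      rewrite rmorphM /= {2}/dl fmorphV rmorph_nat -/(dl n); field.
      by rewrite gt_eqF // dl_gt0.
    have := @tends_sum _ _ _ _ (fib zl) s (fun=> 0) hs; rewrite big1 //; apply: tends_ext.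
    apply: (aeS (ae_and t1 (ae_and t2 t3))) => n [/= e1 [e2 e3]].
    rewrite /tm e1 e2 e3 -sumrB mulr_suml -sumrB big_seq [RHS]big_seq; apply: eq_bigr => p pl.
    by rewrite /s pl.
  have wl (x : nat -> C) l : tends G x l -> tends G (fun n => wt (x n)) (wt l).
    move=> xl; apply: tendsX; apply: tendsV; last by rewrite gt_eqF // ltr_wpDr ?exprn_ge0.
    by apply: tendsD; [exact: tends_cst|apply: tendsX; exact: tends_norm].
  have w1 : tends G (fun n => wt2 n (ii n)) (wt (zl j1 - cr o j1) * wt (zl j2 - cr o j2)).
    apply: tends_ext (tendsM (wl _ _ (tendsB (zlP j1) (tends_cst _))) (wl _ _ (tendsB (zlP j2) (tends_cst _)))).
    by apply: aeT => n /=; rewrite /wt2 (gpE n (ii n)).1 (gpE n (ii n)).2.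
  have wn : wt (zl j1 - cr o j1) * wt (zl j2 - cr o j2) != 0 by rewrite gt_eqF // mulr_gt0 ?wt_gt0.
  have := tendsM lim (tendsV w1 wn); rewrite mul0r => /(_ e e0) h.
  have [n [/= h1 h2]] := ae_ex (ae_and h iiP); move: h1.
  rewrite subr0 normrM normfV (gtr0_norm (w0 n (ii n))) ltr_pdivrMr // => /(lt_trans h2).
  by rewrite ltxx.
move=> e e0.
have e1 : 0 < e / (2 * vol) by rewrite divr_gt0 // mulr_gt0 ?ltr0Sn ?vol_gt0.
have hk : G [set n | ~ (n.+1%:R <= K)].
  have k1 : 0 < K + 1 by rewrite ltr_wpDl ?ltr01.
  have k2 : 0 < (K + 1)^-1 by rewrite invr_gt0.
  apply: (aeS (tends_delta k2)) => n /=; rewrite subr0 (gtr0_norm (dl_gt0 n)).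
  rewrite /dl ltf_pV2 ?posrE ?ltr0Sn // => h h'; have := lt_le_trans h h'.
  by rewrite gtrDl ltr10.
apply: (aeS (ae_and (main _ e1) hk)) => n [/= h1 h2].
have -> : Rsum a' n = - sum4 n (tm n).
  have -> : tm n = fun i => (dl n)^-1 * (trace a (gz n (sh i)) - trace a (gz n i)) + (-1) * trace a' (gz n i).
    by apply: funext => i; rewrite /tm mulN1r mulrC.
  rewrite sum4D !sum4Z mulN1r zsh ?mulr0 ?sub0r ?opprK // => i hi.
  apply/eqP; apply: contraT => /(tr_small _ _ _ sa)[g1 g2].
  by case: h2; case: hi => hi; apply: (le_trans hi).
rewrite subr0 normrN; apply: (@le_lt_trans _ _ (sum4 n (fun i => (e / (2 * vol)) * wt2 n i))).
  exact: sum4_norm.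
rewrite sum4Z; apply: (le_lt_trans (ler_wpM2l (ltW e1) (sum4_wt n))).
have -> : e / (2 * vol) * vol = e * 2^-1 by field; rewrite gt_eqF ?vol_gt0.
by rewrite gtr_pMr // invf_lt1 ?ltr0Sn // ltr1n.
Qed.

Theorem stokes j a d db M : j = j1 \/ j = j2 -> smooth j a d db ->
  contF a -> contF d -> contF db -> supp M a -> M \is Num.real -> I d = 0 /\ I db = 0.
Proof.
move=> jj sm ca cd cdb sa Mr.
have jm : (j < m)%N by case: jj => ->.
have [sd sdb] := deriv_supp jm sm sa Mr.
have id := compact_integrable cd sd; have idb := compact_integrable cdb sdb.
have [s1 s2] : (exists sh, is_shift sh 1 j) /\ (exists sh, is_shift sh 'i j).
  by have [a1 a2 a3 a4] := shifts; case: jj => ->; split; eexists; eassumption.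
have [sh1 h1] := s1; have [sh2 h2] := s2.
have e1 := stokes_shift h1 sm ca cd cdb sa Mr; have e2 := stokes_shift h2 sm ca cd cdb sa Mr.
have hd := I_is id; have hdb := I_is idb.
have f1 : I d + I db = 0.
  apply: (tends_uniq (tendsD hd hdb)); apply: (tends_ext _ e1); apply: aeT => n /=.
  by rewrite conjC1 -RsumD; apply: Rsum_ext => x _; rewrite !mul1r.
have f2 : I d - I db = 0.
  apply: (mulfI (neq0Ci C)); rewrite mulr0.
  apply: (tends_uniq (tendsM (tends_cst 'i) (tendsB hd hdb))).
  apply: (tends_ext _ e2); apply: aeT => n /=.
  have -> : Rsum d n - Rsum db n = Rsum (fun x => d x + (-1) * db x) n by rewrite RsumD RsumZ mulN1r.
  by rewrite -RsumZ; apply: Rsum_ext => x _; rewrite conjCi; ring.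
have f3 : 2 * I d = 0.
  by rewrite (_ : 2 * I d = (I d + I db) + (I d - I db)); [rewrite f1 f2 addr0|ring].
have f4 : I d = 0 by move/eqP: f3; rewrite mulf_eq0 pnatr_eq0 /= => /eqP.
by split=> //; move: f1; rewrite f4 add0r.
Qed.

Lemma trace_near f : contF f -> (forall x, slice x -> 0 <= f x) -> 0 < f o ->
  exists k : nat, forall z : nat -> C,
    (forall l, (l < m)%N -> `|z l - cr o l| <= k.+1%:R^-1) ->
    (forall l, (l < m)%N -> l <> j1 -> l <> j2 -> z l = cr o l) -> f o / 2 <= trace f z.
Proof.
move=> cf f0 fo; apply: contrapT => no.
have ex n : exists z : nat -> C, [/\ forall l, (l < m)%N -> `|z l - cr o l| <= n.+1%:R^-1,
    forall l, (l < m)%N -> l <> j1 -> l <> j2 -> z l = cr o l & ~ (f o / 2 <= trace f z)].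
  apply: contrapT => h; apply: no; exists n => z z1 z2; apply: contrapT => z3; apply: h; by exists z.
have [z zP] := choice ex.
have [|xs [cx Ex]] := @sheet_exists _ _ omega o z so.1.
  move=> k km; apply/tends_sub0; apply: (tends_squeeze tends_delta).
  apply: aeT => n /=; rewrite (gtr0_norm (dl_gt0 n)); by have [h _ _] := zP n; exact: h.
have sx : X0_seq o xs by split=> //; apply: (aeS Ex) => n [].
have h := cf o so.1 xs sx.
have p : 0 < f o / 2 by rewrite divr_gt0 ?ltr0Sn.
have [n [/= h1 [Xn En]]] := ae_ex (ae_and (h _ p) Ex).
have [z1 z2 z3] := zP n; apply: z3.
have [uf _ fz] := fibP (z n).
have xf : xs n \in fib (z n) by apply/fz.
have sl x : x \in fib (z n) -> slice x.
  by move=> /fz[Xx xz]; split=> // k km k1 k2; rewrite xz // z2.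
have fx : f o / 2 <= f (xs n).
  have r1 : 0 <= f (xs n) by apply: f0; exact: sl.
  rewrite real_leNgt ?ger0_real // ?(ltW p) //; apply/negP => h3; move: h1.
  rewrite distrC gtr0_norm; last first.
    by rewrite subr_gt0; apply: (lt_trans h3); rewrite gtr_pMr // invf_lt1 ?ltr0Sn // ltr1n.
  move=> /ltrD /(_ h3); rewrite subrK (_ : f o / 2 + f o / 2 = f o); last by field.
  by rewrite ltxx.
apply: (le_trans fx); rewrite /trace (bigD1_seq (xs n)) //= lerDl big_seq_cond.
by apply: sumr_ge0 => x /andP[/sl /f0].
Qed.

Lemma box_count (P L : nat) : (L <= P)%N ->
  \sum_(p < P + P) ((P <= p) && (p < P + L))%N%:R = L%:R :> C.
Proof.
move=> LP; rewrite big_split_ord /= big1 ?add0r => [|p _]; last by rewrite leqNgt ltn_ord.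
under eq_bigr => p _ do rewrite leq_addr ltn_add2l.
rewrite -[RHS](_ : \sum_(p < L) 1 = L%:R); last by rewrite sumr_const card_ord.
rewrite (big_ord_widen P (fun=> 1) LP) [RHS]big_mkcond; apply: eq_bigr => p _.
by case: (p < L)%N.
Qed.

Theorem I_positive f M : contF f -> supp M f -> (forall x, slice x -> 0 <= f x) -> I f = 0 -> f o = 0.
Proof.
move=> cf sf f0 If; have := f0 o so; rewrite le_eqVlt => /orP[/eqP <- //|fo]; exfalso.
have [k hk] := trace_near cf f0 fo.
pose L n : nat := (n.+1 %/ (2 * k.+1))%N.
pose box n p : C := ((P_ n <= p) && (p < P_ n + L n))%N%:R.
have low n : f o / 2 * (dl n * (L n)%:R) ^+ 4 <= Rsum f n.
  have LP : (L n <= P_ n)%N.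
    apply: (leq_trans (leq_div _ _)); by rewrite /P_ expnS expn1 leq_pmulr.
  apply: (@le_trans _ _ (sum4 n (fun i => f o / 2 * (box n i.1.1 * box n i.1.2 * (box n i.2.1 * box n i.2.2))))).
    rewrite sum4Z; have -> : (dl n * (L n)%:R) ^+ 4 = sum4 n (fun i => box n i.1.1 * box n i.1.2 * (box n i.2.1 * box n i.2.2)).
      have bc : \sum_(p < P_ n + P_ n) box n p = (L n)%:R by exact: box_count.
      rewrite exprMn /sum4; congr (_ * _).
      transitivity (((L n)%:R * (L n)%:R) * ((L n)%:R * (L n)%:R) : C); first by ring.
      rewrite -{1}bc mulr_suml mulr_suml; apply: eq_bigr => p _ /=.
      rewrite -{1}bc mulr_sumr mulr_suml; apply: eq_bigr => q _ /=.
      rewrite -{1}bc mulr_suml mulr_sumr; apply: eq_bigr => r _ /=.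
      by rewrite -bc !mulr_sumr; apply: eq_bigr => s _ /=.
    exact: lexx.
  apply: sum4_le => i; have t0 : 0 <= trace f (gz n i).
    by rewrite /trace big_seq; apply: sumr_ge0 => x /fib_slice[sx _]; exact: f0.
  rewrite /box; case: andP => [[a1 a2]|_]; last by rewrite !(mul0r, mulr0).
  case: andP => [[b1 b2]|_]; last by rewrite !(mul0r, mulr0).
  case: andP => [[c1 c2]|_]; last by rewrite !(mul0r, mulr0).
  case: andP => [[d1 d2]|_]; last by rewrite !(mul0r, mulr0).
  rewrite !mulr1; apply: hk => l lm; last by move=> /eqP l1 /eqP l2; rewrite /gz (negbTE l1) (negbTE l2) !mul0r !addr0.
  have gs (u : nat * nat) : (P_ n <= u.1)%N -> (u.1 < P_ n + L n)%N -> (P_ n <= u.2)%N -> (u.2 < P_ n + L n)%N ->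
      `|gp n u| <= k.+1%:R^-1.
    move=> u1 u2 u3 u4; rewrite /gp normrM (gtr0_norm (dl_gt0 n)) -!natrB //.
    apply: (@le_trans _ _ (dl n * (L n + L n)%:R)).
      apply: (ler_wpM2l (ltW (dl_gt0 n))); apply: (le_trans (ler_normD _ _)).
      rewrite normrM normCi mul1r !normr_nat -natrD ler_nat; apply: leq_add; rewrite leq_subLR; exact: ltnW.
    rewrite /dl mulrC ler_pdivrMr ?ltr0Sn // mulrC ler_pdivlMr ?ltr0Sn // -natrM ler_nat addnn -muln2 -mulnA.
    exact: leq_divM.
  have n12 : (j1 == j2) = false by apply/eqP.
  have -> : gz n i l - cr o l = (l == j1)%:R * gp n i.1 + (l == j2)%:R * gp n i.2 by rewrite /gz; ring.
  have k0 : 0 <= (k.+1%:R^-1 : C) by rewrite invr_ge0 ler0n.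
  case: eqP => [->|_]; first by rewrite n12 mul0r mul1r addr0; exact: gs.
  by case: eqP => _; rewrite !(mul0r, mul1r, add0r, addr0) ?normr0 //; exact: gs.
pose r : C := (4 * k.+1)%N%:R^-1.
have r0 : 0 < r by rewrite invr_gt0 ltr0n.
have big : G [set n | f o / 2 * r ^+ 4 <= Rsum f n].
  apply: (aeS (G_free (2 * k.+1)%N)) => n /= nk; apply: le_trans (low n).
  have fo2 : 0 <= f o / 2 by rewrite divr_ge0 ?ler0n // ltW.
  apply: (ler_wpM2l fo2); apply: lerXn2r; rewrite ?nnegrE ?(ltW r0) //.
    by rewrite mulr_ge0 ?ler0n // ltW ?dl_gt0.
  rewrite /r /dl mulrC ler_pdivlMr ?ltr0Sn // mulrC ler_pdivrMr ?ltr0n // -natrM ler_nat.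
  have Ld : (n.+1 < (L n).+1 * (2 * k.+1))%N by rewrite ltn_ceil // muln_gt0.
  have L1 : (0 < L n)%N by rewrite divn_gt0 ?muln_gt0 // ltnW.
  apply: ltnW; apply: (leq_trans Ld); have -> : (L n * (4 * k.+1) = L n * 2 * (2 * k.+1))%N by rewrite -mulnA (mulnA 2).
  rewrite leq_mul2r.
  by apply/orP; right; rewrite muln2 -addnn -addn1 leq_add2l.
have Ii : integrable f by exact: compact_integrable sf.
have := tends_le big (tends_cst _) (I_is Ii); rewrite If.
have p : 0 < f o / 2 * r ^+ 4 by rewrite mulr_gt0 ?exprn_gt0 ?divr_gt0 ?ltr0Sn.
by move=> /(lt_le_trans p); rewrite ltxx.
Qed.

End Integration.


(** The functions of moderate growth with respect to [B]. *)
Definition dom B a : Prop :=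
  exists2 c : C, 0 <= c & exists k, forall x, slice x -> `|a x| <= c * B x ^+ k.

Section Growth.
Variable B : pts -> C.
Hypothesis B1 : forall x, slice x -> 1 <= B x.

Lemma dom_raise a (c0 : C) k l : 0 <= c0 -> (k <= l)%N -> (forall x, slice x -> `|a x| <= c0 * B x ^+ k) ->
  forall x, slice x -> `|a x| <= c0 * B x ^+ l.
Proof.
move=> c00 kl h x sx; apply: le_trans (h x sx) _; apply: (ler_wpM2l c00).
by apply: ler_weXn2l => //; exact: B1.
Qed.

Lemma dom_cst (e : C) : dom B (fun=> e).
Proof. by exists `|e|; [exact: normr_ge0|exists 0%N => x _; rewrite expr0 mulr1]. Qed.

Lemma domD a c : dom B a -> dom B c -> dom B (fun x => a x + c x).
Proof.
move=> [u u0 [k hk]] [v v0 [l hl]]; exists (u + v); first exact: addr_ge0.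
exists (k + l)%N => x sx; apply: le_trans (ler_normD _ _) _; rewrite mulrDl; apply: lerD.
  by apply: (dom_raise u0 _ hk) => //; exact: leq_addr.
by apply: (dom_raise v0 _ hl) => //; exact: leq_addl.
Qed.

Lemma domM a c : dom B a -> dom B c -> dom B (fun x => a x * c x).
Proof.
move=> [u u0 [k hk]] [v v0 [l hl]]; exists (u * v); first exact: mulr_ge0.
exists (k + l)%N => x sx; rewrite normrM exprD mulrACA; apply: ler_pM; rewrite ?normr_ge0 //.
  exact: hk.
exact: hl.
Qed.

Lemma dom_sum (I : Type) (s : seq I) (F : I -> pts -> C) : (forall i, dom B (F i)) ->
  dom B (fun x => \sum_(i <- s) F i x).
Proof.
move=> h; elim: s => [|i s IH].
  by under [X in dom _ X]eq_fun do rewrite big_nil; exact: dom_cst.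
by under [X in dom _ X]eq_fun do rewrite big_cons; exact: domD.
Qed.

Lemma domX a k : dom B a -> dom B (fun x => a x ^+ k).
Proof.
move=> h; elim: k => [|k IH]; first exact: dom_cst.
by under [X in dom _ X]eq_fun do rewrite exprS; exact: domM.
Qed.

Lemma dom_le a c : (forall x, slice x -> `|a x| <= `|c x|) -> dom B c -> dom B a.
Proof.
move=> ac [u u0 [k hk]]; exists u => //; exists k => x sx.
exact: le_trans (ac x sx) (hk x sx).
Qed.

Lemma dom_tev n (f : tower C n) : (forall k, (k < n)%N -> dom B (fun x => cr x k)) ->
  dom B (fun x => tev n (cr x) f).
Proof.
elim: n f => [|n IH] f h; first exact: dom_cst.
under [X in dom _ X]eq_fun do rewrite tevS.
apply: dom_sum => i; apply: domM; last by apply: domX; exact: h.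
by apply: IH => k kn; apply: h; exact: ltnW.
Qed.
End Growth.

Lemma dom_base B B' a : (forall x, slice x -> 1 <= B x) -> (forall x, slice x -> B x <= B' x) ->
  dom B a -> dom B' a.
Proof.
move=> B1 BB [u u0 [k hk]]; exists u => //; exists k => x sx; apply: le_trans (hk x sx) _.
apply: (ler_wpM2l u0); apply: lerXn2r; rewrite ?nnegrE ?BB //.
  by apply: le_trans (B1 x sx); exact: ler01.
by apply: le_trans (BB x sx); apply: le_trans (B1 x sx); exact: ler01.
Qed.

Definition qq j x : C := 1 + `|cr x j - cr o j| ^+ 2.
Definition Dv x : C := tev m (cr x) (sh_D H).

Lemma qq_ge1 j x : 1 <= qq j x.
Proof. by rewrite lerDl exprn_ge0. Qed.
Lemma qq_gt0 j x : 0 < qq j x.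
Proof. exact: lt_le_trans ltr01 (qq_ge1 j x). Qed.
Lemma qq_neq0 j x : qq j x != 0. Proof. by rewrite gt_eqF ?qq_gt0. Qed.

Lemma le_sq (t : C) : 0 <= t -> t <= 1 + t ^+ 2.
Proof.
move=> t0; have [t1|t1] := real_leP (ger0_real t0) (@real1 C).
  by apply: le_trans t1 _; rewrite lerDl exprn_ge0.
by rewrite ler_wpDl ?ler01 // expr2 ler_peMl // ltW.
Qed.

Definition q2 x : C := qq j1 x * qq j2 x.
Lemma q2_ge1 x : 1 <= q2 x.
Proof. by rewrite /q2 -[1](mulr1 1); apply: ler_pM; rewrite ?ler01 ?qq_ge1. Qed.

Lemma dom_free k : (k < m)%N -> dom q2 (fun x => cr x k).
Proof.
move=> km; have B1 x : slice x -> 1 <= q2 x by move=> _; exact: q2_ge1.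
have dz j : j = j1 \/ j = j2 -> dom q2 (fun x => cr x j - cr o j).
  move=> jj; exists 1; first exact: ler01.
  exists 1%N => x _; rewrite mul1r expr1; apply: (le_trans (le_sq (normr_ge0 _))); rewrite -/(qq j x) /q2.
  by case: jj => ->; rewrite ?ler_peMr ?ler_peMl ?qq_ge1 // ltW ?qq_gt0.
have dj j : j = j1 \/ j = j2 -> dom q2 (fun x => cr x j).
  move=> jj; have := domD B1 (dz j jj) (dom_cst q2 (cr o j)); apply: dom_le => x _.
  by rewrite subrK.
have [->|/eqP k1] := eqVneq k j1; first by apply: dj; left.
have [->|/eqP k2] := eqVneq k j2; first by apply: dj; right.
by apply: (dom_le _ (dom_cst q2 (cr o k))) => x [_ ->].
Qed.

Lemma exhaustion_constants : exists (cc : C) (e : nat), 1 <= cc /\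
  forall x, slice x -> `|Dv x| ^+ 2 <= cc * q2 x ^+ e.
Proof.
have B1 x : slice x -> 1 <= q2 x by move=> _; exact: q2_ge1.
have := dom_tev B1 (sh_D H) dom_free => /(domX 2)[u u0 [k hk]].
exists (u + 1), k; split=> [|x sx]; first by rewrite lerDr.
have := hk x sx; rewrite normrX => h; apply: le_trans h _.
apply: ler_wpM2r; last by rewrite lerDl ler01.
by rewrite exprn_ge0 // (le_trans ler01 (q2_ge1 x)).
Qed.

Definition Ec : C := projT1 (cid exhaustion_constants).
Definition Ee : nat := projT1 (cid (projT2 (cid exhaustion_constants))).
Lemma EcP : 1 <= Ec /\ forall x, slice x -> `|Dv x| ^+ 2 <= Ec * q2 x ^+ Ee.
Proof. exact: projT2 (cid (projT2 (cid exhaustion_constants))). Qed.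

(** The exhaustion function. *)
Definition Ex x : C := Ec * q2 x ^+ Ee.+1 / (Dv x * (Dv x)^*).

Lemma Dv_sq x : X0 H x -> 0 < Dv x * (Dv x)^*.
Proof. by move=> [_ D0]; rewrite -normCK exprn_gt0 // normr_gt0. Qed.

Lemma Ex_gt0 x : X0 H x -> 0 < Ex x.
Proof.
move=> Xx; rewrite divr_gt0 ?Dv_sq // mulr_gt0 //; first exact: lt_le_trans ltr01 (EcP).1.
by rewrite exprn_gt0 // mulr_gt0 ?qq_gt0.
Qed.

Lemma Ex_real x : Ex x \is Num.real.
Proof.
rewrite /Ex realM ?realV //; last by rewrite -normCK realX ?normr_real.
apply: realM; first by apply: ger0_real; exact: le_trans ler01 (EcP).1.
by apply: realX; apply: ger0_real; exact: le_trans ler01 (q2_ge1 x).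
Qed.

Lemma Ex_ge x : slice x -> q2 x <= Ex x.
Proof.
move=> sx; rewrite /Ex ler_pdivlMr ?Dv_sq //; last exact: sx.1.
rewrite -normCK (exprS _ Ee) [X in _ <= X]mulrCA; apply: ler_wpM2l; last exact: (EcP).2.
exact: le_trans ler01 (q2_ge1 x).
Qed.

Lemma Ex_ge1 x : slice x -> 1 <= Ex x.
Proof. by move=> sx; apply: le_trans (q2_ge1 x) (Ex_ge sx). Qed.

Lemma dom_Dinv : dom Ex (fun x => (Dv x)^-1).
Proof.
exists 1; first exact: ler01.
exists 1%N => x sx; rewrite mul1r expr1.
have D0 : Dv x != 0 := sx.1.2.
have h : `|(Dv x)^-1| ^+ 2 <= Ex x.
  rewrite normfV exprVn normCK /Ex -[X in X <= _]mul1r; apply: ler_wpM2r; first by rewrite invr_ge0 ltW ?Dv_sq //; exact: sx.1.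
  rewrite -[1](mulr1 1); apply: ler_pM; rewrite ?ler01 ?(EcP).1 //.
  exact: exprn_ege1 (q2_ge1 x).
have [t1|t1] := real_leP (normr_real (Dv x)^-1) (@real1 C); first exact: le_trans t1 (Ex_ge1 sx).
by apply: le_trans h; rewrite expr2 ler_peMl ?normr_ge0 // ltW.
Qed.

Lemma root_bound (p : {poly C}) (y : C) : root p y -> p != 0 ->
  `|y| <= 1 + \sum_(l < (size p).-1) `|p`_l| / `|lead_coef p|.
Proof.
move=> /rootP py p0; have lc0 : 0 < `|lead_coef p| by rewrite normr_gt0 lead_coef_eq0.
have s0 : 0 <= \sum_(l < (size p).-1) `|p`_l| / `|lead_coef p|.
  by apply: sumr_ge0 => l _; rewrite divr_ge0.
have [y1|y1] := real_leP (normr_real y) (@real1 C); first by apply: le_trans y1 _; rewrite lerDl.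
rewrite ler_wpDl ?ler01 // -mulr_suml ler_pdivlMr //.
have y0 : 0 < `|y| := lt_trans ltr01 y1.
have [s sE] : exists s, size p = s.+1 by move: p0; rewrite -size_poly_gt0; case: (size p) => // s; exists s.
move: py; rewrite horner_coef lead_coefE sE /= big_ord_recr /= => /eqP; rewrite addr_eq0 => /eqP e.
case: s sE e => [|s] sE e.
  move: e; rewrite big_ord0 => /esym/eqP; rewrite oppr_eq0 expr0 mulr1.
  by move: p0; rewrite -lead_coef_eq0 lead_coefE sE /= => /negbTE ->.
rewrite -(ler_pM2r (exprn_gt0 s y0)) mulrAC -exprS mulrC -normrX -normrM.
rewrite -[X in X <= _]normrN -e; apply: le_trans (ler_norm_sum _ _ _) _; rewrite mulr_suml.
apply: ler_sum => l _; rewrite normrM; apply: ler_wpM2l => //.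
by rewrite normrX; apply: ler_weXn2l; [exact: ltW|rewrite -ltnS].
Qed.

Lemma dom_cr k : (k < N.+1)%N -> dom Ex (fun x => cr x k).
Proof.
have B1 := Ex_ge1; suff h n k' : (k' < n)%N -> (k' < N.+1)%N -> dom Ex (fun x => cr x k') by exact: (h k.+1).
elim: n k' => // n IH k'; rewrite ltnS leq_eqVlt => /orP[/eqP -> nN|/IH h /h //].
have [nm|mn] := ltnP n m.
  by apply: dom_base (dom_free nm) => x sx; [exact: q2_ge1|exact: Ex_ge].
have mnN : (m <= n < N.+1)%N by rewrite mn.
have [F hF] := sh_lead mnN.
have dt f : dom Ex (fun x => tev n (cr x) f).
  by apply: dom_tev => // k2 kn; apply: IH => //; exact: ltn_trans nN.
have dl : dom Ex (fun x => (tev n (cr x) (lead_coef (sh_Q H n)))^-1).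
  apply: dom_le (domM (dt F) dom_Dinv) => x sx; have e := hF _ (X0_S sx.1).
  have l0 := X0_lead sx.1 mnN; have D0 : Dv x != 0 := sx.1.2.
  rewrite /= -[X in _ <= X]/(`|_ * (tev m (cr x) (sh_D H))^-1|) -e.
  have F0 : tev n (cr x) F != 0 by move: D0; rewrite /Dv -e mulf_eq0 negb_or => /andP[].
  by rewrite invfM mulrA divff // mul1r.
pose s := (size (sh_Q H n)).-1.
have := domD B1 (dom_cst Ex 1) (dom_sum B1 (index_enum 'I_s) (F := fun l x => `|tev n (cr x) (sh_Q H n)`_l| * `|(tev n (cr x) (lead_coef (sh_Q H n)))^-1|) _).
move=> /(_ _) h; apply: dom_le (h _) => [x sx|l]; last first.
  by apply: domM => //; [apply: dom_le (dt (sh_Q H n)`_l)|apply: dom_le dl] => x _; rewrite normr_id.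
pose p : {poly C} := map_poly (tev n (cr x)) (sh_Q H n).
have l0 := X0_lead sx.1 mnN.
have sp : size p = size (sh_Q H n) by rewrite size_map_poly_id0.
have lp : lead_coef p = tev n (cr x) (lead_coef (sh_Q H n)) by rewrite lead_coef_map_id0 ?rmorph0.
have rp : root p (cr x n) by apply/rootP; exact: (X0_eq sx.1 mnN).
have p0 : p != 0 by rewrite -lead_coef_eq0 lp.
apply: le_trans (root_bound rp p0) _; rewrite sp lp [X in _ <= X]ger0_norm; last first.
  by rewrite addr_ge0 ?ler01 // sumr_ge0 // => l _; rewrite mulr_ge0.
by rewrite lerD2l; apply: ler_sum => l _; rewrite coef_map normfV.
Qed.

Lemma Ex_proper M (xs : nat -> pts) : G [set n | slice (xs n) /\ Ex (xs n) <= M] ->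
  exists2 x, X0 H x & X0_seq x xs.
Proof.
move=> hs.
have bd a : dom Ex a -> exists l, tends G (fun n => a (xs n)) l.
  move=> [u u0 [k hk]]; apply: (bounded_tends (M := u * M ^+ k)); apply: (aeS hs) => n [/= sn En].
  apply: le_trans (hk _ sn) _; apply: (ler_wpM2l u0).
  have E0 := ltW (Ex_gt0 sn.1); apply: lerXn2r; rewrite ?nnegrE //; exact: le_trans E0 En.
have ex k : exists l, (k < N.+1)%N -> tends G (fun n => cr (xs n) k) l.
  have [kN|_] := boolP (k < N.+1)%N; last by exists 0.
  by have [l hl] := bd _ (dom_cr kN); exists l.
have [v vP] := choice ex.
have ts n (f : tower C n) : (n <= N.+1)%N -> tends G (fun j => tev n (cr (xs j)) f) (tev n v f).
  by move=> nN; apply: tends_tev => k kn; apply: vP; exact: leq_trans nN.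
have [|x xb xv] := @chart_closed (sh_b H) (sh_s H) v (sh_uniq H) (sh_size H).
  move=> f vf; apply: (tends_uniq (ts _ f (leqnn _))); apply: (tends_ext _ (tends_cst 0)).
  by apply: (aeS hs) => n [sn _]; exact/esym/(vf _ (X0_S sn.1)).
have cx : conv H G xs x.
  by move=> k kN; rewrite -[X in tends _ _ X]/(coords (sh_b H) (sh_s H) x k) xv //; exact: vP.
have [l hl] := bd _ dom_Dinv.
have D1 : tev m v (sh_D H) * l = 1.
  apply: (tends_uniq (tendsM (ts _ (sh_D H) (sh_mN H)) hl)).
  apply: (tends_ext _ (tends_cst 1)); apply: (aeS hs) => n [/= sn _].
  by rewrite mulfV //; exact: sn.1.2.
have Xx : X0 H x.
  split=> //; rewrite (@tev_ext _ m _ v) => [|k km]; last by apply: xv; exact: leq_trans km (sh_mN H).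
  apply/eqP => D0; move: D1; rewrite D0 mul0r => /esym/eqP; by rewrite oner_eq0.
exists x => //; split=> //; by apply: (aeS hs) => n [/= [] ].
Qed.

Lemma Ex_cont : contF Ex.
Proof.
move=> x Xx; have cq j : (j < m)%N -> cont x (qq j).
  move=> jm; apply: contD => //; first exact: cont_cst.
  apply: contX => //; apply: cont_norm => //; apply: contD => //; last exact: cont_cst.
  by move=> xs [cx _]; apply: cx; exact: leq_trans jm (sh_mN H).
have cD : cont x Dv by apply: cont_tev => //; exact: sh_mN.
apply: contM => //; last by apply: contV => //; [rewrite gt_eqF // Dv_sq|apply: contM => //; exact: cont_conj].
apply: contM => //; first exact: cont_cst.
by apply: contX => //; apply: contM => //; exact: cq.
Qed.


Implicit Types (b d db e eb f : pts -> C).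
Notation E := Ex.

Let jm j : j = j1 \/ j = j2 -> (j < m)%N.
Proof. by case=> ->. Qed.

Definition LE x : C := lnC (E x).
Definition ut (T : nat) x : C := posC (1 - T.+1%:R^-1 * LE x).
Definition zeta j x : C := cr x j - cr o j.
Definition pole : C := (Ee).+1%:R.
Definition tau j x : C := pdv j Dv x / Dv x - pole * ((zeta j x)^* / qq j x).
Definition hq j x : C := (qq j x)^-1 ^+ 2.

Lemma real_embed (r : R) : r%:C%C \is Num.real :> bool.
Proof. by rewrite complex_real. Qed.

Lemma conj_real (z : C) : z \is Num.real -> z^* = z.
Proof. by move/CrealP. Qed.

Lemma LE_real x : LE x \is Num.real. Proof. exact: real_embed. Qed.

Lemma ut_ge0 T x : 0 <= ut T x.
Proof. by rewrite /ut /posC -(rmorph0 (real_complex R)) lecR le_max lexx. Qed.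

Lemma hq_ge0 j x : 0 <= hq j x.
Proof. by rewrite exprn_ge0 // invr_ge0 ltW // qq_gt0. Qed.

Local Ltac nonneg := repeat first [assumption | exact: ler0n | exact: ler01 | exact: lexx | exact: normr_ge0
  | exact: mul_conjC_ge0 | exact: ut_ge0 | exact: hq_ge0 | apply: exprn_ge0 | rewrite invr_ge0
  | apply: mulr_ge0 | apply: addr_ge0 | apply: ltW; assumption].
Local Hint Extern 0 (is_true (0 <= _)) => solve [nonneg] : core.

Lemma LE_ge0 x : slice x -> 0 <= LE x.
Proof.
move=> sx; rewrite /LE /lnC -(rmorph0 (real_complex R)) lecR; apply: exp.ln_ge0.
by have := Ex_ge1 sx; rewrite lecE => /andP[].
Qed.

Lemma posC_le (y z : C) : y \is Num.real -> z \is Num.real -> y <= z -> posC y <= posC z.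
Proof.
move=> yr zr; rewrite {1}(real_Re yr) {1}(real_Re zr) /posC !lecR => yz.
by rewrite ge_max !le_max lexx yz orbT.
Qed.

Let arg_real T x : 1 - T.+1%:R^-1 * LE x \is Num.real.
Proof. by rewrite realB ?real1 // realM ?LE_real // realV realn. Qed.

Lemma ut_le1 T x : slice x -> ut T x <= 1.
Proof.
move=> sx; have -> : (1 : C) = posC 1 by rewrite /posC max_r //= ler01.
apply: posC_le; [exact: arg_real|exact: real1|].
by rewrite gerBl mulr_ge0 ?invr_ge0 ?ler0n ?LE_ge0.
Qed.

Lemma ut_mono S T x : slice x -> (S <= T)%N -> ut S x <= ut T x.
Proof.
move=> sx ST; apply: posC_le; [exact: arg_real|exact: arg_real|].
rewrite lerD2l lerN2; apply: ler_wpM2r; first exact: LE_ge0.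
by rewrite lef_pV2 ?posrE ?ltr0Sn // ler_nat.
Qed.

Lemma ut_neq0 T x : X0 H x -> ut T x != 0 -> E x <= (sequences.expR T.+1%:R)%:C%C /\ LE x <= T.+1%:R.
Proof.
move=> Xx; have [eE E0] := Re_gt0 (Ex_gt0 Xx).
rewrite /ut /posC => h.
have : 0 < complex.Re (1 - T.+1%:R^-1 * LE x).
  by rewrite ltNge; apply: contra h => /max_l ->; rewrite eqxx.
have e1 : 1 - T.+1%:R^-1 * LE x = (1 - T.+1%:R^-1 * exp.ln (complex.Re (E x)))%:C%C.
  by rewrite rmorphB rmorphM fmorphV rmorph_nat rmorph1.
rewrite e1 /= subr_gt0 mulrC ltr_pdivrMr ?ltr0Sn // mul1r => l1.
have l2 : exp.ln (complex.Re (E x)) <= T.+1%:R by exact: ltW.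
split; last by rewrite /LE /lnC -(rmorph_nat (real_complex R)) lecR.
by rewrite eE lecR -[X in X <= _]exp.lnK ?posrE // exp.ler_expR.
Qed.

Lemma contF_E : contF E. Proof. exact: Ex_cont. Qed.
Lemma contF_LE : contF LE.
Proof. by apply: contF_ln; [move=> x; exact: Ex_gt0|exact: contF_E]. Qed.
Local Hint Resolve contF_E contF_LE j1m j2m jm : cts.
Lemma contF_ut T : contF (ut T).
Proof. by apply: contF_pos => // x _; exact: arg_real. Qed.

Lemma contF_zeta j : (j < m)%N -> contF (zeta j).
Proof. by move=> jl x Xx xs [cx _]; apply: (tendsB (cx j (leq_trans jl (sh_mN H))) (tends_cst _)). Qed.
Local Hint Resolve contF_ut contF_zeta : cts.
Lemma contF_qq j : (j < m)%N -> contF (qq j).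
Proof. by move=> jl; apply: contFD => //; apply/contFX/contF_norm/contF_zeta. Qed.
Lemma contF_qqV j : (j < m)%N -> contF (fun x => (qq j x)^-1).
Proof. by move=> jl; apply: contFV; [move=> x _; exact: qq_neq0|exact: contF_qq]. Qed.
Local Hint Resolve contF_qq contF_qqV : cts.
Lemma contF_hq j : (j < m)%N -> contF (hq j).
Proof. by move=> jl; apply/contFX/contF_qqV. Qed.
Lemma hol_D : hol Dv.
Proof. by move=> x [xb _]; exact: cr_regat. Qed.
Lemma D_neq0 x : X0 H x -> Dv x != 0. Proof. by case. Qed.
Lemma hol_dlogD j : hol (fun x => pdv j Dv x / Dv x).
Proof. by apply: hol_div; [exact: (hol_pdv j hol_D)|exact: hol_D|exact: D_neq0]. Qed.
Local Hint Resolve contF_hq hol_D hol_dlogD : cts.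

Lemma contF_tau j : (j < m)%N -> contF (tau j).
Proof. by move=> jl; apply: contFD => //; exact/contF_hol/hol_dlogD. Qed.
Local Hint Resolve contF_tau : cts.

Lemma smooth_zeta i j : (j < m)%N -> smooth i (zeta j) (fun=> (j == i)%:R) (fun=> 0).
Proof.
move=> jl; have hj : hol (fun x => cr x j) by move=> x [xb _]; exact: cr_regat1.
have := smoothD (@smooth_hol i _ hj) (@smooth_cst i (- cr o j)).
apply: smooth_eq => x Xx; rewrite addr0 //.
by rewrite (pdv_cr i Xx (leq_trans jl (sh_mN H))) jl.
Qed.

Lemma qqE j x : qq j x = 1 + zeta j x * (zeta j x)^*.
Proof. by rewrite /qq normCK. Qed.

Lemma smooth_qq i j : (j < m)%N ->
  smooth i (qq j) (fun x => (j == i)%:R * (zeta j x)^*) (fun x => (j == i)%:R * zeta j x).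
Proof.
move=> jl; have sz := smooth_zeta (i := i) jl; have cz := contF_zeta jl.
have h := smoothD (@smooth_cst i 1) (smoothM cz (contF_conj cz) sz (smooth_conj sz)).
apply: (smooth_ext (a := fun x => 1 + zeta j x * (zeta j x)^*)) => [x _|]; first by rewrite qqE.
by apply: smooth_eq h => x _; rewrite ?conjC0 ?conjC_nat; ring.
Qed.

Lemma qq_real j x : (qq j x)^* = qq j x.
Proof. by apply: conj_real; apply: ger0_real; apply: ltW; exact: qq_gt0. Qed.

Lemma pole_real : pole^* = pole. Proof. exact: conjC_nat. Qed.

Definition taubb i j x : C := (pdv i (fun y => pdv j Dv y / Dv y) x)^* + pole * ((j == i)%:R * (zeta j x * (qq j x)^-1) ^+ 2).

Lemma smooth_qqV i j : (j < m)%N -> smooth i (fun x => (qq j x)^-1)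
  (fun x => - (qq j x)^-1 ^+ 2 * ((j == i)%:R * (zeta j x)^*)) (fun x => - (qq j x)^-1 ^+ 2 * ((j == i)%:R * zeta j x)).
Proof. by move=> jl; apply: smoothV => // [x _|]; [exact: qq_neq0|exact: smooth_qq]. Qed.

Lemma smooth_taub i j : (j < m)%N ->
  smooth i (fun x => (tau j x)^*) (fun x => - pole * ((j == i)%:R * hq j x)) (taubb i j).
Proof.
move=> jl; have s1 := smooth_conj (@smooth_hol i _ (hol_dlogD j)).
have s2 := smoothM (contF_zeta jl) (contF_qqV jl) (smooth_zeta (i := i) jl) (smooth_qqV (i := i) jl).
have h := smoothD s1 (smoothZ (- pole) s2).
apply: (smooth_ext (a := fun x => (pdv j Dv x / Dv x)^* + - pole * (zeta j x * (qq j x)^-1))) => [x _|].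
  have e : (pole * ((zeta j x)^* / qq j x))^* = pole * (zeta j x / qq j x).
    by rewrite !rmorphM /= conjCK fmorphV /= qq_real pole_real.
  by rewrite /tau rmorphB /= e mulNr.
apply: smooth_eq h => x Xx; last by rewrite /taubb; ring.
have e : qq j x - zeta j x * (zeta j x)^* = 1 by rewrite qqE addrK.
rewrite conjC0 add0r /hq; congr (_ * _).
transitivity ((j == i)%:R * ((qq j x - zeta j x * (zeta j x)^*) / qq j x ^+ 2)); first by field; exact: qq_neq0.
by rewrite e mul1r exprVn.
Qed.

Lemma contF_taubb i j : (j < m)%N -> contF (taubb i j).
Proof. by move=> jl; apply: contFD; first by apply/contF_conj/contF_hol/hol_pdv/hol_dlogD. Qed.
Local Hint Resolve contF_taubb : cts.

Lemma smoothX i n a d db : contF a -> smooth i a d db ->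
  smooth i (fun x => a x ^+ n.+1) (fun x => n.+1%:R * a x ^+ n * d x) (fun x => n.+1%:R * a x ^+ n * db x).
Proof.
move=> ca sa; elim: n => [|n IH].
  by apply: smooth_eq sa => x _; rewrite expr0 mulr1 mul1r.
have := smoothM ca (contFX n.+1 ca) sa IH.
apply: smooth_eq => x _; rewrite -[n.+2%:R]nat1r !exprS; ring.
Qed.

(** The logarithm of the exhaustion has the meromorphic derivatives [- tau]: this is
    what makes the cutoff commute with holomorphic integration by parts. *)
Lemma smooth_LE j : j = j1 \/ j = j2 ->
  smooth j LE (fun x => - tau j x) (fun x => - (tau j x)^*).
Proof.
move=> jj; have n12 : (j1 == j2) = false by apply/eqP.
have n21 : (j2 == j1) = false by rewrite eq_sym.
have cD := contF_hol hol_D; have cd := contFM cD (contF_conj cD).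
have DD0 x : X0 H x -> Dv x * (Dv x)^* != 0 by move=> Xx; rewrite gt_eqF // Dv_sq.
have sD := @smooth_hol j _ hol_D.
have s1 := smoothM (contF_qq j1m) (contF_qq j2m) (smooth_qq (i := j) j1m) (smooth_qq (i := j) j2m).
have s2 := smoothZ Ec (smoothX Ee (contFM (contF_qq j1m) (contF_qq j2m)) s1).
have s3 := smoothM cD (contF_conj cD) sD (smooth_conj sD).
have cn : contF (fun x => Ec * (qq j1 x * qq j2 x) ^+ Ee.+1) by [].
have sE := smoothM cn (contFV DD0 cd) s2 (smoothV DD0 cd s3).
have E0 x : X0 H x -> 0 < E x by exact: Ex_gt0.
have Ec0 : Ec != 0 by rewrite gt_eqF // (lt_le_trans ltr01) //; exact: EcP.1.
have p0 x : (qq j1 x * qq j2 x) ^+ Ee != 0 by rewrite expf_neq0 // mulf_neq0 ?qq_neq0.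
have := smooth_ln E0 contF_E sE; apply: smooth_eq => x /D_neq0 D0; have := p0 x;
  have D0' : (Dv x)^* != 0 by rewrite ?conjC_eq0.
- rewrite /Ex /q2 /tau /pole !exprS conjC0; set p := (_ * _) ^+ Ee => p0'.
  case: jj => ->; rewrite eqxx ?n12 ?n21 ?mulr0n ?mulr1n; field;
    by rewrite ?D0 ?D0' ?Ec0 ?p0' ?qq_neq0.
- rewrite rmorphB !rmorphM /= !fmorphV /= conjCK qq_real pole_real.
  rewrite /Ex /q2 /pole !exprS; set p := (_ * _) ^+ Ee => p0'.
  case: jj => ->; rewrite eqxx ?n12 ?n21 ?mulr0n ?mulr1n; field;
    by rewrite ?D0 ?D0' ?Ec0 ?p0' ?qq_neq0.
Qed.

(** ** Integrals with a cutoff *)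

Definition J T k b : C := I (fun x => ut T x ^+ k.+1 * b x).

Definition bT T : C := (sequences.expR T.+1%:R)%:C%C.

Lemma J_supp T k b : supp E (bT T) (fun x => ut T x ^+ k.+1 * b x).
Proof.
move=> x Xx h; apply: (ut_neq0 Xx _).1; apply: contraNneq h => ->.
by rewrite exprS !mul0r.
Qed.

Lemma J_cont T k b : contF b -> contF (fun x => ut T x ^+ k.+1 * b x).
Proof. by []. Qed.

Lemma J_int T k b : contF b -> integrable (fun x => ut T x ^+ k.+1 * b x).
Proof. by move=> cb; exact: (compact_integrable Ex_proper (J_cont T k cb) (@J_supp T k b)). Qed.

Lemma integrableZ (z : C) b : integrable b -> integrable (fun x => z * b x).
Proof. by move=> [c hc]; exists (`|z| * c) => x /hc; rewrite normrM -mulrA; exact: ler_wpM2l. Qed.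

Lemma integrableD b c : integrable b -> integrable c -> integrable (fun x => b x + c x).
Proof.
move=> [c1 h1] [c2 h2]; exists (c1 + c2) => x sx; rewrite mulrDl.
by apply: (le_trans (ler_normD _ _)); apply: lerD; [exact: h1|exact: h2].
Qed.
Local Hint Extern 0 (integrable _) => solve [auto 12 using J_int, integrableZ, integrableD with cts nocore] : core.

Lemma JD T k b c : contF b -> contF c -> J T k (fun x => b x + c x) = J T k b + J T k c.
Proof. by move=> cb cc; rewrite /J -ID //; apply: I_ext => // x _; rewrite mulrDr. Qed.

Lemma JZ T k (z : C) b : contF b -> J T k (fun x => z * b x) = z * J T k b.
Proof. by move=> cb; rewrite /J -IZ //; apply: I_ext => // x _; rewrite mulrCA. Qed.

Lemma J_ext T k b c : contF b -> (forall x, slice x -> b x = c x) -> J T k b = J T k c.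
Proof. by move=> cb bc; apply: I_ext => // x sx; rewrite bc. Qed.

Lemma J_le T k b c : contF b -> contF c -> (forall x, slice x -> b x <= c x) -> J T k b <= J T k c.
Proof. by move=> cb cc bc; apply: I_le => // x sx; apply: ler_wpM2l; [|exact: bc]. Qed.

Lemma J_ge0 T k b : contF b -> (forall x, slice x -> 0 <= b x) -> 0 <= J T k b.
Proof.
move=> cb b0; rewrite -(mul0r (J T k (fun=> 0))) -JZ //.
by apply: J_le => // x sx; rewrite mul0r b0.
Qed.

Lemma J_norm T k b : contF b -> `|J T k b| <= J T k (fun x => `|b x|).
Proof.
move=> cb; have i1 := I_is (J_int T k cb); have i2 := I_is (J_int T k (contF_norm cb)).
apply: (tends_le _ (tends_norm i1) i2); apply: aeT => n /=.
apply: sum4_norm => i; apply: (le_trans (ler_norm_sum _ _ _)); apply: ler_sum => x _.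
by rewrite normrM (ger0_norm (exprn_ge0 _ (ut_ge0 _ _))).
Qed.

Lemma J_stokes T k j b d db : j = j1 \/ j = j2 -> contF b -> contF d -> contF db -> smooth j b d db ->
  J T k.+1 d = - (k.+2%:R / T.+1%:R) * J T k (fun x => tau j x * b x) /\
  J T k.+1 db = - (k.+2%:R / T.+1%:R) * J T k (fun x => (tau j x)^* * b x).
Proof.
move=> jj cb cd cdb sb; have ca : contF (fun x => 1 - T.+1%:R^-1 * LE x) by [].
have sarg := smoothD (@smooth_cst j 1) (smoothN (smoothZ T.+1%:R^-1 (smooth_LE jj))).
have su := smooth_pos k (fun x _ => arg_real T x) ca sarg.
have cu2 : contF (fun x => ut T x ^+ k.+2) by [].
have h (t c : pts -> C) : contF t -> contF c ->
    contF (fun x => ut T x ^+ k.+2 * c x + b x * (k.+2%:R * ut T x ^+ k.+1 * (0 - T.+1%:R^-1 * - t x))).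
  by move=> ct cc; apply: contFD.
have ct := contF_tau (jm jj).
have [e1 e2] := stokes contF_E Ex_real Ex_proper jj (smoothM cu2 cb su sb) (J_cont T k.+1 cb)
  (h _ _ ct cd) (h _ _ (contF_conj ct) cdb) (@J_supp T k.+1 b) (real_embed _).
have fin (t c : pts -> C) : contF t -> contF c ->
    I (fun x => ut T x ^+ k.+2 * c x + b x * (k.+2%:R * ut T x ^+ k.+1 * (0 - T.+1%:R^-1 * - t x))) = 0 ->
    J T k.+1 c = - (k.+2%:R / T.+1%:R) * J T k (fun x => t x * b x).
  move=> ht h1 e; apply/eqP; rewrite mulNr -addr_eq0 -[X in _ == X]e /J -IZ // -ID //.
  by apply/eqP; apply: I_ext => // x _; ring.
by split; apply: fin.
Qed.

Definition sm j b d : Prop := exists db, [/\ smooth j b d db, contF b, contF d & contF db].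

Lemma smM j a c d e : sm j a d -> sm j c e -> sm j (fun x => a x * c x) (fun x => a x * e x + c x * d x).
Proof.
by move=> [db [s1 ca cd cdb]] [eb [s2 cc ce ceb]]; exists (fun x => a x * eb x + c x * db x); split=> //; exact: smoothM.
Qed.
Lemma smB j a c d e : sm j a d -> sm j c e -> sm j (fun x => a x - c x) (fun x => d x - e x).
Proof.
move=> [db [s1 ca cd cdb]] [eb [s2 cc ce ceb]]; exists (fun x => db x - eb x).
by split=> //; apply: smoothD => //; exact: smoothN.
Qed.
Lemma sm_hol j f : hol f -> sm j f (pdv j f).
Proof. by move=> hf; exists (fun=> 0); split=> //; exact: smooth_hol. Qed.
Lemma sm_conj j f : hol f -> sm j (fun x => (f x)^*) (fun=> 0).
Proof.
move=> hf; exists (fun x => (pdv j f x)^*); split=> //.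
by have := smooth_conj (@smooth_hol j _ hf); apply: smooth_eq => x _ //; rewrite conjC0.
Qed.
Lemma sm_taub i j : (j < m)%N -> sm i (fun x => (tau j x)^*) (fun x => - pole * ((j == i)%:R * hq j x)).
Proof. by move=> jl; exists (taubb i j); split=> //; exact: smooth_taub. Qed.
Lemma smooth_hq i j : (j < m)%N -> j != i -> smooth i (hq j) (fun=> 0) (fun=> 0).
Proof.
move=> jl /negbTE ji; have := smoothX 1 (contF_qqV jl) (smooth_qqV (i := i) jl).
by apply: smooth_eq => x _; rewrite ji !(mul0r, mulr0).
Qed.

Lemma J_sm T k j b d : j = j1 \/ j = j2 -> sm j b d ->
  J T k.+1 d = - (k.+2%:R / T.+1%:R) * J T k (fun x => tau j x * b x).
Proof. by move=> jj [db [s1 cb cd cdb]]; have [] := J_stokes T k jj cb cd cdb s1. Qed.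

Lemma J_comb T k l p b c e (al be : C) : contF b -> contF c -> contF e ->
  (forall x, slice x -> ut T x ^+ k.+1 * b x <= al * (ut T x ^+ l.+1 * c x) + be * (ut T x ^+ p.+1 * e x)) ->
  J T k b <= al * J T l c + be * J T p e.
Proof. by move=> cb cc ce h; rewrite /J -!IZ // -ID //; apply: I_le. Qed.

Lemma amgm (u v : C) : u \is Num.real -> v \is Num.real -> u * v <= 2^-1 * u ^+ 2 + 2^-1 * v ^+ 2.
Proof.
move=> ur vr; rewrite -subr_ge0.
have -> : 2^-1 * u ^+ 2 + 2^-1 * v ^+ 2 - u * v = 2^-1 * (u - v) ^+ 2 by field.
by apply: mulr_ge0 => //; rewrite real_exprn_even_ge0 // realB.
Qed.

Lemma half_le (F' B' : C) : F' <= 2^-1 * F' + B' -> F' <= 2 * B'.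
Proof.
rewrite -lerBlDl (_ : F' - 2^-1 * F' = 2^-1 * F'); last by field.
by rewrite mulrC ler_pdivrMr ?ltr0n // mulrC.
Qed.

Lemma eq_le_trans (u v w : C) : u = v -> v <= w -> u <= w. Proof. by move=> ->. Qed.

(** The energy of the cutoff function. *)
Lemma tau_bound : exists2 K : C, 0 <= K & forall T j j', j = j1 \/ j = j2 -> j' = j1 \/ j' = j2 -> j' != j ->
  J T 2 (fun x => tau j x * (tau j x)^* * hq j' x) <= K * T.+1%:R.
Proof.
have v0 : 0 <= vol by exact: ltW vol_gt0.
exists (4^-1 * (pole * (fibre_bound%:R * vol))) => // T j j' jj jj' jd.
have sh : sm j (hq j') (fun=> 0) by exists (fun=> 0); split=> //; exact: smooth_hq (jm jj') jd.
have := J_sm T 2 jj (smM (sm_taub j (jm jj)) sh).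
have -> : J T 3 (fun x => (tau j x)^* * 0 + hq j' x * (- pole * ((j == j)%:R * hq j x))) = - pole * J T 3 (fun x => hq j x * hq j' x).
  by rewrite -JZ //; apply: J_ext => // x _; rewrite eqxx mulr1n; ring.
have <- : J T 2 (fun x => tau j x * (tau j x)^* * hq j' x) = J T 2 (fun x => tau j x * ((tau j x)^* * hq j' x)).
  by apply: J_ext => // x _; exact/esym/mulrA.
move=> /eqP; rewrite !mulNr eqr_opp => /eqP e3.
apply: (@eq_le_trans _ (4^-1 * T.+1%:R * pole * J T 3 (fun x => hq j x * hq j' x))).
  by rewrite -[_ * pole * _]mulrA e3; field; rewrite nat1r pnatr_eq0.
rewrite (_ : _ * _ * T.+1%:R = 4^-1 * T.+1%:R * pole * (fibre_bound%:R * vol)); last by ring.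
apply: ler_wpM2l => //; rewrite -[J _ _ _]ger0_norm; last by apply: J_ge0.
rewrite -[X in _ <= X]mul1r; apply: I_bound => x sx.
have -> : hh x = hq j x * hq j' x.
  by case: jj jj' jd => -> [] ->; rewrite ?eqxx // => _; rewrite mulrC.
have h0 : 0 <= hq j x * hq j' x by [].
rewrite normrM (ger0_norm h0) (ger0_norm (exprn_ge0 _ (ut_ge0 _ _))); apply: (ler_wpM2r h0).
by apply: exprn_ile1 => //; exact: ut_le1.
Qed.

(** ** Logarithmic derivatives *)

Section LogDerivative.
Variable g : pts -> C.
Hypothesis g_hol : hol g.
Hypothesis g_neq0 : forall x, X0 H x -> g x != 0.
Hypothesis g_dom : dom E g.
Hypothesis gV_dom : dom E (fun x => (g x)^-1).

Definition sig j x : C := pdv j g x / g x.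
Definition lam x : C := lnC (g x * (g x)^*).

Lemma hol_sig j : hol (sig j).
Proof. by apply: hol_div => //; exact: hol_pdv. Qed.

Lemma sig_closed i j x : X0 H x -> pdv i (sig j) x = pdv j (sig i) x.
Proof.
move=> Xx; have h k l : pdv k (pdv l g) x = sig l x * pdv k g x + g x * pdv k (sig l) x.
  rewrite -(pdvM k Xx (hol_sig l Xx) (g_hol Xx)); apply: pdv_ext => //; first exact: hol_pdv.
  apply: locally_mono (X0_open Xx) => y Xy; rewrite /sig divfK //; exact: g_neq0.
have := h i j; rewrite (pdv_comm i j g_hol Xx) h => e.
apply: (mulfI (g_neq0 Xx)); apply: (addrI (sig i x * pdv j g x)).
rewrite e; congr (_ + _); rewrite /sig; ring.
Qed.

Lemma gg_gt0 x : X0 H x -> 0 < g x * (g x)^*.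
Proof. by move=> Xx; rewrite -normCK exprn_gt0 // normr_gt0 g_neq0. Qed.

Lemma smooth_lam j : smooth j lam (sig j) (fun x => (sig j x)^*).
Proof.
have cg := contF_hol g_hol; have sg := @smooth_hol j _ g_hol.
have := smooth_ln gg_gt0 (contFM cg (contF_conj cg)) (smoothM cg (contF_conj cg) sg (smooth_conj sg)).
apply: smooth_eq => x Xx; have g0 := g_neq0 Xx; have g0' : (g x)^* != 0 by rewrite conjC_eq0.
  by rewrite conjC0 /sig; field; rewrite ?g0 ?g0'.
by rewrite /sig rmorphM /= fmorphV /=; field; rewrite ?g0 ?g0'.
Qed.

Lemma contF_lam : contF lam.
Proof. by apply: contF_ln; [exact: gg_gt0|have := contF_hol g_hol]. Qed.

Lemma ln_norm_le (F' m' e' : R) q : 0 < F' -> 1 <= m' -> 1 <= e' -> F' <= m' * e' ^+ q -> F'^-1 <= m' * e' ^+ q ->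
  `|exp.ln F'| <= exp.ln m' + q%:R * exp.ln e'.
Proof.
move=> F0 m1 e1 h1 h2; have m0 : 0 < m' := lt_le_trans ltr01 m1; have e0 : 0 < e' := lt_le_trans ltr01 e1.
have p0 : 0 < e' ^+ q by exact: exprn_gt0.
have -> : exp.ln m' + q%:R * exp.ln e' = exp.ln (m' * e' ^+ q).
  by rewrite exp.lnM ?posrE // exp.lnXn // mulr_natl.
rewrite ler_norml -[X in X && _]lerN2 opprK -exp.lnV ?posrE // !exp.ler_ln ?posrE ?invr_gt0 ?mulr_gt0 //.
by rewrite h1 h2.
Qed.

Lemma lam_bound : exists2 K : C, 0 <= K & forall T x, slice x -> ut T x != 0 -> `|lam x| <= K * T.+1%:R.
Proof.
have [c1 c10 [k1 h1]] := g_dom; have [c2 c20 [k2 h2]] := gV_dom.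
pose M : C := c1 + c2 + 1; have M1 : 1 <= M by rewrite lerDr addr_ge0.
have M0 : 0 <= M := le_trans ler01 M1.
have eM := real_Re (ger0_real M0); set m' := complex.Re M in eM.
have m1 : 1 <= m' by rewrite -(lecR _ m') -eM rmorph1.
pose p := (k1 + k2)%N.
have up (z : C) x (c0 : C) k : slice x -> 0 <= c0 -> c0 <= M -> (k <= p)%N -> `|z| <= c0 * E x ^+ k -> `|z| ^+ 2 <= M ^+ 2 * E x ^+ (2 * p).
  move=> sx c00 cM kp h; have E0 : 0 <= E x by exact: le_trans ler01 (Ex_ge1 sx).
  rewrite mulnC exprM -exprMn; apply: lerXn2r; rewrite ?nnegrE //.
  apply: (le_trans h); apply: ler_pM => //; apply: ler_weXn2l => //; exact: Ex_ge1.
exists ((exp.ln (m' ^+ 2) + (2 * p)%:R)%:C%C) => [|T x sx ux].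
  by rewrite -(rmorph0 (real_complex R)) lecR addr_ge0 ?ler0n // exp.ln_ge0 // exprn_ege1.
have [eG G0] := Re_gt0 (gg_gt0 sx.1); have [eE E0] := Re_gt0 (Ex_gt0 sx.1).
have e1 : 1 <= complex.Re (E x) by rewrite -(lecR _ (complex.Re (E x))) -eE rmorph1; exact: Ex_ge1.
have [_ l1] := ut_neq0 sx.1 ux.
have E1 : (m' ^+ 2 * complex.Re (E x) ^+ (2 * p))%:C%C = M ^+ 2 * E x ^+ (2 * p).
  by rewrite eM [in RHS]eE -!rmorphXn -rmorphM.
have q1 : complex.Re (g x * (g x)^*) <= m' ^+ 2 * complex.Re (E x) ^+ (2 * p).
  rewrite -lecR E1 -eG -normCK; apply: (up _ x c1 k1) => //; [|exact: leq_addr|exact: h1].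
  by rewrite /M -addrA lerDl addr_ge0.
have q2 : (complex.Re (g x * (g x)^*))^-1 <= m' ^+ 2 * complex.Re (E x) ^+ (2 * p).
  rewrite -lecR E1.
  have -> : ((complex.Re (g x * (g x)^*))^-1)%:C%C = `|(g x)^-1| ^+ 2 by rewrite normfV exprVn normCK [in RHS]eG fmorphV.
  apply: (up _ x c2 k2) => //; [|exact: leq_addl|exact: h2].
  by rewrite /M -addrA addrC -addrA lerDl addr_ge0.
rewrite /lam /lnC normc_def /= expr0n addr0 sqrtr_sqr -(rmorph_nat (real_complex R)) -rmorphM lecR.
apply: (le_trans (ln_norm_le G0 (exprn_ege1 2 m1) e1 q1 q2)).
rewrite mulrDl; apply: lerD.
  by apply: ler_peMr; rewrite ?ler1n // exp.ln_ge0 // exprn_ege1.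
apply: ler_wpM2l; first exact: ler0n.
by move: l1; rewrite /LE /lnC -(rmorph_nat (real_complex R)) lecR.
Qed.

Lemma sig_bound : exists2 K : C, 0 <= K & forall T j j', j = j1 \/ j = j2 -> j' = j1 \/ j' = j2 -> j' != j ->
  J T 4 (fun x => hq j' x * (sig j x * (sig j x)^*)) <= K * T.+1%:R.
Proof.
have [c c0 hc] := lam_bound; have [k k0 hk] := tau_bound.
exists (2 * (2^-1 * 25 * c ^+ 2 * k)) => // T j j' jj jj' jd.
have cs := contF_hol (hol_sig j); have cl := contF_lam.
have cpd := contF_hol (hol_pdv j (hol_sig j)); have ch := contF_hq (jm jj').
have sb := smoothM ch (contFM cs cl) (smooth_hq (jm jj') jd)
  (smoothM cs cl (@smooth_hol j _ (hol_sig j)) (smooth_lam (j := j))).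
have sb' : smooth j (fun x => hq j' x * (sig j x * lam x)) (fun x => hq j' x * (sig j x * sig j x + lam x * pdv j (sig j) x))
    (fun x => hq j' x * (sig j x * (sig j x)^*)).
  by apply: smooth_eq sb => x _; rewrite !mulr0 !addr0.
have cb : contF (fun x => hq j' x * (sig j x * lam x)) by [].
have cd : contF (fun x => hq j' x * (sig j x * sig j x + lam x * pdv j (sig j) x)) by [].
have cs2 : contF (fun x => hq j' x * (sig j x * (sig j x)^*)) by [].
have [_ e] := J_stokes T 3 jj cb cd cs2 sb'.
have F0 : 0 <= J T 4 (fun x => hq j' x * (sig j x * (sig j x)^*)) by apply: J_ge0.
have T0 : T.+1%:R != 0 :> C by rewrite pnatr_eq0.
apply: (le_trans (half_le (B' := (2^-1 * 25 * c ^+ 2) * J T 2 (fun x => tau j x * (tau j x)^* * hq j' x)) _)); last first.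
  by do 2 (rewrite -[X in _ <= X]mulrA; apply: ler_wpM2l => //); exact: hk.
have c5 : 0 <= 5 / T.+1%:R :> C by [].
rewrite -{1}(ger0_norm F0) {1}e normrM normrN (ger0_norm c5).
apply: (le_trans (ler_wpM2l c5 (J_norm T 3 _))); first by [].
rewrite -JZ //; apply: J_comb => // x sx; have [u0|u0] := eqVneq (ut T x) 0.
  by rewrite u0 !expr0n /= !mul0r !mulr0 addr0.
have l1 := hc T x sx u0; have up := ut_ge0 T x; set u := ut T x in u0 up *.
rewrite -!normCK; move: (hq j' x) (hq_ge0 j' x) => h' h0.
have -> : `|(tau j x)^* * (h' * (sig j x * lam x))| = `|tau j x| * (h' * (`|sig j x| * `|lam x|)).
  by move: (sig j x) (tau j x) => sg tg; rewrite !normrM norm_conjC (ger0_norm h0).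
pose s' : C := `|sig j x|; pose t' : C := `|tau j x|; pose l' : C := `|lam x|; rewrite -/s' -/t' -/l' in l1 *.
have s0 : 0 <= s' by exact: normr_ge0.
have t0 : 0 <= t' by exact: normr_ge0.
apply: (@le_trans _ _ (u ^+ 3 * h' * ((u * s') * (5 * c * t')))).
  rewrite [X in X <= _](_ : _ = (u ^+ 4 * 5 * t' * h' * s' / T.+1%:R) * l'); last by field; rewrite nat1r.
  rewrite [X in _ <= X](_ : _ = (u ^+ 4 * 5 * t' * h' * s' / T.+1%:R) * (c * T.+1%:R)); last by field; rewrite nat1r.
  by apply: ler_wpM2l.
have r1 : u * s' \is Num.real by exact: ger0_real.
have r2 : 5 * c * t' \is Num.real by exact: ger0_real.
have p0 : 0 <= u ^+ 3 * h' by [].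
by rewrite (le_trans (ler_wpM2l p0 (amgm r1 r2))) // le_eqVlt; apply/orP; left; apply/eqP; ring.
Qed.

(** The key identity: integration by parts twice. *)
Lemma wedge_bound : exists2 K : C, 0 <= K & forall T,
  J T 3 (fun x => `|tau j1 x * sig j2 x - tau j2 x * sig j1 x| ^+ 2) <= K * T.+1%:R ^+ 2.
Proof.
have [k k0 hk] := sig_bound; exists (5^-1 * pole * (k + k)) => // T.
have n12 : (j1 == j2) = false by apply/eqP.
have n21 : (j2 == j1) = false by rewrite eq_sym.
have cs j := contF_hol (hol_sig j).
have st i j (hm : (i < m)%N) (hm' : (j < m)%N) :=
  smB (smM (sm_taub i hm) (smM (sm_hol i (hol_sig j)) (sm_conj i (hol_sig j))))
    (smM (sm_taub i hm') (smM (sm_hol i (hol_sig j)) (sm_conj i (hol_sig i)))).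
have e1 := J_sm T 3 (or_introl erefl) (st j1 j2 j1m j2m); have [db1 [_ cb1 cd1 _]] := st j1 j2 j1m j2m.
have e2 := J_sm T 3 (or_intror erefl) (st j2 j1 j2m j1m); have [db2 [_ cb2 cd2 _]] := st j2 j1 j2m j1m.
pose w x := hq j1 x * (sig j2 x * (sig j2 x)^*) + hq j2 x * (sig j1 x * (sig j1 x)^*).
have cw : contF w by apply: contFD.
pose Y x := tau j1 x * sig j2 x - tau j2 x * sig j1 x.
have cY : contF Y by apply: contFD.
have f1 : - pole * J T 4 w = - (5 / T.+1%:R) * J T 3 (fun x => `|Y x| ^+ 2).
  transitivity (- (5 / T.+1%:R) * (J T 3 (fun x => tau j1 x * ((tau j1 x)^* * (sig j2 x * (sig j2 x)^*) -
      (tau j2 x)^* * (sig j2 x * (sig j1 x)^*))) + J T 3 (fun x => tau j2 x * ((tau j2 x)^* * (sig j1 x * (sig j1 x)^*) -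
      (tau j1 x)^* * (sig j1 x * (sig j2 x)^*))))); last first.
    by congr (_ * _); rewrite -JD //; apply: J_ext => // x _; apply/esym; rewrite normCK /Y rmorphB !rmorphM /=; ring.
  rewrite mulrDr -e1 -e2 -(JD T 4 cd1 cd2) -(JZ T 4 _ cw).
  apply: J_ext => // x sx; rewrite (sig_closed j1 j2 sx.1) /w !eqxx n12 n21 /= ?mulr1n ?mulr0n; ring.
have T0 : T.+1%:R != 0 :> C by rewrite pnatr_eq0.
apply: (@eq_le_trans _ (5^-1 * T.+1%:R * pole * J T 4 w)).
  transitivity (- (5^-1 * T.+1%:R) * (- pole * J T 4 w)); last by ring.
  by rewrite f1; field; rewrite nat1r.
rewrite (_ : _ * _ ^+ 2 = 5^-1 * T.+1%:R * pole * (k * T.+1%:R + k * T.+1%:R)); last by ring.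
apply: ler_wpM2l => //; rewrite JD //.
apply: lerD; apply: hk => //; by [right|left|rewrite n12|rewrite n21].
Qed.
End LogDerivative.

(** ** The vanishing theorem *)

Variables (A1 A2 : pts -> C) (r : nat) (g : 'I_r -> pts -> C) (K : C).
Hypothesis A1_hol : hol A1.
Hypothesis A2_hol : hol A2.
Hypothesis g_hol : forall i, hol (g i).
Hypothesis g_neq0 : forall i x, X0 H x -> g i x != 0.
Hypothesis g_dom : forall i, dom E (g i).
Hypothesis gV_dom : forall i, dom E (fun x => (g i x)^-1).
Hypothesis A_bound : forall x, slice x -> forall a1 a2 : C,
  `|a1 * A1 x + a2 * A2 x| <= K * \sum_i `|a1 * sig (g i) j1 x + a2 * sig (g i) j2 x|.

Definition curv x : C := pdv j1 A2 x - pdv j2 A1 x.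
Definition Bf x : C := tau j1 x * A2 x - tau j2 x * A1 x.
Definition energy T : C := J T 5 (fun x => `|curv x| ^+ 2).

Local Hint Resolve A1_hol A2_hol : cts.
Lemma contF_Bf : contF Bf.
Proof. by apply: contFD. Qed.

Lemma hol_curv : hol curv.
Proof. by move=> x Xx; apply: regatB; apply: pdv_regat => //; [exact: A2_hol|exact: A1_hol]. Qed.
Local Hint Resolve contF_Bf hol_curv : cts.

Lemma sum_sq_le n (v : 'I_n -> C) : (forall i, 0 <= v i) -> (\sum_i v i) ^+ 2 <= n%:R * \sum_i v i ^+ 2.
Proof.
move=> v0; rewrite expr2 mulr_suml.
apply: (@le_trans _ _ (\sum_(i < n) \sum_(j < n) (2^-1 * v i ^+ 2 + 2^-1 * v j ^+ 2))).
  apply: ler_sum => i _; rewrite mulr_sumr; apply: ler_sum => j _.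
  by apply: amgm; exact: ger0_real.
under eq_bigr => i _ do rewrite big_split /= sumr_const card_ord -(mulr_natl _ n) -mulr_sumr.
rewrite big_split /= sumr_const card_ord -(mulr_natl _ n) -!mulr_sumr.
by rewrite le_eqVlt; apply/orP; left; apply/eqP; field.
Qed.

Lemma Bf_bound : exists2 be : C, 0 <= be & forall T, J T 3 (fun x => `|Bf x| ^+ 2) <= be * T.+1%:R ^+ 2.
Proof.
pose Y i x : C := `|tau j1 x * sig (g i) j2 x - tau j2 x * sig (g i) j1 x|.
have hw i : exists k : C, 0 <= k /\ forall T, J T 3 (fun x => Y i x ^+ 2) <= k * T.+1%:R ^+ 2.
  have [k k0 hk] := wedge_bound (g_hol i) (fun x => @g_neq0 i x) (g_dom i) (gV_dom i).
  by exists k.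
have [k kP] := choice hw.
have k0 : 0 <= \sum_i k i by apply: sumr_ge0 => i _; exact: (kP i).1.
exists (`|K| ^+ 2 * (r%:R * \sum_i k i)) => // T.
have cs i j := contF_hol (hol_sig (g_hol i) (fun x => @g_neq0 i x) j).
have cY i : contF (fun x => Y i x ^+ 2) by apply: contFX; apply: contF_norm; apply: contFD.
have sumc (s : seq 'I_r) : contF (fun x => \sum_(i <- s) Y i x ^+ 2).
  elim: s => [|i s IH]; first by under [X in contF X]eq_fun do rewrite big_nil; exact: contF_cst.
  by under [X in contF X]eq_fun do rewrite big_cons; exact: contFD.
have sumJ (s : seq 'I_r) : J T 3 (fun x => \sum_(i <- s) Y i x ^+ 2) = \sum_(i <- s) J T 3 (fun x => Y i x ^+ 2).
  elim: s => [|i s IH].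
    by rewrite big_nil -[RHS](mul0r (J T 3 (fun=> 0))) -JZ //; apply: J_ext => // x _; rewrite big_nil mul0r.
  by rewrite big_cons -IH -JD //; apply: J_ext => // x _; rewrite big_cons.
apply: (@le_trans _ _ (J T 3 (fun x => `|K| ^+ 2 * r%:R * \sum_i Y i x ^+ 2))).
  apply: J_le => // x sx; have h := A_bound sx (- tau j2 x) (tau j1 x).
  have e : - tau j2 x * A1 x + tau j1 x * A2 x = Bf x by rewrite /Bf; ring.
  have e2 : \sum_i `|- tau j2 x * sig (g i) j1 x + tau j1 x * sig (g i) j2 x| = \sum_i Y i x.
    by apply: eq_bigr => i _; rewrite /Y; congr `|_|; ring.
  rewrite e e2 in h; have S0 : 0 <= \sum_i Y i x by apply: sumr_ge0 => i _; exact: normr_ge0.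
  have h2 : `|Bf x| <= `|K| * \sum_i Y i x.
    apply: (le_trans h); have [z|z] := eqVneq (\sum_i Y i x) 0; first by rewrite z !mulr0.
    have K0 : 0 <= K by rewrite -(pmulr_lge0 _ (_ : 0 < \sum_i Y i x)) ?lt_def ?z // (le_trans (normr_ge0 _) h).
    by rewrite (ger0_norm K0).
  apply: (@le_trans _ _ ((`|K| * \sum_i Y i x) ^+ 2)); first by apply: lerXn2r; rewrite ?nnegrE.
  rewrite exprMn -mulrA; apply: ler_wpM2l => //; apply: sum_sq_le => i; exact: normr_ge0.
rewrite JZ // sumJ -[X in X <= _]mulrA -[X in _ <= X]mulrA -[X in _ <= _ * X]mulrA; do 2 (apply: ler_wpM2l => //).
by rewrite mulr_suml; apply: ler_sum => i _; exact: (kP i).2.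
Qed.

Lemma energy_ge0 T : 0 <= energy T.
Proof. by apply: J_ge0. Qed.

Lemma energy_le T : energy T <= 6 / T.+1%:R * J T 4 (fun x => `|curv x| * `|Bf x|).
Proof.
have s1 := smM (sm_conj j1 hol_curv) (sm_hol j1 A2_hol).
have s2 := smM (sm_conj j2 hol_curv) (sm_hol j2 A1_hol).
have e1 := J_sm T 4 (or_introl erefl) s1; have e2 := J_sm T 4 (or_intror erefl) s2.
have e : energy T = - (6 / T.+1%:R) * J T 4 (fun x => (curv x)^* * Bf x).
  transitivity (J T 5 (fun x => ((curv x)^* * pdv j1 A2 x + A2 x * 0) + -1 * ((curv x)^* * pdv j2 A1 x + A1 x * 0))).
    by apply: J_ext => // x _; rewrite normCK {1}/curv; ring.
  rewrite JD // JZ // e1 e2.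
  have -> : J T 4 (fun x => (curv x)^* * Bf x) = J T 4 (fun x => tau j1 x * ((curv x)^* * A2 x)) + -1 * J T 4 (fun x => tau j2 x * ((curv x)^* * A1 x)).
    by rewrite -JZ // -JD //; apply: J_ext => // x _; rewrite /Bf; ring.
  by ring.
have c6 : 0 <= 6 / T.+1%:R :> C by [].
rewrite -(ger0_norm (energy_ge0 T)) e normrM normrN (ger0_norm c6); apply: ler_wpM2l => //.
apply: (le_trans (J_norm T 4 _)) => //.
by apply: J_le => // x _; rewrite normrM norm_conjC.
Qed.

Lemma energy_bounded : exists B : C, forall T, energy T <= B.
Proof.
have [be be0 hbe] := Bf_bound; exists (2 * (18 * be)) => T; apply: half_le.
apply: (le_trans (energy_le T)); rewrite -JZ //.
have T0 : T.+1%:R != 0 :> C by rewrite pnatr_eq0.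
apply: (@le_trans _ _ (2^-1 * energy T + 18 / T.+1%:R ^+ 2 * J T 3 (fun x => `|Bf x| ^+ 2))).
  apply: J_comb => // x sx; have u0 := ut_ge0 T x; set u := ut T x in u0 *.
  pose w' : C := `|curv x|; pose b' : C := `|Bf x|; rewrite -/w' -/b'.
  have w0 : 0 <= w' by exact: normr_ge0.
  have b0 : 0 <= b' by exact: normr_ge0.
  have r1 : u ^+ 3 * w' \is Num.real by exact: ger0_real.
  have r2 : 6 / T.+1%:R * u ^+ 2 * b' \is Num.real by exact: ger0_real.
  have := amgm r1 r2; rewrite (_ : u ^+ 3 * w' * _ = u ^+ 5 * (6 / T.+1%:R * (w' * b'))); last by ring.
  rewrite [X in _ <= X -> _](_ : _ = 2^-1 * (u ^+ 6 * w' ^+ 2) + 18 / T.+1%:R ^+ 2 * (u ^+ 4 * b' ^+ 2)) //.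
  by field; rewrite nat1r.
have p0 : 0 <= 18 / T.+1%:R ^+ 2 :> C by [].
rewrite lerD2l (le_trans (ler_wpM2l p0 (hbe T))) // le_eqVlt; apply/orP; left; apply/eqP.
by field; rewrite nat1r.
Qed.

Lemma energy_split S T (et : C) : 0 < et -> (S <= T)%N ->
  energy T <= 6 / T.+1%:R * J S 2 (fun x => `|curv x| * `|Bf x|)
    + 2^-1 / et * (energy T - energy S) + 18 * et / T.+1%:R ^+ 2 * J T 3 (fun x => `|Bf x| ^+ 2).
Proof.
move=> e0 ST; apply: (le_trans (energy_le T)).
have T0 : T.+1%:R != 0 :> C by rewrite pnatr_eq0.
rewrite /energy -[_ - J S 5 _]/(_ + - _) -[- J S 5 _]mulN1r /J -!IZ // -!ID // -!IZ // -!ID //.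
apply: I_le => // x sx.
have v0 := ut_ge0 S x; have vu := ut_mono sx ST; have u1 := ut_le1 T sx.
have u0 := ut_ge0 T x; move: (ut T x) (ut S x) u0 v0 vu u1 => u v u0 v0 vu u1.
move: (normr_ge0 (curv x)) (normr_ge0 (Bf x)); move: (`|curv x| : C) (`|Bf x| : C) => w' b' w0 b0.
pose P : C := u ^+ 3 - v ^+ 3.
have p3 : 0 <= P by rewrite subr_ge0; apply: lerXn2r; rewrite ?nnegrE.
have ei : 0 <= et^-1 by rewrite invr_ge0 ltW.
have et0 : 0 <= et by exact: ltW.
have r1 : P * w' \is Num.real by exact: ger0_real.
have r2 : et * 6 / T.+1%:R * u ^+ 2 * b' \is Num.real by exact: ger0_real.
have q : 6 / T.+1%:R * (u ^+ 5 * (w' * b')) = (6 / T.+1%:R) * (v ^+ 3 * (u ^+ 2 * (w' * b'))) + et^-1 * ((P * w') * (et * 6 / T.+1%:R * u ^+ 2 * b')).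
  by rewrite /P; field; rewrite ?nat1r ?T0 gt_eqF.
rewrite q -addrA; apply: lerD; first by do 2 (apply: ler_wpM2l => //); rewrite ler_piMl // exprn_ile1.
apply: (le_trans (ler_wpM2l ei (amgm r1 r2))); rewrite mulrDr; apply: lerD.
  rewrite [X in X <= _]mulrA [et^-1 * _]mulrC; apply: ler_wpM2l => //.
  rewrite exprMn mulN1r -mulrBl; apply: ler_wpM2r; first by [].
  have -> : u ^+ 6 - v ^+ 6 = P * (u ^+ 3 + v ^+ 3) by rewrite /P; ring.
  rewrite expr2; apply: (ler_wpM2l p3); rewrite /P lerD2l (@le_trans _ _ 0) // oppr_le0 //.
by rewrite le_eqVlt; apply/orP; left; apply/eqP; field; rewrite ?nat1r ?T0 gt_eqF.
Qed.

Lemma energy_mono S T : (S <= T)%N -> energy S <= energy T.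
Proof.
move=> ST; apply: I_le => // x sx; apply: ler_wpM2r => //.
by apply: lerXn2r; rewrite ?nnegrE ?ut_ge0 //; exact: ut_mono.
Qed.

Lemma energy0 S : energy S = 0.
Proof.
have [B hB] := energy_bounded; have [be be0 hbe] := Bf_bound.
have [F hF] : exists F, tends G energy F.
  by apply: (bounded_tends (M := B)); apply: aeT => n /=; rewrite ger0_norm ?energy_ge0.
have SF T : energy T <= F.
  by apply: (tends_le _ (tends_cst (energy T)) hF); apply: (aeS (G_free T)) => n; exact: energy_mono.
have step1 et T : 0 < et -> F <= 2^-1 / et * (F - energy T) + 18 * et * be.
  move=> e0; have h1 := tendsM (tendsM (tends_cst 6) tends_delta) (tends_cst (J T 2 (fun x => `|curv x| * `|Bf x|))).
  have h2 := tendsM (tends_cst (2^-1 / et)) (tendsB hF (tends_cst (energy T))).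
  have := tendsD (tendsD h1 h2) (tends_cst (18 * et * be)); rewrite mulr0 mul0r add0r => h3.
  apply: (tends_le _ hF h3); apply: (aeS (G_free T)) => n /= Tn.
  have p0 : 0 <= 18 * et / n.+1%:R ^+ 2 :> C by [].
  rewrite (le_trans (energy_split e0 Tn)) // lerD2l (le_trans (ler_wpM2l p0 (hbe n))) //.
  by rewrite le_eqVlt; apply/orP; left; apply/eqP; field; rewrite nat1r pnatr_eq0.
have step2 et : 0 < et -> F <= 18 * et * be.
  move=> e0; have h2 := tendsM (tends_cst (2^-1 / et)) (tendsB (tends_cst F) hF).
  have := tendsD h2 (tends_cst (18 * et * be)); rewrite subrr mulr0 add0r => h3.
  by apply: (tends_le _ (tends_cst F) h3); apply: aeT => n; exact: step1.
have F0 : F <= 0.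
  have := tendsM (tendsM (tends_cst 18) tends_delta) (tends_cst be); rewrite mulr0 mul0r => h3.
  by apply: (tends_le _ (tends_cst F) h3); apply: aeT => n; apply: step2; exact: delta_gt0.
by apply/eqP; rewrite eq_le energy_ge0 andbT (le_trans (SF S)).
Qed.

Theorem curv_vanishes : pdv j1 A2 o = pdv j2 A1 o.
Proof.
have [T hT] : exists T, ut T o != 0.
  have h := tendsM tends_delta (tends_cst (LE o)); rewrite mul0r in h.
  have [n hn] := ae_ex (h 1 (@ltr01 _)); exists n.
  move: hn; rewrite /= subr0 ger0_norm; last by rewrite mulr_ge0 ?invr_ge0 ?ler0n // LE_ge0.
  rewrite -subr_gt0 => h2; have [e e0] := Re_gt0 h2.
  rewrite (_ : ut n o = posC (1 - n.+1%:R^-1 * LE o)) // /posC max_r ?(ltW e0) // -e; exact: lt0r_neq0.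
have cw2 : contF (fun x => `|curv x| ^+ 2) by [].
have := I_positive Ex_proper (J_cont T 5 cw2) (@J_supp T 5 (fun x => `|curv x| ^+ 2)).
move=> /(_ _ (energy0 T)) h; apply/eqP; rewrite -subr_eq0 -normr_eq0 -sqrf_eq0.
have /eqP : ut T o ^+ 6 * `|curv o| ^+ 2 = 0 by apply: h.
by rewrite mulf_eq0 (negbTE (expf_neq0 6 hT)).
Qed.
End Slices.
End SheetCalculus.

Section CommonNorm.
Variables (S : set (nat -> C)) (m M : nat).
Hypothesis S_prime : forall n (f g : tower C n), vanishes S (f * g) -> vanishes S f \/ vanishes S g.
Hypothesis norm : forall n, (m <= n <= M)%N -> forall f : tower C n, ~ vanishes S f ->
  exists (E : tower C n) (D : tower C m), ~ vanishes S D /\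
    forall v, S v -> tev n v E * tev n v f = tev m v D.
Hypothesis S_ex : exists v, S v.

Lemma common_norm (ts : seq {n & tower C n}) :
  (forall t, List.In t ts -> (m <= tag t <= M)%N /\ ~ vanishes S (tagged t)) ->
  exists D : tower C m, ~ vanishes S D /\ forall t, List.In t ts ->
    exists E : tower C (tag t), forall v, S v -> tev _ v E * tev _ v (tagged t) = tev m v D.
Proof.
elim: ts => [_|t ts IH h].
  exists 1; split=> // v1; have [v Sv] := S_ex; have /eqP := v1 v Sv.
  by rewrite rmorph1 oner_eq0.
have [D [nD hD]] := IH (fun u us => h u (or_intror us)).
have [tm nt] := h t (or_introl erefl); have [E [D' [nD' hE]]] := norm tm nt.
exists (D * D'); split; first by move=> /S_prime[].
have lift (c : tower C m) n : (m <= n)%N -> exists L : tower C n, forall v, tev n v L = tev m v c.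
  by move=> mn; have [L hL] := tev_lift mn c; exists L.
move=> u [<-|us].
  have [L hL] := lift D _ (proj1 (andP tm)); exists (L * E) => v Sv.
  by rewrite !rmorphM -mulrA hE // hL.
have [E' hE'] := hD u us; have [L hL] := lift D' _ (proj1 (andP (h u (or_intror us)).1)).
exists (L * E') => v Sv; rewrite !rmorphM -mulrA hE' // hL; exact: mulrC.
Qed.
End CommonNorm.

Lemma sheeted_exists (b : 'I_N.+1) (Fs : seq (nat * {mpoly C[N.+1]})) : (exists x : pts, hc x b != 0) ->
  (forall F, List.In F Fs -> F.2 \is F.1.-homog /\ exists y : pts, heval F.2 (val y) != 0) ->
  exists H : sheeted, [/\ sh_b H = b, exists x, X0 H x & forall F, List.In F Fs ->
    exists f f' : tower C N.+1, (forall y : pts, tev N.+1 (cr H y) f = F.2.@[fun l => aff b l y]) /\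
      forall x, X0 H x -> tev N.+1 (cr H x) f' * tev N.+1 (cr H x) f = tev (sh_m H) (cr H x) (sh_D H)].
Proof.
move=> exb hF; have [s [m [us ss mN free alg]]] := chart_tower exb.
pose S := chart_points b s.
have prime n (f g : tower C n) : vanishes S (f * g) -> vanishes S f \/ vanishes S g by exact: chart_prime.
have S_ex : exists v, S v by exact: chart_points_ex.
have exQ i : exists Q : {poly tower C i}, (m <= i < N.+1)%N -> minimal_equation S Q.
  have [mi|_] := boolP (m <= i < N.+1)%N; last by exists 0.
  by have [Q hQ] := minimal_equation_exists alg mi; exists Q.
pose Q i := projT1 (cid (exQ i)).
have QP i : (m <= i < N.+1)%N -> minimal_equation S (Q i) by exact: projT2 (cid (exQ i)).
have char0 k : k.+1%:R != 0 :> C by rewrite Num.Theory.pnatr_eq0.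
have ins l : l \in s.
  have sub : {subset s <= enum 'I_N.+1} by move=> j _; rewrite mem_enum.
  have sz : (size (enum 'I_N.+1) <= size s)%N by rewrite ss size_enum_ord.
  by have [_ ->] := uniq_min_size us sub sz; rewrite mem_enum.
have idx l : (index l s < N.+1)%N by have := ins l; rewrite -index_mem ss.
pose fF (F : nat * {mpoly C[N.+1]}) := projT1 (cid (tower_mpoly F.2 idx)).
have fFP F v : tev N.+1 v (fF F) = F.2.@[fun l => v (index l s)] by exact: (projT2 (cid (tower_mpoly F.2 idx)) v).
have fE F (y : pts) : tev N.+1 (coords b s y) (fF F) = F.2.@[fun l => aff b l y].
  by rewrite fFP; congr (_.@[_]); apply: funext => l; rewrite /coords index_mem ins nth_index.
pose T n (f : tower C n) : {n & tower C n} := existT _ n f.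
pose is_ := [seq i <- iota 0 N.+1 | (m <= i)%N].
pose ts := [seq T i (lead_coef (Q i)) | i <- is_] ++ ([seq T i.+1 ((Q i)^`() : {poly tower C i}) | i <- is_] ++ [seq T N.+1 (fF F) | F <- Fs]).
have InM (A B : Type) (h : A -> B) (u : seq A) z : List.In z (map h u) -> exists2 a, List.In a u & h a = z.
  by elim: u => //= a u IH [<-|/IH[a' ? <-]]; [exists a; [left|]|exists a'; [right|]].
have InI i : List.In i is_ -> (m <= i < N.+1)%N.
  move=> ii; have : i \in is_ by elim: (is_) ii => //= a u IH [->|/IH h]; rewrite inE ?eqxx ?h ?orbT.
  by rewrite mem_filter mem_iota => /andP[-> /andP[_]].
have iIn i : (m <= i < N.+1)%N -> List.In i is_.
  by move=> /andP[mi iN]; apply: in_In; rewrite mem_filter mem_iota mi.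
have [t||D [nD hD]] := @common_norm S m N.+1 prime _ S_ex ts.
- exact: (norm_exists prime S_ex alg).
- move=> u hu; case: (List.in_app_or _ _ _ hu) => {hu}[h|hu]; last case: (List.in_app_or _ _ _ hu) => h.
  + have [i /InI mi <-] /= := InM _ _ _ _ _ h.
    by have /andP[h1 h2] := mi; split; [rewrite h1 ltnW|have [] := QP i mi].
  + have [i /InI mi <-] /= := InM _ _ _ _ _ h.
    by have /andP[h1 h2] := mi; split; [rewrite (leq_trans h1)|exact: deriv_not_vanishes char0 (QP i mi)].
  + have [F FF <-] /= := InM _ _ _ _ _ h; split; first by rewrite mN leqnn.
    have [hom [y Fy]] := hF F FF; have [x xb] := exb.
    have xo : oset (chart_op b) x by apply/chart_opE.
    have yo : oset (Opens (@open_hneq0 _ _ X F.1 F.2 hom)) y by [].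
    have [z [/chart_opE zb Fz]] := opens_meet xo yo.
    move=> /(_ (coords b s z)) h'; have /eqP := h' (ex_intro2 _ _ z zb erefl); rewrite fE => /eqP z0.
    by move: Fz; rewrite /= (heval_aff hom zb) z0 mulr0 eqxx.
have inl i : (m <= i < N.+1)%N -> List.In (T i (lead_coef (Q i))) ts.
  by move=> mi; apply: List.in_or_app; left; apply: (List.in_map (fun i => T i (lead_coef (Q i)))); exact: iIn.
have ind i : (m <= i < N.+1)%N -> List.In (T i.+1 ((Q i)^`() : {poly tower C i})) ts.
  move=> mi; apply: List.in_or_app; right; apply: List.in_or_app; left.
  by apply: (List.in_map (fun i => T i.+1 ((Q i)^`() : {poly tower C i}))); exact: iIn.
have inF F : List.In F Fs -> List.In (T N.+1 (fF F)) ts.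
  move=> FF; apply: List.in_or_app; right; apply: List.in_or_app; right.
  exact: (List.in_map (fun F => T N.+1 (fF F))).
pose H := @Sheeted b s m D Q us ss mN exb free QP (fun i mi => hD _ (inl i mi)) (fun i mi => hD _ (ind i mi)).
exists H; split=> // [|F FF].
  move/existsNP: nD => [v /not_implyP[[x xb vE] Dv]]; exists x; split=> //; apply/eqP => D0; apply: Dv.
  by rewrite vE.
have [f' hf'] := hD _ (inF F FF); exists (fF F), f'; split=> [y|x Xx]; first exact: fE.
by apply: hf'; exact: (X0_S Xx).
Qed.

Variable n : nat.
Hypothesis Xns : nonsingular X n.

Section FormBound.
Variable H : sheeted.
Notation G := omega.
Implicit Types (x y p : pts) (f : pts -> C).
Notation pdv := (pdv H).
Notation hol := (hol H).
Notation X0op := (X0op H).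
Notation pd_der := (pd_der H).

Lemma pdv_point_derivation j x : X0 H x -> point_derivation x (fun f => \row_(i < 1) pdv j f x).
Proof.
move=> Xx; split=> [f g rf fg|f g rf rg|f g rf rg|c]; apply/rowP => i; rewrite !mxE.
- exact: pdv_ext.
- exact: pdvD.
- exact: pdvM.
- exact: pdv_cst.
Qed.

Lemma regat_tends (x : nat -> pts) (c : nat -> C) p f : (forall n, c n != 0) ->
  (forall j, tends G (fun n => c n * hc (x n) j) (hc p j)) -> regat p f -> tends G (fun n => f (x n)) (f p).
Proof.
move=> c0 cl /regat_frac[d [P [Q [hP hQ [O [Op PQ]]]]]].
have h1 := tends_open c0 cl Op; have [Qp fp] := PQ p Op.
have tP := tends_mpoly P (v := fun n j => c n * hc (x n) j) cl.
have tQ := tends_mpoly Q (v := fun n j => c n * hc (x n) j) cl.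
rewrite fp; apply: (tends_ext _ (tendsM tP (tendsV tQ Qp))).
apply: (aeS h1) => k Ok; have [Qk fk] := PQ _ Ok.
rewrite /= fk !(meval_homog _ _ hP) !(meval_homog _ _ hQ) -/(heval P _) -/(heval Q _) invfM mulrACA.
by rewrite divff ?mul1r // expf_neq0.
Qed.

Variables (r : nat) (g : 'I_r -> pts -> C).
Hypothesis g_hol : forall i, hol (g i).
Hypothesis g_neq0 : forall i x, X0 H x -> g i x != 0.
Hypothesis g_aff : forall l, (exists x, hc x l != 0) -> exists i, forall x, X0 H x -> g i x = aff (sh_b H) l x.

Definition lsum j1 j2 x (a1 a2 : C) i : C := a1 * sig H (g i) j1 x + a2 * sig H (g i) j2 x.

Lemma lsum_le j1 j2 x a1 a2 i : `|lsum j1 j2 x a1 a2 i| <= \sum_i `|lsum j1 j2 x a1 a2 i|.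
Proof. by rewrite [X in _ <= X](bigD1 i) //= lerDl; apply: sumr_ge0 => k _. Qed.

Lemma aff_dlog c l x : X0 H x -> hc x c != 0 -> forall j1 j2 (a1 a2 : C),
  `|a1 * pdv j1 (aff c l) x + a2 * pdv j2 (aff c l) x| <= `|aff c l x| * 2 * \sum_i `|lsum j1 j2 x a1 a2 i|.
Proof.
move=> Xx xc j1 j2 a1 a2; set S := \sum_i _; have S0 : 0 <= S by exact: sumr_ge0.
have [ic icE] : exists i, forall x, X0 H x -> g i x = aff (sh_b H) c x by apply: g_aff; exists x.
have ra := aff_regat l xc.
have [ex|nex] := pselect (exists y : pts, hc y l != 0); last first.
  have z j : pdv j (aff c l) x = 0.
    rewrite -(pdv_cst j 0 Xx); apply: pdv_ext => //.
    apply: locally_all => y; rewrite /aff; suff -> : hc y l = 0 by rewrite mul0r.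
    by apply/eqP; apply: contraT => h; case: nex; exists y.
  by rewrite !z !mulr0 addr0 normr0 !mulr_ge0.
have [il ilE] := g_aff ex.
have e y : X0 H y -> aff c l y * g ic y = g il y.
  move=> Xy; rewrite (icE y Xy) (ilE y Xy) /aff; have := g_neq0 ic Xy; rewrite icE // /aff => yc.
  have yc' : hc y c != 0 by apply: contraNneq yc => ->; rewrite mul0r.
  by rewrite mulrA divfK.
have d j : pdv j (aff c l) x = aff c l x * (sig H (g il) j x - sig H (g ic) j x).
  have := pdv_ext j Xx (regatM ra (g_hol ic Xx)) (locally_mono e (X0_open Xx)).
  rewrite (pdvM j Xx ra (g_hol ic Xx)) => E.
  have gc := g_neq0 ic Xx; have gl := g_neq0 il Xx; apply: (mulfI gc).
  rewrite -[LHS](addKr (aff c l x * pdv j (g ic) x)) E /sig -(e x Xx).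
  have al : aff c l x != 0 by apply: contraNneq gl => z; rewrite -(e x Xx) z mul0r.
  by field; rewrite gc al.
rewrite !d (_ : _ + _ = aff c l x * (lsum j1 j2 x a1 a2 il - lsum j1 j2 x a1 a2 ic)); last by rewrite /lsum; ring.
rewrite normrM -mulrA; apply: ler_wpM2l => //; apply: (le_trans (ler_normB _ _)).
rewrite (_ : 2 * S = S + S); last by ring.
by apply: lerD; exact: lsum_le.
Qed.

Variables (K : Type) (W : K -> op) (theta : forall k, form1 (W k)) (A : nat -> pts -> C).
Hypothesis W_cover : forall p, exists k, oset (W k) p /\ exists (XW : X0op `<=` W k) (i i' : 'I_r),
  forall x, X0 H x -> forall j,
    A j x = theta k X0op XW (der_pv Xns (pd_der j)) x + (sig H (g i) j x - sig H (g i') j x).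

Lemma form_bound j1 j2 : exists Kc : C, forall x, X0 H x -> forall a1 a2 : C,
  `|a1 * A j1 x + a2 * A j2 x| <= Kc * \sum_i `|lsum j1 j2 x a1 a2 i|.
Proof.
apply: contrapT => no.
have bad k : exists t : pts * (C * C), X0 H t.1 /\
    k%:R * \sum_i `|lsum j1 j2 t.1 t.2.1 t.2.2 i| < `|t.2.1 * A j1 t.1 + t.2.2 * A j2 t.1|.
  apply: contrapT => h; apply: no; exists k%:R => x Xx a1 a2; rewrite real_leNgt ?normr_real //; last first.
    by apply: ger0_real; rewrite mulr_ge0 ?ler0n // sumr_ge0.
  by apply/negP => h'; apply: h; exists (x, (a1, a2)).
have [t tP] := choice bad; pose xs k := (t k).1.
have [p [c [c0 cl]]] := proj_limit omega xs.
have [k [Wp [XW [i [i' AE]]]]] := W_cover p.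
have [b pb] := vpick_neq0 p.
have [Z [ZW [fg [Zp rep]]]] := fm_local (theta k) Wp.
have gen (u : regfun Z * regfun Z) : exists a : 'I_N.+1 -> pts -> C, (forall l, regat p (a l)) /\
    locally p (fun z => forall n (d : (pts -> C) -> 'rV[C]_n), point_derivation z d -> d u.2 = \sum_l a l z *: d (aff b l)).
  by have [_ [a [ra Ea]]] := regat_generated pb (regat_rf u.2 Zp); exists a.
pose a u := projT1 (cid (gen u)).
have ra u l : regat p (a u l) by exact: (projT2 (cid (gen u))).1.
have Ea : locally p (fun z => forall u, List.In u fg -> forall n (d : (pts -> C) -> 'rV[C]_n), point_derivation z d ->
    d u.2 = \sum_l a u l z *: d (aff b l)).
  by apply: locally_seq => u; exact: (projT2 (cid (gen u))).2.
pose B x := \sum_(u <- fg) \sum_l `|u.1 x| * (`|a u l x| * `|aff b l x|).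
have [M hM] : exists M : C, G [set n | B (xs n) <= M].
  have [l hl] : exists l, tends G (fun n => B (xs n)) l.
    exists (\sum_(u <- fg) \sum_l `|u.1 p| * (`|a u l p| * `|aff b l p|)).
    apply: (@tends_sum _ _ _ _ fg (fun u n => \sum_l `|u.1 (xs n)| * (`|a u l (xs n)| * `|aff b l (xs n)|)) (fun u => \sum_l `|u.1 p| * (`|a u l p| * `|aff b l p|))) => u.
    apply: (@tends_sum _ _ _ _ _ (fun l n => `|u.1 (xs n)| * (`|a u l (xs n)| * `|aff b l (xs n)|)) (fun l => `|u.1 p| * (`|a u l p| * `|aff b l p|))) => l; apply: tendsM; first exact: (tends_norm (regat_tends c0 cl (regat_rf u.1 Zp))).
    apply: tendsM; first exact: (tends_norm (regat_tends c0 cl (ra u l))).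
    exact: (tends_norm (regat_tends c0 cl (aff_regat l pb))).
  have [M hM] := tends_bounded hl; exists M; apply: (aeS hM) => n'; apply: le_trans.
  by rewrite ger0_norm // sumr_ge0 // => u _; apply: sumr_ge0 => l' _; rewrite !mulr_ge0.
have toG (P : pts -> Prop) : locally p P -> G [set n | P (xs n)].
  by move=> [O [Op OP]]; apply: (aeS (tends_open c0 cl Op)) => n' /= /OP.
have big : G [set n | M * 2 + 2 <= n%:R].
  have M0 : 0 <= M.
    have [n' hn] := ae_ex hM; apply: le_trans hn.
    by rewrite sumr_ge0 // => u _; apply: sumr_ge0 => l' _; rewrite !mulr_ge0.
  have q0 : 0 < M * 2 + 2 by rewrite ltr_wpDl ?mulr_ge0 ?ltr0n ?ler0n.
  have q1 : 0 < (M * 2 + 2 + 1)^-1 by rewrite invr_gt0 addr_gt0 ?ltr01.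
  apply: (aeS (tends_delta q1)) => n' /=; rewrite subr0 gtr0_norm ?delta_gt0 //.
  rewrite ltf_pV2 ?posrE ?ltr0Sn ?(addr_gt0 q0 ltr01) // -[X in _ < X -> _]natr1 ltrD2r; exact: ltW.
have lim := ae_and hM (ae_and (toG _ Ea) (ae_and (toG _ (locally_and (locally_in Zp) (locally_chart pb))) big)).
have [m' [/= hB [/= hE [/= [Zx xb] /= hb]]]] := ae_ex lim.
have [Xx bd] := tP m'; rewrite -/(xs m') in Xx bd; move: (xs m') (t m').2.1 (t m').2.2 Xx bd hB hE Zx xb => x a1 a2 Xx bd hB hE Zx xb.
set S := \sum_i _ in bd; have S0 : 0 <= S by exact: sumr_ge0.
have theta_at j : theta k X0op XW (der_pv Xns (pd_der j)) x = \sum_(u <- fg) \sum_l u.1 x * (a u l x * pdv j (aff b l) x).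
  pose V := Opens (openI (oset_open Z) (oset_open X0op)).
  have VZ : V `<=` Z by move=> y [].
  have VX : V `<=` X0op by move=> y [].
  have Vx : oset V x by [].
  have := congr1 (fun u : regfun V => u x) (rep V VZ (pv_res VX (der_pv Xns (pd_der j)))).
  rewrite rf_ev_sum (irr (VZ >> ZW) (VX >> XW)) => E.
  transitivity (theta k V (VX >> XW) (pv_res VX (der_pv Xns (pd_der j))) x).
    by rewrite -(fm_res (theta k) XW _ VX) rf_resE.
  rewrite E; elim: (fg) hE => [|u s IH] hE; first by rewrite !big_nil.
  rewrite !big_cons IH => [|v vs]; last by apply: hE; right.
  congr (_ + _); rewrite rf_evM rf_resE // -mulr_sumr; congr (_ * _).
  rewrite -[LHS]/(der_pv Xns (pd_der j) V _ [:: rf_res VZ u.2] x) der_pvE pd_derE //.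
  have := hE u (or_introl erefl) 1%N _ (pdv_point_derivation j Xx) => /rowP/(_ 0).
  rewrite !mxE summxE => E2; transitivity (pdv j u.2 x).
    apply: pdv_ext => //; first exact: (regat_rf (rf_res VZ u.2) Vx).
    by apply: locally_mono (locally_in Vx) => y Vy; rewrite rf_resE.
  by rewrite E2; apply: eq_bigr => l _; rewrite !mxE.
have main : `|a1 * A j1 x + a2 * A j2 x| <= (M * 2 + 2) * S.
  rewrite !AE // !theta_at.
  have -> : a1 * (\sum_(u <- fg) \sum_l u.1 x * (a u l x * pdv j1 (aff b l) x) + (sig H (g i) j1 x - sig H (g i') j1 x)) +
      a2 * (\sum_(u <- fg) \sum_l u.1 x * (a u l x * pdv j2 (aff b l) x) + (sig H (g i) j2 x - sig H (g i') j2 x))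
    = \sum_(u <- fg) \sum_l u.1 x * (a u l x * (a1 * pdv j1 (aff b l) x + a2 * pdv j2 (aff b l) x))
      + (lsum j1 j2 x a1 a2 i - lsum j1 j2 x a1 a2 i').
    have -> : \sum_(u <- fg) \sum_l u.1 x * (a u l x * (a1 * pdv j1 (aff b l) x + a2 * pdv j2 (aff b l) x))
      = a1 * (\sum_(u <- fg) \sum_l u.1 x * (a u l x * pdv j1 (aff b l) x)) + a2 * (\sum_(u <- fg) \sum_l u.1 x * (a u l x * pdv j2 (aff b l) x)).
      rewrite !mulr_sumr -big_split; apply: eq_bigr => u _ /=; rewrite !mulr_sumr -big_split.
      by apply: eq_bigr => l _ /=; ring.
    by rewrite /lsum; ring.
  apply: (le_trans (ler_normD _ _)); rewrite mulrDl; apply: lerD; last first.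
    apply: (le_trans (ler_normB _ _)); rewrite (_ : 2 * S = S + S); last by ring.
    by apply: lerD; exact: lsum_le.
  apply: (@le_trans _ _ (B x * 2 * S)); last by rewrite -!mulrA; apply: ler_wpM2r => //; rewrite mulr_ge0 ?ler0n.
  rewrite /B !mulr_suml; apply: (le_trans (ler_norm_sum _ _ _)); apply: ler_sum => u _.
  rewrite !mulr_suml; apply: (le_trans (ler_norm_sum _ _ _)); apply: ler_sum => l _.
  rewrite normrM (normrM (a u l x)) -!mulrA; do 2 (apply: ler_wpM2l => //); rewrite mulrA; exact: (aff_dlog l Xx xb).
by have := lt_le_trans (lt_le_trans bd main) (ler_wpM2r S0 hb); rewrite ltxx.
Qed.
End FormBound.
Implicit Types (U V W Z : op) (x y : pts).

Section Curvature.
Variable H : sheeted.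
Notation G := omega.
Notation pdv := (pdv H).
Notation X0op := (X0op H).
Notation pd_der := (pd_der H).
Notation m := (sh_m H).

Lemma der_coordinates U (UX : U `<=` X0op) (D : derivation U) (f : regfun U) :
  D U subxx f = \sum_(j < m) D U subxx (zz UX j) * pd_der j U UX f.
Proof.
pose c j := D U subxx (zz UX j).
pose F V (VU : V `<=` U) (u : regfun V) :=
  D V VU u - \sum_(j < m) rf_res VU (c j) * pd_der j V (VU >> UX) u.
have FD V (VU : V `<=` U) u w : F V VU (u + w) = F V VU u + F V VU w.
  rewrite /F der_D (eq_bigr _ (fun j _ => congr1 _ (der_D _ _ _ _))).
  rewrite (eq_bigr _ (fun j _ => mulrDr _ _ _)) big_split /=; ring.
have FZ V (VU : V `<=` U) (e : C) u : F V VU (rf_cst V e * u) = rf_cst V e * F V VU u.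
  rewrite /F der_Z (eq_bigr _ (fun j _ => congr1 _ (der_Z _ _ _ _))) mulrBr mulr_sumr.
  by congr (_ - _); apply: eq_bigr => j _; rewrite mulrCA.
have FM V (VU : V `<=` U) u w : F V VU (u * w) = u * F V VU w + w * F V VU u.
  rewrite /F der_M (eq_bigr _ (fun j _ => congr1 _ (der_M _ _ _ _))) !mulrBr !mulr_sumr.
  rewrite (_ : \sum_(j < m) _ = \sum_(j < m) u * (rf_res VU (c j) * pd_der j V (VU >> UX) w) +
    \sum_(j < m) w * (rf_res VU (c j) * pd_der j V (VU >> UX) u)); first by ring.
  by rewrite -big_split; apply: eq_bigr => j _; rewrite /=; ring.
have FR V V' (VU : V `<=` U) (V'U : V' `<=` U) (V'V : V' `<=` V) u :
    rf_res V'V (F V VU u) = F V' V'U (rf_res V'V u).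
  rewrite /F rf_resD rf_resN (der_res _ VU V'U V'V) rf_res_sum; congr (_ - _).
  apply: eq_bigr => j _; rewrite rf_resM (rf_res_comp VU V'V V'U).
  by rewrite (der_res _ (VU >> UX) (V'U >> UX) V'V).
pose F' := @Derivation _ _ X U F FD FZ FM FR.
have h : F' U subxx f = 0.
  apply: (@annihilates H U UX F') => V VU k km.
  have VX := VU >> UX; apply/eqP; rewrite subr_eq0; apply/eqP.
  have zE : zz (VU >> UX) k = rf_res VU (zz UX k).
    by apply: regfun_eqP => x Vx; rewrite rf_resE // !mk_rfE //; exact: VU.
  rewrite [in LHS]zE -(der_res _ subxx VU VU).
  rewrite (eq_bigr (fun j : 'I_m => rf_res VU (c j) * rf_cst V (k == j)%:R)) => [|j _]; last first.
    by congr (_ * _); apply: regfun_eqP => x Vx; rewrite pd_zz // rf_cstE.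
  rewrite (bigD1 (Ordinal km)) //= big1 ?eqxx => [|j jk]; first by rewrite addr0 (_ : rf_cst V _ = 1) ?mulr1.
  suff -> : rf_cst V (k == j)%:R = 0 by rewrite mulr0.
  apply: regfun_eqP => x Vx; rewrite rf_cstE // rf_ev0.
  by rewrite (_ : (k == j) = false) //; apply: contra_neqF jk => /eqP kj; exact: val_inj.
move: h; rewrite -[LHS]/(D U _ f - _) => /eqP; rewrite subr_eq0 => /eqP ->.
apply: eq_bigr => j _; rewrite rf_res_refl.
by rewrite (irr (_ >> UX) UX).
Qed.

Lemma curvature_closed U (theta : form1 U) (XU : X0op `<=` U) : (exists x, X0 H x) ->
  (forall i j x, (i < m)%N -> (j < m)%N -> i <> j -> X0 H x ->
    pdv i (theta X0op XU (der_pv Xns (pd_der j))) x = pdv j (theta X0op XU (der_pv Xns (pd_der i))) x) ->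
  closed_form theta.
Proof.
move=> [x0 Xx0] curv W WU ts rep D E.
suff h V (VW : V `<=` W) (VX : V `<=` X0op) : rf_res VW (ext_der ts D E) = 0.
  apply: regfun_eqP => x Wx; rewrite rf_ev0; apply/eqP; apply: contraT => nz.
  have [O [Ox OP]] := locally_and (locally_in Wx) (regat_neq0 (regat_rf (ext_der ts D E) Wx) nz).
  have [z [/OP[Wz Ez] Xz]] := opens_meet Ox (Xx0 : oset X0op x0).
  pose V := W ∩ X0op; have Vz : oset V z by [].
  have := congr1 (fun u : regfun V => u z) (h V subl subr).
  by rewrite rf_resE // rf_ev0 => /eqP; rewrite (negbTE Ez).
rewrite ext_der_res; move: (represents_res VW rep) (der_restrict VW D) (der_restrict VW E).
move: (res_ts VW ts) (VW >> WU) => ts' VU rep' D' E' {ts D E rep VW W WU}.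
pose P j := der_restrict VX (pd_der j).
have PE j (f : regfun V) : pd_der j V VX f = P j V subxx f.
  by rewrite -[RHS]/(pd_der j V (_ >> VX) f) (irr (_ >> VX) VX).
have ij i j : (i < m)%N -> (j < m)%N -> ext_der ts' (P i) (P j) = 0.
  move=> im jm; have [->|/eqP nij] := eqVneq i j; first by apply: big1 => t _; rewrite subrr.
  rewrite (cartan Xns rep') (represents_der Xns rep' (der_comm (P i) (P j))) big1 ?subr0; last first.
    move=> t _; rewrite -[X in _ * X]/(der_comm (pd_der i) (pd_der j) V (_ >> VX) t.2).
    by rewrite comm_annihilates mulr0.
  have res j' : theta V VU (der_pv Xns (P j')) = rf_res VX (theta X0op XU (der_pv Xns (pd_der j'))).
    rewrite (fm_res theta XU VU); congr (theta V VU _); apply: polyvec_ext => Z ZV fs.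
    by case: fs => [|f [|f' fs]]; rewrite /= /wedge //= !det_mx11 !mxE.
  apply: regfun_eqP => x Vx; rewrite rf_evB rf_ev0 -!PE !pd_derE //.
  have e l f : pdv l (rf_res VX f) x = pdv l f x.
    apply: pdv_ext; [exact: (VX x Vx)|exact: regat_rf|].
    by apply: locally_mono (locally_in Vx) => y Vy; rewrite rf_resE.
  by rewrite !res !e (curv i j) ?subrr //; exact: (VX x Vx).
rewrite /ext_der; transitivity (\sum_(i < m) \sum_(j < m)
    D' V subxx (zz VX i) * E' V subxx (zz VX j) * ext_der ts' (P i) (P j)).
  under [RHS]eq_bigr => i _ do under eq_bigr => j _ do rewrite /ext_der mulr_sumr.
  under [RHS]eq_bigr => i _ do rewrite exchange_big.
  rewrite exchange_big; apply: eq_bigr => t _.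
  rewrite !(der_coordinates VX D') !(der_coordinates VX E').
  under [RHS]eq_bigr => i _ do under eq_bigr => j _ do rewrite mulrBr.
  under [RHS]eq_bigr => i _ do rewrite sumrB.
  rewrite sumrB [X in _ = _ - X]exchange_big /=; congr (_ - _); rewrite mulr_suml.
    by apply: eq_bigr => i _; rewrite mulr_sumr; apply: eq_bigr => j _; rewrite /= !(irr (_ >> VX) VX); ring.
  apply: eq_bigr => i _; rewrite mulr_sumr; apply: eq_bigr => j _.
  by rewrite /= !(irr (_ >> VX) VX); ring.
by apply: big1 => i _; apply: big1 => j _; rewrite ij ?mulr0.
Qed.
End Curvature.

Lemma unit_fraction Z p (v u : regfun Z) : oset Z p -> v * u = 1 ->
  exists (O : op) d (P Q : {mpoly C[N.+1]}), [/\ oset O p, O `<=` Z, P \is d.-homog, Q \is d.-homog &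
    forall y, oset O y -> [/\ heval P (val y) != 0, heval Q (val y) != 0 &
      u y = heval P (val y) / heval Q (val y)]].
Proof.
move=> Zp vu; have [d [P [Q [hP hQ loc]]]] := regat_frac (regat_rf u Zp).
have [O [Op OP]] := locally_and (locally_in Zp) loc.
exists O, d, P, Q; split=> // [y /OP[]//|y /OP[Zy [Qy uy]]]; split=> //.
apply/negP => /eqP P0; have := congr1 (fun w : regfun Z => w y) vu.
by rewrite rf_evM uy P0 mul0r mulr0 (rf_cstE 1 Zy) => /eqP; rewrite eq_sym oner_eq0.
Qed.

Lemma nth_List_In (T : Type) (t0 : T) (s : seq T) i : (i < size s)%N -> List.In (nth t0 s i) s.
Proof. by elim: s i => // t s IH [|i] /= h; [left|right; exact: IH]. Qed.

Lemma dlog_difference_closed (K : Type) (W : K -> op) (theta : forall k, form1 (W k)) :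
  covers W ->
  (forall k l, exists (v u : regfun ((W k) ∩ W l)), v * u = 1 /\
     forall (V : op) (Vk : V `<=` W k) (Vl : V `<=` W l) (P : polyvec 1 V),
       theta l V Vl P - theta k V Vk P = vdu v u V (subII Vk Vl) P) ->
  forall k, closed_form (theta k).
Proof.
move=> cov cob k0; have [[z0 Wz0]|empty] := pselect (exists z, oset (W k0) z); last first.
  move=> W' W'W ts rep D E; apply: regfun_eqP => x W'x; case: empty; exists x; exact: (W'W x W'x).
have [ks ksP] := quasi_compact cov.
pose good k (t : op * (nat * ({mpoly C[N.+1]} * {mpoly C[N.+1]}))) : Prop :=
  [/\ exists y, oset t.1 y, t.2.2.1 \is t.2.1.-homog, t.2.2.2 \is t.2.1.-homog,
    forall y, oset t.1 y -> heval t.2.2.1 (val y) != 0 /\ heval t.2.2.2 (val y) != 0 &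
    (exists y, oset (W k) y) -> t.1 `<=` W k /\ exists (v u : regfun ((W k) ∩ W k0)),
      [/\ v * u = 1, forall (V : op) (Vk : V `<=` W k) (Vl : V `<=` W k0) (P : polyvec 1 V),
        theta k0 V Vl P - theta k V Vk P = vdu v u V (subII Vk Vl) P &
        forall y, oset t.1 y -> u y = heval t.2.2.1 (val y) / heval t.2.2.2 (val y)]].
have ex k : exists t, good k t.
  have [[y Wy]|no] := pselect (exists y, oset (W k) y); last first.
    exists (opens_setT pts, (0%N, (1, 1))); split=> /=; [by exists z0|exact: dhomog1|exact: dhomog1| |by move=> /no].
    by move=> y _; rewrite /heval meval1 oner_eq0.
  have [z [Wz Wz']] := opens_meet Wy Wz0; have [v [u [vu hth]]] := cob k k0.
  have Zz : oset ((W k) ∩ W k0) z by [].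
  have [O [d [P [Q [Oz OZ hP hQ h]]]]] := unit_fraction Zz vu.
  exists (O, (d, (P, Q))); split=> //=; [by exists z|by move=> y' /h[]|move=> _; split=> [y' /OZ[]//|]].
  by exists v, u; split=> // y' /h[].
have [t tP] := choice ex.
have [k _|V [z [Vz VW0 Vt]]] := opens_meet_seq (s := ks) (W := fun k => (t k).1) Wz0; first by have [] := tP k.
have [dF [F [hF Fz FV]]] := open_homog Vz; have [b zb] := vpick_neq0 z.
pose good_l l : bool := `[< exists x : pts, hc x l != 0 >].
pose Fs : seq (nat * {mpoly C[N.+1]}) := (dF, F) ::
  ([seq (1%N, 'X_l) | l <- [seq l <- enum 'I_N.+1 | good_l l]] ++
  ([seq ((t k).2.1, (t k).2.2.1) | k <- ks] ++ [seq ((t k).2.1, (t k).2.2.2) | k <- ks])).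
have InM (A B : Type) (h : A -> B) (s : seq A) e : List.In e (map h s) -> exists2 a, List.In a s & h a = e.
  by elim: s => //= a s IH [<-|/IH[a' ? <-]]; [exists a; [left|]|exists a'; [right|]].
have inl l : (exists x : pts, hc x l != 0) -> List.In (1%N, 'X_l) Fs.
  move=> /asboolP gl; right; apply: List.in_or_app; left; apply: (List.in_map (fun l => (1%N, 'X_l))).
  by apply: in_In; rewrite mem_filter mem_enum /good_l gl.
have inP k : List.In k ks -> List.In ((t k).2.1, (t k).2.2.1) Fs.
  move=> kk; right; apply: List.in_or_app; right; apply: List.in_or_app; left.
  exact: (List.in_map (fun k => ((t k).2.1, (t k).2.2.1))).
have inQ k : List.In k ks -> List.In ((t k).2.1, (t k).2.2.2) Fs.
  move=> kk; right; apply: List.in_or_app; right; apply: List.in_or_app; right.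
  exact: (List.in_map (fun k => ((t k).2.1, (t k).2.2.2))).
have [F1|H [Hb exX HF]] := sheeted_exists (ex_intro _ z zb : exists x : pts, hc x b != 0) (Fs := Fs).
  move=> [<-|F1s]; first by split=> //; exists z.
  case: (List.in_app_or _ _ _ F1s) => {F1s}[h|F1s]; last case: (List.in_app_or _ _ _ F1s) => h.
  - have [l lE <-] := InM _ _ _ _ _ h; split; first exact: homog_X.
    have /asboolP[x xl] : good_l l.
      by elim: (enum _) lE => //= l1 s IH; case: ifP => // gl [<-//|/IH].
    by exists x; rewrite heval_X.
  - by have [k _ <-] := InM _ _ _ _ _ h; have [[y ty] hP _ nz _] := tP k; split=> //; exists y; exact: (nz y ty).1.
  - by have [k _ <-] := InM _ _ _ _ _ h; have [[y ty] _ hQ nz _] := tP k; split=> //; exists y; exact: (nz y ty).2.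
subst b; pose r := size Fs; pose gF (e : nat * {mpoly C[N.+1]}) y : C := e.2.@[fun l => aff (sh_b H) l y].
pose g (i : 'I_r) := gF (nth (0%N, 0) Fs i).
have gE i : exists f f' : tower C N.+1, g i = (fun y => tev N.+1 (cr H y) f) /\
    forall x, X0 H x -> tev N.+1 (cr H x) f' * tev N.+1 (cr H x) f = tev (sh_m H) (cr H x) (sh_D H).
  have [f [f' [fE ff]]] := HF _ (nth_List_In (0%N, 0) (ltn_ord i)).
  by exists f, f'; split=> //; apply: funext => y; rewrite fE.
have gex e : List.In e Fs -> exists i, g i = gF e.
  by move=> eF; have [i ir E] := In_nth (0%N, 0) eF; exists (Ordinal ir); rewrite /g E.
have g_hol i : hol H (g i) by have [f [f' [-> _]]] := gE i; move=> x [xb _]; exact: cr_regat.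
have g_neq0 i x : X0 H x -> g i x != 0.
  move=> Xx; have [f [f' [-> ff]]] := gE i; apply: contraNneq (Xx.2) => f0.
  by rewrite -(ff x Xx) f0 mulr0.
have gh e x : List.In e Fs -> e.2 \is e.1.-homog -> X0 H x -> heval e.2 (val x) != 0.
  move=> eF he Xx; have [i gi] := gex e eF; have := g_neq0 i x Xx; rewrite gi => g0.
  by rewrite (heval_aff he Xx.1) mulf_neq0 // expf_neq0 // Xx.1.
have XV : X0op H `<=` V by move=> x Xx; apply: FV; exact: (gh (dF, F) x (or_introl erefl) hF Xx).
pose A j x := theta k0 (X0op H) (XV >> VW0) (der_pv Xns (pd_der H j)) x.
have g_aff l : (exists x : pts, hc x l != 0) -> exists i, forall x, X0 H x -> g i x = aff (sh_b H) l x.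
  by move=> /inl/gex[i gi]; exists i => x _; rewrite gi /gF mevalXU.
have cover p : exists k, oset (W k) p /\ exists (XW : X0op H `<=` W k) (i i' : 'I_r), forall x, X0 H x -> forall j,
    A j x = theta k (X0op H) XW (der_pv Xns (pd_der H j)) x + (sig H (g i) j x - sig H (g i') j x).
  have [k kk Wp] := ksP p; exists k; split=> //.
  have [_ hP hQ _ /(_ (ex_intro _ p Wp))[tW [v [u [vu hth uE]]]]] := tP k.
  have Xt : X0op H `<=` (t k).1 := XV >> (Vt k kk); exists (Xt >> tW).
  have [i gi] := gex _ (inP k kk); have [i' gi'] := gex _ (inQ k kk); exists i, i' => x Xx j.
  have Xop : oset (X0op H) x by [].
  have := congr1 (fun w : regfun (X0op H) => w x) (hth _ (Xt >> tW) (XV >> VW0) (der_pv Xns (pd_der H j))).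
  rewrite rf_evB => /eqP; rewrite subr_eq addrC -/(A j x) => /eqP ->; congr (_ + _).
  set XZ := subII _ _; rewrite -[LHS]/((rf_res XZ v * der_pv Xns (pd_der H j) _ subxx [:: rf_res XZ u] : regfun _) x).
  have ru := regat_rf (rf_res XZ u) Xop.
  rewrite rf_evM der_pvE pd_derE //; set u' := rf_res XZ u.
  have u'E y : X0 H y -> u' y * g i' y = g i y.
    move=> Xy; have Xy' : oset (X0op H) y by [].
    rewrite /u' rf_resE // uE; last exact: (Xt y Xy').
    have := g_neq0 i' y Xy; have yb := Xy.1.
    rewrite gi gi' /gF (heval_aff hP yb) (heval_aff hQ yb) /= => g0.
    by rewrite -mulf_div divff ?expf_neq0 // mul1r divfK.
  have vu' : rf_res XZ v x * u' x = 1.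
    by rewrite !rf_resE // -rf_evM vu; apply: (rf_cstE 1); exact: (XZ x Xop).
  have := pdv_ext j Xx (regatM ru (g_hol i' x Xx)) (locally_mono u'E (X0_open Xx)).
  rewrite (pdvM j Xx ru (g_hol i' x Xx)) /sig => <-; rewrite -(u'E x Xx).
  have u0 : u' x != 0 by apply: contra_eqN vu' => /eqP ->; rewrite mulr0 eq_sym oner_eq0.
  have -> : rf_res XZ v x = (u' x)^-1 by apply: (mulIf u0); rewrite vu' mulVf.
  by field; rewrite u0 g_neq0.
apply: (@curvature_closed H _ (theta k0) (XV >> VW0) exX) => i j x im jm ij Xx.
have [Kc hK] := form_bound g_hol g_neq0 g_aff cover i j.
have so : slice H x i j x by [].
have g_dom l : dom H x i j (Ex H x i j) (g l).
  have [f [f' [-> _]]] := gE l; apply: dom_tev => [y|k kN]; [exact: Ex_ge1|exact: dom_cr].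
have A_hol l : hol H (A l) by move=> y Xy; exact: (regat_rf _ (Xy : oset (X0op H) y)).
apply: (@curv_vanishes H x i j im jm ij so _ _ r g Kc (A_hol i) (A_hol j) g_hol g_neq0 g_dom).
  move=> l; have [f [f' [gf ff]]] := gE l.
  apply: (@dom_le H x i j _ _ (fun y => tev N.+1 (cr H y) f' * (Dv H y)^-1)) => [y sy|].
    have Dy : Dv H y != 0 := sy.1.2; have := g_neq0 l y sy.1; rewrite gf => g0.
    by rewrite /Dv -(ff y sy.1) invfM mulrA divff ?mul1r // -?(mulr_neq0 _ _); apply: contraNneq Dy => f0; rewrite /Dv -(ff y sy.1) f0 mul0r.
  apply: domM; last exact: dom_Dinv.
  by apply: dom_tev => [y|k kN]; [exact: Ex_ge1|exact: dom_cr].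
by move=> y sy a1 a2; exact: hK sy.1 a1 a2.
Qed.
End AnalyticGeometry.

Section Final.
Variables (R : realType) (N n : nat) (X : projective_variety R N).
Hypothesis Xns : nonsingular X n.
Variable Lambda : polyvec 2 (opens_setT (set_type (pv_set X))).

Lemma comparison_closed (L L' : poisson_invertible_sheaf Lambda)
    (tau : trivialization L) (tau' : trivialization L')
    (K : Type) (W : K -> opens (set_type (pv_set X)))
    (r : K -> tr_index tau) (r' : K -> tr_index tau')
    (Wr : forall k, W k `<=` @tr_open _ _ _ _ L tau (r k))
    (Wr' : forall k, W k `<=` @tr_open _ _ _ _ L' tau' (r' k))
    (theta : forall k, form1 (W k)) :
  form_comparison Wr Wr' theta -> forall k, closed_form (theta k).
Proof.
move=> [cov cob _]; apply: (dlog_difference_closed Xns cov) => k l.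
pose Z := (W k) ∩ W l.
pose Zk : Z `<=` W k := subl; pose Zl : Z `<=` W l := subr.
pose Ik := Zk >> (@Wr k); pose Il := Zl >> (@Wr l).
pose Ik' := Zk >> (@Wr' k); pose Il' := Zl >> (@Wr' l).
exists (tr_hres Il Ik * tr_hres Ik' Il'), (tr_hres Ik Il * tr_hres Il' Ik'); split.
  by rewrite mulrACA !tr_hresV mul1r.
move=> V Vk Vl P; rewrite -(cob k l V Vk Vl P).
pose VZ : V `<=` Z := subII Vk Vl.
have mP : mder 1 (P V subxx) := (polyvec_md P).2 V _.
rewrite -[RHS]/(rf_res VZ _ * _) -contract1 !rf_resM.
rewrite !tr_hres_res (dlogM _ mP) ?tr_hresV //; congr (_ + _).
  rewrite [LHS](dlog_hE (VZ >> Ik) (VZ >> Il)) //.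
by rewrite (dlog_hresN (VZ >> Ik') (VZ >> Il') [::] mP)
  [X in - X](dlog_hE (VZ >> Ik') (VZ >> Il')).
Qed.

Lemma class_ext_iso (L L' : poisson_invertible_sheaf Lambda)
    (tau : trivialization L) (tau' : trivialization L') d dE iota pi dE' iota' pi' :
  @is_atiyah_data _ _ _ _ _ tau dE iota pi ->
  @is_atiyah_data _ _ _ _ _ tau' dE' iota' pi' ->
  poisson_chern_class L' = poisson_chern_class L ->
  ext_iso (poisson_atiyah d dE' iota' pi') (poisson_atiyah d dE iota pi).
Proof.
move=> dat dat' E.
have [_ [tau2 [K [W [r [r' [Wr [Wr' [theta H]]]]]]]]] :
    poisson_chern_class L (poisson_chern_cochain tau').
  rewrite -E; split; first exact: hyper_cocycle.
  have [K [W [r [r' [Wr [Wr' [theta [H _]]]]]]]] := same_sheaf_comparison Xns tau' tau'.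
  by exists tau', K, W, r, r', Wr, Wr', theta.
have cmp : form_comparison Wr Wr' theta by [].
have dat2 := atiyah_dataP Xns tau2.
apply: (ext_iso_trans (comparison_ext_iso Xns d cmp (comparison_closed cmp) dat' dat2)).
have [K2 [W2 [s [s' [Ws [Ws' [theta2 [cmp2 cl2]]]]]]]] := same_sheaf_comparison Xns tau2 tau.
exact: (comparison_ext_iso Xns d cmp2 cl2 dat2 dat).
Qed.

End Final.

Local Close Scope ring_scope.
Local Close Scope classical_set_scope.

Theorem proposition7p0p1 (R : realType) (N n : nat)
  (X : projective_variety R N)
  (X_dim : krull_dim (set_type (pv_set X)) n)
  (X_nonsingular : nonsingular X n)
  (Lambda : polyvec 2 (opens_setT (set_type (pv_set X))))
  (Lambda_poisson : is_poisson Lambda)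
  (L : poisson_invertible_sheaf Lambda) :
  exists d : forall p, chom (forget (wedgeT X p)) (forget (wedgeT X p.+1)),
    [/\ is_poisson_differential Lambda d,
        is_ccomplex (O_complex d),
        is_ccomplex (T_complex d),
        inhabited (trivialization L) &
        forall tau : trivialization L,
        exists (dE : forall p, chom (forget (atiyah_sheaf tau p))
                                    (forget (atiyah_sheaf tau p.+1)))
               (iota : forall p, ohom (wedgeT X p) (atiyah_sheaf tau p))
               (pi : forall p, ohom (atiyah_sheaf tau p) (wedgeT X p.+1)),
          [/\ is_atiyah_data dE iota pi,
              is_extension (poisson_atiyah d dE iota pi),
              (forall (L' : poisson_invertible_sheaf Lambda)
                      (tau' : trivialization L') dE' iota' pi',
                 @is_atiyah_data _ _ _ _ _ tau' dE' iota' pi' ->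
                 poisson_chern_class L' = poisson_chern_class L ->
                 ext_iso (poisson_atiyah d dE' iota' pi')
                         (poisson_atiyah d dE iota pi)),
              (forall p, 'C(n, p) + 'C(n, p.+1) = 'C(n.+1, p.+1) /\
                 locally_free (atiyah_sheaf tau p) ('C(n, p) + 'C(n, p.+1))) &
              is_extension_of_class (chern_class L) (iota 0) (pi 0)]].
Proof.
exists (d_chom X_nonsingular Lambda); split.
- exact: d_chom_poisson.
- exact: O_complexP.
- exact: T_complexP.
- exact: trivialization_exists.
move=> tau.
have dat := atiyah_dataP X_nonsingular tau.
exists (dE_chom X_nonsingular tau), (iota_hom tau), (pi_hom tau); split=> //.
- exact: poisson_atiyah_extension.
- move=> L' tau' dE' iota' pi' dat' E; exact: class_ext_iso dat dat' E.
- by move=> p; split; [rewrite binS addnC|exact: atiyah_free].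
- exact: atiyah_class.
Qed.
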